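(* Let $\mathbb{X}$ be a weighted projective line of weight type $(p_1,p_2,p_3)$ with all $p_i\ge2$ over a finite field $\mathbf{k}=\mathbb{F}_q$. Let $E,E'$ be extension bundles on $\mathbb{X}$, let $z$ be an ordinary point with $\deg z=d$, and let $S=S_z^{(n)}$ for some $n\ge1$ be an indecomposable torsion sheaf in the homogeneous tube $\mathcal{T}_z$. Assume $[E']+[S]=[E]$ in $K_0(\mathbb{X})$. Then $$F_{SE'}^{E}=f_{dn}-f_{dn-1}+(q^d-1)\sum_{t\ge1}q^{d(t-1)}\bigl(f_{d(n-2t)}-f_{d(n-2t)-1}\bigr),$$ where $f_m=f_m(q)$.
   Context: Weighted projective line of weight type $(p_1,p_2,p_3)$ over a field $\mathbf{k}$: $\mathbb{L}$ is the abelian group with generators $\vec{x}_1,\vec{x}_2,\vec{x}_3$ and relations $p_1\vec{x}_1=p_2\vec{x}_2=p_3\vec{x}_3=:\vec{c}$. Every $\vec{x}\in\mathbb{L}$ has a unique normal form $\vec{x}=\sum_i l_i\vec{x}_i+l\vec{c}$ with $0\le l_i<p_i$, $l\in\mathbb{Z}$; $\mathbb{L}_+$ is the set of those with $l\ge 0$, and $\vec{x}\le\vec{y}$ means $\vec{y}-\vec{x}\in\mathbb{L}_+$. Let $A=\mathbf{k}[X_1,X_2,X_3]/(X_3^{p_3}-X_2^{p_2}+X_1^{p_1})$ (the exceptional points being normalized to $\infty,0,1$), $\mathbb{L}$-graded by $\deg X_i=\vec{x}_i$. Then $\mathrm{coh}\,\mathbb{X}=\mathrm{mod}^{\mathbb{L}}(A)/\mathrm{mod}_0^{\mathbb{L}}(A)$,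 the quotient of finitely generated $\mathbb{L}$-graded $A$-modules by those of finite length; it is a hereditary abelian category. The structure sheaf $\mathcal{O}$ is the image of $A$, the line bundles are the grading shifts $\mathcal{O}(\vec{x})$, $\vec{x}\in\mathbb{L}$, and $L(\vec{x})$ denotes the shift of $L$ by $\vec{x}$. The dualizing element is $\vec{\omega}=\vec{c}-\vec{x}_1-\vec{x}_2-\vec{x}_3$. Extension bundle: for a line bundle $L$ and $\vec{x}\in\mathbb{L}$ with $0\le\vec{x}\le\sum_{i=1}^3(p_i-2)\vec{x}_i$, one has $\dim\mathrm{Ext}^1(L(\vec{x}),L(\vec{\omega}))=1$, and $E_L\langle\vec{x}\rangle$ denotes the middle term of the (unique up to isomorphism of the middle term) non-split exact sequence $0\to L(\vec{\omega})\to E_L\langle\vec{x}\rangle\to L(\vec{x})\to 0$. An extension bundle is an object isomorphic to some $E_L\langle\vec{x}\rangle$. Torsion sheaves are the finite length objects of $\mathrm{coh}\,\mathbb{X}$. Ordinary points $z$ are the closed points of $\mathbb{P}^1(\mathbf{k})$ other than the three exceptional points; $\deg z$ is the degree of the corresponding prime homogeneous polynomial in $\mathbf{k}[T_1,T_2]$ (equivalently the degree of its residue field over $\mathbf{k}$). For an ordinary point $z$, $\mathcal{T}_z$ is the category of torsion sheaves supported at $z$; it has a unique simple object, and $S_z^{(n)}$ is its unique indecomposable object of length $n$. $[X]$ denotes the class of $X$ in the Grothendieck group $K_0(\mathbb{X})$ of $\mathrm{coh}\,\mathbb{X}$. Hall number: $F_{AB}^{M}=|\{X\subseteq M\mid X\cong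 B,\ M/X\cong A\}|$. Polynomials $f_n$: for $n\ge1$, $f_n(q)=\sum_{i=1}^n(-1)^{i-1}(2i-1)q^{n+1-i}+(-1)^n(n+1)$; $f_0(q)=1$; and $f_{-n}(q)=0$ for $n\ge 1$ (so the sum in the formula is finite). *)

(* Defs.v *)
From HB Require Import structures.
From mathcomp Require Import all_boot all_order all_algebra.
From mathcomp Require Import generic_quotient ring_quotient.
From mathcomp Require Import mpoly.
From mathcomp Require Import boolp classical_sets.

Set Implicit Arguments.
Unset Strict Implicit.
Unset Printing Implicit Defensive.

Import Order.TTheory GRing.Theory Num.Theory.

Local Open Scope classical_set_scope.
Local Open Scope quotient_scope.
Local Open Scope ring_scope.

Section GradedSub.
Variables (R : nzRingType) (G : Type).

(* [pr x v] is the homogeneous component of degree x of v. *)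
Definition gsub (V : lmodType R) (pr : G -> V -> V) (N : set V) : Prop :=
  [/\ N 0, forall u v, N u -> N v -> N (u + v),
      forall a v, N v -> N (a *: v) & forall x v, N v -> N (pr x v)].

(* Q/P has length at most b: graded submodules of Q/P correspond to graded
   submodules between P and Q. *)
Definition glength_le (V : lmodType R) (pr : G -> V -> V) (P Q : set V)
    (b : nat) : Prop :=
  forall (r : nat) (N : nat -> set V),
    (forall i, (i <= r)%N -> [/\ gsub pr (N i), P `<=` N i & N i `<=` Q]) ->
    (forall i, (i < r)%N -> N i `<` N i.+1) -> (r <= b)%N.

Definition fin_length (V : lmodType R) (pr : G -> V -> V) (P Q : set V) :=
  exists b, glength_le pr P Q b.

Definition pairpr (V W : lmodType R) (prV : G -> V -> V) (prW : G -> W -> W)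
  (x : G) (u : V * W) : V * W := (prV x u.1, prW x u.2).

Definition converse (V W : Type) (F : set (V * W)) : set (W * V) :=
  [set u | F (u.2, u.1)].

Definition preim (V W : Type) (F : set (V * W)) (P : set W) : set V :=
  [set v | exists2 w, P w & F (v, w)].

Definition relcomp (U V W : Type) (F2 : set (V * W)) (F1 : set (U * V)) :
  set (U * W) := [set u | exists2 v, F1 (u.1, v) & F2 (v, u.2)].

Definition addset (V : lmodType R) (P Q : set V) : set V :=
  [set v | exists a b, [/\ P a, Q b & v = a + b]].

Section Lemmas.
Variables (V W : lmodType R) (prV : G -> V -> V) (prW : G -> W -> W).
Hypothesis prVD : forall x u v, prV x (u + v) = prV x u + prV x v.
Hypothesis prWD : forall x u v, prW x (u + v) = prW x u + prW x v.

Lemma pr0 x : prV x 0 = 0.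
Proof. by apply: (addrI (prV x 0)); rewrite -prVD !addr0. Qed.

Lemma gsubB N u v : gsub prV N -> N u -> N v -> N (u - v).
Proof. by case=> _ HD HZ _ Hu Hv; apply: HD => //; rewrite -scaleN1r; exact: HZ. Qed.

Lemma gsubN N v : gsub prV N -> N v -> N (- v).
Proof. by move=> HN Hv; rewrite -sub0r; apply: gsubB => //; case: HN. Qed.

Lemma gsubT : gsub prV setT. Proof. by []. Qed.

Lemma gsub_zero : gsub prV [set 0].
Proof.
split=> //= [u v -> ->|a v ->|x v ->]; by rewrite ?addr0 ?scaler0 ?pr0.
Qed.

Lemma gsubI N1 N2 : gsub prV N1 -> gsub prV N2 -> gsub prV (N1 `&` N2).
Proof.
case=> [a1 a2 a3 a4] [b1 b2 b3 b4]; split=> //.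
- by move=> u v [? ?] [? ?]; split; auto.
- by move=> u v [? ?]; split; auto.
- by move=> u v [? ?]; split; auto.
Qed.

Lemma gsub_add N1 N2 : gsub prV N1 -> gsub prV N2 -> gsub prV (addset N1 N2).
Proof.
case=> [a1 a2 a3 a4] [b1 b2 b3 b4]; split.
- by exists 0, 0; rewrite addr0.
- move=> u v [a [b [Ha Hb ->]]] [c [d [Hc Hd ->]]].
  by exists (a + c), (b + d); split; auto; rewrite addrACA.
- by move=> k u [a [b [Ha Hb ->]]]; exists (k *: a), (k *: b); split; auto; rewrite scalerDr.
- by move=> x u [a [b [Ha Hb ->]]]; exists (prV x a), (prV x b); split; auto.
Qed.

Lemma gsub_preim (F : set (V * W)) P :
  gsub (pairpr prV prW) F -> gsub prW P -> gsub prV (preim F P).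
Proof.
case=> [a1 a2 a3 a4] [b1 b2 b3 b4]; split.
- by exists 0.
- move=> u v [w Pw Fw] [w' Pw' Fw']; exists (w + w'); auto.
  exact: (a2 _ _ Fw Fw').
- by move=> k u [w Pw Fw]; exists (k *: w); auto; exact: (a3 k _ Fw).
- by move=> x u [w Pw Fw]; exists (prW x w); auto; exact: (a4 x _ Fw).
Qed.

Lemma fin_lengthS (P P' Q Q' : set V) : P `<=` P' -> Q' `<=` Q ->
  fin_length prV P Q -> fin_length prV P' Q'.
Proof.
move=> PP QQ [b Hb]; exists b => r N H1 H2; apply: (Hb r N) => // i ir.
have [h1 h2 h3] := H1 i ir; split=> //; [exact: subset_trans h2|exact: subset_trans QQ].
Qed.

Lemma weak_chain (P Q : set V) b : glength_le prV P Q b ->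
  forall (r : nat) (N : nat -> set V),
    (forall i, (i <= r)%N -> [/\ gsub prV (N i), P `<=` N i & N i `<=` Q]) ->
    (forall i, (i < r)%N -> N i `<=` N i.+1) ->
  (\sum_(i < r) (`[< N i <> N i.+1 >] : nat) <= b)%N.
Proof.
move=> Hb r N H1 H2; set s := (X in (X <= b)%N).
suff: exists N' : nat -> set V, [/\ (forall i, (i <= s)%N ->
   [/\ gsub prV (N' i), P `<=` N' i & N' i `<=` Q]),
   (forall i, (i < s)%N -> N' i `<` N' i.+1) & N' s = N r].
  by case=> N' [h1 h2 _]; exact: Hb h1 h2.
rewrite {}/s; elim: r H1 H2 => [|r IH] H1 H2.
  exists N; rewrite big_ord0; split=> //.
have [|i ir|N' [h1 h2 h3]] := IH; first by move=> i ir; apply: H1; exact: leqW.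
  by apply: H2; exact: leqW.
rewrite big_ord_recr /=; set s := (X in (X + _)%N) in h1 h2 h3 *.
case: asboolP => [ne|/contrapT e]; last first.
  by exists N'; rewrite addn0 h3; split.
exists (fun i => if (i <= s)%N then N' i else N r.+1).
rewrite addn1 ltnn; split=> // i.
  by case: (leqP i s) => [/h1//|_ _]; exact: H1.
rewrite ltnS => le_is; have [->|ne'] := eqVneq i s; last first.
  have lt : (i < s)%N by rewrite ltn_neqAle ne'.
  by rewrite /= (ltnW lt) lt; exact: h2.
by rewrite /= leqnn ltnn h3 properEneq; split; [exact/eqP|exact: H2].
Qed.

Lemma fin_length_trans (P Q T : set V) : gsub prV Q -> P `<=` Q -> Q `<=` T ->
  gsub prV T -> fin_length prV P Q -> fin_length prV Q T -> fin_length prV P T.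
Proof.
move=> gQ PQ QT gT [a Ha] [b Hb]; exists (a + b)%N => r N H1 H2.
have m i : (i < r)%N -> N i `<=` N i.+1 by move=> /H2/properW.
have Q0 : Q 0 by case: gQ.
have k1 := @weak_chain _ _ _ Ha r (fun i => N i `&` Q).
have k2 := @weak_chain _ _ _ Hb r (fun i => addset (N i) Q).
apply: leq_trans (leq_add (k1 _ _) (k2 _ _)).
- rewrite -big_split /= -[X in (X <= _)%N]card_ord -sum1_card; apply: leq_sum => i _.
  case: asboolP => [//|/contrapT e1]; case: asboolP => [//|/contrapT e2].
  exfalso; have [_ /existsNP[v /not_implyP[Nv nNv]]] := H2 i (ltn_ord i).
  have [gN _ _] := H1 i (ltnW (ltn_ord i)).
  have [gN' _ _] := H1 i.+1 (ltn_ord i).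
  apply: nNv.
  have : addset (N i) Q v by rewrite e2; exists v, 0; rewrite addr0.
  case=> x [y [Nx Qy e]].
  have : (N i `&` Q) y.
    rewrite e1; split=> //.
    have -> : y = v - x by rewrite e addrC addKr.
    by apply: gsubB => //; exact: m Nx.
  by case=> Ny _; rewrite e; case: gN => _ h _ _; exact: h.
- move=> i ir; have [h1 h2 h3] := H1 i ir.
  by split; [exact: gsubI|by move=> v Pv; split; [exact: h2|exact: PQ]|move=> v []].
- by move=> i ir v [Nv Qv]; split=> //; exact: m Nv.
- move=> i ir; have [h1 h2 h3] := H1 i ir; split; first exact: gsub_add.
    by move=> v Qv; exists 0, v; rewrite add0r; split=> //; case: h1.
  move=> v [x [y [/h3 Tx /QT Ty ->]]]; by case: gT => _ h _ _; exact: h.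
- by move=> i ir v [x [y [Nx Qy ->]]]; exists x, y; split=> //; exact: m Nx.
Qed.

End Lemmas.

Section Transport.
Variables (V W : lmodType R) (prV : G -> V -> V) (prW : G -> W -> W).
Hypothesis prVD : forall x u v, prV x (u + v) = prV x u + prV x v.
Hypothesis prWD : forall x u v, prW x (u + v) = prW x u + prW x v.

Lemma gsub_converse (F : set (V * W)) :
  gsub (pairpr prV prW) F -> gsub (pairpr prW prV) (converse F).
Proof.
case=> [a1 a2 a3 a4]; split => //.
- by move=> [u v] [u' v'] /= h h'; exact: (a2 _ _ h h').
- by move=> k [u v] /= h; exact: (a3 k _ h).
- by move=> x [u v] /= h; exact: (a4 x _ h).
Qed.

Lemma fin_length_preim (F : set (V * W)) (P Q : set W) :
  gsub (pairpr prV prW) F -> gsub prW P -> gsub prW Q -> P `<=` Q ->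
  fin_length prW P Q -> fin_length prV (preim F P) (preim F Q).
Proof.
move=> gF gP gQ PQ [b Hb]; exists b => r N H1 H2.
apply: (Hb r (fun i => addset (preim (converse F) (N i) `&` Q) P)) => i ir.
  have [h1 h2 h3] := H1 i ir; split.
  - apply: gsub_add => //; apply: gsubI => //.
    exact: (gsub_preim (gsub_converse gF) h1).
  - move=> w Pw; exists 0, w; rewrite add0r; split=> //; split.
      by exists 0; [case: h1|case: gF].
    by case: gQ.
  - move=> w [x [y [[_ Qx] Py ->]]]; by case: gQ => _ h _ _; apply: h => //; exact: PQ.
have [gN hP hQ] := H1 i (ltnW ir); have [gN' hP' hQ'] := H1 i.+1 ir.
have [sN /existsNP[v /not_implyP[Nv nNv]]] := H2 i ir.
split.
  move=> w [x [y [[[u Nu Fu] Qx] Py ->]]]; exists x, y; split=> //; split=> //.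
  by exists u => //; exact: sN.
have [w Qw Fw] := hQ' _ Nv.
apply/existsNP; exists w; apply/not_implyP; split.
  by exists w, 0; rewrite addr0; split; [split=> //; exists v| case: gP|].
case=> x [y [[[u Nu Fu] Qx] Py e]]; apply: nNv.
have -> : v = u + (v - u) by rewrite addrC subrK.
case: (gN) => _ h _ _; apply: h => //; apply: hP; exists y => //.
have -> : (v - u, y) = (v, w) - (u, x) by rewrite e; congr pair; rewrite /= addrC addKr.
exact: gsubB gF Fw Fu.
Qed.

End Transport.
End GradedSub.

(* Arrows form setoids: [heq] is the equality of arrows. *)
Record category := Category {
  Ob :> Type;
  Hom : Ob -> Ob -> Type;
  heq : forall X Y, Hom X Y -> Hom X Y -> Prop;
  idm : forall X, Hom X X;
  comp : forall X Y Z, Hom Y Z -> Hom X Y -> Hom X Z;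
  heq_refl : forall X Y (f : Hom X Y), heq f f;
  heq_sym : forall X Y (f g : Hom X Y), heq f g -> heq g f;
  heq_trans : forall X Y (f g h : Hom X Y), heq f g -> heq g h -> heq f h;
  comp_heq : forall X Y Z (g g' : Hom Y Z) (f f' : Hom X Y),
    heq g g' -> heq f f' -> heq (comp g f) (comp g' f');
  compA : forall X Y Z T (h : Hom Z T) (g : Hom Y Z) (f : Hom X Y),
    heq (comp h (comp g f)) (comp (comp h g) f);
  comp1m : forall X Y (f : Hom X Y), heq (comp (idm Y) f) f;
  compm1 : forall X Y (f : Hom X Y), heq (comp f (idm X)) f
}.
Arguments idm {c} X.

Local Notation "f ~~ g" := (heq f g) (at level 70).
Local Notation "g \c f" := (comp g f) (at level 40, left associativity).

Section CategoryNotions.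
Variable C : category.
Implicit Types X Y Z W M : C.

Definition is_iso X Y (f : Hom X Y) : Prop :=
  exists2 g : Hom Y X, g \c f ~~ idm X & f \c g ~~ idm Y.

Definition isomorphic X Y : Prop := exists f : Hom X Y, is_iso f.

Definition zero_object Z : Prop :=
  forall X, (exists f : Hom Z X, forall g, f ~~ g) /\
            (exists f : Hom X Z, forall g, f ~~ g).

Definition zero_arrow X Y (f : Hom X Y) : Prop :=
  exists Z (a : Hom X Z) (b : Hom Z Y), zero_object Z /\ f ~~ b \c a.

Definition monic X Y (f : Hom X Y) : Prop :=
  forall W (u v : Hom W X), f \c u ~~ f \c v -> u ~~ v.

Definition is_kernel X Y Z (f : Hom X Y) (g : Hom Y Z) : Prop :=
  zero_arrow (g \c f) /\
  forall W (h : Hom W Y), zero_arrow (g \c h) ->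
    exists2 u : Hom W X, f \c u ~~ h & forall u', f \c u' ~~ h -> u ~~ u'.

Definition is_cokernel X Y Z (f : Hom X Y) (g : Hom Y Z) : Prop :=
  zero_arrow (g \c f) /\
  forall W (h : Hom Y W), zero_arrow (h \c f) ->
    exists2 u : Hom Z W, u \c g ~~ h & forall u', u' \c g ~~ h -> u ~~ u'.

Definition short_exact X Y Z (f : Hom X Y) (g : Hom Y Z) : Prop :=
  is_kernel f g /\ is_cokernel f g.

Definition splits Y Z (g : Hom Y Z) : Prop :=
  exists s : Hom Z Y, g \c s ~~ idm Z.

Definition is_coproduct X Y M (i : Hom X M) (j : Hom Y M) : Prop :=
  forall W (f : Hom X W) (g : Hom Y W),
    exists2 u : Hom M W, u \c i ~~ f /\ u \c j ~~ g &
      forall u', u' \c i ~~ f -> u' \c j ~~ g -> u ~~ u'.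

Definition indecomposable M : Prop :=
  ~ zero_object M /\
  forall X Y (i : Hom X M) (j : Hom Y M),
    is_coproduct i j -> zero_object X \/ zero_object Y.

Definition simple_object M : Prop :=
  ~ zero_object M /\
  forall X (i : Hom X M), monic i -> zero_object X \/ is_iso i.

Fixpoint has_length (n : nat) M : Prop :=
  if n is n'.+1 then
    exists X T (i : Hom X M) (g : Hom M T),
      [/\ has_length n' X, simple_object T & short_exact i g]
  else zero_object M.

Record subobject M := Subobject {
  sub_ob :> C;
  sub_arrow : Hom sub_ob M;
  sub_monic : monic sub_arrow
}.

Definition sub_le M (u v : subobject M) : Prop :=
  exists h : Hom u v, sub_arrow v \c h ~~ sub_arrow u.

Definition sub_eq M (u v : subobject M) : Prop := sub_le u v /\ sub_le v u.

Definition hall_sub (A B M : C) (X : subobject M) : Prop :=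
  isomorphic X B /\ exists g : Hom M A, is_cokernel (sub_arrow X) g.

(* F_{AB}^M = N; a subobject is an equivalence class of monomorphisms, and u
   lists one representative of each class. *)
Definition hall_number (A B M : C) (N : nat) : Prop :=
  exists u : 'I_N -> subobject M,
    [/\ forall i, hall_sub A B (u i),
        forall i j, sub_eq (u i) (u j) -> i = j &
        forall X : subobject M, hall_sub A B X -> exists i, sub_eq X (u i)].

(* The Grothendieck group is the group of finitely supported functions C -> int
   modulo the subgroup K0_relation. *)
Definition delta_ob X : C -> int := fun Y => (`[< X = Y >] : nat)%:Z.

Inductive K0_relation : (C -> int) -> Prop :=
| K0_zero : K0_relation (fun=> 0)
| K0_exact X Y Z (f : Hom X Y) (g : Hom Y Z) : short_exact f g ->
    K0_relation (fun T => delta_ob Y T - delta_ob X T - delta_ob Z T)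
| K0_sub u v : K0_relation u -> K0_relation v ->
    K0_relation (fun T => u T - v T).

Definition K0_eq (u v : C -> int) : Prop := K0_relation (fun T => u T - v T).

End CategoryNotions.

Record weights := Weights {
  wt :> 'I_3 -> nat;
  wt_ge2 : forall i, (2 <= wt i)%N
}.

Local Notation i1 := (@Ordinal 3 0 isT).
Local Notation i2 := (@Ordinal 3 1 isT).
Local Notation i3 := (@Ordinal 3 2 isT).

Section GradingGroup.
Variable p : weights.

Definition Zgen (i : 'I_3) : 'rV[int]_3 := delta_mx 0 i.

Definition Lrelations : {pred 'rV[int]_3} := [pred v | `[< exists a b : int,
  v = (Zgen i1 *+ p i1 - Zgen i2 *+ p i2) *~ a
    + (Zgen i1 *+ p i1 - Zgen i3 *+ p i3) *~ b >]].

Lemma Lrelations_zmod : zmod_closed Lrelations.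
Proof.
split; first by apply/asboolP; exists 0, 0; rewrite !mulr0z addr0.
move=> u v /asboolP[a [b ->]] /asboolP[c [d ->]]; apply/asboolP.
by exists (a - c), (b - d); rewrite !mulrzBr opprD addrACA.
Qed.

HB.instance Definition _ :=
  GRing.isZmodClosed.Build 'rV[int]_3 Lrelations Lrelations_zmod.

Definition Lgroup : Type := {ideal_quot Lrelations}.
HB.instance Definition _ := GRing.Zmodule.on Lgroup.

Definition vx (i : 'I_3) : Lgroup := \pi_({ideal_quot Lrelations}) (Zgen i).
Definition vc : Lgroup := vx i1 *+ p i1.
Definition vomega : Lgroup := vc - vx i1 - vx i2 - vx i3.

Lemma vcE i : vx i *+ p i = vc.
Proof.
rewrite /vc /vx -!raddfMn /=; apply/esym/eqP; rewrite -Quotient.idealrBE.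
apply/asboolP; case: i => [[|[|[|//]]] Hi]; rewrite (bool_irrelevance Hi isT).
- by exists 0, 0; rewrite !mulr0z addr0 subrr.
- by exists 1, 0; rewrite mulr1z mulr0z addr0.
- by exists 0, 1; rewrite mulr1z mulr0z add0r.
Qed.

Definition Lpos (x : Lgroup) : Prop :=
  exists (l : 'I_3 -> nat) (m : nat),
    (forall i, (l i < p i)%N) /\ x = \sum_i vx i *+ l i + vc *+ m.

Definition Lle (x y : Lgroup) : Prop := Lpos (y - x).

Definition degL (m : 'X_{1..3}) : Lgroup := \sum_i vx i *+ m i.

End GradingGroup.

Section CoordinateAlgebra.
Variables (k : fieldType) (p : weights).
Local Notation S := {mpoly k[3]}.
Local Notation L := (Lgroup p).

Definition relator : S := 'X_i3 ^+ p i3 - 'X_i2 ^+ p i2 + 'X_i1 ^+ p i1.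

Definition relator_ideal : {pred S} := [pred g | `[< exists h, g = h * relator >]].

Lemma relator_idealP : idealr_closed relator_ideal.
Proof.
split.
- by apply/asboolP; exists 0; rewrite mul0r.
- apply/asboolP => -[h /(congr1 (meval (fun=> 0)))].
  rewrite mevalM /relator mevalD mevalB !rmorphXn /= !mevalXU meval1 !expr0n.
  rewrite !(gtn_eqF (ltnW (wt_ge2 p _))) subrr addr0 mulr0 => /eqP.
  by rewrite oner_eq0.
- move=> a u v /asboolP[g ->] /asboolP[h ->]; apply/asboolP.
  by exists (a * g + h); rewrite mulrDl mulrA.
Qed.

HB.instance Definition _ := isIdealr.Build S relator_ideal relator_idealP.

Definition coordA : Type := {ideal_quot relator_ideal}.
HB.instance Definition _ := GRing.ComNzRing.on coordA.
Definition toA (g : S) : coordA := \pi_({ideal_quot relator_ideal}) g.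

Definition homogS (x : L) (g : S) : Prop := forall m, m \in msupp g -> degL p m = x.

Definition homogA (x : L) (a : coordA) : Prop := exists2 g, homogS x g & a = toA g.

Definition prS (x : L) (g : S) : S :=
  \sum_(m <- msupp g | degL p m == x) g@_m *: 'X_[m].

Lemma prSE x g m : (prS x g)@_m = if degL p m == x then g@_m else 0.
Proof.
rewrite /prS raddf_sum /=.
under eq_bigr do rewrite mcoeffZ mcoeffX.
have [mg|mg] := boolP (m \in msupp g).
  rewrite big_mkcond (bigD1_seq m) ?msupp_uniq //= eqxx mulr1 big1 ?addr0 //.
  by move=> m' /negPf ne; rewrite ne mulr0 if_same.
rewrite big1_seq ?memN_msupp_eq0 ?if_same // => m' /andP[_ m'g].
by case: eqVneq => [e|]; [rewrite -e m'g in mg|rewrite mulr0].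
Qed.

Lemma prSD x g h : prS x (g + h) = prS x g + prS x h.
Proof. by apply/mpolyP => m; rewrite mcoeffD !prSE mcoeffD; case: eqP; rewrite ?addr0. Qed.

Lemma prS0 x : prS x 0 = 0.
Proof. by apply/mpolyP => m; rewrite prSE !mcoeff0 if_same. Qed.

Lemma prS_sum (I : Type) (r : seq I) (P : pred I) (F : I -> S) x :
  prS x (\sum_(i <- r | P i) F i) = \sum_(i <- r | P i) prS x (F i).
Proof. exact: (big_morph (prS x) (prSD x) (prS0 x)). Qed.

Lemma prSX x c m : prS x (c *: 'X_[m]) = if degL p m == x then c *: 'X_[m] else 0.
Proof.
apply/mpolyP => m'; rewrite prSE mcoeffZ mcoeffX.
case: (eqVneq m m') => [->|ne]; last first.
  by rewrite mulr0 if_same; case: ifP; rewrite ?mcoeffZ ?mcoeffX ?mcoeff0 ?(negPf ne) ?mulr0.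
by case: ifP; rewrite ?mcoeffZ ?mcoeffX ?mcoeff0 ?eqxx ?mulr1.
Qed.

Lemma degLD m m' : degL p (m + m')%MM = degL p m + degL p m'.
Proof. by rewrite /degL -big_split; apply: eq_bigr => i _; rewrite mnmDE mulrnDr. Qed.

Lemma prSM x y h q : homogS y q -> prS (x + y) (h * q) = prS x h * q.
Proof.
move=> hq; rewrite {1}(mpolyE h) [in RHS](mpolyE h) mulr_suml !prS_sum mulr_suml.
apply: eq_bigr => m _; rewrite prSX {1}(mpolyE q) mulr_sumr prS_sum.
have E m' : m' \in msupp q ->
    prS (x + y) (h@_m *: 'X_[m] * (q@_m' *: 'X_[m'])) =
    (if degL p m == x then h@_m *: 'X_[m] else 0) * (q@_m' *: 'X_[m']).
  move=> /hq dm'; rewrite -scalerAl -scalerAr scalerA -mpolyXD prSX degLD dm'.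
  rewrite (inj_eq (addIr _)); case: ifP; rewrite ?mul0r // => _.
  by rewrite -scalerAl -scalerAr scalerA mpolyXD.
by rewrite big_seq (eq_bigr _ E) -big_seq -mulr_sumr -mpolyE.
Qed.

Lemma homogS_prS x g : homogS x (prS x g).
Proof. by move=> m; rewrite mcoeff_msupp prSE; case: (degL p m =P x) => // _; rewrite eqxx. Qed.

Lemma prS_homog x g : homogS x g -> prS x g = g.
Proof.
move=> hg; apply/mpolyP => m; rewrite prSE; case: eqP => // ne.
by apply/esym/memN_msupp_eq0/negP => /hg.
Qed.

Lemma homogSXn i : homogS (vc p) ('X_i ^+ p i : S).
Proof.
move=> m; rewrite mpolyXn msuppX inE => /eqP ->.
rewrite /degL (bigD1 i) //= big1 ?addr0; last first.
  by move=> j ne; rewrite mulmnE mnm1E eq_sym (negPf ne) mul0n mulr0n.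
by rewrite mulmnE mnm1E eqxx mul1n vcE.
Qed.

Lemma homogS_relator : homogS (vc p) relator.
Proof.
move=> m; rewrite /relator mcoeff_msupp mcoeffD mcoeffB => nz.
have [|e3] := boolP (m \in msupp ('X_i3 ^+ p i3 : S)); first exact: homogSXn.
have [|e2] := boolP (m \in msupp ('X_i2 ^+ p i2 : S)); first exact: homogSXn.
apply: (@homogSXn i1); rewrite mcoeff_msupp.
by move: nz; rewrite (memN_msupp_eq0 e2) (memN_msupp_eq0 e3) subr0 add0r.
Qed.

Definition prA (x : L) (a : coordA) : coordA := toA (prS x (repr a)).

Lemma toA_is_zmod_morphism : zmod_morphism toA.
Proof. exact: raddfB. Qed.
HB.instance Definition _ := GRing.isZmodMorphism.Build S coordA toA toA_is_zmod_morphism.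
Lemma toA_is_monoid_morphism : monoid_morphism toA.
Proof. by split; [exact: rmorph1|exact: rmorphM]. Qed.
HB.instance Definition _ := GRing.isMonoidMorphism.Build S coordA toA toA_is_monoid_morphism.

Lemma toA_eq0 g : toA g = 0 <-> exists h, g = h * relator.
Proof.
split=> [e|[h ->]].
  apply/asboolP; rewrite -[g]subr0.
  have : g - 0 \in relator_ideal.
    by rewrite Quotient.idealrBE; apply/eqP; rewrite -/(toA g) e -[LHS](raddf0 toA).
  by [].
have : h * relator - 0 \in relator_ideal by rewrite subr0; apply/asboolP; exists h.
by rewrite Quotient.idealrBE => /eqP e; rewrite -(raddf0 toA).
Qed.

Lemma prS_toA0 x g : toA g = 0 -> toA (prS x g) = 0.
Proof.
move=> /toA_eq0[h ->]; rewrite -[x](subrK (vc p)) (prSM _ _ homogS_relator).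
by apply/toA_eq0; eexists.
Qed.

Lemma toAK a : toA (repr a) = a. Proof. exact: reprK. Qed.

Lemma prS_raddfB x g h : prS x (g - h) = prS x g - prS x h.
Proof. by apply: (addIr (prS x h)); rewrite -prSD !subrK. Qed.

Lemma prAE x g : prA x (toA g) = toA (prS x g).
Proof.
apply/eqP; rewrite -subr_eq0 /prA -raddfB -prS_raddfB.
by apply/eqP/prS_toA0; rewrite raddfB /= toAK subrr.
Qed.

Lemma prAD x a b : prA x (a + b) = prA x a + prA x b.
Proof. by rewrite -[a]toAK -[b]toAK -raddfD /= !prAE prSD raddfD. Qed.

Lemma prAK x y a : prA x (prA y a) = if x == y then prA y a else 0.
Proof.
rewrite -[a]toAK !prAE; case: eqVneq => [->|ne].
  by rewrite prS_homog //; exact: homogS_prS.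
rewrite -(raddf0 toA); congr toA; apply/mpolyP => m; rewrite !prSE mcoeff0.
by case: eqVneq => // ->; rewrite (negPf ne).
Qed.

Lemma prA_sum a : exists2 s : seq L, uniq s & a = \sum_(x <- s) prA x a.
Proof.
pose g := repr a; exists (undup [seq degL p m | m <- msupp g]); first exact: undup_uniq.
rewrite -[a]toAK -/g; under eq_bigr do rewrite prAE.
rewrite -raddf_sum /=; congr toA; apply/mpolyP => m; rewrite raddf_sum /=.
under eq_bigr do rewrite prSE.
have [mg|mg] := boolP (m \in msupp g).
  rewrite (bigD1_seq (degL p m)) ?undup_uniq ?mem_undup ?map_f //= eqxx big1 ?addr0 //.
  by move=> x /negPf ne; rewrite eq_sym ne.
by rewrite memN_msupp_eq0 // big1 // => x _; rewrite if_same.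
Qed.

Lemma prA_scale x y a b : homogA x a -> prA (x + y) (a * prA y b) = a * prA y b.
Proof.
case=> g hg ->; rewrite -[b]toAK prAE -rmorphM prAE /= mulrC addrC prSM //.
by rewrite prS_homog //; exact: homogS_prS.
Qed.

End CoordinateAlgebra.

Section GradedModules.
Variables (k : fieldType) (p : weights).
Local Notation A := (coordA k p).
Local Notation L := (Lgroup p).

(* The decomposition of M into the direct sum of the M_x is given by the
   projections [hc x] onto its summands, M_x being the image of [hc x]. *)
Record gmod := GMod {
  gm_mod :> lmodType A;
  hc : L -> gm_mod -> gm_mod;
  hcD : forall x u v, hc x (u + v) = hc x u + hc x v;
  hcK : forall x y v, hc x (hc y v) = if x == y then hc y v else 0;
  hc_sum : forall v, exists2 s : seq L, uniq s & v = \sum_(x <- s) hc x v;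
  hc_scale : forall x y a v,
    homogA x a -> hc (x + y) (a *: hc y v) = a *: hc y v;
  gm_fg : exists (n : nat) (g : 'I_n -> gm_mod),
    forall v, exists a : 'I_n -> A, v = \sum_i a i *: g i
}.

Definition hpart (M : gmod) (x : L) : set M := [set v | hc x v = v].
Arguments hpart : clear implicits.

Definition graded_submodule (M : gmod) : set M -> Prop := gsub (@hc M).

(* M(x)_y = M_{x + y} *)
Section Shift.
Variables (M : gmod) (x : L).
Definition shift_hc (y : L) : M -> M := hc (x + y).

Lemma shift_hcK y z v :
  shift_hc y (shift_hc z v) = if y == z then shift_hc z v else 0.
Proof. by rewrite /shift_hc hcK (inj_eq (addrI _)). Qed.

Lemma shift_hc_sum v : exists2 s : seq L, uniq s & v = \sum_(y <- s) shift_hc y v.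
Proof.
have [s us e] := hc_sum v; exists [seq y - x | y <- s].
  by rewrite map_inj_uniq //; exact: addIr.
by rewrite big_map {1}e; apply: eq_bigr => y _; rewrite /shift_hc addrC subrK.
Qed.

Lemma shift_hc_scale y z (a : A) v : homogA y a ->
  shift_hc (y + z) (a *: shift_hc z v) = a *: shift_hc z v.
Proof. by rewrite /shift_hc addrCA; exact: hc_scale. Qed.

Definition gshift : gmod := GMod (fun y => @hcD M (x + y)) shift_hcK shift_hc_sum
  shift_hc_scale (gm_fg M).
End Shift.

Lemma A_fg : exists (n : nat) (g : 'I_n -> A^o),
  forall v, exists a : 'I_n -> A, v = \sum_i a i *: g i.
Proof. by exists 1%N, (fun=> 1) => v; exists (fun=> v); rewrite big_ord1 [RHS]mulr1. Qed.

Definition structure_module : gmod :=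
  @GMod A^o (@prA k p) (@prAD k p) (@prAK k p) (@prA_sum k p) (@prA_scale k p) A_fg.

(* Serre quotient by the modules of finite length, after Gabriel: an arrow from M to N is an element of the colimit of the groups
   Hom(M', N/N') over the graded submodules M' of M and N' of N such that M/M'
   and N' have finite length.  A homomorphism f : M' -> N/N' is encoded by the
   graded submodule {(m, n) | m in M', n in f(m)} of M x N; one recovers M' as
   its domain and N' as the set of n related to 0. *)

Definition gdom (M N : gmod) (F : set (M * N)) : set M := preim F setT.
Definition gind (M N : gmod) (F : set (M * N)) : set N :=
  preim (converse F) [set 0].

Record qhom (M N : gmod) := QHom {
  graph : set (M * N);
  graph_gsub : gsub (pairpr (@hc M) (@hc N)) graph;
  graph_dom : fin_length (@hc M) (gdom graph) setT;
  graph_ind : fin_length (@hc N) [set 0] (gind graph)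
}.

(* f : M1 -> N/N1 and g : M2 -> N/N2 are identified when they induce the same
   map M' -> N/N' for some M' contained in M1 and M2 and some N' containing N1
   and N2. *)
Definition qheq (M N : gmod) (f g : qhom M N) : Prop :=
  exists (M' : set M) (N' : set N),
    [/\ [/\ graded_submodule M', fin_length (@hc M) M' setT,
            M' `<=` gdom (graph f) & M' `<=` gdom (graph g)],
        [/\ graded_submodule N', fin_length (@hc N) [set 0] N',
            gind (graph f) `<=` N' & gind (graph g) `<=` N'] &
        forall m n n', M' m -> graph f (m, n) -> graph g (m, n') -> N' (n - n')].

Implicit Types M N P : gmod.

Local Notation fl M := (fin_length (@hc M)).
Local Notation hD M := (@hcD M).

Lemma gdom_gsub M N (f : qhom M N) : graded_submodule (gdom (graph f)).
Proof. exact: (gsub_preim (graph_gsub f) (@gsubT _ _ _ _)). Qed.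

Lemma img_gsub M N (f : qhom M N) (X : set M) : graded_submodule X ->
  graded_submodule (preim (converse (graph f)) X).
Proof. exact: (gsub_preim (gsub_converse (graph_gsub f))). Qed.

Lemma pre_gsub M N (f : qhom M N) (Y : set N) : graded_submodule Y ->
  graded_submodule (preim (graph f) Y).
Proof. exact: (gsub_preim (graph_gsub f)). Qed.

Lemma zero_gsub M : graded_submodule [set (0 : M)].
Proof. exact: gsub_zero (hD M). Qed.

Lemma sub0 M (X : set M) : graded_submodule X -> [set (0 : M)] `<=` X.
Proof. by case=> X0 _ _ _ ? ->. Qed.

Lemma preimS (V W : Type) (F : set (V * W)) (P Q : set W) :
  P `<=` Q -> preim F P `<=` preim F Q.
Proof. by move=> PQ v [w Pw Fw]; exists w => //; exact: PQ. Qed.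

Lemma pre_fl M N (f : qhom M N) (Y : set N) : graded_submodule Y ->
  fl N Y setT -> fl M (preim (graph f) Y) setT.
Proof.
move=> gY flY.
apply: (fin_length_trans (hD M) (gdom_gsub f) _ _ _ _ (graph_dom f)) => //.
  exact: preimS.
exact: (fin_length_preim (hD N) (graph_gsub f) gY (@gsubT _ _ _ _)
  (@subsetT _ _) flY).
Qed.

Lemma img_fl M N (f : qhom M N) (X : set M) : graded_submodule X ->
  fl M [set 0] X -> fl N [set 0] (preim (converse (graph f)) X).
Proof.
move=> gX flX; have gi := img_gsub f (zero_gsub M).
apply: (fin_length_trans (hD N) gi _ _ _ (graph_ind f)).
- exact: sub0.
- by apply: preimS; exact: sub0.
- exact: img_gsub.
- apply: (fin_length_preim (hD M) (gsub_converse (graph_gsub f))) => //.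
    exact: zero_gsub.
  exact: sub0.
Qed.

Lemma flI M (X Y : set M) : graded_submodule X -> graded_submodule Y ->
  fl M X setT -> fl M Y setT -> fl M (X `&` Y) setT.
Proof.
move=> gX gY flX flY.
apply: (fin_length_trans (hD M) gX _ _ _ _ flX) => //.
pose F : set (M * M) := [set u | X u.1 /\ u.1 = u.2].
have gF : gsub (pairpr (@hc M) (@hc M)) F.
  case: gX => h1 h2 h3 h4; split=> //=.
  - move=> [a b] [c d] [/= Xa eab] [/= Xc ecd]; rewrite -eab -ecd.
    by split=> //; exact: h2.
  - by move=> c [a b] [/= Xa <-]; split=> //; exact: h3.
  - by move=> c [a b] [/= Xa <-]; split=> //; exact: h4.
have := fin_length_preim (hD M) gF gY (@gsubT _ _ _ _) (@subsetT _ _) flY.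
apply: fin_lengthS.
  by move=> v [w Yw [/= Xv e]]; split=> //; rewrite e.
by move=> v Xv; exists v.
Qed.

Lemma flD M (X Y : set M) : graded_submodule X -> graded_submodule Y ->
  fl M [set 0] X -> fl M [set 0] Y -> fl M [set 0] (addset X Y).
Proof.
move=> gX gY flX flY.
have [X0 XD XZ Xp] := gX; have [Y0 YD YZ Yp] := gY.
apply: (fin_length_trans (hD M) gY _ _ _ flY).
- exact: sub0.
- by move=> v Yv; exists 0, v; rewrite add0r.
- exact: (gsub_add (hD M)).
pose F : set (M * M) := [set u | X u.2 /\ Y (u.1 - u.2)].
have gF : gsub (pairpr (@hc M) (@hc M)) F.
  split; first by split; [exact: X0|change (Y (0 - 0)); rewrite subr0].
  - move=> [a b] [c d] [/= ? ?] [/= ? ?]; split=> /=; first exact: XD.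
    by rewrite opprD addrACA; exact: YD.
  - by move=> c [a b] [/= ? ?]; split=> /=; [exact: XZ|rewrite -scalerBr; exact: YZ].
  - move=> c [a b] [/= ? h]; split=> /=; first exact: Xp.
    suff -> : hc c a - hc c b = hc c (a - b) by exact: Yp.
    by apply: (addIr (hc c b)); rewrite -hcD !subrK.
have := fin_length_preim (hD M) gF (zero_gsub M) gX (sub0 gX) flX.
apply: fin_lengthS.
  by move=> v [w -> [/= _]]; rewrite subr0.
by move=> v [x [y [Xx Yy ->]]]; exists x => //; split=> //=; rewrite addrC addKr.
Qed.

Lemma relcomp_gsub M N P (g : qhom N P) (f : qhom M N) :
  gsub (pairpr (@hc M) (@hc P)) (relcomp (graph g) (graph f)).
Proof.
have [a1 a2 a3 a4] := graph_gsub g; have [b1 b2 b3 b4] := graph_gsub f.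
split.
- by exists 0.
- move=> [a b] [c d] /= [n h h'] [n' h1 h1']; exists (n + n').
    exact: (b2 _ _ h h1).
  exact: (a2 _ _ h' h1').
- move=> c [a b] /= [n h h']; exists (c *: n); [exact: (b3 c _ h)|exact: (a3 c _ h')].
- move=> x [a b] /= [n h h']; exists (hc x n); [exact: (b4 x _ h)|exact: (a4 x _ h')].
Qed.

Lemma relcomp_dom M N P (g : qhom N P) (f : qhom M N) :
  fl M (gdom (relcomp (graph g) (graph f))) setT.
Proof.
apply: fin_lengthS (pre_fl f (gdom_gsub g) (graph_dom g)) => //.
by move=> m [n [q _ gq] fn]; exists q => //; exists n.
Qed.

Lemma relcomp_ind M N P (g : qhom N P) (f : qhom M N) :
  fl P [set 0] (gind (relcomp (graph g) (graph f))).
Proof.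
apply: fin_lengthS (img_fl g (img_gsub f (zero_gsub M)) (graph_ind f)) => //.
by move=> q [m -> [n /= fn gn]]; exists n => //; exists 0.
Qed.

Definition qcomp M N P (g : qhom N P) (f : qhom M N) : qhom M P :=
  QHom (relcomp_gsub g f) (relcomp_dom g f) (relcomp_ind g f).

Lemma fl_refl M (X : set M) : fl M X X.
Proof.
exists 0%N => -[//|r] N H1 H2; have [_ h] := H2 0%N (ltn0Sn r).
have [_ h1 _] := H1 0%N isT; have [_ _ h2] := H1 1%N isT.
by exfalso; apply: h; exact: subset_trans h1.
Qed.

Lemma diag_gsub M : gsub (pairpr (@hc M) (@hc M)) [set u | u.1 = u.2].
Proof. by split=> //= [[a b] [c d] /= -> ->|c [a b] /= ->|x [a b] /= ->]. Qed.

Lemma diag_dom M : fl M (gdom [set u : M * M | u.1 = u.2]) setT.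
Proof. by apply: fin_lengthS (fl_refl (@setT M)) => // m _; exists m. Qed.

Lemma diag_ind M : fl M [set 0] (gind [set u : M * M | u.1 = u.2]).
Proof.
apply: fin_lengthS (fl_refl [set 0]) => // m [n -> e].
by have {}e : 0 = m := e; rewrite -e.
Qed.

Definition qid M : qhom M M := QHom (@diag_gsub M) (@diag_dom M) (@diag_ind M).

Lemma graphB M N (f : qhom M N) m n m' n' :
  graph f (m, n) -> graph f (m', n') -> graph f (m - m', n - n').
Proof. exact: (gsubB (graph_gsub f)). Qed.

Lemma qheq_graph M N (f g : qhom M N) : graph f = graph g -> qheq f g.
Proof.
move=> e; exists (gdom (graph f)), (gind (graph f)); split.
- by split; rewrite -?e //; [exact: gdom_gsub|exact: graph_dom].
- by split; rewrite -?e //; [exact: img_gsub (zero_gsub M)|exact: graph_ind].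
- rewrite -e => m n n' _ fn fn'; exists 0 => //=.
  by rewrite -(subrr m); exact: graphB.
Qed.

Lemma qheq_sym M N (f g : qhom M N) : qheq f g -> qheq g f.
Proof.
case=> M' [N' [[a1 a2 a3 a4] [b1 b2 b3 b4] h]]; exists M', N'; split=> //.
by move=> m n n' M'm gn fn'; rewrite -opprB; apply: (gsubN b1); exact: h fn' gn.
Qed.

Lemma qheq_trans M N (f g h : qhom M N) : qheq f g -> qheq g h -> qheq f h.
Proof.
case=> M' [N' [[a1 a2 a3 a4] [b1 b2 b3 b4] E]].
case=> M2 [N2 [[c1 c2 c3 c4] [d1 d2 d3 d4] E2]].
exists (M' `&` M2), (addset N' N2); split.
- split; [exact: gsubI|exact: flI| |].
    by move=> m [/a3].
  by move=> m [_ /c4].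
- split; [exact: (gsub_add (hD N))|exact: flD| |].
    by move=> n /b3 N'n; exists n, 0; rewrite addr0; split=> //; case: d1.
  by move=> n /d4 N2n; exists 0, n; rewrite add0r; split=> //; case: b1.
- move=> m n n' [M'm M2m] fn hn'; have [n0 _ gn0] := a4 _ M'm.
  exists (n - n0), (n0 - n'); split; [exact: E fn gn0|exact: E2 gn0 hn'|].
  by rewrite addrA subrK.
Qed.

Lemma qcomp_heq M N P (g g' : qhom N P) (f f' : qhom M N) :
  qheq g g' -> qheq f f' -> qheq (qcomp g f) (qcomp g' f').
Proof.
case=> Y0 [Z0 [[a1 a2 a3 a4] [b1 b2 b3 b4] E]].
case=> X1 [Y1 [[c1 c2 c3 c4] [d1 d2 d3 d4] E1]].
pose XX := X1 `&` (preim (graph f) Y0 `&` preim (graph f') Y0).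
pose ZZ := addset Z0 (addset (preim (converse (graph g)) Y1)
                             (preim (converse (graph g')) Y1)).
have gI2 : graded_submodule (addset (preim (converse (graph g)) Y1)
                             (preim (converse (graph g')) Y1)).
  by apply: (gsub_add (hD P)); exact: img_gsub.
have gP2 : graded_submodule (preim (graph f) Y0 `&` preim (graph f') Y0).
  by apply: gsubI; exact: pre_gsub.
have Z00 : Z0 0 by case: b1.
have g0 : graph g (0, 0) by case: (graph_gsub g).
have g'0 : graph g' (0, 0) by case: (graph_gsub g').
have Y10 : Y1 0 by case: d1.
exists XX, ZZ; split.
- split; first exact: gsubI.
  + by apply: flI => //; apply: flI; do ?exact: pre_gsub; exact: pre_fl.
  + by move=> m [_ [[n /a3[q _ gq] fn] _]]; exists q => //; exists n.
  + by move=> m [_ [_ [n /a4[q _ gq] fn]]]; exists q => //; exists n.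
- split; first exact: (gsub_add (hD P)).
  + by apply: flD => //; apply: flD; do ?exact: img_gsub; exact: img_fl.
  + move=> q [m -> [n /= fn gn]]; exists 0, q; rewrite add0r; split=> //.
    exists q, 0; rewrite addr0; split=> //; last by exists 0.
    by exists n => //; apply: d3; exists 0.
  + move=> q [m -> [n /= fn gn]]; exists 0, q; rewrite add0r; split=> //.
    exists 0, q; rewrite add0r; split=> //; first by exists 0.
    by exists n => //; apply: d4; exists 0.
- move=> m z z' [X1m [[y0 Y0y0 fy0] _]] [y /= fy gy] [y' /= fy' gy'].
  have [z0 _ gz0] := a3 _ Y0y0; have [z0' _ gz0'] := a4 _ Y0y0.
  exists (z0 - z0'), ((z - z0) + (z0' - z')); split.
  + exact: E gz0 gz0'.
  + exists (z - z0), (z0' - z'); split=> //.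
      exists (y - y0); last exact: graphB.
      by apply: d3; exists 0 => //=; rewrite -(subrr m); exact: graphB.
    exists (y0 - y'); last exact: graphB.
    exact: E1 fy0 fy'.
  + by rewrite addrCA (addrA (z0 - z0')) subrK addrA subrK.
Qed.

Lemma qcompA M N P Q (h : qhom P Q) (g : qhom N P) (f : qhom M N) :
  qheq (qcomp h (qcomp g f)) (qcomp (qcomp h g) f).
Proof.
apply: qheq_graph; apply/seteqP; split=> -[m q] /=.
  by case=> z [n /= fn gz] hz; exists n => //; exists z.
by case=> n fn [z /= gz hz]; exists z => //; exists n.
Qed.

Lemma qcomp1m M N (f : qhom M N) : qheq (qcomp (qid N) f) f.
Proof.
apply: qheq_graph; apply/seteqP; split=> -[m q] /=; first by case=> n /= fn <-.
by move=> fq; exists q.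
Qed.

Lemma qcompm1 M N (f : qhom M N) : qheq (qcomp f (qid M)) f.
Proof.
apply: qheq_graph; apply/seteqP; split=> -[m q] /=; first by case=> n /= ->.
by move=> fq; exists m.
Qed.

Definition coh : category :=
  Category (fun M N f => @qheq_graph M N f f erefl) qheq_sym qheq_trans
    qcomp_heq qcompA qcomp1m qcompm1.

Definition line_bundle (y : L) : coh := gshift structure_module y.

Definition twist (F : coh) (x : L) : coh := gshift F x.

Definition extension_term (Lb : coh) (x : L) (E : coh) : Prop :=
  exists (f : Hom (twist Lb (vomega p)) E) (g : Hom E (twist Lb x)),
    short_exact f g /\ ~ splits g.

Definition vdelta : L := \sum_(i < 3) vx p i *+ (p i - 2).

Definition extension_bundle (E : coh) : Prop :=
  exists (y x : L) (E0 : coh),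
    [/\ Lle 0 x, Lle x vdelta, extension_term (line_bundle y) x E0
      & isomorphic E E0].

(* Points of the weighted projective line are graded prime ideals of A other
   than the irrelevant ideal; primality is only tested on homogeneous elements,
   the ideal of an ordinary point need not be prime as an ungraded ideal. *)
Definition is_homogA (a : coordA k p) : Prop := exists x, homogA x a.

Definition graded_prime (I : set structure_module) : Prop :=
  [/\ graded_submodule I, ~ I (1 : A) &
      forall a b : A, is_homogA a -> is_homogA b -> I (a * b) -> I a \/ I b].

Definition relevant (I : set structure_module) : Prop :=
  exists i : 'I_3, ~ I (toA p ('X_i : {mpoly k[3]})).

(* Non-vanishing of the graded localization of M at I. *)
Definition stalk_nonzero (M : gmod) (I : set structure_module) : Prop :=
  exists (x : L) (m : M), hpart M x m /\
    forall a : A, is_homogA a -> ~ I a -> a *: m <> 0.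

(* The inclusion k[T1,T2] -> A, T1 |-> X1^p1, T2 |-> X2^p2. *)
Definition point_eq (z : {mpoly k[2]}) : A :=
  toA p (z \mPo [tuple 'X_i1 ^+ p i1; 'X_i2 ^+ p i2]).

Definition supported_at (z : {mpoly k[2]}) (F : coh) : Prop :=
  forall I : set structure_module, graded_prime I -> relevant I ->
    stalk_nonzero F I -> I (point_eq z).

(* [has_length n S] includes that S is torsion, i.e. of finite length. *)
Definition is_tube_object (z : {mpoly k[2]}) (n : nat) (S : coh) : Prop :=
  [/\ supported_at z S, indecomposable S & has_length n S].

End GradedModules.

Definition prime_elt (R : comUnitRingType) (z : R) : Prop :=
  [/\ z != 0, z \isn't a GRing.unit &
      forall a b, (exists c, a * b = z * c) ->
        (exists c, a = z * c) \/ (exists c, b = z * c)].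

(* An ordinary point is given by a prime form z in k[T1,T2]; the exceptional
   points are those of T1, T2 and T2 - T1, the latter being X3^p3 in A. *)
Definition ordinary_point (k : fieldType) (d : nat) (z : {mpoly k[2]}) : Prop :=
  [/\ z \is d.-homog, prime_elt z &
      forall a : k, [/\ z <> a *: 'X_ord0, z <> a *: 'X_ord_max
                      & z <> a *: ('X_ord_max - 'X_ord0)]].

Definition fpoly (m : int) : {poly int} :=
  match m with
  | Posz 0 => 1
  | Posz n => \sum_(1 <= i < n.+1) ((-1) ^+ i.-1 * (2 * i - 1)%N%:R) *: 'X^(n.+1 - i)
              + ((-1) ^+ n * n.+1%:R)%:P
  | Negz _ => 0
  end.

(* Main.v *)
(* A coherent sheaf is determined by the components of a graded module in degrees
   x = sum_i l_i x_i + l c with l large.  Put T1 = X1^p1, T2 = X2^p2 and t = T2/T1.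
   Dehomogenizing at T1 = 1 turns A_x into the polynomials in t of degree at most l, and
   turns S into k[t]/(zeta^n) in each degree, zeta being the dehomogenization of z.  The
   components of an extension bundle E become spaces of pairs (r1, r2) of polynomials of
   bounded degree, subject to the conditions r2(0) = 0 and r1(1) = r2(1), each of which is
   imposed or not depending on x.  The equality in K_0 forces the same description for E',
   with the degree bound lowered by D = d n.

   A subobject of E with quotient S is then the kernel of
   (r1, r2) |-> al r1 + be r2 mod zeta^n for a unique point (al : be) of the projective line
   over k[t]/(zeta^n), which has q^D + q^(D-d) points, and it is isomorphic to E' unless it
   contains a nonzero pair that is too small.  Such a pair is, up to a factor zeta^s, a
   multiple of a primitive pair, which is unique up to scalars.  Counting bounded pairs by
   their primitive parts, over the four choices of linear conditions, gives
   S_M + 2 S_(M-1) + S_(M-2) = 4 (q - 1) (q^(M-1) + 1) for the number S_M of primitive pairs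
   of size at most M, and this recursion is solved by the polynomials f_m. *)

From HB Require Import structures.
From mathcomp Require Import all_boot all_order all_algebra.
From mathcomp Require Import generic_quotient ring_quotient.
From mathcomp Require Import mpoly.
From mathcomp Require Import boolp classical_sets.
From mathcomp Require Import zify ring.
Require Import Defs.

Set Implicit Arguments.
Unset Strict Implicit.
Unset Printing Implicit Defensive.

Import Order.TTheory GRing.Theory Num.Theory.

Local Open Scope classical_set_scope.
Local Open Scope quotient_scope.
Local Open Scope ring_scope.

Local Notation i1 := (@Ordinal 3 0 isT).
Local Notation i2 := (@Ordinal 3 1 isT).
Local Notation i3 := (@Ordinal 3 2 isT).


(** Arrows of [coh] are relations between modules. Passing to components of high degree is faithful
    because an element annihilated by A in high degrees vanishes if its own degree is high, which
    follows by counting since k is finite. The pair (r1, r2) of an element of E consists of its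
    coordinates in the splittings of the defining sequence over T1 <> 0 and T2 <> 0, the second
    multiplied by t; they differ by the extension cocycle, up to a scalar a single monomial. The
    class in K_0 yields only the dimensions of the components. These show where a linear condition
    switches, not on which side of the switch it is imposed, so E and E' may come with complementary
    conditions; the coordinate changes (r2, t r1) and (r1 - r2, t r1 - r2) complement one condition
    at a time. The four choices of conditions have equal weight because the degree bound is raised
    by the number of imposed conditions, which makes the number of bounded pairs q^M each time. The
    conditions met by a primitive pair differ from the four choices in 0, 1, 1 and 2 places; this
    produces the coefficients 1, 2, 1 of the recursion. *)

Lemma ord3P (P : 'I_3 -> Prop) : P i1 -> P i2 -> P i3 -> forall i, P i.
Proof.
by move=> h1 h2 h3 [[|[|[|//]]] Hi]; rewrite (bool_irrelevance Hi isT).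
Qed.

Lemma big_ord3 (R : Type) (idx : R) (op : Monoid.law idx) (F : 'I_3 -> R) :
  \big[op/idx]_i F i = op (F i1) (op (F i2) (F i3)).
Proof.
rewrite !big_ord_recl big_ord0 Monoid.mulm1.
by congr (op (F _) (op (F _) (F _))); apply: val_inj.
Qed.

(** * The grading group and the coordinate algebra *)

Section NormalForm.
Variable p : weights.
Local Notation L := (Lgroup p).

Implicit Types (x y : L).

Definition piL (v : 'rV[int]_3) : L := \pi_({ideal_quot Lrelations p}) v.

(* The normal form: x = sum_i (sL i x) x_i + (lL x) c. *)
Definition sL (i : 'I_3) (x : L) : nat := `|((repr x) ord0 i %% (p i)%:Z)%Z|%N.
Definition lL (x : L) : int := \sum_i ((repr x) ord0 i %/ (p i)%:Z)%Z.

Lemma wt_gt0 i : (0 < p i)%N. Proof. exact: ltnW (wt_ge2 p i). Qed.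

Lemma wtz_neq0 i : (p i)%:Z != 0.
Proof. by have := wt_gt0 i; lia. Qed.

Lemma piLD u v : piL (u + v) = piL u + piL v.
Proof. exact: raddfD. Qed.

Lemma piLK x : piL (repr x) = x. Proof. exact: reprK. Qed.

Lemma repr_piL v : exists a b : int, forall i, (repr (piL v)) ord0 i =
  v ord0 i + (p i)%:Z * (if i == i1 then a + b else if i == i2 then - a else - b).
Proof.
have : piL (repr (piL v)) == piL v by rewrite piLK.
rewrite -Quotient.idealrBE => /asboolP[a [b e]]; exists a, b => i.
have e' : repr (piL v) = v + (repr (piL v) - v) by rewrite addrC subrK.
rewrite {1}e' [in X in X = _]mxE; congr (_ + _); rewrite e.
rewrite /Zgen !pmulrn -!scaler_int !mxE !eqxx /= !intz.
elim/ord3P: i; rewrite !eqE /= ?mulr1 ?mulr0; ring.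
Qed.

Lemma sL_pi i v : sL i (piL v) = `|(v ord0 i %% (p i)%:Z)%Z|%N.
Proof.
have [a [b e]] := repr_piL v; rewrite /sL e mulrC addrC modzMDl //.
Qed.

Lemma lL_pi v : lL (piL v) = \sum_i (v ord0 i %/ (p i)%:Z)%Z.
Proof.
have [a [b e]] := repr_piL v; rewrite /lL !big_ord3 !e !eqE /=.
rewrite -!(mulrC (_ + _)) -?(mulrC (- _)).
rewrite !(addrC (v _ _)) !divzMDl ?wtz_neq0 //; ring.
Qed.

Lemma sL_lt i x : (sL i x < p i)%N.
Proof.
rewrite /sL; have := ltz_pmod ((repr x) ord0 i) (_ : 0 < (p i)%:Z).
have := modz_ge0 ((repr x) ord0 i) (wtz_neq0 i); have := wt_gt0 i; lia.
Qed.

Lemma repr_sL i x : (repr x) ord0 i = ((repr x) ord0 i %/ (p i)%:Z)%Z * (p i)%:Z + (sL i x)%:Z.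
Proof.
rewrite {1}(divz_eq ((repr x) ord0 i) (p i)) /sL; congr (_ + _).
have := modz_ge0 ((repr x) ord0 i) (wtz_neq0 i); lia.
Qed.

Lemma divz_nat (a b : nat) : (a%:Z %/ b%:Z)%Z = (a %/ b)%N%:Z.
Proof. by rewrite divz_nat. Qed.

Lemma sLD i x y : sL i (x + y) = ((sL i x + sL i y) %% p i)%N.
Proof.
rewrite -{1}[x]piLK -{1}[y]piLK -piLD sL_pi mxE (repr_sL i x) (repr_sL i y).
rewrite addrACA -mulrDl modzMDl -PoszD modz_nat //.
Qed.

Lemma lLD x y : lL (x + y) = lL x + lL y + (\sum_i ((sL i x + sL i y) %/ p i)%N)%:Z.
Proof.
rewrite -{1}[x]piLK -{1}[y]piLK -piLD lL_pi /lL !big_ord3 !PoszD.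
have E i : ((repr x + repr y) ord0 i %/ (p i)%:Z)%Z = ((repr x) ord0 i %/ (p i)%:Z)%Z
   + ((repr y) ord0 i %/ (p i)%:Z)%Z + ((sL i x + sL i y) %/ p i)%N%:Z.
  rewrite mxE {1}(repr_sL i x) {1}(repr_sL i y) addrACA -mulrDl divzMDl ?wtz_neq0 //.
  by rewrite -PoszD divz_nat.
rewrite /= !E; ring.
Qed.

Lemma sL0 i : sL i 0 = 0%N.
Proof.
have -> : 0 = piL 0 by rewrite /piL raddf0.
by rewrite sL_pi mxE mod0z.
Qed.

Lemma lL0 : lL 0 = 0.
Proof.
have -> : 0 = piL 0 by rewrite /piL raddf0.
by rewrite lL_pi big1 // => i _; rewrite mxE div0z.
Qed.

Lemma sL_vx i j : sL i (vx p j) = (i == j).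
Proof.
rewrite -[vx p j]/(piL (Zgen j)) sL_pi mxE eqxx andTb natz modz_nat absz_nat modn_small //.
by have := wt_ge2 p i; case: (i == j) => //=; lia.
Qed.

Lemma lL_vx j : lL (vx p j) = 0.
Proof.
rewrite -[vx p j]/(piL (Zgen j)) lL_pi big1 // => i _; rewrite mxE eqxx andTb natz divz_nat divn_small //.
by have := wt_ge2 p i; case: (i == j) => //=; lia.
Qed.

Lemma sL_mulvx i j n : (n < p j)%N -> sL i (vx p j *+ n) = if i == j then n else 0%N.
Proof.
elim: n => [|n IH] lt; first by rewrite mulr0n sL0 if_same.
rewrite mulrSr sLD IH ?sL_vx; last exact: ltnW.
case: eqVneq => [e|_]; last by rewrite modn_small // ltnW ?wt_ge2.
by rewrite e addn1 modn_small.
Qed.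

Lemma lL_mulvx j n : (n < p j)%N -> lL (vx p j *+ n) = 0.
Proof.
elim: n => [|n IH] lt; first by rewrite mulr0n lL0.
rewrite mulrSr lLD IH ?lL_vx 1?ltnW // !add0r; congr Posz; rewrite big1 // => i _.
rewrite sL_mulvx 1?ltnW // sL_vx; case: eqVneq => [e|_]; last first.
  by rewrite divn_small // ltnW ?wt_ge2.
by rewrite e addn1 divn_small.
Qed.

Lemma sL_vc i : sL i (vc p) = 0%N.
Proof.
rewrite -(vcE p i1); have [n e] : exists n, p i1 = n.+1.
  by exists (p i1).-1; rewrite prednK // wt_gt0.
rewrite e mulrSr sLD sL_mulvx ?sL_vx; last by rewrite e.
by case: eqVneq => [->|_]; rewrite ?mod0n // addn1 -e modnn.
Qed.

Lemma lL_vc : lL (vc p) = 1.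
Proof.
rewrite -(vcE p i1); have [n e] : exists n, p i1 = n.+1.
  by exists (p i1).-1; rewrite prednK // wt_gt0.
rewrite e mulrSr lLD lL_mulvx ?lL_vx; last by rewrite e.
rewrite !add0r; congr Posz; rewrite big_ord3 !sL_mulvx ?e // !sL_vx !eqE /=.
by rewrite !div0n !addn0 addn1 -e divnn wt_gt0.
Qed.

Lemma sL_addvc i x : sL i (x + vc p) = sL i x.
Proof. by rewrite sLD sL_vc addn0 modn_small // sL_lt. Qed.

Lemma lL_addvc x : lL (x + vc p) = lL x + 1.
Proof.
rewrite lLD lL_vc big1 ?addr0 // => i _.
by rewrite sL_vc addn0 divn_small // sL_lt.
Qed.

Lemma sL_addvcn i x n : sL i (x + vc p *+ n) = sL i x.
Proof. by elim: n => [|n IH]; rewrite ?mulr0n ?addr0 // mulrSr addrA sL_addvc. Qed.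

Lemma lL_addvcn x n : lL (x + vc p *+ n) = lL x + n%:Z.
Proof.
elim: n => [|n IH]; rewrite ?mulr0n ?addr0 // mulrSr addrA lL_addvc IH; lia.
Qed.

Lemma sL_subvcn i x n : sL i (x - vc p *+ n) = sL i x.
Proof. by rewrite -{2}[x](subrK (vc p *+ n)) sL_addvcn. Qed.

Lemma lL_subvcn x n : lL (x - vc p *+ n) = lL x - n%:Z.
Proof. by rewrite -{2}[x](subrK (vc p *+ n)) lL_addvcn addrK. Qed.

Lemma sL_addvx i j x : sL i (x + vx p j) =
  if i == j then (if (sL i x).+1 == p i then 0 else (sL i x).+1)%N else sL i x.
Proof.
rewrite sLD sL_vx; have := sL_lt i x; case: eqVneq => _ lt; last by rewrite addn0 modn_small.
by rewrite addn1; case: eqP => [->|ne]; rewrite ?modnn // modn_small //; lia.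
Qed.

Lemma lL_addvx j x : lL (x + vx p j) = lL x + ((sL j x).+1 == p j)%:Z.
Proof.
rewrite lLD lL_vx addr0; congr (_ + Posz _).
rewrite (bigD1 j) //= big1 ?addn0 => [|i ne]; last first.
  by rewrite sL_vx (negPf ne) addn0 divn_small // sL_lt.
rewrite sL_vx eqxx addn1; have := sL_lt j x; case: eqP => [->|ne] lt.
  by rewrite divnn wt_gt0.
by rewrite divn_small //; lia.
Qed.

Lemma lLD_ge x y : lL x + lL y <= lL (x + y).
Proof. by rewrite lLD; lia. Qed.

Lemma normal_form x : x = \sum_i vx p i *+ sL i x + vc p *~ lL x.
Proof.
have E (v : 'rV[int]_3) : piL v = \sum_i vx p i *~ v ord0 i.
  have -> : v = \sum_i Zgen i *~ v ord0 i.
    rewrite {1}(row_sum_delta v); apply: eq_bigr => i _.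
    by rewrite -scaler_int intz.
  rewrite /piL raddf_sum /=; apply: eq_bigr => i _; rewrite raddfMz.
  congr (_ *~ _); rewrite summxE (bigD1 i) //= big1 ?addr0 => [|j ne].
    by rewrite -scaler_int intz !mxE !eqxx mulr1.
  by rewrite -scaler_int intz !mxE [i == j]eq_sym (negPf ne) mulr0.
rewrite -{1}[x]piLK E /lL.
rewrite mulrz_sumr -big_split /=; apply: eq_bigr => i _.
by rewrite {1}(repr_sL i x) mulrzDr addrC mulrC mulrzA pmulrn -(vcE p i) -!pmulrn.
Qed.

Lemma sL_degL i (m : 'X_{1..3}) : sL i (degL p m) = (m i %% p i)%N.
Proof.
have E n j : sL i (vx p j *+ n) = if i == j then (n %% p i)%N else 0%N.
  elim: n => [|n IH]; first by rewrite mulr0n sL0 mod0n if_same.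
  rewrite mulrSr sLD IH sL_vx; case: eqP => _; last by rewrite mod0n.
  by rewrite modnDml addn1.
rewrite /degL !big_ord3 !sLD !E modnDmr.
by elim/ord3P: i {E}; rewrite !eqE /= ?add0n ?addn0 ?modn_mod.
Qed.

Lemma lL_mulvxn j n : lL (vx p j *+ n) = (n %/ p j)%N%:Z.
Proof.
rewrite {1}(divn_eq n (p j)) mulrnDr mulnC mulrnA vcE addrC lL_addvcn.
by rewrite lL_mulvx ?ltn_mod ?wt_gt0.
Qed.

Lemma lL_degL (m : 'X_{1..3}) : lL (degL p m) = (\sum_i (m i %/ p i)%N)%:Z.
Proof.
have E n j i : sL i (vx p j *+ n) = if i == j then (n %% p i)%N else 0%N.
  elim: n => [|n IH]; first by rewrite mulr0n sL0 mod0n if_same.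
  rewrite mulrSr sLD IH sL_vx; case: eqP => _; last by rewrite mod0n.
  by rewrite modnDml addn1.
rewrite /degL !big_ord3 !lLD !lL_mulvxn.
rewrite !big1 => [|i _|i _]; first by rewrite !addr0 -!PoszD.
- rewrite !sLD !E; elim/ord3P: i; rewrite !eqE /= ?add0n ?addn0 ?modn_mod ?mod0n ?addn0;
  by rewrite ?div0n // divn_small // ltn_mod wt_gt0.
- rewrite !E; elim/ord3P: i; rewrite !eqE /= ?add0n ?addn0;
  by rewrite ?div0n // divn_small // ltn_mod wt_gt0.
Qed.

End NormalForm.

(** * Dehomogenization of the coordinate algebra *)

Section Theta.
Variables (k : fieldType) (p : weights).
Local Notation S := {mpoly k[3]}.
Local Notation A := (coordA k p).
Local Notation L := (Lgroup p).
Implicit Types (x y : L) (a b : A) (g h : S) (f : {poly k}).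

Definition tau (i : 'I_3) : {poly k} :=
  if i == i1 then 1 else if i == i2 then 'X else 'X - 1.

Lemma tau1 : tau i1 = 1. Proof. by []. Qed.
Lemma tau2 : tau i2 = 'X. Proof. by []. Qed.
Lemma tau3 : tau i3 = 'X - 1. Proof. by []. Qed.
Definition tauE := (tau1, tau2, tau3).

(* Dehomogenization at X1^p1 = 1, with 'X standing for X2^p2 and 'X - 1 for X3^p3; the
   remaining powers X_i^j with j < p_i are sent to 1. *)
Definition thm (m : 'X_{1..3}) : {poly k} := \prod_i tau i ^+ (m i %/ p i).

Definition thS (g : S) : {poly k} := \sum_(m <- msupp g) g@_m *: thm m.

Lemma thSE (r : seq 'X_{1..3}) g : uniq r -> {subset msupp g <= r} ->
  thS g = \sum_(m <- r) g@_m *: thm m.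
Proof.
move=> ur sr; rewrite (bigID (mem (msupp g))) /= [X in _ + X]big1 ?addr0; last first.
  by move=> m /memN_msupp_eq0 ->; rewrite scale0r.
rewrite -big_filter; apply: perm_big; apply: uniq_perm; rewrite ?msupp_uniq ?filter_uniq //.
by move=> m; rewrite mem_filter; case: (boolP (m \in msupp g)) => //= /sr ->.
Qed.

Lemma thSD g h : thS (g + h) = thS g + thS h.
Proof.
pose r := undup (msupp g ++ msupp h ++ msupp (g + h)).
have ur : uniq r by exact: undup_uniq.
rewrite !(@thSE r) //; last first.
1-3: by move=> m mg; rewrite mem_undup !mem_cat mg /=; do ?case: (_ \in _).
by rewrite -big_split; apply: eq_bigr => m _; rewrite mcoeffD scalerDl.
Qed.

Lemma thSZ c g : thS (c *: g) = c *: thS g.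
Proof.
rewrite (@thSE (msupp g)) ?msupp_uniq //; last exact: msuppZ_le.
by rewrite scaler_sumr; apply: eq_bigr => m _; rewrite mcoeffZ scalerA.
Qed.

Lemma thS0 : thS 0 = 0.
Proof. by rewrite /thS msupp0 big_nil. Qed.

Lemma thSN g : thS (- g) = - thS g.
Proof. by apply: (addIr (thS g)); rewrite -thSD !addNr thS0. Qed.

Lemma thS_sum (I : Type) (r : seq I) (P : pred I) (F : I -> S) :
  thS (\sum_(i <- r | P i) F i) = \sum_(i <- r | P i) thS (F i).
Proof. exact: (big_morph thS thSD thS0). Qed.

Lemma thSX m : thS 'X_[m] = thm m.
Proof. by rewrite /thS msuppX big_seq1 mcoeffX eqxx scale1r. Qed.

Lemma thS_XnM i g : thS ('X_i ^+ p i * g) = tau i * thS g.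
Proof.
rewrite {1}(mpolyE g) [in RHS](mpolyE g) mulr_sumr !thS_sum mulr_sumr.
apply: eq_bigr => m _; rewrite -scalerAr !thSZ -scalerAr; congr (_ *: _).
rewrite mpolyXn -mpolyXD !thSX /thm !(bigD1 (P := predT) i) //= mulrA -exprS; congr (_ ^+ _ * _).
  by rewrite mnmDE mulmnE mnm1E eqxx mul1n divnDl ?divnn ?wt_gt0.
apply: eq_bigr => j ne; rewrite mnmDE mulmnE mnm1E eq_sym (negPf ne) mul0n //.
Qed.

(** All monomials of degree x have the same exponent of X_i modulo [p i], namely [sL i x], so
    multiplication by X_i completes a power X_i^(p_i) in all of them or in none. *)
Lemma thS_XM x i g : homogS x g ->
  thS ('X_i * g) = tau i ^+ ((sL i x).+1 == p i) * thS g.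
Proof.
move=> hg; rewrite {1}(mpolyE g) [in RHS](mpolyE g) mulr_sumr !thS_sum mulr_sumr.
apply: eq_big_seq => m /hg dm; rewrite -scalerAr !thSZ -scalerAr; congr (_ *: _).
rewrite -mpolyXD !thSX /thm !(bigD1 (P := predT) i) //= mulrA -exprD; congr (_ ^+ _ * _).
  rewrite mnmDE mnm1E eqxx -dm sL_degL.
  rewrite {1}(divn_eq (m i) (p i)) addnCA divnMDl ?wt_gt0 // addnC; congr (_ + _)%N.
  have := ltn_pmod (m i) (wt_gt0 p i); rewrite add1n; case: eqP => [->|ne] lt.
    by rewrite divnn wt_gt0.
  by rewrite divn_small // ltn_neqAle lt andbT; exact/eqP.
by apply: eq_bigr => j ne; rewrite mnmDE mnm1E eq_sym (negPf ne) add0n.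
Qed.

Lemma thS_relator h : thS (h * relator k p) = 0.
Proof.
rewrite /relator mulrC mulrDl mulrBl !thSD thSN !thS_XnM ?tauE; ring.
Qed.

Definition th (a : A) : {poly k} := thS (repr a).

Lemma th_toA g : th (toA p g) = thS g.
Proof.
have /toA_eq0[h e] : toA p (repr (toA p g) - g) = 0.
  by rewrite raddfB /= toAK subrr.
by apply/eqP; rewrite -subr_eq0 /th -thSN -thSD e thS_relator.
Qed.

Lemma thD a b : th (a + b) = th a + th b.
Proof. by rewrite -[a]toAK -[b]toAK -raddfD !th_toA thSD. Qed.

Lemma th0 : th 0 = 0.
Proof. by rewrite -(raddf0 (toA p)) th_toA thS0. Qed.

Lemma thN a : th (- a) = - th a.
Proof. by rewrite -[a]toAK -raddfN !th_toA thSN. Qed.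

Lemma thB a b : th (a - b) = th a - th b.
Proof. by rewrite thD thN. Qed.

Lemma th_sum (I : Type) (r : seq I) (P : pred I) (F : I -> A) :
  th (\sum_(i <- r | P i) F i) = \sum_(i <- r | P i) th (F i).
Proof. exact: (big_morph th thD th0). Qed.

(** Graded modules are modules over A alone; k-linearity is expressed by scaling with these images
    of the constants. *)
Definition kA (c : k) : A := toA p c%:MP.

Lemma kAD c d : kA (c + d) = kA c + kA d.
Proof. by rewrite /kA mpolyCD raddfD. Qed.
Lemma kAM c d : kA (c * d) = kA c * kA d.
Proof. by rewrite /kA mpolyCM rmorphM. Qed.
Lemma kA0 : kA 0 = 0.
Proof. by rewrite /kA mpolyC0 raddf0. Qed.
Lemma kA1 : kA 1 = 1.
Proof. by rewrite /kA mpolyC1 rmorph1. Qed.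
Lemma kAN c : kA (- c) = - kA c.
Proof. by rewrite /kA mpolyCN raddfN. Qed.

Lemma toAZ c g : toA p (c *: g) = kA c * toA p g.
Proof. by rewrite -mul_mpolyC rmorphM. Qed.

Lemma th_kA c a : th (kA c * a) = c *: th a.
Proof. by rewrite -[a]toAK -rmorphM mul_mpolyC !th_toA thSZ. Qed.

Definition XA (i : 'I_3) : A := toA p 'X_i.
Definition TA (i : 'I_3) : A := XA i ^+ p i.

Lemma TA_rel : TA i3 = TA i2 - TA i1.
Proof.
apply/eqP; rewrite -subr_eq0 opprB addrA addrAC.
rewrite /TA /XA -!rmorphXn -raddfB -raddfD /=.
by apply/eqP/toA_eq0; exists 1; rewrite mul1r.
Qed.

Lemma th_TA i a : th (TA i * a) = tau i * th a.
Proof. by rewrite -[a]toAK /TA /XA -rmorphXn -rmorphM !th_toA thS_XnM. Qed.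

Lemma th_XA x i a : homogA x a -> th (XA i * a) = tau i ^+ ((sL i x).+1 == p i) * th a.
Proof. by case=> g hg ->; rewrite /XA -rmorphM !th_toA (thS_XM _ hg). Qed.

Lemma homogAP x a : homogA x a <-> prA x a = a.
Proof.
split=> [[g hg ->]|<-]; first by rewrite prAE prS_homog.
by exists (prS x (repr a)) => //; exact: homogS_prS.
Qed.

Lemma homogA0 x : homogA x (0 : A).
Proof. by apply/homogAP; apply: (@pr0 A _ A^o _ (@prAD k p)). Qed.

Lemma homogAD x a b : homogA x a -> homogA x b -> homogA x (a + b).
Proof. by move=> /homogAP ha /homogAP hb; apply/homogAP; rewrite prAD ha hb. Qed.

Lemma homogAM x y a b : homogA x a -> homogA y b -> homogA (x + y) (a * b).
Proof.
by move=> ha /homogAP hb; apply/homogAP; rewrite -{1}hb prA_scale // hb.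
Qed.

Lemma homog_kA c : homogA 0 (kA c).
Proof.
exists c%:MP => // m; rewrite msuppC; case: (c == 0) => //=.
by rewrite inE => /eqP ->; rewrite /degL big1 // => i _; rewrite mnm0E.
Qed.

Lemma homog_XA i : homogA (vx p i) (XA i).
Proof.
exists 'X_i => // m; rewrite msuppX inE => /eqP ->.
rewrite /degL (bigD1 i) //= big1 ?addr0 ?mnm1E ?eqxx // => j ne.
by rewrite mnm1E eq_sym (negPf ne).
Qed.

Lemma homogAX x a n : homogA x a -> homogA (x *+ n) (a ^+ n).
Proof.
move=> ha; elim: n => [|n IH]; first by rewrite expr0 mulr0n -kA1; exact: homog_kA.
by rewrite mulrS exprS; exact: homogAM.
Qed.

Lemma homog_TA i : homogA (vc p) (TA i).
Proof. by rewrite -(vcE p i); apply: homogAX; exact: homog_XA. Qed.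

Lemma homogA_sum x (I : Type) (r : seq I) (P : pred I) (F : I -> A) :
  (forall i, P i -> homogA x (F i)) -> homogA x (\sum_(i <- r | P i) F i).
Proof.
move=> h; apply: (big_ind (homogA x)) => //; [exact: homogA0|exact: homogAD].
Qed.

Lemma homogAZ x c a : homogA x a -> homogA x (kA c * a).
Proof. by move=> ha; rewrite -[x]add0r; apply: homogAM => //; exact: homog_kA. Qed.

Lemma homogAN x a : homogA x a -> homogA x (- a).
Proof. by rewrite -mulN1r -kA1 -kAN; exact: homogAZ. Qed.

(* The binary form of degree l whose dehomogenization at T1 = 1 is f; coefficients
   of f above degree l are dropped. *)
Definition etaR (l : nat) (f : {poly k}) : A :=
  \sum_(j < l.+1) kA f`_j * (TA i1 ^+ (l - j) * TA i2 ^+ j).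

Lemma etaRD l f (g : {poly k}) : etaR l (f + g) = etaR l f + etaR l g.
Proof. by rewrite -big_split; apply: eq_bigr => j _; rewrite coefD kAD mulrDl. Qed.

Lemma etaRZ l c f : etaR l (c *: f) = kA c * etaR l f.
Proof. by rewrite /etaR mulr_sumr; apply: eq_bigr => j _; rewrite coefZ kAM -mulrA. Qed.

Lemma etaRB l f (g : {poly k}) : etaR l (f - g) = etaR l f - etaR l g.
Proof. by rewrite etaRD -scaleN1r etaRZ kAN kA1 mulN1r. Qed.

Lemma etaR_T2 l f : TA i2 * etaR l f = etaR l.+1 ('X * f).
Proof.
rewrite /etaR [in RHS]big_ord_recl coefXM eqxx kA0 mul0r add0r mulr_sumr.
apply: eq_bigr => j _; rewrite coefXM /= /bump add1n subSS /= exprS; ring.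
Qed.

Lemma etaR_T1 l f : (size f <= l.+1)%N -> TA i1 * etaR l f = etaR l.+1 f.
Proof.
move=> sf; rewrite /etaR [in RHS]big_ord_recr /= nth_default // kA0 mul0r addr0 mulr_sumr.
apply: eq_bigr => j _; rewrite subSn ?exprS; last by rewrite -ltnS.
by rewrite mulrCA !mulrA.
Qed.

Lemma etaR_T i l f : (size f <= l.+1)%N -> TA i * etaR l f = etaR l.+1 (tau i * f).
Proof.
move=> sf; elim/ord3P: i; rewrite ?tauE.
- by rewrite mul1r etaR_T1.
- by rewrite etaR_T2.
- by rewrite TA_rel mulrBl etaR_T1 // etaR_T2 mulrBl mul1r etaRB.
Qed.

Lemma tau_neq0 i : tau i != 0.
Proof.
elim/ord3P: i; rewrite ?tauE ?oner_eq0 ?polyX_eq0 //.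
by rewrite -[1]/(1%:P) polyXsubC_eq0.
Qed.

Lemma size_tau i : (size (tau i) <= 2)%N.
Proof.
elim/ord3P: i; rewrite ?tauE ?size_poly1 ?size_polyX //.
by rewrite -[1]/(1%:P) size_XsubC.
Qed.

Lemma size_tauM i n f l : (size f <= l.+1)%N -> (size (tau i ^+ n * f)%R <= (n + l).+1)%N.
Proof.
move=> sf; elim: n => [|n IH]; first by rewrite expr0 mul1r.
rewrite exprS -mulrA; apply: leq_trans (size_polyMleq _ _) _.
have := size_tau i; lia.
Qed.

Lemma etaR_Tn i n l f : (size f <= l.+1)%N ->
  TA i ^+ n * etaR l f = etaR (n + l) (tau i ^+ n * f).
Proof.
move=> sf; elim: n => [|n IH]; first by rewrite !expr0 !mul1r.
by rewrite !exprS -!mulrA IH etaR_T // size_tauM.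
Qed.

Lemma th_TAn i n a : th (TA i ^+ n * a) = tau i ^+ n * th a.
Proof. by elim: n => [|n IH]; rewrite ?expr0 ?mul1r // !exprS -!mulrA th_TA IH. Qed.

Lemma th_etaRM l f a : (size f <= l.+1)%N -> th (etaR l f * a) = f * th a.
Proof.
move=> sf; rewrite /etaR mulr_suml th_sum.
under eq_bigr => j _.
  rewrite -!mulrA th_kA !th_TAn ?tauE expr1n mul1r -mul_polyC mulrA mul_polyC.
  over.
rewrite -mulr_suml; congr (_ * _); rewrite -poly_def.
apply/polyP => i; rewrite coef_poly; case: ltnP => // h.
by rewrite nth_default // (leq_trans sf).
Qed.

Lemma homog_etaR l f : homogA (vc p *+ l) (etaR l f).
Proof.
apply: homogA_sum => j _; apply: homogAZ.
have -> : vc p *+ l = vc p *+ (l - j) + vc p *+ j.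
  by rewrite -mulrnDr subnK // -ltnS.
by apply: homogAM; apply: homogAX; exact: homog_TA.
Qed.

(* The dimension of A_x. *)
Definition dsz (x : L) : nat := if lL x is Posz l then l.+1 else 0%N.

Lemma dszE x : 0 <= lL x -> (dsz x)%:Z = lL x + 1.
Proof. by rewrite /dsz; case: (lL x) => // n _; lia. Qed.

Definition smono (x : L) : A := \prod_i XA i ^+ sL i x.

(** The inverse of [th] on A_x: an element of A_x is the monomial with exponents [sL i x] times a
    binary form of degree [lL x] in T1 and T2, and A_x = 0 when [lL x] is negative. *)
Definition eta (x : L) (f : {poly k}) : A :=
  if lL x is Posz l then smono x * etaR l f else 0.

Lemma sum_vx_sL x l : lL x = Posz l -> x = \sum_i vx p i *+ sL i x + vc p *+ l.
Proof. by move=> e; rewrite {1}(normal_form x) e. Qed.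

Lemma homog_smono x : homogA (\sum_i vx p i *+ sL i x) (smono x).
Proof.
rewrite /smono !big_ord3 /=; apply: homogAM; last apply: homogAM;
by apply: homogAX; exact: homog_XA.
Qed.

Lemma homog_eta x f : homogA x (eta x f).
Proof.
rewrite /eta; case E: (lL x) => [l|l]; last exact: homogA0.
rewrite {1}(sum_vx_sL E); apply: homogAM; [exact: homog_smono|exact: homog_etaR].
Qed.

Lemma etaD x f (g : {poly k}) : eta x (f + g) = eta x f + eta x g.
Proof. by rewrite /eta; case: (lL x) => l; rewrite ?addr0 // etaRD mulrDr. Qed.

Lemma etaZ x c f : eta x (c *: f) = kA c * eta x f.
Proof. by rewrite /eta; case: (lL x) => l; rewrite ?mulr0 // etaRZ mulrCA. Qed.

Lemma eta0 x : eta x 0 = 0.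
Proof. by rewrite -(scale0r 0) etaZ kA0 mul0r. Qed.

Lemma eta_sum x (I : Type) (r : seq I) (P : pred I) (F : I -> {poly k}) :
  eta x (\sum_(i <- r | P i) F i) = \sum_(i <- r | P i) eta x (F i).
Proof. exact: (big_morph (eta x) (etaD x) (eta0 x)). Qed.

Lemma etaR01 : etaR 0 1 = 1.
Proof. by rewrite /etaR big_ord_recl big_ord0 coef1 eqxx kA1 !expr0 !mulr1 addr0. Qed.

Lemma toA_mono m : toA p 'X_[m] = eta (degL p m) (thm m).
Proof.
rewrite /eta lL_degL /smono.
have -> : toA p 'X_[m] = \prod_i XA i ^+ m i.
  by rewrite mpolyXE_id rmorph_prod; apply: eq_bigr => i _; rewrite rmorphXn.
have E i : XA i ^+ m i = XA i ^+ sL i (degL p m) * TA i ^+ (m i %/ p i).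
  by rewrite sL_degL /TA -exprM -exprD addnC mulnC -divn_eq.
under eq_bigr do rewrite E.
rewrite big_split /=; congr (_ * _).
rewrite /thm !big_ord3 /= -[LHS]mulr1 -etaR01 -!mulrA.
rewrite !etaR_Tn ?size_poly1 //; last first.
- by apply: size_tauM; rewrite size_poly1.
- by do 2!apply: size_tauM; rewrite size_poly1.
- by rewrite addn0 mulr1.
Qed.

Lemma size_thm m x : degL p m = x -> (size (thm m) <= dsz x)%N.
Proof.
move=> <-; rewrite /dsz lL_degL /thm !big_ord3 /=.
rewrite -[X in (size (polyseq X) <= _)%N]mulr1 -!mulrA -[X in (_ <= X.+1)%N]addn0 -!addnA.
by do 3!apply: size_tauM; rewrite size_poly1.
Qed.

Lemma size_th x a : homogA x a -> (size (th a) <= dsz x)%N.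
Proof.
case=> g hg ->; rewrite th_toA /thS; apply: leq_trans (size_sum _ _ _) _.
apply/bigmax_leqP_seq => m mg _.
by apply: leq_trans (size_scale_leq _ _) _; apply: size_thm; exact: hg.
Qed.

Lemma thK x a : homogA x a -> eta x (th a) = a.
Proof.
case=> g hg ->; rewrite th_toA /thS eta_sum [in RHS](mpolyE g) raddf_sum /=.
by apply: eq_big_seq => m mg; rewrite etaZ toAZ toA_mono hg.
Qed.

(** This replaces computation modulo the relation of A by computation in k[t]: identities between
    homogeneous elements are checked on their dehomogenizations. *)
Lemma th_inj x a b : homogA x a -> homogA x b -> th a = th b -> a = b.
Proof. by move=> ha hb e; rewrite -(thK ha) -(thK hb) e. Qed.

Lemma th_smono x l f : (size f <= l.+1)%N -> th (smono x * etaR l f) = f.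
Proof.
move=> sf; rewrite mulrC th_etaRM //.
have -> : smono x = toA p 'X_[[multinom sL i x | i < 3]].
  rewrite mpolyXE_id rmorph_prod; apply: eq_bigr => i _.
  by rewrite mnmE rmorphXn.
rewrite th_toA thSX /thm big1 ?mulr1 // => i _.
by rewrite mnmE divn_small ?expr0 // sL_lt.
Qed.

Lemma etaK x f : (size f <= dsz x)%N -> th (eta x f) = f.
Proof.
rewrite /dsz /eta; case: (lL x) => [l|l] sf; first exact: th_smono.
by rewrite th0; move: sf; rewrite leqn0 size_poly_eq0 => /eqP.
Qed.

Lemma homogA_lt0 x a : homogA x a -> lL x < 0 -> a = 0.
Proof.
move=> ha lx; have := size_th ha; rewrite /dsz; case: (lL x) lx => // n _.
rewrite leqn0 size_poly_eq0 => /eqP e.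
by apply: (th_inj ha (homogA0 x)); rewrite th0.
Qed.

(** Division of the dehomogenization by t: the quotient loses one degree, and the constant remainder
    fits into A_x because [lL x] is nonnegative. *)
Lemma homogA_split x a : 0 <= lL x -> homogA (x + vc p) a ->
  exists a1 a2, [/\ homogA x a1, homogA x a2 & a = TA i1 * a1 + TA i2 * a2].
Proof.
move=> lx ha; have := size_th ha; set f := th a => sf.
pose f2 := f %/ 'X; pose f1 := f %% 'X.
have [l e] : exists l : nat, lL x = l by case: (lL x) lx => // l; exists l.
have s : dsz x = l.+1 by rewrite /dsz e.
have s' : dsz (x + vc p) = l.+2 by rewrite /dsz lL_addvc e -[_ + 1]/(Posz (l + 1)%N) addn1.
have s1 : (size f1 <= dsz x)%N.
  have : (size f1 < size ('X : {poly k}))%N by rewrite ltn_modp polyX_eq0.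
  by rewrite size_polyX s; lia.
have s2 : (size f2 <= dsz x)%N by rewrite size_divp ?polyX_eq0 // size_polyX s leq_subLR add1n -s'.
exists (eta x f1), (eta x f2); split; do ?exact: homog_eta.
apply: (th_inj ha).
  by rewrite addrC; apply: homogAD; apply: homogAM; do ?[exact: homog_TA|exact: homog_eta].
rewrite thD !th_TA !etaK // ?tauE mul1r addrC mulrC -divp_eq //.
Qed.

End Theta.

(** * Finite components and bounded torsion *)

Section FiniteSets.

Definition enum_of (V : choiceType) (X : set V) (s : seq V) :=
  uniq s /\ forall v, v \in s <-> X v.

Definition fin (V : choiceType) (X : set V) := exists s, enum_of X s.

(* Only meaningful for finite sets. *)
Definition ncard (V : choiceType) (X : set V) : nat := size (xget [::] (enum_of X)).

Lemma ncardE (V : choiceType) (X : set V) s : enum_of X s -> ncard X = size s.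
Proof.
move=> [us hs]; rewrite /ncard; case: xgetP => [s' -> [us' hs']|/(_ s) []] //.
by apply/perm_size/uniq_perm => // v; apply/idP/idP => [/hs'/hs|/hs/hs'].
Qed.

Lemma fin_sub (V : choiceType) (X : set V) (s : seq V) : (forall v, X v -> v \in s) -> fin X.
Proof.
move=> h; exists (undup [seq v <- s | `[< X v >]]); split; first exact: undup_uniq.
move=> v; rewrite mem_undup mem_filter; split; first by case/andP => /asboolP.
by move=> Xv; rewrite h // andbT; exact/asboolP.
Qed.

Lemma sub_fin (V : choiceType) (X Y : set V) : X `<=` Y -> fin Y -> fin X.
Proof. by move=> XY [s [us hs]]; apply: (@fin_sub _ _ s) => v /XY/hs. Qed.

Lemma ncard_le (V : choiceType) (X Y : set V) : X `<=` Y -> fin Y -> (ncard X <= ncard Y)%N.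
Proof.
move=> XY fY; have [s hs] := sub_fin XY fY; have [s' hs'] := fY.
rewrite (ncardE hs) (ncardE hs'); apply: uniq_leq_size; first by case: hs.
by move=> v /hs.2/XY/hs'.2.
Qed.

Lemma ncard_eq (V : choiceType) (X Y : set V) : X `<=` Y -> fin Y ->
  (ncard Y <= ncard X)%N -> Y `<=` X.
Proof.
move=> XY fY; have [s hs] := sub_fin XY fY; have [s' hs'] := fY.
rewrite (ncardE hs) (ncardE hs') => le v /hs'.2 vs'; apply/hs.2.
have [] := @uniq_min_size _ s s' hs.1 _ le; first by move=> u /hs.2/XY/hs'.2.
by move=> _ ->.
Qed.

Lemma ncard_gt0 (V : choiceType) (X : set V) v : X v -> fin X -> (0 < ncard X)%N.
Proof. by move=> Xv [s hs]; rewrite (ncardE hs); case: s hs => // -[_ /(_ v)[_ /(_ Xv)]]. Qed.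

Lemma ncard_bij (V W : choiceType) (X : set V) (Y : set W) (f : V -> W) :
  fin X -> (forall u v, X u -> X v -> f u = f v -> u = v) ->
  (forall v, X v -> Y (f v)) -> (forall w, Y w -> exists2 v, X v & f v = w) ->
  fin Y /\ ncard Y = ncard X.
Proof.
move=> [s hs] fi fY fs.
have e : enum_of Y (map f s).
  split; first by rewrite map_inj_in_uniq ?hs.1 // => u v /hs.2 ? /hs.2 ?; exact: fi.
  move=> w; split; first by case/mapP => v /hs.2 /fY ? ->.
  by case/fs => v Xv <-; apply: map_f; exact/hs.2.
by split; [exists (map f s)|rewrite (ncardE e) (ncardE hs) size_map].
Qed.

Definition subgrp (V : zmodType) (X : set V) :=
  X 0 /\ forall u v, X u -> X v -> X (u - v).

Lemma subgrpN (V : zmodType) (X : set V) u : subgrp X -> X u -> X (- u).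
Proof. by move=> [X0 XB] Xu; rewrite -sub0r; exact: XB. Qed.

Lemma subgrpD (V : zmodType) (X : set V) u v : subgrp X -> X u -> X v -> X (u + v).
Proof. by move=> hX Xu Xv; rewrite -[v]opprK; apply: hX.2 => //; exact: subgrpN. Qed.

Lemma additive_on0 (V W : zmodType) (X : set V) (f : V -> W) : X 0 ->
  (forall u v, X u -> X v -> f (u + v) = f u + f v) -> f 0 = 0.
Proof. by move=> X0 fD; apply: (addrI (f 0)); rewrite -fD // !addr0. Qed.

(** Each nonempty fibre is a coset of the kernel. Additivity is asked on X only, as the maps of
    interest are unspecified elsewhere. *)
Lemma ncard_fiber (V W : zmodType) (X : set V) (f : V -> W) : fin X -> subgrp X ->
  (forall u v, X u -> X v -> f (u + v) = f u + f v) ->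
  ncard X = (ncard [set w | exists2 v, X v & f v = w] *
             ncard [set v | X v /\ f v = 0%R])%N.
Proof.
move=> [s hs] gX fD; pose t := undup (map f s).
have f0 := additive_on0 gX.1 fD.
have fN u : X u -> f (- u) = - f u.
  by move=> Xu; apply: (addrI (f u)); rewrite -fD ?subrr //; exact: subgrpN.
have ht : enum_of [set w | exists2 v, X v & f v = w] t.
  split; first exact: undup_uniq.
  move=> w; rewrite mem_undup; split; first by case/mapP => v /hs.2 ? ->; exists v.
  by case=> v Xv <-; apply: map_f; apply/hs.2.
pose u := [seq v <- s | f v == 0].
have hu : enum_of [set v | X v /\ f v = 0] u.
  split; first by rewrite filter_uniq ?hs.1.
  move=> v; rewrite mem_filter; split; first by case/andP => /eqP ? /hs.2.
  by case=> Xv e; rewrite e eqxx; exact/hs.2.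
rewrite (ncardE hs) (ncardE ht) (ncardE hu).
have c1 : size s = (\sum_(w <- t) count (fun v => f v == w) s)%N.
  under eq_bigr do rewrite -sum1_count big_mkcond.
  rewrite exchange_big /= -sum1_size; apply: eq_big_seq => v vs.
  have ft : f v \in t by rewrite mem_undup map_f.
  rewrite (bigD1_seq (f v)) ?undup_uniq //= eqxx big1 // => w ne.
  by rewrite eq_sym (negPf ne).
rewrite c1 (eq_big_seq (fun=> size u)); first by rewrite big_const_seq count_predT iter_addn_0 mulnC.
move=> w; rewrite mem_undup => /mapP[v0 /hs.2 Xv0 ->].
rewrite -size_filter -[RHS](size_map (fun v => v + v0)); apply/perm_size/uniq_perm.
- by rewrite filter_uniq ?hs.1.
- by rewrite map_inj_uniq ?filter_uniq ?hs.1 //; exact: addIr.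
move=> v; rewrite mem_filter; apply/andP/mapP => [[/eqP e /hs.2 Xv]|[v' ]].
  exists (v - v0); last by rewrite subrK.
  rewrite mem_filter fD ?fN ?e ?subrr ?eqxx //=; first by apply/hs.2; exact: gX.2.
  exact: subgrpN.
rewrite mem_filter => /andP[/eqP e /hs.2 Xv'] ->; rewrite fD // e add0r; split=> //.
by apply/hs.2; exact: subgrpD.
Qed.

End FiniteSets.

Section PolysOfBoundedSize.
Variable k : finFieldType.

Definition ps (m : nat) : seq {poly k} := [seq rVpoly v | v <- enum {: 'rV[k]_m}].

Lemma mem_ps m f : (f \in ps m) = (size f <= m)%N.
Proof.
apply/mapP/idP => [[v _ ->]|sf]; first exact: size_poly.
by exists (poly_rV f); rewrite ?mem_enum // poly_rV_K.
Qed.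

Lemma ps_uniq m : uniq (ps m).
Proof. by rewrite map_inj_uniq ?enum_uniq //; exact: (can_inj rVpolyK). Qed.

Lemma size_ps m : size (ps m) = (#|k| ^ m)%N.
Proof. by rewrite size_map -cardE card_mx mul1n. Qed.

End PolysOfBoundedSize.

(* A finitely generated graded k[t1,t2]-module has no t1,t2-power torsion in high
   degrees.  M j / (ker t1^i + t1 M (j-1)) is finite, and its cardinality decreases
   with i and j, hence stabilizes; from then on t2 is injective on it. *)
Section BoundedTorsion.
Variables (V : zmodType) (t1 t2 : V -> V) (M : nat -> set V).
Hypothesis t1D : forall u v, t1 (u + v) = t1 u + t1 v.
Hypothesis t2D : forall u v, t2 (u + v) = t2 u + t2 v.
Hypothesis t12 : forall u, t1 (t2 u) = t2 (t1 u).
Hypothesis Mg : forall j, subgrp (M j).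
Hypothesis Mf : forall j, fin (M j).
Hypothesis M1 : forall j v, M j v -> M j.+1 (t1 v).
Hypothesis M2 : forall j v, M j v -> M j.+1 (t2 v).
Variable n1 : nat.
Hypothesis MS : forall j v, (n1 <= j)%N -> M j.+1 v ->
  exists a b, [/\ M j a, M j b & v = t1 a + t2 b].

Let tB (t : V -> V) : (forall u v, t (u + v) = t u + t v) ->
  (t 0 = 0) * (forall u v, t (u - v) = t u - t v).
Proof.
move=> tD; have t0 : t 0 = 0 by apply: (addrI (t 0)); rewrite -tD !addr0.
split=> // u v; apply: (addIr (t v)); by rewrite -tD !subrK.
Qed.
Let t10 := (tB t1D).1.
Let t1B := (tB t1D).2.
Let t20 := (tB t2D).1.
Let t2B := (tB t2D).2.

Let it0 i : iter i t1 0 = 0.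
Proof. by elim: i => //= i ->. Qed.
Let itB i u v : iter i t1 (u - v) = iter i t1 u - iter i t1 v.
Proof. by elim: i => //= i ->. Qed.
Let it12 i u : iter i t1 (t2 u) = t2 (iter i t1 u).
Proof. by elim: i => //= i ->. Qed.

Let Ker i j : set V := [set m | M j m /\ iter i t1 m = 0].
Let Nn i j : set V := [set m | exists a b, [/\ Ker i j.+1 a, M j b & m = a + t1 b]].

Let Ker_g i j : subgrp (Ker i j).
Proof.
split; first by split; [exact: (Mg j).1|exact: it0].
by move=> u v [Mu eu] [Mv ev]; split; [exact: (Mg j).2|rewrite itB eu ev subrr].
Qed.

Let Nn_g i j : subgrp (Nn i j).
Proof.
split; first by exists 0, 0; rewrite t10 addr0; split=> //; [exact: (Ker_g _ _).1|exact: (Mg _).1].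
move=> _ _ [a [b [Ka Mb ->]]] [a' [b' [Ka' Mb' ->]]]; exists (a - a'), (b - b'); split.
- exact: (Ker_g _ _).2.
- exact: (Mg _).2.
- by rewrite t1B opprD addrACA.
Qed.

Let Nn_M i j : Nn i j `<=` M j.+1.
Proof. by move=> _ [a [b [[Ma _] Mb ->]]]; apply: (subgrpD (Mg _)) => //; exact: M1. Qed.

Let NnS i i' j : (i <= i')%N -> Nn i j `<=` Nn i' j.
Proof.
move=> le v [a [b [[Ma e] Mb ->]]]; exists a, b; split=> //; split=> //.
by rewrite -(subnK le) iterD e it0.
Qed.

Let ind i j := (ncard (M j.+1) %/ ncard (Nn i j))%N.

Let Nf i j : fin (Nn i j). Proof. exact: sub_fin (@Nn_M i j) (Mf _). Qed.

Let N_gt0 i j : (0 < ncard (Nn i j))%N.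
Proof. exact: ncard_gt0 (Nn_g i j).1 (Nf i j). Qed.

Let pairs (X Y : set V) : set (V * V) := [set u | X u.1 /\ Y u.2].

Lemma fin_pairs (X Y : set V) : fin X -> fin Y ->
  fin (pairs X Y) /\ ncard (pairs X Y) = (ncard X * ncard Y)%N.
Proof.
move=> [s hs] [s' hs'].
have e : enum_of (pairs X Y) [seq (a, b) | a <- s, b <- s'].
  split; first by apply: allpairs_uniq; rewrite ?hs.1 ?hs'.1 // => -[? ?] [? ?] _ _ [-> ->].
  move=> [a b]; split; first by case/allpairsP => -[a' b'] /= [/hs.2 ? /hs'.2 ? [-> ->]].
  by case=> /= Xa Yb; apply/allpairsP; exists (a, b); split=> //=; [exact/hs.2|exact/hs'.2].
by split; [eexists; exact: e|rewrite (ncardE e) (ncardE hs) (ncardE hs') size_allpairs].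
Qed.

Let ncard_sub (X Y : set V) : fin Y -> subgrp Y -> subgrp X -> X `<=` Y ->
  exists c, ncard Y = (c * ncard X)%N.
Proof.
move=> fY gY gX XY.
have [s hs] := fY; have [r hr] := sub_fin XY fY.
pose cls v : seq V := [seq u <- s | `[< X (u - v) >]].
pose rep v := head 0 (cls v).
have repP v : Y v -> X (rep v - v) /\ Y (rep v).
  move=> Yv; have : v \in cls v.
    by rewrite mem_filter subrr; apply/andP; split; [apply/asboolP; exact: gX.1|exact/hs.2].
  rewrite /rep; case E: (cls v) => [|u c] //= _.
  have : u \in cls v by rewrite E mem_head.
  by rewrite mem_filter => /andP[/asboolP ? /hs.2].
have cls_eq u v : Y u -> Y v -> X (u - v) -> rep u = rep v.
  move=> Yu Yv Xuv; rewrite /rep; congr head; apply: eq_filter => w; apply/asboolP/asboolP => h.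
    by rewrite -[w](subrK u) -addrA; apply: subgrpD.
  by rewrite -[w](subrK v) -addrA; apply: subgrpD => //; rewrite -opprB; exact: subgrpN.
pose t := undup (map rep s); exists (size t).
rewrite (ncardE hs) (ncardE hr).
have c1 : size s = (\sum_(w <- t) count (fun v => rep v == w) s)%N.
  under eq_bigr do rewrite -sum1_count big_mkcond.
  rewrite exchange_big /= -sum1_size; apply: eq_big_seq => v vs.
  have ft : rep v \in t by rewrite mem_undup map_f.
  rewrite (bigD1_seq (rep v)) ?undup_uniq //= eqxx big1 // => w ne.
  by rewrite eq_sym (negPf ne).
rewrite c1 (eq_big_seq (fun=> size r)); first by rewrite big_const_seq count_predT iter_addn_0 mulnC.
move=> w; rewrite mem_undup => /mapP[v0 /hs.2 Yv0 ->].
rewrite -size_filter -[RHS](size_map (fun v => v + v0)); apply/perm_size/uniq_perm.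
- by rewrite filter_uniq ?hs.1.
- by rewrite map_inj_uniq ?hr.1 //; exact: addIr.
move=> v; rewrite mem_filter; apply/andP/mapP => [[/eqP e /hs.2 Yv]|[v' /hr.2 Xv' ->]].
  exists (v - v0); last by rewrite subrK.
  apply/hr.2; rewrite -[v](subrK (rep v)) -addrA; apply: subgrpD => //.
    by rewrite -opprB; apply: subgrpN => //; exact: (repP v Yv).1.
  by rewrite e; exact: (repP v0 Yv0).1.
have Yv : Y (v' + v0) by apply: subgrpD => //; exact: XY.
split; last exact/hs.2.
by apply/eqP; apply: cls_eq => //; rewrite addrK.
Qed.

(** The map [t2] sends M (j+1) / Nn i j onto M (j+2) / Nn i (j+1), since M (j+2) is generated
    through [t1] and [t2], and K is the preimage of the zero class. The equation counts the fibres
    of (a, b) |-> t2 a - b. *)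
Let ind_key i j : (n1 < j)%N -> let K := [set m | M j.+1 m /\ Nn i j.+1 (t2 m)] in
  [/\ Nn i j `<=` K, fin K &
     (ncard (M j.+1) * ncard (Nn i j.+1) = ncard (M j.+2) * ncard K)%N].
Proof.
move=> lj K; split.
- move=> v Nv; split; first exact: Nn_M Nv.
  case: Nv => a [b [[Ma e] Mb ->]]; exists (t2 a), (t2 b); split.
  + by split; [exact: M2|rewrite it12 e].
  + exact: M2.
  + by rewrite t2D t12.
- by apply: sub_fin (Mf j.+1) => v [].
pose X := pairs (M j.+1) (Nn i j.+1).
have [fX cX] := fin_pairs (Mf j.+1) (Nf i j.+1).
pose f (u : V * V) := t2 u.1 - u.2.
have gX : subgrp X.
  split; first by split; [exact: (Mg _).1|exact: (Nn_g _ _).1].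
  by move=> [a b] [c d] [/= ? ?] [/= ? ?]; split; [exact: (Mg _).2|exact: (Nn_g _ _).2].
rewrite -cX (ncard_fiber (f := f) fX gX); last first.
  by move=> [a b] [c d] _ _; rewrite /f /= t2D opprD addrACA.
congr (ncard _ * _)%N.
  apply/seteqP; split=> v.
    by case=> -[a b] [/= Ma Nb] <-; apply: (Mg _).2; [exact: M2|exact: Nn_M Nb].
  move=> Mv; have [a [b [Ma Mb e]]] := MS (leqW (ltnW lj)) Mv.
  exists (b, - t1 a); last by rewrite /f /= opprK e addrC.
  split=> //=; apply: (subgrpN (Nn_g _ _)); exists 0, a; rewrite add0r; split=> //.
  exact: (Ker_g _ _).1.
apply/esym; apply: (proj2 (@ncard_bij _ _ [set v | X v /\ f v = 0] K (fun u => u.1) _ _ _ _)).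
- by apply: sub_fin fX => u [].
- move=> [a b] [c d] [_ /eqP] + [_ /eqP] /=; rewrite /f /= !subr_eq0 => /eqP e /eqP e' ac.
  by rewrite ac in e *; rewrite -e -e'.
- by move=> [a b] [[/= Ma Nb] /eqP]; rewrite /f /= subr_eq0 => /eqP e; split=> //=; rewrite e.
- by move=> v [Mv Nv]; exists (v, t2 v) => //; split=> //; rewrite /f /= subrr.
Qed.

Let cancel_mid c1 c2 a b K : (0 < b)%N -> (c1 * a * b = c2 * b * K)%N ->
  (c1 * a = c2 * K)%N.
Proof. by move=> b0 e; apply/eqP; rewrite -(eqn_pmul2r b0) e mulnAC. Qed.

Let ind_stepj i j : (n1 < j)%N -> (ind i j.+1 <= ind i j)%N.
Proof.
move=> lj; have [NK fK e] := ind_key i lj.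
set K := [set _ | _] in NK fK e.
have [c1 ec1] := ncard_sub (Mf _) (Mg _) (Nn_g i j) (@Nn_M i j).
have [c2 ec2] := ncard_sub (Mf _) (Mg _) (Nn_g i j.+1) (@Nn_M i j.+1).
rewrite /ind ec1 ec2 !mulnK ?N_gt0 //.
have le := ncard_le NK fK; move: e; rewrite ec1 ec2 => /(cancel_mid (N_gt0 _ _)) e.
by rewrite -(leq_pmul2r (N_gt0 i j)) e leq_mul2l le orbT.
Qed.

Let ind_inj i j : (n1 < j)%N -> ind i j.+1 = ind i j ->
  forall m, M j.+1 m -> Nn i j.+1 (t2 m) -> Nn i j m.
Proof.
move=> lj; have [NK fK e] := ind_key i lj.
set K := [set _ | _] in NK fK e.
have [c1 ec1] := ncard_sub (Mf _) (Mg _) (Nn_g i j) (@Nn_M i j).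
have [c2 ec2] := ncard_sub (Mf _) (Mg _) (Nn_g i j.+1) (@Nn_M i j.+1).
rewrite /ind ec1 ec2 !mulnK ?N_gt0 // => ec m Mm Nm.
have Kle : (ncard K <= ncard (Nn i j))%N.
  move: e; rewrite ec1 ec2 ec => /(cancel_mid (N_gt0 _ _)) e.
  have : (0 < ncard (M j.+1))%N by exact: ncard_gt0 (Mg _).1 (Mf _).
  by rewrite ec1 muln_gt0 => /andP[c0 _]; rewrite -(leq_pmul2l c0) e.
exact: (ncard_eq NK fK Kle).
Qed.

Let ind_stepi i i' j : (i <= i')%N -> (ind i' j <= ind i j)%N.
Proof.
move=> le; apply: leq_div2l; first exact: N_gt0.
exact: ncard_le (NnS le) (Nf _ _).
Qed.

Lemma eventually_constant (u : nat -> nat) n : (forall j, (n <= j)%N -> (u j.+1 <= u j)%N) ->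
  exists2 n', (n <= n')%N & forall j, (n' <= j)%N -> u j = u n'.
Proof.
move=> dec.
have ex : exists v, `[< exists2 j, (n <= j)%N & u j = v >].
  by exists (u n); apply/asboolP; exists n.
case: (ex_minnP ex) => v /asboolP[n0 le0 e0] mn.
exists n0 => // j lj; apply/eqP; rewrite eqn_leq; apply/andP; split; last first.
  by rewrite e0; apply: mn; apply/asboolP; exists j => //; exact: leq_trans lj.
elim: j lj => [|j IH]; first by rewrite leqn0 => /eqP ->.
rewrite leq_eqVlt => /predU1P[->//|]; rewrite ltnS => lj.
by apply: leq_trans (IH lj); apply: dec; exact: leq_trans lj.
Qed.

(** The bound must not depend on i. The index decreases in both arguments, so it is constant beyond
    a pair (i0, j0) where it is minimal; each of the finitely many i < i0 stabilizes by itself. *)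
Let ind_stable : exists2 n3, (n1 < n3)%N & forall i j, (n3 <= j)%N -> ind i j.+1 = ind i j.
Proof.
have ex : exists v, `[< exists i j, (n1 < j)%N /\ ind i j = v >].
  by exists (ind 0 n1.+1); apply/asboolP; exists 0%N, n1.+1.
case: (ex_minnP ex) => v /asboolP[i0 [j0 [lj0 e0]]] mn.
have A i j : (i0 <= i)%N -> (j0 <= j)%N -> ind i j = v.
  move=> li lj; apply/eqP; rewrite eqn_leq; apply/andP; split; last first.
    by apply: mn; apply/asboolP; exists i, j; split=> //; exact: leq_trans lj.
  apply: leq_trans (ind_stepi _ li) _; rewrite -e0.
  elim: j lj => [|j IH]; first by rewrite leqn0 => /eqP ->.
  rewrite leq_eqVlt => /predU1P[->//|]; rewrite ltnS => lj.
  by apply: leq_trans (IH lj); apply: ind_stepj; exact: leq_trans lj.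
have [n3 l3 h3] : exists2 n3, (j0 <= n3)%N &
    forall i j, (i < i0)%N -> (n3 <= j)%N -> ind i j.+1 = ind i j.
  elim: {1}i0 => [|i' [n3 l3 h3]]; first by exists j0.
  have [n4 l4 h4] := @eventually_constant (ind i') n3
    (fun j lj => ind_stepj i' (leq_trans lj0 (leq_trans l3 lj))).
  exists n4; first exact: leq_trans l4.
  move=> i j; rewrite ltnS leq_eqVlt => /predU1P[->|li] lj.
    by rewrite !h4 // ltnW.
  by apply: h3 => //; exact: leq_trans lj.
exists n3; first exact: leq_trans l3.
move=> i j lj; have [li|li] := ltnP i i0; first exact: h3.
by rewrite !A //; [exact: leq_trans lj|apply: leqW; exact: leq_trans lj].
Qed.

Lemma bounded_torsion : exists n0, forall j m i, (n0 <= j)%N -> M j m ->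
  iter i t1 m = 0 -> iter i t2 m = 0 -> m = 0.
Proof.
have [n3 l3 st] := ind_stable.
(* In the single degree n3 + 1 the kernels of the powers of [t1] form an increasing sequence of
   subsets of a finite set. *)
have [i1 hi1] : exists i1, forall i m, (i1 <= i)%N -> Ker i n3.+1 m -> Ker i1 n3.+1 m.
  pose u i := (ncard (M n3.+1) - ncard (Ker i n3.+1))%N.
  have KS i : Ker i n3.+1 `<=` Ker i.+1 n3.+1 by move=> v [Mv e]; split=> //=; rewrite e t10.
  have KM i : Ker i n3.+1 `<=` M n3.+1 by move=> v [].
  have Kf i : fin (Ker i n3.+1) by exact: sub_fin (KM i) (Mf _).
  have [i1 _ hi1] := @eventually_constant u 0%N
    (fun i _ => leq_sub2l _ (ncard_le (@KS i) (Kf i.+1))).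
  exists i1 => i m le; apply: ncard_eq => //.
    by move=> v [Mv e]; split=> //; rewrite -(subnK le) iterD e it0.
  have := hi1 i le; rewrite /u; have := ncard_le (@KM i) (Mf _); have := ncard_le (@KM i1) (Mf _); lia.
have Ninj i j r m : (n3 <= j)%N -> M j.+1 m -> Nn i (j + r) (iter r t2 m) -> Nn i j m.
  elim: r j m => [|r IH] j m lj Mm; first by rewrite addn0.
  rewrite addnS iterSr => h; apply: (ind_inj (leq_trans l3 lj) (st i j lj) Mm).
  by apply: IH; [exact: leqW|exact: M2|rewrite addSn].
(* Descent on the degree n3 + e + 1: injectivity of [t2] gives m = a + t1 b with t1^i a = 0, and b
   has the same property one degree lower with i + 1 in place of i. The sum i + e is preserved, so
   at e = 0 the exponent has reached i1. *)
have main e : forall i r m, (i1 <= i + e)%N -> M (n3 + e).+1 m ->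
    iter (i + r) t1 m = 0 -> Ker i (n3 + e + r).+1 (iter r t2 m) -> iter i t1 m = 0.
  elim: e => [|e IH] i r m le Mm h1 h2.
    rewrite addn0 in le; rewrite addn0 in Mm.
    have [_] : Ker i1 n3.+1 m by apply: (hi1 (i + r)%N) => //; exact: leq_trans (leq_addr _ _).
    by move=> e; rewrite -(subnK le) iterD e it0.
  have [a [b [[Ma ea] Mb em]]] : Nn i (n3 + e.+1) m.
    apply: (Ninj _ _ r) => //; first exact: leq_addr.
    by exists (iter r t2 m), 0; rewrite t10 addr0; split=> //; exact: (Mg _).1.
  rewrite addnS in Mb.
  have iD j u v : iter j t1 (u + v) = iter j t1 u + iter j t1 v by elim: j => //= j ->.
  have i2D j u v : iter j t2 (u + v) = iter j t2 u + iter j t2 v by elim: j => //= j ->.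
  have i2M j u l : M l u -> M (l + j)%N (iter j t2 u).
    by move=> Mu; elim: j => [|j IHj] /=; rewrite ?addn0 // addnS; exact: M2.
  have c12 j l u : iter j t1 (iter l t2 u) = iter l t2 (iter j t1 u).
    by elim: l => //= l IHl; rewrite it12 IHl.
  have i20 l : iter l t2 0 = 0 by elim: l => //= l ->.
  have eb : iter i t1 (t1 b) = 0.
    rewrite -iterSr; apply: (IH i.+1 r b); rewrite ?addSnnS //.
      have := h1; rewrite em iD addnC {1}iterD ea it0 add0r -iterSr => <-.
      by rewrite addnS addnC.
    split; first by have := i2M r _ _ Mb; rewrite addSn.
    case: h2 => _; rewrite em i2D iD c12 ea i20 add0r.
    have -> : iter r t2 (t1 b) = t1 (iter r t2 b).
      by elim: (r) => //= l ->; rewrite t12.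
    by rewrite -iterSr.
  by rewrite em iD ea eb addr0.
exists (n3 + i1).+1 => j m i lj Mm h1 h2.
case: j lj Mm => // j; rewrite ltnS => lj Mm.
apply: (main (j - n3)%N 0%N i m); rewrite ?add0n.
- by rewrite leq_subRL ?(leq_trans (leq_addr _ _) lj).
- by rewrite subnKC ?(leq_trans (leq_addr _ _) lj).
- by [].
- rewrite h2; exact: (Ker_g _ _).1.
Qed.

End BoundedTorsion.

(** * Graded modules and their tails *)

Section Eventually.
Variable p : weights.
Local Notation L := (Lgroup p).
Implicit Types (x y : L) (P Q : L -> Prop).

(** Only [lL] is bounded from below, as the residues [sL] take finitely many values; modules of
    finite length vanish on such a tail of degrees. *)
Definition ev P := exists n : nat, forall x, n%:Z <= lL x -> P x.

Lemma ev_and P Q : ev P -> ev Q -> ev (fun x => P x /\ Q x).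
Proof. by move=> [n hn] [m hm]; exists (n + m)%N => x hx; split; [apply: hn|apply: hm]; lia. Qed.

Lemma ev_imp P Q : (forall x, P x -> Q x) -> ev P -> ev Q.
Proof. by move=> PQ [n hn]; exists n => x /hn/PQ. Qed.

Lemma ev_true P : (forall x, P x) -> ev P.
Proof. by move=> h; exists 0%N. Qed.

Lemma ev_up P : ev P -> ev (fun x => forall y, lL x <= lL y -> P y).
Proof. by move=> [n hn]; exists n => x hx y hy; apply: hn; lia. Qed.

Lemma ev_ge (n : int) : ev (fun x => n <= lL x).
Proof. by exists `|n|%N => x; lia. Qed.

Lemma ev_shift P y : ev P -> ev (fun x => P (x + y)).
Proof.
move=> [n hn]; exists (n + `|lL y|)%N => x hx; apply: hn.
by have := lLD_ge x y; lia.
Qed.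

Lemma ev_ex P : ev P -> exists x, P x.
Proof.
by move=> [n hn]; exists (0 + vc p *+ n); apply: hn; rewrite lL_addvcn lL0; lia.
Qed.

Lemma lL_vx_ge x i : lL x <= lL (vx p i + x).
Proof. by rewrite addrC lL_addvx; lia. Qed.

Lemma lL_vc_ge x : lL x <= lL (vc p + x).
Proof. by rewrite addrC lL_addvc; lia. Qed.

Lemma degs_fin (lo hi : int) : exists s : seq L, forall x, lo <= lL x -> lL x < hi -> x \in s.
Proof.
pose r := [seq lo + j%:Z | j <- iota 0 `|hi - lo|%N].
pose F (a b c : nat) (l : int) : L :=
  vx p i1 *+ a + (vx p i2 *+ b + vx p i3 *+ c) + vc p *~ l.
exists (flatten [seq flatten [seq flatten [seq [seq F a b c l | l <- r]
   | c <- iota 0 (p i3)] | b <- iota 0 (p i2)] | a <- iota 0 (p i1)]).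
move=> x hlo hhi; rewrite (normal_form x) big_ord3.
apply/flatten_mapP; exists (sL i1 x); first by rewrite mem_iota add0n sL_lt.
apply/flatten_mapP; exists (sL i2 x); first by rewrite mem_iota add0n sL_lt.
apply/flatten_mapP; exists (sL i3 x); first by rewrite mem_iota add0n sL_lt.
apply/mapP; exists (lL x) => //; apply/mapP; exists `|lL x - lo|%N; last by lia.
by rewrite mem_iota; lia.
Qed.

End Eventually.

Lemma seq_bound (I : eqType) (r : seq I) (F : I -> int) :
  exists n : nat, forall i, i \in r -> F i <= n%:Z.
Proof.
elim: r => [|i r [n hn]]; first by exists 0%N.
exists (`|F i| + n)%N => j; rewrite inE => /predU1P[->|/hn]; lia.
Qed.

Section Gmod.
Variables (k : finFieldType) (p : weights).
Local Notation A := (coordA k p).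
Local Notation L := (Lgroup p).
Local Notation gm := (gmod k p).
Implicit Types (M N : gm) (x y : L) (a : A).

Lemma homog_prA x a : homogA x (prA x a).
Proof. by apply/homogAP; rewrite prAK eqxx. Qed.

Lemma hc0 M x : hc x (0 : M) = 0.
Proof. exact: pr0 (@hcD _ _ M) x. Qed.

Lemma hcN M x (v : M) : hc x (- v) = - hc x v.
Proof. by apply: (addIr (hc x v)); rewrite -hcD !addNr hc0. Qed.

Lemma hcB M x (u v : M) : hc x (u - v) = hc x u - hc x v.
Proof. by rewrite hcD hcN. Qed.

Lemma hc_bigsum M x (I : Type) (r : seq I) (P : pred I) (F : I -> M) :
  hc x (\sum_(i <- r | P i) F i) = \sum_(i <- r | P i) hc x (F i).
Proof. exact: (big_morph _ (@hcD _ _ M x) (hc0 M x)). Qed.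

Lemma hpart_hc M x (v : M) : hpart x (hc x v).
Proof. by rewrite /hpart /= hcK eqxx. Qed.

Lemma hpart0 M x : hpart x (0 : M). Proof. exact: hc0. Qed.

Lemma hpartD M x (u v : M) : hpart x u -> hpart x v -> hpart x (u + v).
Proof. by rewrite /hpart /= hcD => -> ->. Qed.

Lemma hpartN M x (u : M) : hpart x u -> hpart x (- u).
Proof. by rewrite /hpart /= hcN => ->. Qed.

Lemma hpartB M x (u v : M) : hpart x u -> hpart x v -> hpart x (u - v).
Proof. by move=> hu hv; apply: hpartD => //; exact: hpartN. Qed.

Lemma hpart_subgrp M x : subgrp (hpart x : set M).
Proof. by split; [exact: hpart0|exact: hpartB]. Qed.

Lemma hpart_ne M x y (v : M) : hpart y v -> x != y -> hc x v = 0.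
Proof. by move=> <- /negPf ne; rewrite hcK ne. Qed.

Lemma hcZ M x y a (v : M) : homogA x a -> hc (x + y) (a *: v) = a *: hc y v.
Proof.
move=> ha; have [s _ ev] := hc_sum v; rewrite {1}ev [in RHS]ev scaler_sumr !hc_bigsum scaler_sumr.
apply: eq_bigr => z _; rewrite -(hc_scale z v ha) !hcK (inj_eq (addrI x)).
by case: eqP => _; rewrite ?scaler0 // hc_scale.
Qed.

Lemma hpartZ M x y a (v : M) : homogA x a -> hpart y v -> hpart (x + y) (a *: v).
Proof. by move=> ha hv; rewrite /hpart /= (hcZ _ _ ha) hv. Qed.

Lemma hpartkA M x c (v : M) : hpart x v -> hpart x (kA p c *: v).
Proof. by move=> hv; rewrite -[x]add0r; apply: hpartZ hv; exact: homog_kA. Qed.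

Lemma gsub_sum (R : nzRingType) (G : Type) (V : lmodType R) (pr : G -> V -> V) (P : set V)
  (I : eqType) (r : seq I) (F : I -> V) :
  gsub pr P -> (forall i, i \in r -> P (F i)) -> P (\sum_(i <- r) F i).
Proof.
by case=> P0 PD _ _ h; rewrite big_seq; apply: (big_ind P).
Qed.

Lemma gsub_hcP M (P : set M) v : graded_submodule P -> (forall x, P (hc x v)) -> P v.
Proof. by move=> gP h; have [s _ ->] := hc_sum v; apply: gsub_sum gP _. Qed.

(** The submodule with prescribed components [C y], used for truncations of a module and for graphs
    given degree by degree. *)
Lemma gsub_family (V : lmodType A) (pr : L -> V -> V) (C : L -> set V) :
  (forall x u v, pr x (u + v) = pr x u + pr x v) ->
  (forall x y v, pr x (pr y v) = if x == y then pr y v else 0) ->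
  (forall x y a v, homogA x a -> pr (x + y) (a *: v) = a *: pr y v) ->
  (forall y, C y 0) -> (forall y u v, C y u -> C y v -> C y (u + v)) ->
  (forall x y a v, homogA x a -> C y (pr y v) -> C (x + y) (a *: pr y v)) ->
  gsub pr [set v | forall y, C y (pr y v)].
Proof.
move=> prD prK prZ C0 CD CZ; have pr0 x : pr x 0 = 0 by exact: pr0 prD x.
split=> /=.
- by move=> y; rewrite pr0.
- by move=> u v hu hv y; rewrite prD; exact: CD.
- move=> a v hv y; have [s _ ->] := prA_sum a; rewrite scaler_suml.
  rewrite (big_morph _ (prD y) (pr0 y)); apply: (big_ind (C y)) => //; first exact: CD.
  move=> x _; have ha : homogA x (prA x a) by exact: homog_prA.
  by rewrite -[y](subrKC x) prZ //; exact: CZ.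
- by move=> x v hv y; rewrite prK; case: eqP => [->|_].
Qed.

Section Pairs.
Variables M N : gm.
Local Notation pr := (pairpr (@hc _ _ M) (@hc _ _ N)).

Lemma pairprD x (u v : M * N) : pr x (u + v) = pr x u + pr x v.
Proof. by rewrite /pairpr /= !hcD. Qed.
Lemma pairprK x y (v : M * N) : pr x (pr y v) = if x == y then pr y v else 0.
Proof. by rewrite /pairpr /= !hcK; case: ifP. Qed.
Lemma pairprZ x y a (v : M * N) : homogA x a -> pr (x + y) (a *: v) = a *: pr y v.
Proof. by move=> ha; rewrite /pairpr /= !(hcZ _ _ ha). Qed.
End Pairs.

(** The homogeneous generators are the components of the given ones, in the finitely many degrees
    occurring in their decompositions; the coefficients are the components of the matching
    degree. *)
Lemma hom_gens M : exists (I : eqType) (r : seq I) (e : I -> L) (h : I -> M),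
  (forall i, hpart (e i) (h i)) /\
  forall x v, hpart x v -> exists2 b : I -> A,
    forall i, homogA (x - e i) (b i) & v = \sum_(i <- r) b i *: h i.
Proof.
have [n [g hg]] := gm_fg M.
have ch i : exists s : seq L, uniq s /\ g i = \sum_(x <- s) hc x (g i).
  by have [s us e] := hc_sum (g i); exists s.
pose f i := projT1 (cid (ch i)); have hf i := projT2 (cid (ch i)); rewrite -/(f _) in hf.
pose S := undup (flatten [seq f i | i <- enum 'I_n]).
have gS i : g i = \sum_(x <- S) hc x (g i).
  rewrite {1}(hf i).2 [RHS](bigID (mem (f i))) /= [X in _ + X]big1 ?addr0.
    rewrite -[RHS]big_filter; apply: perm_big; apply: uniq_perm.
    - exact: (hf i).1.
    - by rewrite filter_uniq ?undup_uniq.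
    move=> y; rewrite mem_filter; case: (boolP (y \in f i)) => //= yf.
    by apply/esym; rewrite mem_undup; apply/flatten_mapP; exists i => //; rewrite mem_enum.
  move=> y yf; rewrite {1}(hf i).2 hc_bigsum big1_seq // => z /= zf.
  by rewrite hcK; case: eqP => // e; rewrite e zf in yf.
exists ('I_n * L)%type, [seq (i, y) | i <- enum 'I_n, y <- S],
  (fun c => c.2), (fun c => hc c.2 (g c.1)); split; first by move=> i; exact: hpart_hc.
move=> x v hv; have [a ea] := hg v; exists (fun c => prA (x - c.2) (a c.1)).
  by move=> c; exact: homog_prA.
rewrite big_allpairs /= big_enum /= -[LHS]hv ea hc_bigsum; apply: eq_bigr => i _.
rewrite {1}(gS i) scaler_sumr hc_bigsum; apply: eq_bigr => y _.
have [s us es] := prA_sum (a i); rewrite {1}es scaler_suml hc_bigsum.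
have ha z : homogA z (prA z (a i)) by exact: homog_prA.
under eq_bigr => z _.
  have -> : hc x (prA z (a i) *: hc y (g i)) = if x - y == z then prA z (a i) *: hc y (g i) else 0.
    rewrite -(hc_scale y (g i) (ha z)) hcK -(inj_eq (addIr (- y))) addrK.
    by case: ifP.
  over.
rewrite -big_mkcond /=; have [xs|xs] := boolP (x - y \in s).
  rewrite -big_filter (_ : [seq _ <- s | _] = [:: x - y]) ?big_seq1 //.
  by rewrite -(eq_filter (a1 := pred1 (x - y))) ?filter_pred1_uniq // => z; rewrite /= eq_sym.
rewrite big1_seq; last by move=> z /andP[/eqP <- xs']; rewrite xs' in xs.
have -> : prA (x - y) (a i) = 0; last by rewrite scale0r.
rewrite es; have := @hc_bigsum (structure_module k p) (x - y); move=> /= ->.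
apply: big1_seq => z /andP[_ zs]; rewrite prAK; case: eqP => // e.
by rewrite e zs in xs.
Qed.

Lemma fin_hpart M x : fin (hpart x : set M).
Proof.
have [I [r [e [h [hh gen]]]]] := hom_gens M.
suff [s hs] : exists s : seq M, forall b : I -> A, (forall i, homogA (x - e i) (b i)) ->
    \sum_(i <- r) b i *: h i \in s.
  by apply: (@fin_sub _ _ s) => v /gen[b hb ->]; exact: hs.
elim: r {gen} => [|i r [s hs]]; first by exists [:: 0] => b _; rewrite big_nil mem_head.
exists [seq eta (x - e i) f *: h i + w | f <- ps k (dsz (x - e i)), w <- s] => b hb.
rewrite big_cons; apply/allpairsP; exists (th (b i), \sum_(j <- r) b j *: h j); split=> /=.
- by rewrite mem_ps; exact: size_th.
- exact: hs.
- by rewrite thK.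
Qed.

Lemma low_zero M : exists n : nat, forall x (v : M), lL x < - n%:Z -> hpart x v -> v = 0.
Proof.
have [I [r [e [h [hh gen]]]]] := hom_gens M.
have [n hn] := seq_bound r (fun i => - lL (e i)).
exists n => x v lx /gen[b hb ->]; rewrite big1_seq // => i /= /hn le.
rewrite (homogA_lt0 (hb i)) ?scale0r //.
by have := lLD_ge (x - e i) (e i); rewrite subrK; lia.
Qed.

Lemma gen_T M : ev (fun x => forall v : M, hpart (x + vc p) v ->
  exists v1 v2, [/\ hpart x v1, hpart x v2 & v = TA k p i1 *: v1 + TA k p i2 *: v2]).
Proof.
have [I [r [e [h [hh gen]]]]] := hom_gens M.
have [n hn] := seq_bound r (fun i => - lL (- e i)).
exists n => x lx v /gen[b hb ->].
suff [v1 [v2 [h1 h2 E]]] : exists v1 v2, [/\ hpart x v1, hpart x v2 &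
    \sum_(i <- r) b i *: h i = TA k p i1 *: v1 + TA k p i2 *: v2] by exists v1, v2.
elim: r hn {gen} => [|i r IH] hn.
  by exists 0, 0; rewrite big_nil !scaler0 addr0; split=> //; exact: hpart0.
have [|v1 [v2 [h1 h2 E]]] := IH; first by move=> j jr; apply: hn; rewrite inE jr orbT.
have l0 : 0 <= lL (x - e i).
  by have := lLD_ge x (- e i); have := hn i (mem_head _ _); lia.
have hb' : homogA (x - e i + vc p) (b i) by rewrite addrAC.
have [a1 [a2 [ha1 ha2 ea]]] := homogA_split l0 hb'.
exists (a1 *: h i + v1), (a2 *: h i + v2); split.
- by apply: hpartD => //; rewrite -[x](subrK (e i)); exact: hpartZ.
- by apply: hpartD => //; rewrite -[x](subrK (e i)); exact: hpartZ.
- by rewrite big_cons E ea !scalerDr scalerDl !scalerA addrACA.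
Qed.

(** The submodules [D j] of those elements of Q whose components with [lL] below j lie in P decrease
    with j and lie between P and Q. Finite length allows at most b strict steps, so [D j] is
    eventually constant. A homogeneous element of Q of high degree lies in that constant value,
    hence in every later [D j], hence in P. *)
Lemma fl_ev M (P Q : set M) : graded_submodule P -> graded_submodule Q -> P `<=` Q ->
  fin_length (@hc _ _ M) P Q -> ev (fun x => forall v : M, hpart x v -> Q v -> P v).
Proof.
move=> gP gQ PQ [b hb].
have [P0 PD PZ Ph] := gP; have [Q0 QD QZ Qh] := gQ.
pose C (j : nat) (y : L) : set M := [set u | Q u /\ (lL y < j%:Z -> P u)].
pose D j : set M := [set v | forall y, C j y (hc y v)].
have gD j : graded_submodule (D j).
  apply: gsub_family; do ?[exact: hcD|exact: hcK|exact: hcZ].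
  - by [].
  - by move=> y u v [Qu Pu] [Qv Pv]; split; [exact: QD|move=> h; apply: PD; auto].
  - move=> x y a v ha [Qv Pv]; split; first exact: QZ.
    move=> lt; have [lx|lx] := ltP (lL x) 0.
      by rewrite (homogA_lt0 ha lx) scale0r.
    by apply: PZ; apply: Pv; have := lLD_ge x y; lia.
have DQ j : D j `<=` Q by move=> v h; apply: gsub_hcP => // y; case: (h y).
have PD' j : P `<=` D j by move=> v Pv y; split=> [|_]; [apply: Qh; exact: PQ|exact: Ph].
have DS j : D j.+1 `<=` D j by move=> v h y; have [Qv Pv] := h y; split=> // lt; apply: Pv; lia.
have bound r : (\sum_(j < r) (`[< D j.+1 <> D j >] : nat) <= b)%N.
  have h : (\sum_(i < r) (`[< D (r - i)%N <> D (r - i.+1)%N >] : nat) <= b)%N.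
    apply: (weak_chain hb (N := fun i => D (r - i)%N)); first by move=> i _; split; [exact: gD|exact: PD'|exact: DQ].
    by move=> i ir; rewrite -subnSK //; exact: DS.
  rewrite (reindex_inj rev_ord_inj) /=; apply: leq_trans h; apply: leq_sum => i _.
  by rewrite subnSK.
pose u r := (b - \sum_(j < r) (`[< D j.+1 <> D j >] : nat))%N.
have [|n' _ hn'] := @eventually_constant u 0.
  by move=> j _; apply: leq_sub2l; rewrite big_ord_recr leq_addr.
have Dst j : (n' <= j)%N -> D j `<=` D j.+1.
  move=> lj; have : u j.+1 = u j by rewrite !hn' // ltnW.
  rewrite /u big_ord_recr /=; have := bound j.+1; rewrite big_ord_recr /=.
  move: (\sum_(i < j) _)%N => s.
  have [->|ne] := pselect (D j.+1 = D j); first by move=> _ _ v.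
  by rewrite !(asboolT ne) /= => h1 h2; exfalso; move: h1 h2; lia.
have Dall j e : (n' <= j)%N -> D j `<=` D (j + e)%N.
  move=> lj; elim: e => [|e IH]; rewrite ?addn0 // addnS.
  by apply: subset_trans IH _; apply: Dst; exact: leq_trans (leq_addr _ _).
exists n' => x lx v hv Qv.
have [l el] : exists l : nat, lL x = l by case: (lL x) lx => l; [exists l|lia].
have Dv : D n' v.
  move=> y; split; first exact: Qh.
  move=> ly; have ne : y != x by apply/eqP => e; rewrite e in ly; lia.
  by rewrite (hpart_ne hv ne).
have /(Dall _ (l.+1 - n')%N) : D n' v by [].
move=> /(_ (leqnn _)) /(_ x)[_]; rewrite hv; apply; rewrite el; lia.
Qed.

(** M vanishes in low degrees and Q lies in P in high ones. The finitely many degrees between have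
    finite components since k is finite, and each strict step of a chain acquires a new homogeneous
    element there. *)
Lemma ev_fl M (P Q : set M) :
  ev (fun x => forall v : M, hpart x v -> Q v -> P v) -> fin_length (@hc _ _ M) P Q.
Proof.
case=> n hn; have [n' hn'] := low_zero M; have [s hs] := degs_fin p (- n'%:Z) n%:Z.
have [Z hZ] : exists Z : seq M, forall x v, x \in s -> hpart x v -> v \in Z.
  elim: s {hs} => [|x s [Z hZ]]; first by exists [::].
  have [r [_ hr]] := fin_hpart M x; exists (r ++ Z) => y v; rewrite inE mem_cat.
  by case/predU1P=> [->|ys] hv; [rewrite (hr v).2|rewrite (hZ y) ?orbT].
exists (size Z) => r N h1 h2.
pose c i := count (fun v => `[< N i v >]) Z.
have ci i : (i < r)%N -> (c i < c i.+1)%N.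
  move=> ir; have [gi Pi Qi] := h1 i (ltnW ir); have [gi' Pi' Qi'] := h1 i.+1 ir.
  have [sN /existsNP[v /not_implyP[Nv nNv]]] := h2 i ir.
  have [x nx] : exists x, ~ N i (hc x v).
    by apply/existsNP => h; apply: nNv; exact: gsub_hcP.
  have Nx : N i.+1 (hc x v) by case: gi' => _ _ _; apply.
  have xZ : hc x v \in Z.
    apply: (hZ x); last exact: hpart_hc.
    apply: hs.
      rewrite leNgt; apply/negP => lt; apply: nx; rewrite (hn' _ _ lt (hpart_hc _ _)).
      by case: gi.
    rewrite ltNge; apply/negP => le; apply: nx; apply: Pi.
    by apply: (hn x le); [exact: hpart_hc|exact: Qi'].
  have /seq.permP pc := perm_to_rem xZ; rewrite /c !pc /=.
  rewrite (asboolT Nx) (asboolF nx) add0n add1n ltnS.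
  by apply: sub_count => w /asboolP Nw; apply/asboolP; exact: sN.
suff : (r <= c r)%N by move=> h; apply: leq_trans h _; exact: count_size.
have : (r <= r)%N by []; elim: {1 3 4}r => // i IH ir.
by apply: leq_ltn_trans (ci _ ir); apply: IH; exact: ltnW.
Qed.

End Gmod.

Lemma gsub_scale (R : nzRingType) (G : Type) (V : lmodType R) (pr : G -> V -> V) (P : set V) :
  gsub pr P -> forall a v, P v -> P (a *: v).
Proof. by case=> _ _ h _; exact: h. Qed.

Lemma gsub_pr (R : nzRingType) (G : Type) (V : lmodType R) (pr : G -> V -> V) (P : set V) :
  gsub pr P -> forall x v, P v -> P (pr x v).
Proof. by case=> _ _ _ h; exact: h. Qed.

(** * Quotients and submodules of graded modules *)

Section QuotientModule.
Variables (k : finFieldType) (p : weights) (M : gmod k p) (P : set M).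
Hypothesis gP : graded_submodule P.
Local Notation A := (coordA k p).
Local Notation L := (Lgroup p).

(** The proof is an argument of the predicate so that the closure instance below, which depends on
    it, is found from the term [qpred gP]. *)
Definition qpred (_ : graded_submodule P) : {pred M} := [pred v | `[< P v >]].

Lemma qpred_zmod : zmod_closed (qpred gP).
Proof.
split; first by apply/asboolP; case: gP.
by move=> u v /asboolP Pu /asboolP Pv; apply/asboolP; exact: gsubB gP Pu Pv.
Qed.

HB.instance Definition _ := GRing.isZmodClosed.Build M (qpred gP) qpred_zmod.

Definition qtype : Type := {ideal_quot (qpred gP)}.
HB.instance Definition _ := GRing.Zmodule.on qtype.

Definition qpi (v : M) : qtype := \pi_({ideal_quot (qpred gP)}) v.

Lemma qpiD u v : qpi (u + v) = qpi u + qpi v. Proof. exact: raddfD. Qed.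
Lemma qpiK (u : qtype) : qpi (repr u) = u. Proof. exact: reprK. Qed.

Lemma qpi_eq u v : qpi u = qpi v <-> P (u - v).
Proof.
split=> [e|Puv].
  by apply/asboolP; have : u - v \in qpred gP by rewrite Quotient.idealrBE; exact/eqP.
by apply/eqP; rewrite -Quotient.idealrBE; apply/asboolP.
Qed.

Definition qscale (a : A) (u : qtype) : qtype := qpi (a *: repr u).

Lemma qscaleE a v : qscale a (qpi v) = qpi (a *: v).
Proof.
apply/qpi_eq; rewrite -scalerBr; apply: (gsub_scale gP).
by apply/qpi_eq; exact: qpiK.
Qed.

Lemma qscaleA a b v : qscale a (qscale b v) = qscale (a * b) v.
Proof. by rewrite -[v]qpiK !qscaleE scalerA. Qed.
Lemma qscale1 : left_id 1 qscale.
Proof. by move=> v; rewrite -[v]qpiK qscaleE scale1r. Qed.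
Lemma qscaleDr : right_distributive qscale +%R.
Proof. by move=> a u v; rewrite -[u]qpiK -[v]qpiK -qpiD !qscaleE scalerDr qpiD. Qed.
Lemma qscaleDl v : {morph qscale^~ v : a b / a + b}.
Proof. by move=> a b; rewrite -[v]qpiK !qscaleE scalerDl qpiD. Qed.

HB.instance Definition _ :=
  GRing.Zmodule_isLmodule.Build A qtype qscaleA qscale1 qscaleDr qscaleDl.

Lemma qpiZ a v : qpi (a *: v) = a *: qpi v.
Proof. by rewrite -[RHS]/(qscale a (qpi v)) qscaleE. Qed.

Definition qhc (x : L) (u : qtype) : qtype := qpi (hc x (repr u)).

Lemma qhcE x v : qhc x (qpi v) = qpi (hc x v).
Proof.
apply/qpi_eq; rewrite -hcB; apply: (gsub_pr gP).
by apply/qpi_eq; exact: qpiK.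
Qed.

Lemma qhcD x u v : qhc x (u + v) = qhc x u + qhc x v.
Proof. by rewrite -[u]qpiK -[v]qpiK -qpiD !qhcE hcD qpiD. Qed.

Lemma qpi0 : qpi 0 = 0. Proof. exact: raddf0. Qed.

Lemma qhcK x y v : qhc x (qhc y v) = if x == y then qhc y v else 0.
Proof. by rewrite -[v]qpiK !qhcE hcK; case: ifP => _ //; rewrite qpi0. Qed.

Lemma qpi_sum (I : Type) (r : seq I) (F : I -> M) :
  qpi (\sum_(i <- r) F i) = \sum_(i <- r) qpi (F i).
Proof. exact: (big_morph _ qpiD qpi0). Qed.

Lemma qhc_sum v : exists2 s : seq L, uniq s & v = \sum_(x <- s) qhc x v.
Proof.
have [s us e] := hc_sum (repr v); exists s => //; rewrite -[v]qpiK {1}e qpi_sum.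
by apply: eq_bigr => x _; rewrite qhcE.
Qed.

Lemma qhc_scale x y (a : A) v : homogA x a -> qhc (x + y) (a *: qhc y v) = a *: qhc y v.
Proof. by move=> ha; rewrite -[v]qpiK qhcE -qpiZ qhcE hc_scale. Qed.

Lemma q_fg : exists (n : nat) (g : 'I_n -> qtype),
  forall v, exists a : 'I_n -> A, v = \sum_i a i *: g i.
Proof.
have [n [g hg]] := gm_fg M; exists n, (fun i => qpi (g i)) => v.
have [a e] := hg (repr v); exists a; rewrite -[v]qpiK e qpi_sum.
by apply: eq_bigr => i _; rewrite qpiZ.
Qed.

Definition gquot : gmod k p := GMod qhcD qhcK qhc_sum qhc_scale q_fg.

Definition gproj (v : M) : gquot := qpi v.

Lemma gprojD u v : gproj (u + v) = gproj u + gproj v. Proof. exact: qpiD. Qed.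
Lemma gprojZ a v : gproj (a *: v) = a *: gproj v. Proof. exact: qpiZ. Qed.
Lemma gproj_hc x v : hc x (gproj v) = gproj (hc x v). Proof. exact: qhcE. Qed.
Lemma gproj_eq0 v : gproj v = 0 <-> P v.
Proof. by rewrite -[0]/(0 : qtype) -qpi0; split=> [/qpi_eq|h]; [|apply/qpi_eq]; rewrite subr0. Qed.
Lemma gproj_surj u : exists v, gproj v = u.
Proof. by exists (repr (u : qtype)); exact: qpiK. Qed.

End QuotientModule.

Section SubModule.
Variables (k : finFieldType) (p : weights) (M : gmod k p) (P : set M).
Hypothesis gP : graded_submodule P.
Local Notation A := (coordA k p).
Local Notation L := (Lgroup p).
Hypothesis fgP : exists (n : nat) (g : 'I_n -> M), (forall i, P (g i)) /\
  forall v, P v -> exists a : 'I_n -> A, v = \sum_i a i *: g i.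

Definition spred (_ : graded_submodule P) : {pred M} := [pred v | `[< P v >]].

Lemma spred_submod : submod_closed (spred gP).
Proof.
have [P0 PD PZ _] : graded_submodule P := gP; split; first exact/asboolP.
by move=> a u v /asboolP Pu /asboolP Pv; apply/asboolP; apply: PD => //; exact: PZ.
Qed.

HB.instance Definition _ := GRing.isSubmodClosed.Build A M (spred gP) spred_submod.

Definition stype : Type := {v : M | v \in spred gP}.
HB.instance Definition _ := SubChoice.on stype.
HB.instance Definition _ := [SubChoice_isSubLmodule of stype by <:].

Lemma shc_subproof x (u : stype) : hc x (val u) \in spred gP.
Proof. by apply/asboolP; apply: (gsub_pr gP); apply/asboolP; exact: (valP u). Qed.

Definition shc x (u : stype) : stype := Sub (hc x (val u)) (shc_subproof x u).

Lemma shcD x u v : shc x (u + v) = shc x u + shc x v.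
Proof. by apply: val_inj; rewrite /= hcD. Qed.
Lemma shcK x y v : shc x (shc y v) = if x == y then shc y v else 0.
Proof. by apply: val_inj; rewrite /= hcK; case: ifP. Qed.
Lemma shc_sum v : exists2 s : seq L, uniq s & v = \sum_(x <- s) shc x v.
Proof.
have [s us e] := hc_sum (val v); exists s => //; apply: val_inj.
by rewrite raddf_sum /= {1}e.
Qed.
Lemma shc_scale x y (a : A) v : homogA x a -> shc (x + y) (a *: shc y v) = a *: shc y v.
Proof. by move=> ha; apply: val_inj; rewrite /= hc_scale. Qed.

Lemma s_fg : exists (n : nat) (g : 'I_n -> stype),
  forall v, exists a : 'I_n -> A, v = \sum_i a i *: g i.
Proof.
have [n [g [Pg hg]]] := fgP.
have Pg' i : g i \in spred gP by exact/asboolP.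
exists n, (fun i => Sub (g i) (Pg' i)) => v.
have [|a e] := hg (val v); first by apply/asboolP; exact: (valP v).
by exists a; apply: val_inj; rewrite raddf_sum /= {1}e.
Qed.

(** Submodules are formed only as spans of finitely many given elements, so finite generation is
    supplied along with the submodule. *)
Definition gsubm : gmod k p := GMod shcD shcK shc_sum shc_scale s_fg.

Definition gincl (u : gsubm) : M := val (u : stype).

Lemma gincl0 : gincl 0 = 0. Proof. by []. Qed.
Lemma gincl_hc x v : gincl (hc x v) = hc x (gincl v). Proof. by []. Qed.
Lemma gincl_inj : injective gincl. Proof. exact: val_inj. Qed.
Lemma gincl_P u : P (gincl u). Proof. by apply/asboolP; exact: (valP (u : stype)). Qed.
Lemma gincl_surj v : P v -> exists u, gincl u = v.
Proof.
move=> Pv; have Pv' : v \in spred gP by exact/asboolP.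
by exists (Sub v Pv' : stype).
Qed.

End SubModule.

(** * Arrows as maps between components of high degree *)

Section Tails.
Variables (k : finFieldType) (p : weights).
Local Notation A := (coordA k p).
Local Notation L := (Lgroup p).
Local Notation gm := (gmod k p).
Implicit Types (M N : gm) (x y : L) (a : A).

(** A homogeneous element is a sum of scaled monomials of its degree, and each of these is reached
    from a constant by multiplications with the X_i. This reduces A-linearity to k-linearity and
    compatibility with three generators. *)
Lemma homogA_ind (Q : L -> A -> Prop) :
  (forall y, Q y 0) -> (forall y a b, Q y a -> Q y b -> Q y (a + b)) ->
  (forall c, Q 0 (kA p c)) ->
  (forall y i a, homogA y a -> Q y a -> Q (vx p i + y) (XA k p i * a)) ->
  forall y a, homogA y a -> Q y a.
Proof.
move=> Q0 QD Qk QX y _ [g hg ->].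
have mono n c m : (mdeg m <= n)%N -> Q (degL p m) (toA p (c *: 'X_[m])).
  elim: n m => [|n IH] m.
    rewrite leqn0 mdeg_eq0 => /eqP ->; rewrite mpolyX0 toAZ rmorph1 mulr1.
    by rewrite /degL big1 // => i _; rewrite mnm0E.
  have [/eqP|nz] := boolP (m == 0%MM).
    move=> -> _; rewrite mpolyX0 toAZ rmorph1 mulr1.
    by rewrite /degL big1 // => i _; rewrite mnm0E.
  have [i mi] : exists i, (0 < m i)%N.
    apply: contrapT => h; case/negP: nz; apply/eqP/mnmP => i; rewrite mnm0E.
    by apply/eqP; rewrite -leqn0 leqNgt; apply/negP => mi; apply: h; exists i.
  have em : m = (U_(i) + (m - U_(i)))%MM.
    apply/mnmP => j; rewrite mnmDE mnmBE mnm1E; case: eqP => [<-|_]; last by rewrite subn0.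
    by rewrite subnKC.
  move=> dm; have dm' : (mdeg (m - U_(i))%MM <= n)%N.
    by move: dm; rewrite {1}em mdegD mdeg1; lia.
  have h := IH _ dm'.
  have -> : toA p (c *: 'X_[m]) = XA k p i * toA p (c *: 'X_[(m - U_(i))%MM] : {mpoly k[3]}).
    by rewrite {1}em mpolyXD /XA -rmorphM -scalerAr.
  have -> : degL p m = vx p i + degL p (m - U_(i))%MM.
    rewrite {1}em degLD; congr (_ + _); rewrite /degL (bigD1 i) //= big1 ?addr0.
      by rewrite mnm1E eqxx.
    by move=> j ne; rewrite mnm1E eq_sym (negPf ne).
  apply: QX => //; exists (c *: 'X_[(m - U_(i))%MM]) => // m'.
  by move=> /msuppZ_le; rewrite msuppX inE => /eqP ->.
rewrite (mpolyE g) raddf_sum /= big_seq; apply: (big_ind (Q y)) => //; first exact: QD.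
by move=> m mg; rewrite -(hg m mg); exact: mono (leqnn _).
Qed.

(** For each of the finitely many classes of degrees modulo c, the components in that class form a
    module over k[T1, T2], to which the bound on torsion applies. *)
Lemma tors M : ev (fun x => forall m : M, hpart x m ->
  ev (fun y => forall a, homogA y a -> a *: m = 0) -> m = 0).
Proof.
have [n hn] := gen_T M.
have [s hs] := degs_fin p 0 1.
pose t i (m : M) := TA k p i *: m.
have class y : lL y = 0 -> exists n0, forall j (m : M) i, (n0 <= j)%N ->
    hpart (y + vc p *+ j) m -> iter i (t i1) m = 0 -> iter i (t i2) m = 0 -> m = 0.
  move=> ly; have eS j : y + vc p *+ j.+1 = vc p + (y + vc p *+ j).
    by rewrite mulrS addrCA.
  apply: (@bounded_torsion M (t i1) (t i2) (fun j => hpart (y + vc p *+ j)) _ _ _ _ _ _ _ n).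
  - by move=> u v; rewrite /t scalerDr.
  - by move=> u v; rewrite /t scalerDr.
  - by move=> u; rewrite /t !scalerA mulrC.
  - by move=> j; exact: hpart_subgrp.
  - by move=> j; exact: fin_hpart.
  - by move=> j v hv; rewrite eS; apply: hpartZ hv; exact: homog_TA.
  - by move=> j v hv; rewrite eS; apply: hpartZ hv; exact: homog_TA.
  - move=> j v lj; rewrite eS addrC => /hn[]; first by rewrite lL_addvcn ly; lia.
    by move=> v1 [v2 [h1 h2 e]]; exists v1, v2.
have [n0 hn0] : exists n0, forall y j (m : M) i, y \in s -> lL y = 0 -> (n0 <= j)%N ->
    hpart (y + vc p *+ j) m -> iter i (t i1) m = 0 -> iter i (t i2) m = 0 -> m = 0.
  elim: s {hs} => [|y s [n0 IH]]; first by exists 0%N.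
  have [ly|ly] := eqVneq (lL y) 0; last first.
    exists n0 => y' j m i; rewrite inE => /predU1P[->|]; last exact: IH.
    by move=> e; rewrite e eqxx in ly.
  have [n1 h1] := class y ly; exists (n0 + n1)%N => y' j m i; rewrite inE => /predU1P[->|ys] ly' lj.
    by apply: h1; lia.
  by apply: (IH y') => //; lia.
exists n0 => x lx m hm [l hl].
have [j ej] : exists j : nat, lL x = j by case: (lL x) lx => j; [exists j|lia].
have ex : x = (x - vc p *+ j) + vc p *+ j by rewrite subrK.
have lx0 : lL (x - vc p *+ j) = 0 by rewrite lL_subvcn ej subrr.
have it i r : iter r (t i) m = TA k p i ^+ r *: m.
  by elim: r => [|r IH] /=; rewrite ?expr0 ?scale1r // IH /t scalerA exprS.
have hT i : iter l (t i) m = 0.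
  rewrite it; apply: (hl (0 + vc p *+ l)); first by rewrite lL_addvcn lL0.
  by rewrite add0r; apply: homogAX; exact: homog_TA.
apply: (hn0 (x - vc p *+ j) j m l) => //.
- by apply: hs; rewrite lx0.
- by move: lx; rewrite ej; lia.
- by rewrite subrK.
Qed.

Section Arrow.
Variables M N : gm.
Implicit Types (f g : qhom M N) (m : M) (n : N).

(* The action of an arrow of coh on homogeneous components of high degree. *)
Definition tf f x m : N := xget 0 [set n | hpart x n /\ graph f (m, n)].

Definition tfok f x :=
  (forall m, hpart x m -> hpart x (tf f x m) /\ graph f (m, tf f x m)) /\
  (forall m n, hpart x m -> hpart x n -> graph f (m, n) -> n = tf f x m).

Lemma graph_hc f x m n : graph f (m, n) -> graph f (hc x m, hc x n).
Proof. by move=> h; have [_ _ _ hh] := graph_gsub f; exact: (hh x _ h). Qed.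

(** In high degrees the domain of the relation is everything and its indeterminacy is zero, both by
    finite length. *)
Lemma tfokP f : ev (tfok f).
Proof.
have gT : graded_submodule ([set: M]) by exact: gsubT.
have g0 : graded_submodule [set (0 : N)] by exact: zero_gsub.
have h1 := fl_ev (gdom_gsub f) gT (@subsetT _ _) (graph_dom f).
have h2 := fl_ev g0 (img_gsub f (zero_gsub M)) (sub0 (img_gsub f (zero_gsub M))) (graph_ind f).
apply: ev_imp (ev_and h1 h2) => x [{}h1 {}h2].
have u m n n' : hpart x n -> hpart x n' -> graph f (m, n) -> graph f (m, n') -> n = n'.
  move=> hn hn' gn gn'; apply/eqP; rewrite -subr_eq0; apply/eqP.
  apply: (h2 (n - n')); first exact: hpartB.
  by exists 0 => //=; rewrite -(subrr m); exact: graphB.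
have ex m : hpart x m -> hpart x (tf f x m) /\ graph f (m, tf f x m).
  move=> hm; have [n _ gn] := h1 m hm I.
  rewrite /tf; case: xgetP => [n' _ []//|/(_ (hc x n))[]].
  by split; [exact: hpart_hc|rewrite -{1}hm; exact: graph_hc].
split=> // m n hm hn gn; have [h h'] := ex m hm; exact: u gn h'.
Qed.

Lemma tfD f x m m' : tfok f x -> hpart x m -> hpart x m' ->
  tf f x (m + m') = tf f x m + tf f x m'.
Proof.
move=> [h u] hm hm'; have [h1 h2] := h _ hm; have [h1' h2'] := h _ hm'.
apply/esym/u; [exact: hpartD|exact: hpartD|].
by have [_ hD _ _] := graph_gsub f; exact: (hD _ _ h2 h2').
Qed.

Lemma tf0 f x : tfok f x -> tf f x 0 = 0.
Proof.
move=> [h u]; apply/esym/u; [exact: hpart0|exact: hpart0|].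
by case: (graph_gsub f).
Qed.

Lemma tfB f x m m' : tfok f x -> hpart x m -> hpart x m' ->
  tf f x (m - m') = tf f x m - tf f x m'.
Proof.
move=> ok hm hm'; apply: (addIr (tf f x m')); rewrite -tfD // ?subrK //.
exact: hpartB.
Qed.

Lemma tfZ f x y a m : tfok f x -> tfok f (y + x) -> homogA y a -> hpart x m ->
  tf f (y + x) (a *: m) = a *: tf f x m.
Proof.
move=> [h u] [h' u'] ha hm; have [h1 h2] := h _ hm.
apply/esym/u'; [exact: hpartZ|exact: hpartZ|].
by have [_ _ hZ _] := graph_gsub f; exact: (hZ a _ h2).
Qed.

Lemma tfkA f x c m : tfok f x -> hpart x m -> tf f x (kA p c *: m) = kA p c *: tf f x m.
Proof.
move=> ok hm; have ok' : tfok f (0 + x) by rewrite add0r.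
by have := tfZ ok ok' (homog_kA p c) hm; rewrite add0r.
Qed.

Lemma qheqP f g : qheq f g <-> ev (fun x => forall m, hpart x m -> tf f x m = tf g x m).
Proof.
split.
  case=> M' [N' [[a1 a2 a3 a4] [b1 b2 b3 b4] E]].
  have h1 := fl_ev a1 (@gsubT _ _ _ _) (@subsetT _ _) a2.
  have h2 := fl_ev (zero_gsub N) b1 (sub0 b1) b2.
  apply: ev_imp (ev_and (ev_and h1 h2) (ev_and (tfokP f) (tfokP g))).
  move=> x [[{}h1 {}h2] [[f1 _] [g1 _]]] m hm; apply/eqP; rewrite -subr_eq0; apply/eqP.
  have [hf gf] := f1 m hm; have [hg gg] := g1 m hm.
  by apply: (h2 (tf f x m - tf g x m)); [exact: hpartB|apply: E gf gg; exact: h1].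
move=> [n0 h0]; have [n1 h1] := tfokP f; have [n2 h2] := tfokP g.
pose n3 := (n0 + n1 + n2)%N.
(* M truncated below n3; together with the sum of the two indeterminacies it witnesses the equality
   of the arrows. *)
pose M' : set M := [set m | forall y, (fun y u => lL y < n3%:Z -> u = 0) y (hc y m)].
have gM' : graded_submodule M'.
  apply: gsub_family; do ?[exact: hcD|exact: hcK|exact: hcZ].
  - by [].
  - by move=> y u v hu hv l; rewrite hu // hv // addr0.
  - move=> x y a v ha hv l; have [lx|lx] := ltP (lL x) 0.
      by rewrite (homogA_lt0 ha lx) scale0r.
    by rewrite hv ?scaler0 //; have := lLD_ge x y; lia.
have gf := img_gsub f (zero_gsub M); have gg := img_gsub g (zero_gsub M).
have inD (h : qhom M N) : (forall x, n3%:Z <= lL x -> tfok h x) -> M' `<=` gdom (graph h).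
  move=> hh m Mm; apply: gsub_hcP; first exact: gdom_gsub.
  move=> y; have [ly|ly] := ltP (lL y) n3%:Z.
    by rewrite Mm //; case: (gdom_gsub h).
  by have [h3 _] := hh y ly; have [_ h4] := h3 _ (hpart_hc y m); exists (tf h y (hc y m)).
have okf x : n3%:Z <= lL x -> tfok f x by move=> l; apply: h1; lia.
have okg x : n3%:Z <= lL x -> tfok g x by move=> l; apply: h2; lia.
exists M', (addset (gind (graph f)) (gind (graph g))); split.
- split=> //; [|exact: inD|exact: inD].
  apply: ev_fl; exists n3 => x lx v hv _ y ly.
  have ne : y != x by apply/eqP => e; rewrite e in ly; lia.
  exact: hpart_ne hv ne.
- split; first exact: (gsub_add (@hcD _ _ N)).
  + exact: flD gf gg (graph_ind f) (graph_ind g).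
  + by move=> n h; exists n, 0; rewrite addr0; split=> //; case: gg.
  + by move=> n h; exists 0, n; rewrite add0r; split=> //; case: gf.
move=> m n n' Mm fn gn'; apply: gsub_hcP; first exact: (gsub_add (@hcD _ _ N)).
move=> y; rewrite hcB; have fy := graph_hc y fn; have gy := graph_hc y gn'.
have [ly|ly] := ltP (lL y) n3%:Z.
  rewrite Mm // in fy gy; exists (hc y n), (- hc y n'); split=> //; first by exists 0.
  by apply: (gsubN gg); exists 0.
have [_ u] := okf y ly; have [_ u'] := okg y ly.
rewrite (u _ _ (hpart_hc y m) (hpart_hc y n) fy) (u' _ _ (hpart_hc y m) (hpart_hc y n') gy).
rewrite h0 ?subrr; last exact: hpart_hc; last by lia.
by exists 0, 0; rewrite addr0; split=> //; [case: gf|case: gg].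
Qed.

Lemma mk_rel (G : set (M * N)) : gsub (pairpr (@hc _ _ M) (@hc _ _ N)) G ->
  ev (fun x => forall m, hpart x m -> exists n, G (m, n)) ->
  ev (fun x => forall n, hpart x n -> G (0, n) -> n = 0) ->
  exists f : qhom M N, graph f = G.
Proof.
move=> gG h1 h2.
have d : fin_length (@hc _ _ M) (gdom G) setT.
  by apply: ev_fl; apply: ev_imp h1 => x h m hm _; have [n gn] := h m hm; exists n.
have i : fin_length (@hc _ _ N) [set 0] (gind G).
  by apply: ev_fl; apply: ev_imp h2 => x h n hn [m -> gn]; exact: h.
by exists (QHom gG d i).
Qed.

(** The graph consists of the pairs whose components match under [phi] in degrees with [lL] at least
    n0 and vanish in the others. *)
Lemma mk_arrow (phi : L -> M -> N) (n0 : nat) :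
  (forall x m, n0%:Z <= lL x -> hpart x m -> hpart x (phi x m)) ->
  (forall x u v, n0%:Z <= lL x -> hpart x u -> hpart x v -> phi x (u + v) = phi x u + phi x v) ->
  (forall x c m, n0%:Z <= lL x -> hpart x m -> phi x (kA p c *: m) = kA p c *: phi x m) ->
  (forall x i m, n0%:Z <= lL x -> hpart x m ->
     phi (vx p i + x) (XA k p i *: m) = XA k p i *: phi x m) ->
  exists f : qhom M N, ev (fun x => forall m, hpart x m -> tf f x m = phi x m).
Proof.
move=> ph pD pk pX.
have p0 x : n0%:Z <= lL x -> phi x 0 = 0.
  move=> lx; apply: (additive_on0 (X := hpart x)); first exact: hpart0.
  by move=> u v; exact: pD.
(* Nonnegative [lL y] keeps y + x in the range where [phi] is controlled; for negative [lL y] the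
   element a is zero. *)
have pZ' y a : homogA y a -> homogA y a /\ (0 <= lL y -> forall x m, n0%:Z <= lL x ->
    hpart x m -> phi (y + x) (a *: m) = a *: phi x m).
  move: y a; apply: homogA_ind.
  - move=> y; split=> [|ly x m lx hm]; first exact: homogA0.
    by rewrite !scale0r p0 //; have := lLD_ge y x; lia.
  - move=> y a b [ha IHa] [hb IHb]; split=> [|ly x m lx hm]; first exact: homogAD.
    rewrite !scalerDl pD; first by rewrite IHa // IHb.
    + by have := lLD_ge y x; lia.
    + exact: hpartZ.
    + exact: hpartZ.
  - by move=> c; split=> [|_ x m lx hm]; [exact: homog_kA|rewrite add0r pk].
  - move=> y i a ha [_ IH]; split=> [|ly x m lx hm]; first by apply: homogAM => //; exact: homog_XA.
    have [l0|l0] := ltP (lL y) 0.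
      rewrite (homogA_lt0 ha l0) mulr0 !scale0r p0 //.
      by have := lLD_ge (vx p i + y) x; lia.
    rewrite -!scalerA -IH // -addrA; apply: pX; last exact: hpartZ.
    by apply: le_trans (lLD_ge y x); lia.
have pZ y a x m : homogA y a -> 0 <= lL y -> n0%:Z <= lL x -> hpart x m ->
    phi (y + x) (a *: m) = a *: phi x m by move=> /pZ'[_ h] ? ? ?; exact: h.
pose C (y : L) : set (M * N) := [set u | [/\ hpart y u.1, hpart y u.2,
  n0%:Z <= lL y -> u.2 = phi y u.1 & lL y < n0%:Z -> u.1 = 0 /\ u.2 = 0]].
pose G : set (M * N) := [set u | forall y, C y (pairpr (@hc _ _ M) (@hc _ _ N) y u)].
have C0 y : C y 0.
  by split=> //=; [exact: hpart0|exact: hpart0|move=> l; rewrite p0].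
have gG : gsub (pairpr (@hc _ _ M) (@hc _ _ N)) G.
  apply: gsub_family; do ?[exact: pairprD|exact: pairprK|exact: pairprZ|exact: C0].
  - move=> y [u1 u2] [v1 v2] [/= a1 a2 a3 a4] [/= b1 b2 b3 b4]; split=> /=; do ?exact: hpartD.
      by move=> l; rewrite a3 // b3 // pD.
    by move=> l; have [-> ->] := a4 l; have [-> ->] := b4 l; rewrite !addr0.
  - move=> x y a v ha; case: (pairpr _ _ _ _) => m n [/= a1 a2 a3 a4].
    have [lx|lx] := ltP (lL x) 0; first by rewrite (homogA_lt0 ha lx) scale0r; exact: C0.
    split=> /=; do ?exact: hpartZ.
      move=> l; have [ly|ly] := ltP (lL y) n0%:Z; last by rewrite a3 // pZ.
      by have [-> ->] := a4 ly; rewrite !scaler0 p0.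
    move=> l; have [|-> ->] := a4; last by rewrite !scaler0.
    by have := lLD_ge x y; lia.
have in_G x m : n0%:Z <= lL x -> hpart x m -> G (m, phi x m).
  move=> lx hm y; rewrite /pairpr /=; have [->|ne] := eqVneq y x.
    split=> /=; do ?exact: hpart_hc; last by lia.
    by move=> _; rewrite hm (ph x m lx hm).
  by rewrite (hpart_ne hm ne) (hpart_ne (ph x m lx hm) ne); exact: C0.
have [||f ef] := @mk_rel G gG.
- by exists n0 => x lx m hm; exists (phi x m); exact: in_G.
- exists n0 => x lx n hn /(_ x)[/= _ _ h _].
  by rewrite -[LHS]hn h // hc0 p0.
exists f; apply: ev_imp (ev_and (tfokP f) (ev_ge p n0)) => x [[_ u] lx] m hm.
by apply/esym/u => //; [exact: ph|rewrite ef; exact: in_G].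
Qed.

End Arrow.
End Tails.

(** * The quotient category in terms of tails *)

Section CategoryTails.
Variables (k : finFieldType) (p : weights).
Local Notation A := (coordA k p).
Local Notation L := (Lgroup p).
Local Notation C := (coh k p).
Implicit Types (X Y Z W M N : C) (x y : L).

Lemma tf_comp X Y Z (g : Hom Y Z) (f : Hom X Y) :
  ev (fun x => forall m, hpart x m -> tf (comp g f) x m = tf g x (tf f x m)).
Proof.
apply: ev_imp (ev_and (tfokP (comp g f)) (ev_and (tfokP f) (tfokP g))).
move=> x [[_ u] [[hf _] [hg _]]] m hm; apply/esym/u => //.
  by apply: (hg _ _).1; exact: (hf _ hm).1.
by exists (tf f x m); [exact: (hf _ hm).2|apply: (hg _ _).2; exact: (hf _ hm).1].
Qed.

Lemma tf_id X : ev (fun x => forall m : X, hpart x m -> tf (idm X) x m = m).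
Proof. by apply: ev_imp (tfokP (idm X)) => x [_ u] m hm; apply/esym/u. Qed.

Lemma heqP X Y (f g : Hom X Y) :
  heq f g <-> ev (fun x => forall m, hpart x m -> tf f x m = tf g x m).
Proof. exact: qheqP. Qed.

Lemma zero_ex X Y : exists f : Hom X Y, ev (fun x => forall m, hpart x m -> tf f x m = 0).
Proof.
apply: (@mk_arrow k p X Y (fun _ _ => 0) 0); do ?by move=> *; rewrite ?addr0 ?scaler0.
by move=> *; exact: hpart0.
Qed.

Lemma gproj_ex (M : gmod k p) (P : set M) (gP : graded_submodule P) :
  exists f : qhom M (gquot gP), ev (fun x => forall m, hpart x m -> tf f x m = gproj gP m).
Proof.
apply: (@mk_arrow k p M (gquot gP) (fun _ => gproj gP) 0).
- by move=> x m _ hm; have := gproj_hc gP x m; rewrite hm.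
- by move=> *; exact: gprojD.
- by move=> *; exact: gprojZ.
- by move=> *; exact: gprojZ.
Qed.

Lemma tf_hpart X Y (f : Hom X Y) x m : tfok f x -> hpart x m -> hpart x (tf f x m).
Proof. by move=> [h _] hm; exact: (h _ hm).1. Qed.

Lemma zero_objectP Z : zero_object Z <-> ev (fun x => forall m : Z, hpart x m -> m = 0).
Proof.
split.
  move=> /(_ Z)[_ [f hf]]; have [z hz] := zero_ex Z Z.
  have /heqP e : heq (idm Z) z := heq_trans (heq_sym (hf (idm Z))) (hf z).
  apply: ev_imp (ev_and (ev_and e hz) (tf_id Z)) => x [[h1 h2] h3] m hm.
  by rewrite -(h3 m hm) h1 // h2.
move=> hZ X; split.
  have [z hz] := zero_ex Z X; exists z => g; apply/heqP.
  apply: ev_imp (ev_and (ev_and hZ hz) (tfokP g)) => x [[h1 h2] h3] m hm.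
  by rewrite (h2 m hm) (h1 m hm) tf0.
have [z hz] := zero_ex X Z; exists z => g; apply/heqP.
apply: ev_imp (ev_and (ev_and hZ hz) (tfokP g)) => x [[h1 h2] h3] m hm.
by rewrite (h2 m hm) (h1 (tf g x m)) //; exact: tf_hpart.
Qed.

Lemma zero_ob : exists Z : C, zero_object Z.
Proof.
have gT : graded_submodule ([set: structure_module k p]) by exact: gsubT.
exists (gquot gT); apply/zero_objectP; apply: ev_true => x m _.
by have [v <-] := gproj_surj m; apply/gproj_eq0.
Qed.

Lemma zero_arrowP X Y (f : Hom X Y) :
  zero_arrow f <-> ev (fun x => forall m, hpart x m -> tf f x m = 0).
Proof.
split.
  move=> [Z [a [b [/zero_objectP hZ /heqP e]]]].
  apply: ev_imp (ev_and (ev_and hZ e) (ev_and (tf_comp b a) (ev_and (tfokP a) (tfokP b)))).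
  move=> x [[h1 h2] [h3 [h4 h5]]] m hm; rewrite h2 // h3 // (h1 (tf a x m)) ?tf0 //.
  exact: tf_hpart.
move=> hf; have [Z hZ] := zero_ob; have [a ha] := zero_ex X Z; have [b hb] := zero_ex Z Y.
exists Z, a, b; split=> //; apply/heqP.
apply: ev_imp (ev_and (ev_and hf ha) (ev_and (tf_comp b a) (tfokP b))).
by move=> x [[h1 h2] [h3 h4]] m hm; rewrite h1 // h3 // h2 // tf0.
Qed.

Definition tinj X Y (f : Hom X Y) :=
  ev (fun x => forall m, hpart x m -> tf f x m = 0 -> m = 0).

Lemma tinj_eq X Y (f : Hom X Y) : tinj f ->
  ev (fun x => forall m m', hpart x m -> hpart x m' -> tf f x m = tf f x m' -> m = m').
Proof.
move=> hf; apply: ev_imp (ev_and hf (tfokP f)) => x [h ok] m m' hm hm' e.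
apply/eqP; rewrite -subr_eq0; apply/eqP; apply: h; first exact: hpartB.
by rewrite tfB // e subrr.
Qed.

Lemma tinj_monic X Y (f : Hom X Y) : tinj f -> monic f.
Proof.
move=> /tinj_eq hf W u v /heqP e; apply/heqP.
apply: ev_imp (ev_and (ev_and hf e) (ev_and (ev_and (tf_comp f u) (tf_comp f v))
  (ev_and (tfokP u) (tfokP v)))).
move=> x [[h1 h2] [[h3 h4] [h5 h6]]] m hm; apply: h1; do ?exact: tf_hpart.
by rewrite -h3 // -h4 // h2.
Qed.

Lemma hpart_shift x0 y (a : gshift (structure_module k p) (- x0)) :
  hpart y a <-> homogA (y - x0) (a : A).
Proof. by rewrite homogAP [y - x0]addrC. Qed.

Lemma om_ex (M : C) x0 (m : M) : hpart x0 m ->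
  exists f : Hom (gshift (structure_module k p) (- x0) : C) M,
    ev (fun y => forall a, hpart y a -> tf f y a = (a : A) *: m).
Proof.
move=> hm.
apply: (@mk_arrow k p (gshift (structure_module k p) (- x0)) M (fun _ a => (a : A) *: m) 0).
- by move=> x a _ /hpart_shift ha; rewrite -[x](subrK x0); apply: hpartZ.
- by move=> *; rewrite -scalerDl.
- by move=> *; rewrite scalerA.
- by move=> *; rewrite scalerA.
Qed.

(** If f kills m in degree x, then f composed with the arrow 1 |-> m from O(-x) is zero. Monicity
    makes that arrow itself zero, so A annihilates m in high degrees and m = 0 by the bound on
    torsion. *)
Lemma monic_tinj X Y (f : Hom X Y) : monic f -> tinj f.
Proof.
move=> mf; apply: ev_imp (ev_and (tors X) (ev_up (tfokP f))) => x [ht ok] m hm e.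
have [o ho] := om_ex hm; have [z hz] := zero_ex (gshift (structure_module k p) (- x) : C) X.
apply: ht => //.
have /heqP h : heq o z.
  apply: mf; apply/heqP.
  apply: ev_imp (ev_and (ev_and ho hz) (ev_and (ev_and (tf_comp f o) (tf_comp f z))
    (ev_ge p (lL x)))).
  move=> y [[h1 h2] [[h3 h4] ly]] a ha; rewrite h3 // h4 // h1 // h2 // tf0; last exact: ok.
  have ha' : homogA (y - x) (a : A) by exact/hpart_shift.
  rewrite -[y](subrK x) tfZ ?e ?scaler0 //; first exact: ok.
  by rewrite subrK; exact: ok.
have /(ev_shift x) := ev_and h (ev_and ho hz); apply: ev_imp => y [h1 [h2 h3]] a ha.
have ha' : hpart (y + x) (a : gshift (structure_module k p) (- x)).
  by apply/hpart_shift; rewrite addrK.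
by rewrite -(h2 a ha') h1 // h3.
Qed.

Lemma gsub_relcomp (U V W : gmod k p) (F2 : set (V * W)) (F1 : set (U * V)) :
  gsub (pairpr (@hc _ _ V) (@hc _ _ W)) F2 -> gsub (pairpr (@hc _ _ U) (@hc _ _ V)) F1 ->
  gsub (pairpr (@hc _ _ U) (@hc _ _ W)) (relcomp F2 F1).
Proof.
move=> [a1 a2 a3 a4] [b1 b2 b3 b4]; split.
- by exists 0.
- move=> [a b] [c d] /= [n h h'] [n' h1 h1']; exists (n + n').
    exact: (b2 _ _ h h1).
  exact: (a2 _ _ h' h1').
- move=> c [a b] /= [n h h']; exists (c *: n); [exact: (b3 c _ h)|exact: (a3 c _ h')].
- move=> x [a b] /= [n h h']; exists (hc x n); [exact: (b4 x _ h)|exact: (a4 x _ h')].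
Qed.

(** The relation of f followed by the converse of that of v is the graph of the lift; injectivity of
    v makes it single-valued in high degrees. *)
Lemma lift_ex X V M (f : Hom X M) (v : Hom V M) : tinj v ->
  ev (fun x => forall m, hpart x m -> exists2 b, hpart x b & tf v x b = tf f x m) ->
  exists h : Hom X V, heq (comp v h) f.
Proof.
move=> iv hv.
have gG := gsub_relcomp (gsub_converse (graph_gsub v)) (graph_gsub f).
have [||h eh] := @mk_rel k p X V _ gG.
- apply: ev_imp (ev_and hv (ev_and (tfokP v) (tfokP f))) => x [{}hv [[ok _] [ok' _]]] m hm.
  have [b hb e] := hv m hm; exists b; exists (tf f x m) => /=; first exact: (ok' _ hm).2.
  by rewrite -e; exact: (ok _ hb).2.
- apply: ev_imp (ev_and iv (ev_and (tfokP v) (tfokP f))) => x [{}iv [[_ u] ok']] b hb.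
  case=> m /= fm vm; apply: iv => //.
  have := graph_hc x vm; rewrite hb => /(u _ _ hb (hpart_hc _ _)) <-.
  have := graph_hc x fm; rewrite hc0 => /(ok'.2 _ _ (hpart0 _ _) (hpart_hc _ _)) ->.
  by rewrite tf0.
exists h; apply/heqP.
apply: ev_imp (ev_and (ev_and hv (tf_comp v h)) (ev_and (tfokP h) (ev_and (tfokP v) (tfokP f)))).
move=> x [[{}hv tc] [okh [okv okf]]] m hm; rewrite tc //.
have [b hb e] := hv m hm; rewrite -e; congr (tf v x _); apply/esym.
apply: okh.2 => //; rewrite eh; exists (tf f x m) => /=; first exact: (okf.1 _ hm).2.
by rewrite -e; exact: (okv.1 _ hb).2.
Qed.

Definition tsurj X Y (f : Hom X Y) :=
  ev (fun x => forall n, hpart x n -> exists2 m, hpart x m & tf f x m = n).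

Lemma isoP X Y (f : Hom X Y) : is_iso f <-> tinj f /\ tsurj f.
Proof.
split.
  move=> [g /heqP e1 /heqP e2]; split.
    apply: ev_imp (ev_and (ev_and e1 (tf_comp g f)) (ev_and (tf_id X) (tfokP g))).
    by move=> x [[h1 h2] [h3 h4]] m hm e; rewrite -(h3 m hm) -h1 // h2 // e tf0.
  apply: ev_imp (ev_and (ev_and e2 (tf_comp f g)) (ev_and (tf_id Y) (tfokP g))).
  move=> x [[h1 h2] [h3 h4]] n hn; exists (tf g x n); first exact: tf_hpart.
  by rewrite -h2 // h1 // h3.
move=> [fi fs]; have [|g eg] := @lift_ex Y X Y (idm Y) f fi.
  apply: ev_imp (ev_and fs (tf_id Y)) => x [h1 h2] n hn.
  by have [m hm e] := h1 n hn; exists m; rewrite ?h2.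
exists g => //; apply: (tinj_monic fi).
apply: heq_trans (compA f g f) _.
apply: heq_trans (comp_heq eg (heq_refl f)) _.
apply: heq_trans (comp1m f) _; exact: heq_sym (compm1 f).
Qed.

Definition texact X Y Z (f : Hom X Y) (g : Hom Y Z) := tsurj g /\
  ev (fun x => forall m, hpart x m -> (tf g x m = 0 <-> exists2 n, hpart x n & tf f x n = m)).

(** A cokernel is tested against two quotients: that of Z by the image of g gives surjectivity, that
    of Y by the image of f gives exactness in the middle. Conversely, an arrow h that kills the
    image of f factors through the relation composed of the converse of g and h. *)
Lemma cokernelP X Y Z (f : Hom X Y) (g : Hom Y Z) : is_cokernel f g <-> texact f g.
Proof.
split.
  case=> /zero_arrowP z0 uni; split.
    have gP := img_gsub g (@gsubT _ _ _ (@hc _ _ Y)).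
    have [q hq] := gproj_ex gP; have [z hz] := zero_ex Z (gquot gP : C).
    have [|u _ uu] := uni _ (comp (q : Hom Z (gquot gP : C)) g).
      apply/zero_arrowP; apply: ev_imp (ev_and (ev_and z0 (tf_comp g f)) (ev_and
        (ev_and (tf_comp (q : Hom Z (gquot gP : C)) g) (tf_comp (comp (q : Hom Z (gquot gP : C)) g) f)) (ev_and (tfokP f) (tfokP q)))).
      move=> x [[h1 h2] [[h3 h4] [h5 h6]]] m hm.
      by rewrite h4 // h3 -?h2 ?h1 ?tf0 //; exact: tf_hpart.
    have e1 := uu q (heq_refl _).
    have /uu e2 : heq (comp z g) (comp (q : Hom Z (gquot gP : C)) g).
      apply/heqP; apply: ev_imp (ev_and (ev_and hq hz) (ev_and (ev_and
        (tf_comp (q : Hom Z (gquot gP : C)) g) (tf_comp z g)) (tfokP g))).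
      move=> x [[h1 h2] [[h3 h4] h5]] m hm; have hm' := tf_hpart h5 hm.
      rewrite h3 // h4 // h1 // h2 //; apply/esym/gproj_eq0.
      by exists m => //; exact: (h5.1 _ hm).2.
    have /heqP e := heq_trans (heq_sym e1) e2.
    apply: ev_imp (ev_and (ev_and e hz) (ev_and hq (tfokP g))) => x [[h1 h2] [h3 h4]] n hn.
    have : gproj gP n = 0 by rewrite -h3 // h1 // h2.
    move=> /gproj_eq0[m _ /= gm]; exists (hc x m); first exact: hpart_hc.
    have := graph_hc x gm; rewrite hn => /(h4.2 _ _ (hpart_hc _ _) hn) <- //.
  have gP := img_gsub f (@gsubT _ _ _ (@hc _ _ X)).
  have [q hq] := gproj_ex gP.
  have [|u /heqP eu _] := uni (gquot gP : C) q.
    apply/zero_arrowP; apply: ev_imp (ev_and hq (ev_and (tf_comp (q : Hom Y (gquot gP : C)) f) (tfokP f))).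
    move=> x [h1 [h2 h3]] m hm; rewrite h2 // h1; last exact: tf_hpart.
    by apply/gproj_eq0; exists m => //; exact: (h3.1 _ hm).2.
  apply: ev_imp (ev_and (ev_and eu (tf_comp u g)) (ev_and (ev_and hq (tfokP f))
    (ev_and (ev_and z0 (tf_comp g f)) (tfokP u)))).
  move=> x [[h1 h2] [[h3 h4] [[h5 h6] h7]]] m hm; split=> [e|[n hn <-]]; last first.
    by rewrite -h6 // h5.
  have : gproj gP m = 0 by rewrite -h3 // -h1 // h2 // e tf0.
  move=> /gproj_eq0[n _ /= gn]; exists (hc x n); first exact: hpart_hc.
  by have := graph_hc x gn; rewrite hm => /(h4.2 _ _ (hpart_hc _ _) hm) <-.
case=> gs ex; split.
  apply/zero_arrowP; apply: ev_imp (ev_and ex (ev_and (tf_comp g f) (tfokP f))).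
  move=> x [h1 [h2 h3]] m hm; rewrite h2 //; apply/h1; first exact: tf_hpart.
  by exists m.
move=> W h /zero_arrowP hz.
have gG := gsub_relcomp (graph_gsub h) (gsub_converse (graph_gsub g)).
have [||u eu] := @mk_rel k p Z W _ gG.
- apply: ev_imp (ev_and gs (ev_and (tfokP g) (tfokP h))) => x [h1 [h2 h3]] n hn.
  have [m hm e] := h1 n hn; exists (tf h x m); exists m => /=.
    by rewrite -e; exact: (h2.1 _ hm).2.
  exact: (h3.1 _ hm).2.
- apply: ev_imp (ev_and (ev_and ex hz) (ev_and (ev_and (tf_comp h f) (tfokP f))
    (ev_and (tfokP g) (tfokP h)))).
  move=> x [[h1 h2] [[h3 h4] [h5 h6]]] w hw [m /= gm hm].
  have := graph_hc x gm; rewrite hc0 => /(h5.2 _ _ (hpart_hc _ _) (hpart0 _ _)) /esym.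
  move=> /(h1 _ (hpart_hc _ _))[n hn e].
  have := graph_hc x hm; rewrite hw => /(h6.2 _ _ (hpart_hc _ _) hw) ->.
  by rewrite -e -h3 // h2.
have key : ev (fun x => forall m, hpart x m -> tf u x (tf g x m) = tf h x m).
  apply: ev_imp (ev_and (tfokP u) (ev_and (tfokP g) (tfokP h))) => x [h1 [h2 h3]] m hm.
  apply/esym/h1.2; do ?exact: tf_hpart.
  rewrite eu; exists m => /=; [exact: (h2.1 _ hm).2|exact: (h3.1 _ hm).2].
exists u.
  apply/heqP; apply: ev_imp (ev_and key (tf_comp u g)) => x [h1 h2] m hm.
  by rewrite h2 // h1.
move=> u' /heqP e; apply/heqP.
apply: ev_imp (ev_and (ev_and key e) (ev_and gs (tf_comp u' g))) => x [[h1 h2] [h3 h4]] n hn.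
by have [m hm <-] := h3 n hn; rewrite h1 // -h4 // h2.
Qed.

Lemma kernel_tinj X Y Z (f : Hom X Y) (g : Hom Y Z) : is_kernel f g -> tinj f.
Proof.
move=> [/zero_arrowP z0 uni]; apply: monic_tinj => W u v e.
have [|w _ uw] := uni W (comp f u).
  apply/zero_arrowP; apply: ev_imp (ev_and (ev_and z0 (tf_comp g f)) (ev_and
    (ev_and (tf_comp g (comp f u)) (tf_comp f u)) (tfokP u))).
  move=> x [[h1 h2] [[h3 h4] h5]] m hm.
  by rewrite h3 // h4 // -h2 ?h1 //; exact: tf_hpart.
apply: heq_trans (uw v (heq_sym e)); apply: heq_sym; apply: uw; exact: heq_refl.
Qed.

Lemma short_exact_tail X Y Z (f : Hom X Y) (g : Hom Y Z) :
  short_exact f g -> tinj f /\ texact f g.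
Proof. by move=> [/kernel_tinj ? /cokernelP]. Qed.

Lemma texact_card X Y Z (f : Hom X Y) (g : Hom Y Z) : tinj f -> texact f g ->
  ev (fun x => ncard (hpart x : set Y) = (ncard (hpart x : set Z) * ncard (hpart x : set X))%N).
Proof.
move=> /tinj_eq fi [gs ex].
apply: ev_imp (ev_and (ev_and fi gs) (ev_and ex (ev_and (tfokP f) (tfokP g)))).
move=> x [[h1 h2] [h3 [h4 h5]]].
rewrite (ncard_fiber (f := tf g x) (fin_hpart Y x) (hpart_subgrp Y x)); last first.
  by move=> u v hu hv; rewrite tfD.
congr (ncard _ * _)%N.
  apply/seteqP; split=> [n [m hm <-]|n hn]; first exact: tf_hpart.
  by have [m hm e] := h2 n hn; exists m.
apply: (proj2 (@ncard_bij _ _ (hpart x : set X) [set v | hpart x v /\ tf g x v = 0] (tf f x) _ _ _ _)).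
- exact: fin_hpart.
- by move=> u v hu hv; exact: h1.
- by move=> v hv; split; [exact: tf_hpart|apply/h3; [exact: tf_hpart|exists v]].
- by move=> w [hw /(h3 w hw)].
Qed.

Lemma iso_card X Y : isomorphic X Y ->
  ev (fun x => ncard (hpart x : set Y) = ncard (hpart x : set X)).
Proof.
move=> [f /isoP[/tinj_eq fi fs]]; apply: ev_imp (ev_and (ev_and fi fs) (tfokP f)).
move=> x [[h1 h2] h3].
apply: (proj2 (@ncard_bij _ _ (hpart x : set X) (hpart x : set Y) (tf f x) _ _ _ _)).
- exact: fin_hpart.
- by move=> u v hu hv; exact: h1.
- by move=> v hv; exact: tf_hpart.
- by [].
Qed.

End CategoryTails.

(** * Cardinalities of components as an invariant of classes in K_0 *)

Section GrothendieckGroup.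
Variables (k : finFieldType) (p : weights).
Local Notation C := (coh k p).
Local Notation L := (Lgroup p).

Definition rep (l : seq (int * C)) (T : C) : int := \sum_(c <- l) c.1 * delta_ob c.2 T.
Definition wtsum (h : C -> int) (l : seq (int * C)) : int := \sum_(c <- l) c.1 * h c.2.

(** The coefficients of each single object sum to zero, so the weighted sum does not depend on the
    formal sum chosen to represent a function. *)
Lemma rep0_wtsum (h : C -> int) l : (forall T, rep l T = 0) -> wtsum h l = 0.
Proof.
have [n le] := ubnP (size l); elim: n l le => // n IH [|[c X] l] le r0; first by rewrite /wtsum big_nil.
pose P (c : int * C) := `[< c.2 = X >].
have E (F : C -> int) : \sum_(c <- (c, X) :: l) c.1 * F c.2 =
    (\sum_(c <- (c, X) :: l | P c) c.1) * F X + \sum_(c <- [seq c <- l | ~~ P c]) c.1 * F c.2.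
  rewrite (bigID P) /= mulr_suml; congr (_ + _).
    by apply: eq_bigr => i /asboolP ->.
  by rewrite big_cons /= {1}/P asboolT //= big_filter.
have c0 : \sum_(c <- (c, X) :: l | P c) c.1 = 0.
  have := r0 X; rewrite /rep (E (fun Y => delta_ob Y X)) (_ : delta_ob X X = 1) ?mulr1; last by rewrite /delta_ob asboolT.
  rewrite big_filter [X in _ + X]big1 ?addr0 // => i /asboolPn ne.
  by rewrite /delta_ob asboolF ?mulr0.
rewrite /wtsum (E h) c0 mul0r add0r; apply: IH.
  by apply: leq_ltn_trans (_ : size l < n)%N => //; rewrite size_filter count_size.
by move=> T; have := r0 T; rewrite /rep (E (fun Y => delta_ob Y T)) c0 mul0r add0r.
Qed.

(** A short exact sequence is exact on components only in high degrees, with a bound depending on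
    the sequence. A derivation of a relation uses finitely many sequences, so one bound serves for
    the whole formal sum. *)
Lemma K0_rep (h : L -> C -> int) (u : C -> int) :
  (forall X Y Z (f : Hom X Y) (g : Hom Y Z), short_exact f g ->
     ev (fun x => h x Y = h x X + h x Z)) ->
  K0_relation u -> exists2 l, forall T, u T = rep l T & ev (fun x => wtsum (h x) l = 0).
Proof.
move=> hE; elim=> [|X Y Z f g ex|{}u v _ [l rl el] _ [l' rl' el']].
- by exists [::] => [T|]; rewrite /rep ?big_nil //; apply: ev_true => x; rewrite /wtsum big_nil.
- exists [:: (1, Y); (-1, X); (-1, Z)].
    by move=> T; rewrite /rep !big_cons big_nil /= mul1r !mulN1r addr0 addrA.
  apply: ev_imp (hE _ _ _ _ _ ex) => x e.
  by rewrite /wtsum !big_cons big_nil /= e; ring.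
- exists (l ++ [seq (- c.1, c.2) | c <- l']).
    move=> T; rewrite rl rl' /rep big_cat big_map /=; congr (_ + _).
    by rewrite -sumrN; apply: eq_bigr => i _; rewrite mulNr.
  apply: ev_imp (ev_and el el') => x [e e']; rewrite /wtsum big_cat big_map /= -/(wtsum _ l) e add0r.
  under eq_bigr do rewrite mulNr.
  by rewrite sumrN -/(wtsum _ l') e' oppr0.
Qed.

Lemma ncard_hpart_gt0 (M : gmod k p) x : (0 < ncard (hpart x : set M))%N.
Proof. exact: ncard_gt0 (hpart0 M x) (fin_hpart M x). Qed.

(* Any prime l gives an additive function; it is applied to the characteristic of k. *)
Lemma K0_card (l : nat) (E E' S : C) :
  K0_eq (fun X => delta_ob E' X + delta_ob S X) (delta_ob E) ->
  ev (fun x => logn l (ncard (hpart x : set E)) =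
     (logn l (ncard (hpart x : set E')) + logn l (ncard (hpart x : set S)))%N).
Proof.
pose h (x : L) (X : C) : int := (logn l (ncard (hpart x : set X)))%:Z.
move=> /(@K0_rep h)[X Y Z f g ex|r rr er].
  have [fi te] := short_exact_tail ex.
  apply: ev_imp (texact_card fi te) => x e.
  by rewrite /h e lognM ?ncard_hpart_gt0 // PoszD addrC.
apply: ev_imp er => x e.
have := @rep0_wtsum (h x) ([:: (1, E'); (1, S); (-1, E)] ++ [seq (- c.1, c.2) | c <- r]).
rewrite /wtsum big_cat big_map /= !big_cons big_nil /=.
under eq_bigr do rewrite mulNr.
rewrite sumrN -/(wtsum _ r) e /h => E0; suff : (logn l (ncard (hpart x : set E')))%:Z
  + (logn l (ncard (hpart x : set S)))%:Z - (logn l (ncard (hpart x : set E)))%:Z = 0 by lia.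
rewrite -[RHS]E0; first by ring.
move=> T; rewrite /rep !big_cons big_map /=.
under eq_bigr do rewrite mulNr.
by rewrite sumrN -/(rep r T) -rr; ring.
Qed.

End GrothendieckGroup.

(** * Ordinary points and torsion sheaves *)

Section PrimePowers.
Variables (k : fieldType) (ze : {poly k}).
Hypothesis irr : irreducible_poly ze.

Lemma ze_neq0 : ze != 0.
Proof. by apply/eqP => e; have [h _] := irr; move: h; rewrite e size_poly0. Qed.

Lemma ze_coprime (f : {poly k}) : ~~ (ze %| f) -> coprimep ze f.
Proof. by rewrite irreducible_poly_coprime. Qed.

Lemma ze_split (f : {poly k}) : f != 0 ->
  exists (j : nat) (f' : {poly k}), f = ze ^+ j * f' /\ ~~ (ze %| f').
Proof.
have [n le] := ubnP (size f); elim: n f le => // n IH f le f0.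
have [/dvdpP[g eg]|nd] := boolP (ze %| f); last by exists 0%N, f; rewrite expr0 mul1r.
have g0 : g != 0 by apply: contraNneq f0 => g0; rewrite eg g0 mul0r.
have [|j [f' [e nd]]] := IH g _ g0.
  have [h _] := irr; apply: leq_trans (_ : size f <= n)%N => //.
  rewrite eg size_mul ?ze_neq0 // -subn1 -addnBA ?(ltnW h) //.
  by rewrite -[X in (X < _)%N]addn0 ltn_add2l subn_gt0.
by exists j.+1, f'; rewrite eg e exprS; split=> //; ring.
Qed.

(** The greatest common divisor of f and ze^(e+1) is a power ze^j with j at most e. *)
Lemma ze_bezout e (f : {poly k}) : ~~ (ze ^+ e.+1 %| f) ->
  exists u v : {poly k}, u * f + v * ze ^+ e.+1 = ze ^+ e.
Proof.
have [->|f0] := eqVneq f 0; first by rewrite dvdp0.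
have [j [f' [ef nd]]] := ze_split f0 => ndf.
have lj : (j <= e)%N.
  rewrite leqNgt; apply/negP => lt; case/negP: ndf; rewrite ef.
  by apply: dvdp_mulr; rewrite dvdp_exp2l.
have /Bezout_eq1_coprimepP[[u v] /= e1] : coprimep f' (ze ^+ e.+1).
  by rewrite coprimep_sym coprimep_expl // ze_coprime.
exists (u * ze ^+ (e - j)), (v * ze ^+ e).
have ee : ze ^+ e = ze ^+ (e - j) * ze ^+ j by rewrite -exprD subnK.
by rewrite ef -[RHS]mulr1 -e1 mulrDr [in X in _ = X + _]ee; ring.
Qed.

Lemma ze_inv n (f : {poly k}) : ~~ (ze %| f) -> exists u : {poly k}, ze ^+ n %| u * f - 1.
Proof.
move=> nd; have /Bezout_eq1_coprimepP[[u v] /= e1] : coprimep f (ze ^+ n).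
  by rewrite coprimep_sym coprimep_expl // ze_coprime.
by exists u; rewrite -e1 opprD addrA subrr sub0r -mulNr dvdp_mull.
Qed.

Lemma ze_cancel n (f g : {poly k}) : ~~ (ze %| f) -> ze ^+ n %| f * g -> ze ^+ n %| g.
Proof.
move=> nd; rewrite Gauss_dvdpr //; apply: coprimep_expl; exact: ze_coprime.
Qed.

Lemma ze_prime (f g : {poly k}) : ze %| f * g -> (ze %| f) || (ze %| g).
Proof.
move=> h; case: (boolP (ze %| f)) => //= nd; rewrite -[ze]expr1.
by apply: (ze_cancel nd); rewrite expr1.
Qed.

Section CyclicSummand.
Variables (V : zmodType) (U : set V) (act : {poly k} -> V -> V) (n : nat).
Hypothesis gU : subgrp U.
Hypothesis fU : fin U.
Hypothesis aU : forall f u, U u -> U (act f u).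
Hypothesis aDr : forall f u v, U u -> U v -> act f (u + v) = act f u + act f v.
Hypothesis aDl : forall f g u, U u -> act (f + g) u = act f u + act g u.
Hypothesis aM : forall f g u, U u -> act (f * g) u = act f (act g u).
Hypothesis a1 : forall u, U u -> act 1 u = u.
Hypothesis an : forall u, U u -> act (ze ^+ n) u = 0.

Let a0r f : act f 0 = 0.
Proof. by apply: (additive_on0 (X := U)); [exact: gU.1|move=> u v; exact: aDr]. Qed.
Let a0l u : U u -> act 0 u = 0.
Proof. by move=> Uu; apply: (addrI (act 0 u)); rewrite -aDl // !addr0. Qed.
Let aNr f u : U u -> act f (- u) = - act f u.
Proof.
by move=> Uu; apply: (addrI (act f u)); rewrite -aDr ?subrr ?a0r //; exact: subgrpN.
Qed.
Let aBr f u v : U u -> U v -> act f (u - v) = act f u - act f v.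
Proof. by move=> Uu Uv; rewrite aDr ?aNr //; exact: subgrpN. Qed.
Let aNl f u : U u -> act (- f) u = - act f u.
Proof. by move=> Uu; apply: (addrI (act f u)); rewrite -aDl // !subrr a0l. Qed.

Lemma act_ann e s f : U s -> act (ze ^+ e) s <> 0 -> act (ze ^+ e.+1) s = 0 ->
  act f s = 0 -> ze ^+ e.+1 %| f.
Proof.
move=> Us ne z fz; apply/negP => /negP /ze_bezout[u [v E]]; apply: ne.
by rewrite -E aDl // !aM // fz z !a0r addr0.
Qed.

Lemma cyclic_summand : exists s U', [/\ U s, subgrp U', U' `<=` U,
  forall f u, U' u -> U' (act f u) &
  [/\ forall u, U u -> exists f v, U' v /\ u = act f s + v,
    forall f, U' (act f s) -> act f s = 0 & s = 0 -> forall u, U u -> u = 0]].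
Proof.
have ex : exists e, `[< forall u, U u -> act (ze ^+ e) u = 0 >] by exists n; exact/asboolP.
case: (ex_minnP ex) => -[|e] /asboolP ze0 mn.
  exists 0, U; split=> //; first exact: gU.1.
  split=> [u Uu|f _|_ u Uu]; [by exists 0, u; rewrite a0r add0r|by rewrite a0r|].
  by have := ze0 u Uu; rewrite expr0 a1.
have [s [Us se]] : exists s, U s /\ act (ze ^+ e) s <> 0.
  apply: contrapT => h; suff: (e < e)%N by rewrite ltnn.
  apply: mn; apply/asboolP => u Uu.
  by apply: contrapT => ne; apply: h; exists u.
pose good (N : set V) := [/\ subgrp N, N `<=` U, forall f u, N u -> N (act f u) &
  forall f, N (act f s) -> act f s = 0].
have exN : exists c, `[< exists N, good N /\ ncard N = c >].
  exists (ncard [set (0 : V)]); apply/asboolP; exists [set 0]; split=> //; split=> //.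
  - by split=> // u v -> ->; rewrite subr0.
  - by move=> u ->; exact: gU.1.
  - by move=> f u ->; rewrite /= a0r.
have bd c : `[< exists N, good N /\ ncard N = c >] -> (c <= ncard U)%N.
  by move=> /asboolP[N [[_ NU _ _] <-]]; exact: ncard_le.
case: (ex_maxnP exN bd) => c /asboolP[N [[gN NU Na Ns] ec]] mx {exN bd}.
exists s, N; split=> //; split=> //; last by move=> s0; case: se; rewrite s0 a0r.
pose sm : set V := [set u | exists f v, N v /\ u = act f s + v].
have smU : sm `<=` U.
  by move=> u [f [v [Nv ->]]]; apply: subgrpD => //; [exact: aU|exact: NU].
have gsm : subgrp sm.
  split; first by exists 0, 0; rewrite a0l // addr0; split=> //; exact: gN.1.
  move=> _ _ [f [v [Nv ->]]] [f' [v' [Nv' ->]]]; exists (f - f'), (v - v'); split.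
    exact: gN.2.
  by rewrite aDl // aNl // opprD addrACA.
have sma f u : sm u -> sm (act f u).
  move=> [g [v [Nv ->]]]; exists (f * g), (act f v); split; first exact: Na.
  by rewrite aDr ?aM //; [exact: aU|exact: NU].
have Nsm : N `<=` sm by move=> v Nv; exists 0, v; rewrite a0l // add0r.
move=> u Uu; apply: contrapT => nu.
(* If the sum [sm] is not U, some power of ze carries u to an element v outside it with ze v inside
   it. *)
have [v [Uv nv zv]] : exists v, [/\ U v, ~ sm v & sm (act ze v)].
  have exj : exists j, `[< sm (act (ze ^+ j) u) >].
    by exists e.+1; apply/asboolP; rewrite ze0 //; exact: gsm.1.
  case: (ex_minnP exj) => -[/asboolP|j /asboolP h mj]; first by rewrite expr0 a1.
  exists (act (ze ^+ j) u); split; first exact: aU.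
    by move=> h'; have /negP[] := negbT (ltnn j); apply: mj; exact/asboolP.
  by rewrite -aM // -exprS.
case: zv => f [w [Nw ew]].
(* Multiplying ze v = f s + w by ze^e gives 0, so ze^e f s lies in N and vanishes; as s has exponent
   e + 1, ze divides f. Subtracting g s from v then moves ze v into N, and adjoining the result
   would enlarge N. *)
have [g eg] : exists g, f = g * ze.
  apply/dvdpP.
  have z1 : act (ze ^+ e * f) s + act (ze ^+ e) w = 0.
    rewrite aM // -aDr; [|exact: aU|exact: NU].
    by rewrite -ew -aM // -exprSr ze0.
  have : act (ze ^+ e * f) s = 0.
    by apply: Ns; rewrite (_ : act _ s = - act (ze ^+ e) w); [apply: subgrpN => //; exact: Na|apply/eqP; rewrite -addr_eq0 z1].
  move/(act_ann Us se (ze0 s Us)); rewrite exprSr dvdp_mul2l // expf_neq0 //; exact: ze_neq0.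
pose v' := v - act g s.
have Uv' : U v' by apply: gU.2 => //; exact: aU.
have nv' : ~ sm v'.
  move=> h; apply: nv; rewrite -[v](subrK (act g s)); apply: (subgrpD gsm) => //.
  by exists g, 0; rewrite addr0; split=> //; exact: gN.1.
have zv' : act ze v' = w.
  by rewrite aBr ?ew ?eg; [rewrite [g * ze]mulrC aM // addrC addKr|by []|exact: aU].
pose N' : set V := [set x | exists h y, N y /\ x = act h v' + y].
have NN' : N `<=` N' by move=> y Ny; exists 0, y; rewrite a0l // add0r.
have gN' : good N'.
  split.
  - split; first by exists 0, 0; rewrite a0l // addr0; split=> //; exact: gN.1.
    move=> _ _ [h [y [Ny ->]]] [h' [y' [Ny' ->]]]; exists (h - h'), (y - y'); split.
      exact: gN.2.
    by rewrite aDl // aNl // opprD addrACA.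
  - by move=> _ [h [y [Ny ->]]]; apply: subgrpD => //; [exact: aU|exact: NU].
  - move=> h _ [h' [y [Ny ->]]]; exists (h * h'), (act h y); split; first exact: Na.
    by rewrite aDr ?aM //; [exact: aU|exact: NU].
  - move=> h [h' [y [Ny E]]]; have [/dvdpP[h2 e2]|nd] := boolP (ze %| h').
      apply: Ns; rewrite E e2 aM // zv'; apply: (subgrpD gN) => //; exact: Na.
    exfalso; apply: nv'; have /Bezout_eq1_coprimepP[[a b] /= e1] := ze_coprime nd.
    rewrite -[v'](a1 Uv') -e1 aDl // !aM // zv'; apply: (subgrpD gsm).
      by apply: sma; exact: Nsm.
    apply: sma; rewrite (_ : act h' v' = act h s - y); last by rewrite E addrK.
    by apply: gsm.2; [exists h, 0; rewrite addr0; split=> //; exact: gN.1|exact: Nsm].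
have le : (ncard N' <= ncard N)%N by rewrite ec; apply: mx; apply/asboolP; exists N'.
have N'f : fin N' by apply: sub_fin fU; case: gN'.
apply: nv'; apply: Nsm; apply: (ncard_eq NN' N'f le).
by exists 1, 0; rewrite a1 // addr0; split=> //; exact: gN.1.
Qed.

End CyclicSummand.
End PrimePowers.

(** * The prime form of an ordinary point and its dehomogenization *)

Section OrdinaryPoint.
Variables (k : fieldType) (d : nat) (z : {mpoly k[2]}).
Hypothesis Hz : ordinary_point d z.
Local Notation T0 := ('X_ord0 : {mpoly k[2]}).
Local Notation T1 := ('X_ord_max : {mpoly k[2]}).

Implicit Types (f g : {poly k}).

Definition zeta : {poly k} := \sum_(m <- msupp z) z@_m *: 'X^(m ord_max).

Definition hform (e : nat) (f : {poly k}) : {mpoly k[2]} :=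
  \sum_(j < e.+1) f`_j *: (T0 ^+ (e - j) * T1 ^+ j).

Lemma hformD e f g : hform e (f + g) = hform e f + hform e g.
Proof. by rewrite -big_split; apply: eq_bigr => j _; rewrite coefD scalerDl. Qed.
Lemma hformZ e c f : hform e (c *: f) = c *: hform e f.
Proof. by rewrite scaler_sumr; apply: eq_bigr => j _; rewrite coefZ scalerA. Qed.
Lemma hform0 e : hform e 0 = 0.
Proof. by rewrite -(scale0r 0) hformZ scale0r. Qed.
Lemma hformB e f g : hform e (f - g) = hform e f - hform e g.
Proof. by rewrite hformD -scaleN1r hformZ scaleN1r. Qed.

Lemma hformX e f : hform e.+1 ('X * f) = T1 * hform e f.
Proof.
rewrite /hform [LHS]big_ord_recl coefXM eqxx scale0r add0r mulr_sumr.
apply: eq_bigr => j _; rewrite coefXM /= /bump add1n subSS /= exprS -scalerAr; congr (_ *: _).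
ring.
Qed.

Lemma hformS e f : (size f <= e.+1)%N -> hform e.+1 f = T0 * hform e f.
Proof.
move=> sf; rewrite /hform [LHS]big_ord_recr /= nth_default // scale0r addr0 mulr_sumr.
apply: eq_bigr => j _; rewrite subSn ?exprS -?scalerAr; last by rewrite -ltnS.
by rewrite mulrA.
Qed.

Lemma hformC e c : hform e c%:P = c *: T0 ^+ e.
Proof.
rewrite /hform big_ord_recl coefC eqxx subn0 expr0 mulr1 big1 ?addr0 // => j _.
by rewrite coefC /= scale0r.
Qed.

Lemma hformSn e n f : (size f <= e.+1)%N -> hform (n + e) f = T0 ^+ n * hform e f.
Proof.
move=> sf; elim: n => [|n IH]; first by rewrite expr0 mul1r.
by rewrite addSn hformS ?IH ?exprS ?mulrA //; apply: leq_trans sf _; rewrite ltnS leq_addl.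
Qed.

Lemma hformM e e' f g : (size f <= e.+1)%N -> (size g <= e'.+1)%N ->
  hform (e + e') (f * g) = hform e f * hform e' g.
Proof.
elim/poly_ind: f e => [|f c IH] e sf sg; first by rewrite mul0r !hform0 mul0r.
case: e sf => [|e] sf.
  have f0 : f = 0.
    apply/eqP/negPn/negP => f0; move: sf; rewrite size_MXaddC (negPf f0) /= ltnS leqn0 size_poly_eq0.
    by rewrite (negPf f0).
  by rewrite f0 mul0r add0r mul_polyC hformZ hformC expr0 -scalerAl mul1r.
have sf' : (size f <= e.+1)%N.
  move: sf; rewrite size_MXaddC; case: ifP => [/andP[/eqP -> _] _|_]; first by rewrite size_poly0.
  by rewrite ltnS.
rewrite mulrDl mul_polyC [f * 'X]mulrC -mulrA addSn !hformD hformX IH // hformZ hformX hformC.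
rewrite -addSn hformSn // mulrDl mulrA -scalerAl //.
Qed.

Definition dh (h : {mpoly k[2]}) : {poly k} :=
  mmap (@polyC k) (fun i : 'I_2 => if i == ord0 then 1 else 'X) h.

Lemma dhM (h h' : {mpoly k[2]}) : dh (h * h') = dh h * dh h'.
Proof. exact: rmorphM. Qed.

Lemma dh_hform e f : (size f <= e.+1)%N -> dh (hform e f) = f.
Proof.
move=> sf; rewrite /dh /hform raddf_sum /=.
under eq_bigr => j _.
  rewrite mmapZ rmorphM !rmorphXn /= !mmapX !mmap1U /= expr1n mul1r mul_polyC; over.
rewrite -poly_def; apply/polyP => i; rewrite coef_poly; case: ltnP => // h.
by rewrite nth_default // (leq_trans sf).
Qed.

Lemma msupp_z m : m \in msupp z -> (m ord_max <= d)%N /\ 'X_[m] = T0 ^+ (d - m ord_max) * T1 ^+ (m ord_max).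
Proof.
have [zh _ _] := Hz; move=> /(dhomog_mf zh) /=; rewrite mdegE !big_ord_recl big_ord0 addn0.
have -> : lift ord0 ord0 = ord_max :> 'I_2 by exact: val_inj.
move=> e; split; first by rewrite -e leq_addl.
rewrite mpolyXE_id !big_ord_recl big_ord0 mulr1.
have -> : lift ord0 ord0 = ord_max :> 'I_2 by exact: val_inj.
by rewrite -e addnK.
Qed.

Lemma size_zeta_le : (size zeta <= d.+1)%N.
Proof.
apply: leq_trans (size_sum _ _ _) _; apply/bigmax_leqP_seq => m /msupp_z[le _] _.
by apply: leq_trans (size_scale_leq _ _) _; rewrite size_polyXn ltnS.
Qed.

Lemma z_hform : z = hform d zeta.
Proof.
rewrite {1}(mpolyE z) /zeta (big_morph _ (hformD d) (hform0 d)).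
apply: eq_big_seq => m /msupp_z[le ->]; rewrite hformZ; congr (_ *: _).
have lt : (m ord_max < d.+1)%N by rewrite ltnS.
rewrite /hform (bigD1 (Ordinal lt)) //= coefXn eqxx scale1r big1 ?addr0 // => j ne.
by rewrite coefXn (_ : (j == m ord_max :> nat) = false) ?scale0r //; exact/negbTE.
Qed.

(** As z is prime it divides l or h; in the second case l would be a unit, although it vanishes at
    the origin. Applied to the linear forms of the three exceptional points, this shows that
    dehomogenization keeps the degree d and that zeta has no zero at 0 or 1. *)
Lemma z_lin (l h : {mpoly k[2]}) : meval (fun=> 0) l = 0 -> z = l * h -> exists a : k, z = a *: l.
Proof.
have [_ [z0 _ pr] _] := Hz => l0 e.
have h0 : h != 0 by apply: contraNneq z0 => h0; rewrite e h0 mulr0.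
have ll0 : l != 0 by apply: contraNneq z0 => h1; rewrite e h1 mul0r.
have [|[c ec]|[c ec]] := pr l h; first by exists 1; rewrite mulr1.
  have hc : c * h = 1.
    apply: (mulfI ll0); rewrite mulr1 {2}ec e; ring.
  have /andP[/eqP hC _] := mpoly_intro_unit hc.
  by exists h@_0; rewrite e {1}hC mulrC mul_mpolyC.
have lc : l * c = 1 by apply: (mulfI h0); rewrite mulr1 {2}ec e; ring.
by have := congr1 (meval (fun=> 0)) lc; rewrite mevalM l0 mul0r meval1 => /esym/eqP; rewrite oner_eq0.
Qed.

Lemma d_gt0 : (0 < d)%N.
Proof.
rewrite lt0n; apply/eqP => d0; have [_ [z0 nu _] _] := Hz.
have := z_hform; rewrite d0 {1}/hform big_ord_recl big_ord0 addr0 !expr0 mulr1 => e.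
case/negP: nu; apply/unitrP; exists ((zeta`_0)^-1 *: 1).
have c0 : zeta`_0 != 0 by apply: contraNneq z0 => c0; rewrite e c0 scale0r.
by rewrite e -!scalerAl -!scalerAr !mulr1 !scalerA mulVf // divff // scale1r.
Qed.

Lemma size_zeta : size zeta = d.+1.
Proof.
apply/eqP; rewrite eqn_leq size_zeta_le ltnNge; apply/negP => le.
have [_ _ /(_ _)] := Hz; case: (d) d_gt0 le z_hform => // d' _ le.
rewrite hformS // => e h; have [|a ea] := z_lin _ e; first by rewrite mevalXU.
by case: (h a).
Qed.

Lemma zeta_0 : zeta.[0] != 0.
Proof.
apply/eqP => /eqP; rewrite -/(root zeta 0) => /factor_theorem[g eg].
have [_ _ /(_ _)] := Hz; case: (d) d_gt0 z_hform => // d' _.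
rewrite eg subr0 mulrC hformX => e h; have [|a ea] := z_lin _ e; first by rewrite mevalXU.
by case: (h a).
Qed.

Lemma zeta_1 : zeta.[1] != 0.
Proof.
apply/eqP => /eqP; rewrite -/(root zeta 1) => /factor_theorem[g eg].
have [_ _ /(_ _)] := Hz; case: (d) d_gt0 size_zeta z_hform => // d' _ sz.
have sg : (size g <= d'.+1)%N.
  have g0 : g != 0 by apply/eqP => g0; move: sz; rewrite eg g0 mul0r size_poly0.
  by move: sz; rewrite eg size_mul ?polyXsubC_eq0 // size_XsubC addn2 /= => -[->].
rewrite {1}eg mulrC mulrBl mul1r hformB hformX hformS // -mulrBl => e h.
have [|a ea] := z_lin _ e; first by rewrite mevalB !mevalXU subrr.
by case: (h a).
Qed.

(** A factorization of zeta homogenizes to one of z, the degrees adding up because zeta has degree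
    exactly d; primality of z then makes one factor divisible by zeta. *)
Lemma zeta_irr : irreducible_poly zeta.
Proof.
have sz := size_zeta; split; first by rewrite sz ltnS d_gt0.
have zn0 : zeta != 0 by rewrite -size_poly_gt0 sz.
move=> q sq qz; have [q' e] : exists q' : {poly k}, zeta = q' * q by exact/dvdpP.
have q0 : q != 0 by apply: contraNneq zn0 => q0; rewrite e q0 mulr0.
have q'0 : q' != 0 by apply: contraNneq zn0 => h0; rewrite e h0 mul0r.
have s1 : (0 < size q)%N by rewrite size_poly_gt0.
have s2 : (0 < size q')%N by rewrite size_poly_gt0.
have ss : ((size q').-1 + (size q).-1 = d)%N.
  have s3 : (size q' + size q).-1 = d.+1 by rewrite -size_mul // -e.
  by lia.
have [_ [z0 _ pr] _] := Hz.
have ez : hform (size q').-1 q' * hform (size q).-1 q = z.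
  by rewrite -hformM ?leqSpred // ss -e -z_hform.
have dz : dh z = zeta by rewrite z_hform dh_hform // size_zeta_le.
have [|[c ec]|[c ec]] := pr (hform (size q').-1 q') (hform (size q).-1 q).
- by exists 1; rewrite mulr1.
- have dv : zeta %| q'.
    by rewrite -[q'](@dh_hform (size q').-1) ?leqSpred // ec dhM dz dvdp_mulr.
  have s4 : (d.+1 <= size q')%N by rewrite -sz dvdp_leq.
  by case/negP: sq; apply/eqP; lia.
- rewrite /eqp qz /= -[q](@dh_hform (size q).-1) ?leqSpred // ec dhM dz dvdp_mulr //.
Qed.

Section PointEq.
Variable p : weights.
Local Notation A := (coordA k p).

Lemma th1 : th (1 : A) = 1.
Proof.
rewrite -[1 : A](rmorph1 (toA p)) th_toA -mpolyX0 thSX /thm big1 // => i _.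
by rewrite mnm0E div0n expr0.
Qed.

Lemma point_eqE : point_eq p z = \sum_(m <- msupp z)
  kA p z@_m * (TA k p i1 ^+ m ord0 * TA k p i2 ^+ m ord_max).
Proof.
rewrite /point_eq comp_mpolyE raddf_sum; apply: eq_bigr => m _ /=.
rewrite toAZ; congr (_ * _); rewrite !big_ord_recl big_ord0 mulr1 rmorphM !rmorphXn.
by congr (_ * (_ ^+ m _)); exact: val_inj.
Qed.

Lemma th_Z a : th (point_eq p z * a) = zeta * th a.
Proof.
rewrite point_eqE mulr_suml th_sum /zeta mulr_suml; apply: eq_bigr => m _.
by rewrite -!mulrA th_kA !th_TAn !tauE expr1n mul1r scalerAl.
Qed.

Lemma homog_Z : homogA (vc p *+ d) (point_eq p z).
Proof.
rewrite point_eqE big_seq; apply: homogA_sum => m mz; apply: homogAZ.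
have [zh _ _] := Hz; have := dhomog_mf zh mz; rewrite /= mdegE !big_ord_recl big_ord0 addn0.
have -> : lift ord0 ord0 = ord_max :> 'I_2 by exact: val_inj.
move=> <-; rewrite mulrnDr; apply: homogAM; apply: homogAX; exact: homog_TA.
Qed.

Lemma th_Zn n a : th (point_eq p z ^+ n * a) = zeta ^+ n * th a.
Proof. by elim: n => [|n IH]; rewrite ?expr0 ?mul1r // !exprS -!mulrA th_Z IH. Qed.

Lemma size_zetan n : size (zeta ^+ n) = (d * n).+1.
Proof.
have zn0 : zeta != 0 by rewrite -size_poly_gt0 size_zeta.
elim: n => [|n IH]; first by rewrite expr0 size_poly1 muln0.
by rewrite exprS size_mul ?expf_neq0 // IH size_zeta mulnS /= addnS.
Qed.

Lemma homog_Zn n : homogA (vc p *+ (d * n)) (point_eq p z ^+ n).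
Proof. by rewrite mulrnA; apply: homogAX; exact: homog_Z. Qed.

Lemma Zn_eta n : point_eq p z ^+ n = etaR p (d * n) (zeta ^+ n).
Proof.
apply: (th_inj (homog_Zn n) (homog_etaR p _ _)).
by rewrite -[point_eq p z ^+ n]mulr1 th_Zn -[etaR _ _ _]mulr1 th_etaRM // size_zetan.
Qed.

End PointEq.
End OrdinaryPoint.

Section SplitForms.
Variables (k : fieldType) (p : weights).

Lemma homogA_splitn n x (a : coordA k p) : n%:Z <= lL x + 1 -> homogA (x + vc p *+ n) a ->
  exists a1 a2, [/\ homogA x a1, homogA x a2 & a = TA k p i1 ^+ n * a1 + TA k p i2 ^+ n * a2].
Proof.
have [->|n0] := posnP n.
  rewrite mulr0n addr0 => _ ha; exists a, 0; rewrite !expr0 !mul1r addr0; split=> //; exact: homogA0.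
move=> lx ha; have := size_th ha; set f := th a => sf.
pose f2 := f %/ 'X^n; pose f1 := f %% 'X^n.
have [l e] : exists l : nat, lL x = l by case: (lL x) lx => l; [exists l|lia].
have s : dsz x = l.+1 by rewrite /dsz e.
have s' : dsz (x + vc p *+ n) = (l + n).+1 by rewrite /dsz lL_addvcn e.
have s1 : (size f1 <= dsz x)%N.
  have : (size f1 < size ('X^n : {poly k}))%N by rewrite ltn_modp -size_poly_gt0 size_polyXn.
  rewrite size_polyXn s; move: lx; rewrite e; lia.
have s2 : (size f2 <= dsz x)%N.
  by rewrite size_divp -?size_poly_gt0 size_polyXn //= s leq_subLR addnS addnC -s'.
exists (eta x f1), (eta x f2); split; do ?exact: homog_eta.
apply: (th_inj ha).
  rewrite [x + _]addrC; apply: homogAD; apply: homogAM; do ?exact: homog_eta;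
  by apply: homogAX; exact: homog_TA.
by rewrite thD !th_TAn !etaK // !tauE expr1n mul1r addrC [_ * f2]mulrC -divp_eq.
Qed.

End SplitForms.

Section Spans.
Variables (k : finFieldType) (p : weights) (M : gmod k p).
Local Notation A := (coordA k p).
Local Notation L := (Lgroup p).

Lemma hcZ_hom x (m : M) a y : hpart x m -> hc y (a *: m) = prA (y - x) a *: m.
Proof.
move=> hm; have [s _ e] := prA_sum a; rewrite {1}e scaler_suml hc_bigsum.
have -> : prA (y - x) a = \sum_(w <- s) prA (y - x) (prA w a).
  by rewrite {1}e; exact: (@hc_bigsum k p (structure_module k p)).
rewrite scaler_suml; apply: eq_bigr => w _.
have := hpartZ (homog_prA w a) hm; rewrite /hpart /= => e1.
rewrite prAK; case: eqP => [e2|ne]; first by rewrite (_ : y = w + x) // -e2 subrK.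
rewrite scale0r; apply: (hpart_ne e1); apply/eqP => e2; apply: ne; by rewrite e2 addrK.
Qed.

Section GSpan.
Variables (n : nat) (g : 'I_n -> M) (x0 : L).
Hypothesis hg : forall i, hpart x0 (g i).

Definition spanset : set M := [set v | exists a : 'I_n -> A, v = \sum_i a i *: g i].

Lemma spanset_gsub : graded_submodule spanset.
Proof.
split.
- by exists (fun=> 0); rewrite big1 // => i _; rewrite scale0r.
- move=> u v [a ->] [b ->]; exists (fun i => a i + b i).
  by rewrite -big_split; apply: eq_bigr => i _; rewrite scalerDl.
- move=> c v [a ->]; exists (fun i => c * a i).
  by rewrite scaler_sumr; apply: eq_bigr => i _; rewrite scalerA.
- move=> x v [a ->]; exists (fun i => prA (x - x0) (a i)).
  by rewrite hc_bigsum; apply: eq_bigr => i _; rewrite (hcZ_hom _ _ (hg i)).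
Qed.

Lemma spanset_fg : exists (n : nat) (g : 'I_n -> M), (forall i, spanset (g i)) /\
  forall v, spanset v -> exists a : 'I_n -> A, v = \sum_i a i *: g i.
Proof.
exists n, g; split=> // i; exists (fun j => (i == j)%:R).
rewrite (bigD1 i) //= eqxx scale1r big1 ?addr0 // => j ne.
by rewrite eq_sym (negPf ne) scale0r.
Qed.

Definition gspan : gmod k p := gsubm spanset_gsub spanset_fg.

Lemma gspan_incl : exists f : Hom (gspan : coh k p) (M : coh k p),
  ev (fun x => forall u, hpart x u -> tf f x u = gincl u).
Proof.
apply: (@mk_arrow k p gspan M (fun _ u => gincl u) 0); do ?by move=> *.
by move=> x u _ hu; rewrite /hpart /= -gincl_hc hu.
Qed.

Lemma hpart_gincl x (u : gspan) : hpart x u <-> hpart x (gincl u).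
Proof.
split=> [hu|hu]; first by rewrite /hpart /= -gincl_hc hu.
by apply: gincl_inj; rewrite gincl_hc.
Qed.

Lemma gspan_homog x v : hpart x v -> spanset v ->
  exists2 a : 'I_n -> A, forall i, homogA (x - x0) (a i) & v = \sum_i a i *: g i.
Proof.
move=> hv [a e]; exists (fun i => prA (x - x0) (a i)); first by move=> i; exact: homog_prA.
by rewrite -[LHS]hv e hc_bigsum; apply: eq_bigr => i _; rewrite (hcZ_hom _ _ (hg i)).
Qed.

End GSpan.
End Spans.

Section MonomialLists.
Variables (k : fieldType) (p : weights).
Local Notation A := (coordA k p).
Local Notation L := (Lgroup p).

Definition Xl (s : seq 'I_3) : A := \prod_(i <- s) XA k p i.
Definition dl (s : seq 'I_3) : L := \sum_(i <- s) vx p i.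

Lemma homog_Xl s : homogA (dl s) (Xl s).
Proof.
rewrite /dl /Xl; elim: s => [|i s IH]; first by rewrite !big_nil -(kA1 k p); exact: homog_kA.
by rewrite !big_cons; apply: homogAM => //; exact: homog_XA.
Qed.

Lemma lL_dl s x : lL x <= lL (dl s + x).
Proof.
rewrite /dl; elim: s x => [|i s IH] x; first by rewrite big_nil add0r.
rewrite big_cons -addrA; apply: le_trans (IH x) _; exact: lL_vx_ge.
Qed.

Lemma etaR1 l : etaR p l (1 : {poly k}) = TA k p i1 ^+ l.
Proof.
rewrite -[RHS]mulr1 -etaR01 etaR_Tn ?size_poly1 // addn0 !tauE expr1n mul1r //.
Qed.

Lemma etaRX l : etaR p l ('X^l : {poly k}) = TA k p i2 ^+ l.
Proof.
by rewrite -[RHS]mulr1 -etaR01 etaR_Tn ?size_poly1 // addn0 !tauE mulr1.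
Qed.

(** As a monomial, [eta y 1] acts injectively wherever the X_i do; it serves to compare components
    of different degrees. *)
Lemma eta1_Xl (y : L) : 0 <= lL y -> exists2 s, eta y (1 : {poly k}) = Xl s & dl s = y.
Proof.
move=> ly; have [l e] : exists l : nat, lL y = l by case: (lL y) ly => // l; exists l.
exists (nseq (sL i1 y) i1 ++ (nseq (sL i2 y) i2 ++ nseq (sL i3 y) i3) ++ nseq (p i1 * l) i1).
  rewrite /eta e /smono etaR1 /Xl !big_cat !big_ord3 /= !big_nseq !iter_mulr_1.
  by rewrite /TA -exprM !mulrA.
rewrite /dl !big_cat /= !big_nseq !iter_addr_0 [in RHS](sum_vx_sL e) big_ord3 /= mulrnA vcE.
by rewrite !addrA.
Qed.

End MonomialLists.

(** * Torsion sheaves supported at an ordinary point *)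

Section TubeTails.
Variables (k : finFieldType) (p : weights) (d : nat) (z : {mpoly k[2]}).
Hypothesis Hz : ordinary_point d z.
Local Notation A := (coordA k p).
Local Notation L := (Lgroup p).
Local Notation C := (coh k p).
Local Notation Z := (point_eq p z).
Local Notation ze := (zeta z).
Local Notation X i := (XA k p i).
Local Notation T i := (TA k p i).

Let irr := zeta_irr Hz.

Definition killed (M : gmod k p) n := ev (fun x => forall v : M, hpart x v -> Z ^+ n *: v = 0).

(** The ordinary point avoids the zero of T_i, so modulo T_i the form Z^n is a nonzero multiple of a
    power of another T_j. The scalar c is the leading coefficient of zeta^n for T1, and its value at
    0 or at 1 for T2 or T3. *)
Lemma Zn_split i n : (0 < n)%N -> exists (c : k) (a : A) (j : 'I_3),
  [/\ c != 0, (i = i1 /\ j = i2) \/ (i <> i1 /\ j = i1) &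
      Z ^+ n = T i * a + kA p c * T j ^+ (d * n)].
Proof.
move=> n0; have D0 : (0 < d * n)%N by rewrite muln_gt0 (d_gt0 Hz).
have szn := size_zetan Hz n; set D := (d * n)%N in D0 szn *.
have key (f : {poly k}) (c : k) j : (size f <= D)%N -> ze ^+ n = tau k i * f + c *: tau k j ^+ D ->
    j = i1 \/ j = i2 -> Z ^+ n = T i * etaR p D.-1 f + kA p c * T j ^+ D.
  move=> sf e hj; rewrite (Zn_eta Hz) e etaRD etaRZ -(prednK D0) etaR_T ?prednK //.
  congr (_ + _ * _); case: hj => ->; first by rewrite !tauE expr1n etaR1.
  by rewrite !tauE etaRX.
have div1 (a : k) (t : {poly k}) : t = 'X - a%:P -> ze.[a] != 0 -> exists (c : k) (f : {poly k}),
    [/\ c != 0, (size f <= D)%N & ze ^+ n = t * f + c *: 1].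
  move=> et za; exists (ze ^+ n).[a], ((ze ^+ n) %/ t); split.
  - by rewrite horner_exp expf_neq0.
  - by rewrite et size_divp ?polyXsubC_eq0 // size_XsubC szn /= subn1.
  - by rewrite et {1}(divp_eq (ze ^+ n) ('X - a%:P)) mulrC modp_XsubC alg_polyC.
elim/ord3P: i key.
- move=> key; pose c := lead_coef (ze ^+ n); pose f := ze ^+ n - c *: 'X^D.
  have c0 : c != 0 by rewrite lead_coef_eq0 -size_poly_gt0 szn.
  have sf : (size f <= D)%N.
    apply/leq_sizeP => j; rewrite leq_eqVlt => /predU1P[<-|lt].
      by rewrite coefB coefZ coefXn eqxx mulr1 /c lead_coefE szn subrr.
    rewrite coefB coefZ coefXn (gtn_eqF lt) mulr0 subr0 nth_default // szn //.
  exists c, (etaR p D.-1 f), i2; split=> //; [by left|]; apply: key => //; last by right.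
  by rewrite !tauE mul1r subrK.
- move=> key; have [|//|c [f [c0 sf e]]] := @div1 0 'X; first by rewrite subr0.
    exact: zeta_0 Hz.
  exists c, (etaR p D.-1 f), i1; split=> //; [by right|]; apply: key => //; last by left.
  by rewrite !tauE expr1n.
- move=> key; have [|//|c [f [c0 sf e]]] := @div1 1 ('X - 1); first by [].
    exact: zeta_1 Hz.
  exists c, (etaR p D.-1 f), i1; split=> //; [by right|]; apply: key => //; last by left.
  by rewrite !tauE expr1n.
Qed.

(** If X_i v = 0, then T_i v = 0, hence T_j^(dn) v = 0 by the decomposition of Z^n. Powers of both
    T1 and T2 then kill v, for T3 because T1 v = T2 v, so A annihilates v in high degrees. *)
Lemma killed_X (M : gmod k p) n : killed M n ->
  ev (fun x => forall i (v : M), hpart x v -> X i *: v = 0 -> v = 0).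
Proof.
move=> kM; apply: ev_imp (ev_and (ev_up kM) (tors M)) => x [{}kM ht] i v hv e.
have Zv : Z ^+ n *: v = 0 by apply: (kM x).
have [n0|n0] := posnP n; first by move: Zv; rewrite n0 expr0 scale1r.
have Tv : T i *: v = 0.
  have [q eq] : exists q, p i = q.+1 by exists (p i).-1; rewrite prednK ?wt_gt0.
  by rewrite /TA eq exprSr -scalerA e scaler0.
have [c [a [j [c0 hj eZ]]]] := Zn_split i n0.
have Tj : T j ^+ (d * n) *: v = 0.
  move: Zv; rewrite eZ scalerDl [T i * a]mulrC -!scalerA Tv scaler0 add0r => /(congr1 (fun u => kA p c^-1 *: u)).
  by rewrite scaler0 scalerA -kAM mulVf // kA1 scale1r.
have [T1 T2] : T i1 ^+ (d * n) *: v = 0 /\ T i2 ^+ (d * n) *: v = 0.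
  have D0 : (0 < d * n)%N by rewrite muln_gt0 (d_gt0 Hz).
  have pw i' : T i' *: v = 0 -> T i' ^+ (d * n) *: v = 0.
    by move=> h; rewrite -(prednK D0) exprSr -scalerA h scaler0.
  case: hj => [[ei ej]|[ni ej]]; first by split; [apply: pw; rewrite -ei|rewrite -ej].
  rewrite ej in Tj; split=> //; move: ni Tv; elim/ord3P: i {e eZ} => // _ Tv; first exact: pw.
  have e : T i2 *: v = T i1 *: v.
    by apply/eqP; rewrite -subr_eq0 -scalerBl -TA_rel Tv.
  suff -> : T i2 ^+ (d * n) *: v = T i1 ^+ (d * n) *: v by [].
  elim: (d * n)%N => [//|r IH].
  by rewrite [in LHS]exprS [in RHS]exprSr -!scalerA IH -e !scalerA mulrC.
apply: ht => //; exists (2 * (d * n))%N => y ly a' ha'.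
have ha2 : homogA (y - vc p *+ (d * n) + vc p *+ (d * n)) a' by rewrite subrK.
have [|a1 [a2 [_ _ ->]]] := homogA_splitn _ ha2; first by rewrite lL_subvcn; lia.
by rewrite scalerDl ![T _ ^+ _ * _]mulrC -!scalerA T1 T2 !scaler0 addr0.
Qed.

End TubeTails.

Section Simple.
Variables (k : finFieldType) (p : weights) (d : nat) (z : {mpoly k[2]}).
Hypothesis Hz : ordinary_point d z.
Local Notation A := (coordA k p).
Local Notation L := (Lgroup p).
Local Notation C := (coh k p).
Local Notation Z := (point_eq p z).
Local Notation ze := (zeta z).
Local Notation X i := (XA k p i).
Local Notation T i := (TA k p i).

Let irr := zeta_irr Hz.

Definition Xinj (M : gmod k p) (x0 : L) :=
  forall x, lL x0 <= lL x -> forall i (v : M), hpart x v -> X i *: v = 0 -> v = 0.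

Lemma Xl_inj (M : gmod k p) x0 s (v : M) : Xinj M x0 -> hpart x0 v -> Xl k p s *: v = 0 -> v = 0.
Proof.
move=> hX hv; elim: s => [|i s IH]; first by rewrite /Xl big_nil scale1r.
rewrite /Xl big_cons -scalerA => e; apply: IH; apply: (hX (dl p s + x0)) e.
  exact: lL_dl.
by apply: hpartZ hv; exact: homog_Xl.
Qed.

Lemma Xinj_up (M : gmod k p) x0 x : lL x0 <= lL x -> Xinj M x0 -> Xinj M x.
Proof. by move=> le hX y ly; apply: hX; exact: le_trans ly. Qed.

Lemma eta1_inj (M : gmod k p) x0 y (v : M) : Xinj M x0 -> hpart x0 v -> 0 <= lL y ->
  eta y 1 *: v = 0 -> v = 0.
Proof. by move=> hX hv ly; have [s -> _] := eta1_Xl k ly => e; exact: (Xl_inj hX hv e). Qed.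

Lemma dvd_Zn y a e : homogA y a -> ze ^+ e %| th a -> exists a', a = Z ^+ e * a'.
Proof.
move=> ha; have [e0|n0] := eqVneq (th a) 0.
  by exists 0; rewrite mulr0; apply: (th_inj ha (homogA0 _ y)); rewrite e0 th0.
move=> dv; have [f ef] : exists f : {poly k}, th a = f * ze ^+ e by exact/dvdpP.
have sa := size_th ha; pose y' : L := y - vc p *+ (d * e).
have f0 : f != 0 by apply: contraNneq n0 => f0; rewrite ef f0 mul0r.
have sf : size (th a) = (size f + d * e)%N.
  rewrite ef size_mul ?expf_neq0 ?(size_zetan Hz) ?addnS //.
  by rewrite -size_poly_gt0 (size_zeta Hz).
have f1 : (0 < size f)%N by rewrite size_poly_gt0.
have ly : 0 <= lL y.
  by rewrite leNgt; apply/negP => lt; case/eqP: n0; rewrite (homogA_lt0 ha lt) th0.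
have ly' : lL y' = lL y - (d * e)%:Z by rewrite lL_subvcn.
have dy := dszE ly; have l0 : 0 <= lL y' by lia.
have dy' := dszE l0.
exists (eta y' f); apply: (th_inj ha).
  have -> : y = vc p *+ (d * e) + y' by rewrite addrC subrK.
  by apply: homogAM; [exact: (homog_Zn Hz)|exact: homog_eta].
have sf' : (size f <= dsz y')%N by lia.
by rewrite (th_Zn z) etaK // ef mulrC.
Qed.

(** If a kills m while ze^(e+1) does not divide [th a], a Bezout identity expresses ze^e by the two.
    Homogenized in a degree that holds all its coefficients, it shows that a monomial kills Z^e m,
    which is impossible. *)
Lemma ann_Zn (M : gmod k p) x (m : M) e y a : Xinj M x -> hpart x m ->
  Z ^+ e *: m <> 0 -> Z ^+ e.+1 *: m = 0 -> homogA y a ->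
  (a *: m = 0 <-> ze ^+ e.+1 %| th a).
Proof.
move=> hX hm ne z0 ha; split=> [am|/(dvd_Zn ha)[a' ->]]; last first.
  by rewrite mulrC -scalerA z0 scaler0.
apply/negP => /negP nd; have [u [v E]] := ze_bezout irr nd.
have ly : 0 <= lL y.
  by rewrite leNgt; apply/negP => lt; case/negP: nd; rewrite (homogA_lt0 ha lt) th0 dvdp0.
pose N := (size u + size v + d * e.+1)%N; pose y1 : L := vc p *+ N + y.
have ly1 : lL y1 = lL y + N%:Z by rewrite /y1 addrC lL_addvcn.
pose y2 : L := y1 - vc p *+ (d * e.+1); pose y3 : L := y1 - vc p *+ (d * e).
have ly2 : lL y2 = lL y1 - (d * e.+1)%:Z by rewrite lL_subvcn.
have ly3 : lL y3 = lL y1 - (d * e)%:Z by rewrite lL_subvcn.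
have de : (d * e <= d * e.+1)%N by rewrite leq_mul2l leqnSn orbT.
have l2 : 0 <= lL y2 by rewrite /N in ly1; lia.
have l3 : 0 <= lL y3 by rewrite /N in ly1; lia.
have d2 := dszE l2; have d3 := dszE l3.
have h1 : homogA y1 (etaR p N u * a) by apply: homogAM => //; exact: homog_etaR.
have h2 : homogA y1 (Z ^+ e.+1 * eta y2 v).
  have -> : y1 = vc p *+ (d * e.+1) + y2 by rewrite addrC subrK.
  by apply: homogAM; [exact: (homog_Zn Hz)|exact: homog_eta].
have h3 : homogA y1 (Z ^+ e * eta y3 1).
  have -> : y1 = vc p *+ (d * e) + y3 by rewrite addrC subrK.
  by apply: homogAM; [exact: (homog_Zn Hz)|exact: homog_eta].
have su : (size u <= N.+1)%N by rewrite /N; lia.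
have sv : (size v <= dsz y2)%N by rewrite /N in ly1; lia.
have s1 : (size (1%R : {poly k}) <= dsz y3)%N by rewrite size_poly1; lia.
have EE : etaR p N u * a + Z ^+ e.+1 * eta y2 v = Z ^+ e * eta y3 1.
  apply: (th_inj (homogAD h1 h2) h3).
  by rewrite thD th_etaRM // !(th_Zn z) !etaK // mulr1 -E [v * _]mulrC.
apply: ne; apply: (@eta1_inj _ (vc p *+ (d * e) + x) y3) => //.
- by apply: Xinj_up hX; rewrite addrC lL_addvcn; lia.
- by apply: hpartZ hm; exact: (homog_Zn Hz).
- rewrite scalerA mulrC -EE scalerDl -scalerA am scaler0 add0r mulrC -scalerA z0 scaler0 //.
Qed.

Lemma simple_gen (T : C) : simple_object T ->
  ev (fun x0 => forall m : T, hpart x0 m -> m <> 0 ->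
    ev (fun x => forall t : T, hpart x t -> exists2 a, homogA (x - x0) a & t = a *: m)).
Proof.
move=> [_ sT]; apply: ev_imp (tors T) => x0 ht m hm m0.
have hg (i : 'I_1) : hpart x0 ((fun _ : 'I_1 => m) i) by [].
have [f hf] := gspan_incl hg.
have fi : tinj f.
  apply: ev_imp hf => x h u hu e; apply: gincl_inj; rewrite -h // e gincl0.
have [/zero_objectP zz|/isoP[_ fs]] := sT _ f (tinj_monic fi).
  case: m0; apply: ht => //; have /(ev_shift x0) := zz; apply: ev_imp => y h a ha.
  have [u eu] : exists u : gspan hg, gincl u = a *: m.
    by apply: gincl_surj; exists (fun=> a); rewrite big_ord1.
  rewrite -eu (h u); last by apply/hpart_gincl; rewrite eu; exact: hpartZ.
  exact: gincl0.
apply: ev_imp (ev_and fs hf) => x [h1 h2] t htx.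
have [u hu e] := h1 t htx; rewrite h2 // in e.
have Pu := gincl_P u; rewrite e in Pu.
have [a ha ea] := gspan_homog hg htx Pu; exists (a ord0) => //.
by rewrite ea big_ord1.
Qed.

Definition supp (M : gmod k p) := forall I : set (structure_module k p),
  graded_prime I -> relevant I -> stalk_nonzero M I -> I Z.

Lemma prime_not (I : set (structure_module k p)) (a b : A) : graded_prime I ->
  is_homogA a -> is_homogA b -> ~ I a -> ~ I b -> ~ I (a * b).
Proof. by move=> [_ _ pr] ha hb na nb /pr[]. Qed.

Lemma prime_pow (I : set (structure_module k p)) i n : graded_prime I -> ~ I (X i) -> ~ I (X i ^+ n).
Proof.
move=> gI nX; elim: n => [|n IH]; first by rewrite expr0; case: gI.
rewrite exprS; apply: prime_not => //; first by exists (vx p i); exact: homog_XA.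
by exists (vx p i *+ n); apply: homogAX; exact: homog_XA.
Qed.

(** A power of an X_i outside I moves the element into degrees where f is given by a map, and
    primality of I keeps its stalk nonzero. *)
Lemma supp_sub (V W : C) (f : Hom V W) : tinj f -> supp W -> supp V.
Proof.
move=> /(ev_and (tfokP f))[n0 h0] sY I gI rI [x [m [hm nm]]]; apply: (sY I gI rI).
have [i nX] := rI.
pose N := (p i * (n0 + `|lL x|))%N.
have hN : homogA (vx p i *+ N) (X i ^+ N) by apply: homogAX; exact: homog_XA.
pose x' : L := vx p i *+ N + x.
have lx' : n0%:Z <= lL x'.
  have := lLD_ge (vx p i *+ N) x; rewrite lL_mulvxn /N mulKn ?wt_gt0 // => h.
  by apply: le_trans h; lia.
have hm' : hpart x' (X i ^+ N *: m) by exact: hpartZ.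
exists x', (tf f x' (X i ^+ N *: m)); split; first exact: tf_hpart (h0 _ lx').1 hm'.
move=> a [y ha] na e; have [ly|ly] := ltP (lL y) 0.
  by apply: na; rewrite (homogA_lt0 ha ly); case: gI => -[].
have ly' : n0%:Z <= lL (y + x') by have := lLD_ge y x'; lia.
have [ok1 _] := h0 _ lx'; have [ok2 inj2] := h0 _ ly'.
rewrite -(tfZ ok1 ok2 ha hm') in e.
apply: (nm (a * X i ^+ N)); last by rewrite -scalerA; apply: inj2 e; exact: hpartZ.
  by exists (y + vx p i *+ N); exact: homogAM.
apply: prime_not => //; [by exists y|by exists (vx p i *+ N)|exact: prime_pow].
Qed.

Lemma simple_card (T : C) : simple_object T -> killed z T 1 ->
  ev (fun x => ncard (hpart x : set T) = #|k| ^ d)%N.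
Proof.
move=> sT kT; have [nzT _] := sT.
have [n0 h0] := ev_and (simple_gen sT) (ev_and kT (ev_up (killed_X Hz kT))).
have [x0 [m [lx0 hm m0]]] : exists x0 (m : T), [/\ n0%:Z <= lL x0, hpart x0 m & m <> 0].
  apply: contrapT => h; apply: nzT; apply/zero_objectP; exists n0 => x lx m hm.
  by apply: contrapT => m0; apply: h; exists x, m.
have [gx0 [kx0 Xx0]] := h0 _ lx0.
have hX : Xinj T x0 by [].
have Zm : Z ^+ 1 *: m = 0 by exact: kx0.
have Zm0 : Z ^+ 0 *: m <> 0 by rewrite expr0 scale1r.
have ann y a : homogA y a -> (a *: m = 0 <-> ze %| th a).
  by move=> ha; rewrite -[ze]expr1; exact: (ann_Zn hX hm Zm0 Zm ha).
have sz := size_zeta Hz; have zn0 : ze != 0 by rewrite -size_poly_gt0 sz.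
have lge : ev (fun x => d%:Z <= lL (x - x0)) by apply: ev_shift (ev_ge p d).
apply: ev_imp (ev_and (gx0 m hm m0) lge) => x [gen ly]; pose y : L := x - x0.
have ly' : d%:Z <= lL y by [].
have dy : (d <= dsz y)%N.
  have l0 : 0 <= lL y by lia.
  by have := dszE l0; lia.
have e : enum_of [set f : {poly k} | (size f <= d)%N] (ps k d).
  by split; [exact: ps_uniq|move=> f; rewrite mem_ps].
rewrite -(size_ps k d) -(ncardE e).
apply: (proj2 (@ncard_bij _ _ _ (hpart x : set T) (fun f => eta y f *: m) _ _ _ _)).
- by exists (ps k d).
- move=> f g sf sg /eqP; rewrite -subr_eq0 -scalerBl => /eqP h.
  have eB : eta y f - eta y g = eta y (f - g) :> A.
    by rewrite etaD -scaleN1r etaZ kAN kA1 mulN1r.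
  have sfg : (size (f - g)%R <= d)%N.
    by apply: leq_trans (size_polyD _ _) _; rewrite size_polyN geq_max sf sg.
  move: h; rewrite eB => /(ann _ _ (homog_eta _ _)); rewrite etaK ?(leq_trans sfg) // => dv.
  apply/eqP; rewrite -subr_eq0; apply/negPn/negP => n0'; have := dvdp_leq n0' dv.
  by rewrite sz ltnNge sfg.
- by move=> f _; rewrite -[x](subrK x0); apply: hpartZ hm; exact: homog_eta.
- move=> t /gen[a ha ->]; exists (th a %% ze).
    by rewrite /= -ltnS -sz ltn_modp.
  have smd : (size (th a %% ze)%R <= dsz y)%N.
    by apply: leq_trans dy; rewrite -ltnS -sz ltn_modp.
  apply/eqP; rewrite -subr_eq0 -scalerBl; apply/eqP/(ann y).
    by apply: homogAD; [exact: homog_eta|exact: homogAN].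
  rewrite thB etaK // {2}(divp_eq (th a) ze) opprD addrCA subrr addr0 -mulNr dvdp_mull //.
Qed.

(** The annihilator I of a nonzero m in T is prime, since every nonzero multiple of m generates T
    again in high degrees. A preimage in Y of a nonzero multiple of m has nonzero stalk at I, so Z
    lies in I by the support condition on Y. *)
Lemma supp_quot_simple (Y T : C) (g : Hom Y T) : simple_object T -> tsurj g -> supp Y ->
  killed z T 1 /\ ev (fun x => ncard (hpart x : set T) = #|k| ^ d)%N.
Proof.
move=> sT gs sY; have [nzT _] := sT.
have [n0 h0] := ev_and (ev_and (tors T) (simple_gen sT)) (ev_and gs (tfokP g)).
have [x0 [m [lx0 hm m0]]] : exists x0 (m : T), [/\ n0%:Z <= lL x0, hpart x0 m & m <> 0].
  apply: contrapT => h; apply: nzT; apply/zero_objectP; exists n0 => x lx m hm.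
  by apply: contrapT => m0; apply: h; exists x, m.
have [[tx0 gx0] _] := h0 _ lx0.
have gen := gx0 m hm m0.
pose I : set (structure_module k p) := [set a | (a : A) *: m = 0].
have hI a : I a <-> (a : A) *: m = 0 by [].
have gI : graded_prime I.
  split.
  - split; first by apply/hI; exact: scale0r.
    + move=> a b /hI ea /hI eb; apply/hI; apply: etrans (scalerDl m (a : A) (b : A)) _.
      by rewrite ea eb addr0.
    + move=> a b /hI eb; apply/hI; apply: etrans (esym (scalerA a (b : A) m)) _.
      by rewrite eb scaler0.
    + move=> x a /hI ea; apply/hI; have := hcZ_hom (a : A) (x + x0) hm.
      by rewrite addrK ea hc0.
  - by move=> /hI h; apply: m0; rewrite -h; apply/esym; exact: scale1r.
  move=> a b [ya ha] [yb hb]; rewrite /I /= => eab.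
  have [eb|nb] := pselect (b *: m = 0); [by right|left].
  have [la|la] := ltP (lL ya) 0; first by rewrite (homogA_lt0 ha la) scale0r.
  have [lb|lb] := ltP (lL yb) 0; first by case: nb; rewrite (homogA_lt0 hb lb) scale0r.
  have lbm : n0%:Z <= lL (yb + x0) by have := lLD_ge yb x0; lia.
  have lam : n0%:Z <= lL (ya + x0) by have := lLD_ge ya x0; lia.
  have [[_ gb] _] := h0 _ lbm; have [[ta _] _] := h0 _ lam.
  apply: ta; first exact: hpartZ.
  have /(ev_shift x0) := gb _ (hpartZ hb hm) nb; apply: ev_imp => y h c hc.
  have [c' hc' ec] := h (c *: m) (hpartZ hc hm).
  have -> : c *: (a *: m) = c' *: ((a * b) *: m).
    transitivity (a *: (c *: m)); first by rewrite !scalerA [a * c]mulrC.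
    by rewrite ec !scalerA; congr (_ *: _); rewrite !mulrA [a * c']mulrC.
  by rewrite eab scaler0.
have rI : relevant I.
  apply: contrapT => h; apply: m0; apply: tx0 => //; exists 1%N => y ly a ha.
  have ha' : homogA (y - vc p + vc p) a by rewrite subrK.
  have [|a1 [a2 [_ _ ->]]] := homogA_split _ ha'.
    by have := lL_subvcn y 1; rewrite mulr1n; lia.
  have XT i : TA k p i *: m = 0.
    have [q eq] : exists q, p i = q.+1 by exists (p i).-1; rewrite prednK ?wt_gt0.
    have Xi : X i *: m = 0 by apply: contrapT => nX; apply: h; exists i.
    by rewrite /TA eq exprSr -scalerA Xi scaler0.
  by rewrite scalerDl ![TA _ _ _ * _]mulrC -!scalerA !XT !scaler0 addr0.
have ZI : Z *: m = 0.
  apply/hI; apply: (sY I gI rI).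
  have [n1 h1] := gen.
  have [x [t [lx htx t0]]] : exists x (t : T), [/\ (n0 + n1)%N%:Z <= lL x, hpart x t & t <> 0].
    apply: contrapT => h; apply: nzT; apply/zero_objectP; exists (n0 + n1)%N => x lx t htx.
    by apply: contrapT => t0; apply: h; exists x, t.
  have lx0' : n0%:Z <= lL x by lia.
  have [_ [gsx okx]] := h0 _ lx0'.
  have [y hy ey] := gsx t htx.
  have [|c hc ec] := h1 x _ t htx; first by lia.
  exists x, y; split=> // a [ya ha] na e0.
  have [la|la] := ltP (lL ya) 0; first by apply: na; rewrite (homogA_lt0 ha la); apply/hI; rewrite scale0r.
  have lax : n0%:Z <= lL (ya + x) by have := lLD_ge ya x; lia.
  have [_ [_ okax]] := h0 _ lax.
  have : tf g (ya + x) (a *: y) = a *: t by rewrite (tfZ okx okax) // ey.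
  rewrite e0 tf0 // ec scalerA => /esym; apply: (@prime_not I a c gI) => //.
  - by exists ya.
  - by exists (x - x0).
  - by move=> /hI ecm; apply: t0; rewrite ec.
have kT : killed z T 1.
  apply: ev_imp gen => x h t /h[c hc ->].
  by rewrite expr1 scalerA mulrC -scalerA ZI scaler0.
by split=> //; exact: simple_card.
Qed.

End Simple.

Lemma ncard_inj_surj (V W : choiceType) (U1 : set V) (U2 : set W) (f : V -> W) :
  fin U1 -> fin U2 -> ncard U1 = ncard U2 ->
  (forall u v, U1 u -> U1 v -> f u = f v -> u = v) -> (forall v, U1 v -> U2 (f v)) ->
  forall w, U2 w -> exists2 v, U1 v & f v = w.
Proof.
move=> f1 f2 ec inj maps w Uw.
pose I : set W := [set w | exists2 v, U1 v & f v = w].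
have [|fI eI] := @ncard_bij _ _ U1 I f f1 inj _ (fun w h => h); first by move=> v Uv; exists v.
have IU : I `<=` U2 by move=> _ [v Uv <-]; exact: maps.
by apply: (ncard_eq IU f2 _ Uw); rewrite eI ec.
Qed.

Lemma coprod_tail (k : finFieldType) (p : weights) (X Y M : coh k p) (i : Hom X M) (j : Hom Y M) :
  ev (fun x => forall m : M, hpart x m ->
    exists u v, [/\ hpart x u, hpart x v & m = tf i x u + tf j x v]) ->
  ev (fun x => forall u v, hpart x u -> hpart x v -> tf i x u + tf j x v = 0 -> u = 0 /\ v = 0) ->
  is_coproduct i j.
Proof.
move=> sp un W f g.
have [n0 h0] := ev_and (ev_and sp un) (ev_and (ev_and (tfokP i) (tfokP j)) (ev_and (tfokP f) (tfokP g))).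
pose R x (m : M) (c : X * Y) := [/\ hpart x c.1, hpart x c.2 & m = tf i x c.1 + tf j x c.2].
pose c x m := xget (0, 0) (R x m).
have cP x m : n0%:Z <= lL x -> hpart x m -> R x m (c x m).
  move=> lx hm; have [[{}sp _] _] := h0 x lx; have [u [v h]] := sp m hm.
  by rewrite /c; case: xgetP => // /(_ (u, v)).
have cU x m u v : n0%:Z <= lL x -> hpart x u -> hpart x v -> m = tf i x u + tf j x v ->
    c x m = (u, v).
  move=> lx hu hv em; have [[_ {}un] [[oi oj] _]] := h0 x lx.
  have hm : hpart x m by rewrite em; apply: hpartD; exact: tf_hpart.
  have := cP x m lx hm; case: (c x m) => u' v' [/= hu' hv' e].
  have [|||e1 e2] := un (u' - u) (v' - v); try exact: hpartB.
    by rewrite !tfB // addrACA -opprD -e -em subrr.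
  by congr pair; apply/eqP; rewrite -subr_eq0 ?e1 ?e2.
pose phi x m := tf f x (c x m).1 + tf g x (c x m).2.
have lxi x l : n0%:Z <= lL x -> n0%:Z <= lL (vx p l + x).
  by move=> lx; apply: le_trans lx (lL_vx_ge _ _).
have [u hu] : exists u : qhom M W, ev (fun x => forall m, hpart x m -> tf u x m = phi x m).
  apply: (@mk_arrow k p M W phi n0).
  - move=> x m lx hm; have [h1 h2 _] := cP x m lx hm; have [_ [_ [o1 o2]]] := h0 x lx.
    by apply: hpartD; exact: tf_hpart.
  - move=> x m m' lx hm hm'; have [h1 h2 e] := cP x m lx hm; have [h1' h2' e'] := cP x m' lx hm'.
    have [_ [[o1 o2] [o3 o4]]] := h0 x lx.
    rewrite /phi (cU x (m + m') ((c x m).1 + (c x m').1) ((c x m).2 + (c x m').2)) //=.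
    + by rewrite !tfD // addrACA.
    + exact: hpartD.
    + exact: hpartD.
    + by rewrite {1}e {1}e' !tfD // addrACA.
  - move=> x a m lx hm; have [h1 h2 e] := cP x m lx hm.
    have [_ [[o1 o2] [o3 o4]]] := h0 x lx.
    rewrite /phi (cU x _ (kA p a *: (c x m).1) (kA p a *: (c x m).2)) //=; do ?exact: hpartkA.
    + by rewrite !tfkA // scalerDr.
    + by rewrite {1}e !tfkA // scalerDr.
  - move=> x l m lx hm; have [h1 h2 e] := cP x m lx hm.
    have [_ [[o1 o2] [o3 o4]]] := h0 x lx; have [_ [[o1' o2'] [o3' o4']]] := h0 _ (lxi x l lx).
    have hX := homog_XA k p l.
    rewrite /phi (cU _ _ (XA k p l *: (c x m).1) (XA k p l *: (c x m).2)) //=; do ?exact: hpartZ.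
    + by rewrite (tfZ o3 o3' hX) // (tfZ o4 o4' hX) // scalerDr.
    + exact: lxi.
    + by rewrite {1}e (tfZ o1 o1' hX) // (tfZ o2 o2' hX) // scalerDr.
exists u.
  have hn0 : ev (fun x : Lgroup p => n0%:Z <= lL x) by exact: ev_ge.
  split; apply/heqP.
    apply: ev_imp (ev_and (ev_and hu (tf_comp u i)) hn0) => x [[h1 h2] lx] m hm.
    have [_ [[o1 o2] [o3 o4]]] := h0 x lx.
    rewrite h2 // h1 ?/phi; last exact: tf_hpart.
    by rewrite (cU x _ m 0) ?tf0 ?addr0 //; exact: hpart0.
  apply: ev_imp (ev_and (ev_and hu (tf_comp u j)) hn0) => x [[h1 h2] lx] m hm.
  have [_ [[o1 o2] [o3 o4]]] := h0 x lx.
  rewrite h2 // h1 ?/phi; last exact: tf_hpart.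
  by rewrite (cU x _ 0 m) ?tf0 ?add0r //; exact: hpart0.
move=> u' /heqP e1 /heqP e2; apply/heqP.
apply: ev_imp (ev_and (ev_and (ev_and hu (tfokP u')) (ev_and (tf_comp u' i) (tf_comp u' j)))
  (ev_and (ev_ge p n0) (ev_and e1 e2))).
move=> x [[[h1 ok] [h2 h3]] [lx [h4 h5]]] m hm; rewrite h1 // /phi.
have [a1 a2 e] := cP x m lx hm; have [_ [[o1 o2] _]] := h0 x lx.
transitivity (tf u' x (tf i x (c x m).1 + tf j x (c x m).2)); last by rewrite -e.
rewrite tfD //; [|exact: tf_hpart|exact: tf_hpart].
by rewrite -h2 // -h3 // h4 // h5.
Qed.

(** * Indecomposable torsion sheaves in a homogeneous tube are cyclic *)

Section TubeChart.
Variables (k : finFieldType) (p : weights) (d : nat) (z : {mpoly k[2]}).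
Hypothesis Hz : ordinary_point d z.
Local Notation A := (coordA k p).
Local Notation L := (Lgroup p).
Local Notation C := (coh k p).
Local Notation Z := (point_eq p z).
Local Notation ze := (zeta z).
Local Notation X i := (XA k p i).
Local Notation T i := (TA k p i).

Let irr := zeta_irr Hz.

Lemma ncard_zero (V : zmodType) (U : set V) : U 0 -> (forall u, U u -> u = 0) -> ncard U = 1%N.
Proof.
move=> U0 h; rewrite (@ncardE _ U [:: 0]) //; split=> // v; rewrite inE.
by split=> [/eqP ->|/h ->].
Qed.

(** Induction along a composition series; its simple quotients all lie at z because subobjects
    inherit the support condition. *)
Lemma len_tail n (M : C) : has_length n M -> supp z M ->
  killed z M n /\ ev (fun x => ncard (hpart x : set M) = #|k| ^ (d * n))%N.
Proof.
elim: n M => [|n IH] M /=.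
  move=> /zero_objectP zM _; split; first by apply: ev_imp zM => x h v /h ->; rewrite scaler0.
  apply: ev_imp zM => x h; rewrite muln0 expn0; apply: ncard_zero; [exact: hpart0|exact: h].
move=> [V [W [i [g [hV sW /short_exact_tail[ti te]]]]]] sM.
have [kV cV] := IH V hV (supp_sub ti sM).
have [gs ex] := te.
have [kW cW] := supp_quot_simple Hz sW gs sM.
split; last first.
  apply: ev_imp (ev_and (texact_card ti te) (ev_and cV cW)) => x [-> [-> ->]].
  by rewrite -expnD mulnS.
have [n0 h0] := ev_and (ev_and kV kW) (ev_and ex (ev_and (tfokP i) (tfokP g))).
exists n0 => x lx v hv.
pose x1 : L := vc p *+ (d * 1) + x; pose x2 : L := vc p *+ (d * n) + x1.
have lx1 : n0%:Z <= lL x1 by rewrite /x1 addrC lL_addvcn; lia.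
have lx2 : n0%:Z <= lL x2 by rewrite /x2 addrC lL_addvcn; lia.
have [[_ kx] [_ [_ gx]]] := h0 x lx.
have [[kx1 _] [ex1 [ix1 gx1]]] := h0 x1 lx1; have [_ [_ [ix2 _]]] := h0 x2 lx2.
have hZ := homog_Zn Hz p.
have h1 : hpart x1 (Z ^+ 1 *: v) by exact: hpartZ.
have [u hu eu] : exists2 u, hpart x1 u & tf i x1 u = Z ^+ 1 *: v.
  by apply/ex1 => //; rewrite (tfZ gx gx1 (hZ 1%N)) //; apply: kx; exact: (tf_hpart gx).
have -> : Z ^+ n.+1 *: v = Z ^+ n *: (Z ^+ 1 *: v) by rewrite scalerA -exprD addn1.
by rewrite -eu -(tfZ ix1 ix2 (hZ n)) // kx1 // tf0.
Qed.

Section Degree.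
Variables (M : gmod k p) (n : nat) (x0 : L).
Implicit Types f g : {poly k}.
Hypothesis kM : forall x, lL x0 <= lL x -> forall v : M, hpart x v -> Z ^+ n *: v = 0.
Hypothesis cM : forall x, lL x0 <= lL x -> ncard (hpart x : set M) = (#|k| ^ (d * n))%N.
Hypothesis iM : Xinj M x0.

Let eta1_i x y (u : M) : lL x0 <= lL x -> 0 <= lL y -> hpart x u -> eta y 1 *: u = 0 -> u = 0.
Proof. by move=> lx ly hu; apply: (eta1_inj (Xinj_up lx iM)). Qed.

Lemma eta1_onto y (w : M) : 0 <= lL y -> hpart (y + x0) w ->
  exists2 u, hpart x0 u & eta y 1 *: u = w.
Proof.
move=> ly; apply: (@ncard_inj_surj _ _ (hpart x0 : set M) (hpart (y + x0) : set M)).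
- exact: fin_hpart.
- exact: fin_hpart.
- by rewrite !cM // (le_trans _ (lLD_ge _ _)) // lerDr.
- move=> u v hu hv /eqP; rewrite -subr_eq0 -scalerBr => /eqP /(eta1_i (lexx _) ly (hpartB hu hv)) /eqP.
  by rewrite subr_eq0 => /eqP.
- by move=> v hv; apply: hpartZ hv; exact: homog_eta.
Qed.

Lemma T1_eta N : T i1 ^+ N = eta (vc p *+ N) 1.
Proof.
have h : homogA (vc p *+ N) (T i1 ^+ N) by apply: homogAX; exact: homog_TA.
rewrite -{1}(thK h); congr eta; rewrite -[T i1 ^+ N]mulr1 th_TAn ?tauE expr1n mul1r; exact: th1.
Qed.

Let lvc N : 0 <= lL (vc p *+ N : L).
Proof. by rewrite -[vc p *+ N]add0r lL_addvcn lL0. Qed.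

Let T1_i x N (u v : M) : lL x0 <= lL x -> hpart x u -> hpart x v ->
  T i1 ^+ N *: u = T i1 ^+ N *: v -> u = v.
Proof.
move=> lx hu hv /eqP; rewrite -subr_eq0 -scalerBr T1_eta => /eqP.
by move=> /(eta1_i lx (lvc N) (hpartB hu hv)) /eqP; rewrite subr_eq0 => /eqP.
Qed.

(** The component of degree x0 is a k[t]-module with t acting as T2 / T1: multiplication by a power
    of T1 is injective between components of the same finite cardinality, hence bijective. The
    exponent [size f] may be replaced by any larger one. *)
Definition act (f : {poly k}) (u : M) : M :=
  xget 0 [set v | hpart x0 v /\ T i1 ^+ size f *: v = etaR p (size f) f *: u].

Lemma actP f u N : hpart x0 u -> (size f <= N)%N ->
  hpart x0 (act f u) /\ T i1 ^+ N *: act f u = etaR p N f *: u.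
Proof.
move=> hu sf.
have [h1 h2] : hpart x0 (act f u) /\ T i1 ^+ size f *: act f u = etaR p (size f) f *: u.
  rewrite /act; case: xgetP => [v _ []//|/=].
  have [|v hv e] := @eta1_onto (vc p *+ size f) (etaR p (size f) f *: u) (lvc _).
    by apply: hpartZ hu; exact: homog_etaR.
  by move=> /(_ v)[]; split=> //; rewrite T1_eta.
split=> //; rewrite -(subnK sf) exprD -scalerA h2 scalerA etaR_Tn ?leqnSn //.
by rewrite ?tauE expr1n mul1r.
Qed.

Lemma act_uniq f u v N : hpart x0 u -> hpart x0 v -> (size f <= N)%N ->
  T i1 ^+ N *: v = etaR p N f *: u -> act f u = v.
Proof.
move=> hu hv sf e; have [h1 h2] := actP hu sf.
by apply: (T1_i (N := N) (lexx _) h1 hv); rewrite h2 e.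
Qed.

Lemma act_h f u : hpart x0 u -> hpart x0 (act f u).
Proof. by move=> hu; have [] := actP hu (leqnn (size f)). Qed.

Lemma etaRM N N' (f g : {poly k}) : (size f <= N)%N -> (size g <= N')%N ->
  etaR p N f * etaR p N' g = etaR p (N + N') (f * g).
Proof.
move=> sf sg; apply: (@th_inj k p (vc p *+ (N + N'))).
- by rewrite mulrnDr; apply: homogAM; exact: homog_etaR.
- exact: homog_etaR.
have t1 m (h : {poly k}) : (size h <= m.+1)%N -> th (etaR p m h) = h.
  by move=> sh; rewrite -[etaR p m h]mulr1 th_etaRM // th1 mulr1.
rewrite th_etaRM ?leqW // !t1 ?leqW //.
by apply: leq_trans (size_polyMleq _ _) _; lia.
Qed.

Lemma actDr f u v : hpart x0 u -> hpart x0 v -> act f (u + v) = act f u + act f v.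
Proof.
move=> hu hv; have [h1 e1] := actP hu (leqnn (size f)); have [h2 e2] := actP hv (leqnn (size f)).
by apply: (act_uniq (N := size f)); rewrite ?scalerDr ?e1 ?e2 //; exact: hpartD.
Qed.

Lemma actDl f g u : hpart x0 u -> act (f + g) u = act f u + act g u.
Proof.
move=> hu; have [h1 e1] := actP hu (leq_addr (size g) (size f)).
have [h2 e2] := actP hu (leq_addl (size f) (size g)).
apply: (act_uniq (N := (size f + size g)%N)) => //; first exact: hpartD.
  by apply: leq_trans (size_polyD _ _) _; rewrite geq_max leq_addr leq_addl.
by rewrite scalerDr e1 e2 -scalerDl etaRD.
Qed.

Lemma actM f g u : hpart x0 u -> act (f * g) u = act f (act g u).
Proof.
move=> hu; have [h1 e1] := actP hu (leqnn (size g)).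
have [h2 e2] := actP h1 (leqnn (size f)).
apply: (act_uniq (N := (size f + size g)%N)) => //.
  by apply: leq_trans (size_polyMleq _ _) _; lia.
by rewrite addnC exprD -scalerA e2 scalerA mulrC -scalerA e1 scalerA etaRM // addnC.
Qed.

Lemma act1 u : hpart x0 u -> act 1 u = u.
Proof. by move=> hu; apply: (act_uniq (N := 1)); rewrite ?size_poly1 // etaR1. Qed.

Lemma actC (c : k) u : hpart x0 u -> act c%:P u = kA p c *: u.
Proof.
move=> hu; apply: (act_uniq (N := 1)) => //; first exact: hpartkA.
  exact: size_polyC_leq1.
by rewrite -[c%:P]mulr1 mul_polyC etaRZ etaR1 !scalerA mulrC.
Qed.

Lemma act_Zn u : hpart x0 u -> act (ze ^+ n) u = 0.
Proof.
move=> hu; apply: (act_uniq (N := (d * n).+1)) => //; first exact: hpart0.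
  by rewrite (size_zetan Hz).
rewrite scaler0 -etaR_T1 ?(size_zetan Hz) // -(Zn_eta Hz) -scalerA.
by rewrite (kM (lexx _)) // scaler0.
Qed.

(** An element a acts on degree x0 as its dehomogenization followed by a monomial that is bijective
    on components; hence the k[t]-module in degree x0 determines all components above it. *)
Lemma actA y a u : homogA y a -> 0 <= lL y -> hpart x0 u -> a *: u = eta y 1 *: act (th a) u.
Proof.
move=> ha ly hu; pose N := size (th a).
have [h1 e1] := actP hu (leqnn N).
have ly0 : lL x0 <= lL (y + x0) by rewrite (le_trans _ (lLD_ge _ _)) // lerDr.
apply: (T1_i (N := N) ly0); first exact: hpartZ.
  by apply: hpartZ h1; exact: homog_eta.
rewrite [in RHS]scalerA [T i1 ^+ N * eta _ _]mulrC -[in RHS]scalerA e1 !scalerA; congr (_ *: _).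
have s1 : (size (1%R : {poly k}) <= dsz y)%N by rewrite size_poly1; have := dszE ly; lia.
apply: (@th_inj k p (vc p *+ N + y)).
- by apply: homogAM ha; apply: homogAX; exact: homog_TA.
- by rewrite addrC; apply: homogAM; [exact: homog_eta|exact: homog_etaR].
by rewrite th_TAn ?tauE expr1n mul1r mulrC th_etaRM ?leqnSn // etaK // mulr1.
Qed.


Hypothesis indM : indecomposable (M : C).

(** A cyclic summand of the k[t]-module in degree x0 spans a direct summand of M in [coh], so by
    indecomposability its complement is zero. The exponent of the generator is read off from the
    cardinality q^(dn). *)
Lemma cyclic_gen : exists s, [/\ hpart x0 s, forall u, hpart x0 u -> exists f, u = act f s &
  forall f, act f s = 0 <-> ze ^+ n %| f].
Proof.
pose U : set M := hpart x0.
have UP u : U u <-> hpart x0 u by [].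
have gU : subgrp U by exact: hpart_subgrp.
have fU : fin U by exact: fin_hpart.
have a0 u : hpart x0 u -> act 0 u = 0.
  by move=> hu; apply: (addrI (act 0 u)); rewrite -actDl // !addr0.
have a0r f : act f 0 = 0.
  have h0 := hpart0 M x0; by apply: (addrI (act f 0)); rewrite -actDr // !addr0.
have [s [U' [Us gU' U'U stU' [sp un s0]]]] :=
  @cyclic_summand k ze irr M U act n gU fU act_h actDr actDl actM act1 act_Zn.
have hs : hpart x0 s by [].
have mz f (v : M) : hpart x0 v -> act (f %% ze ^+ n) v = act f v.
  by move=> hv; rewrite {2}(divp_eq f (ze ^+ n)) actDl // actM // act_Zn // a0r add0r.
have hE x (f : {poly k}) (u : M) : hpart x0 u -> hpart x (eta (x - x0) f *: u).
  by move=> hu; rewrite -{1}[x](subrK x0); apply: hpartZ hu; exact: homog_eta.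
have [r [ur hr]] : fin U' by exact: sub_fin U'U fU.
have hU' (i : 'I_(size r)) : hpart x0 (nth 0 r i).
  by apply: U'U; apply/hr; exact: mem_nth.
have hs1 (i : 'I_1) : hpart x0 ((fun _ : 'I_1 => s) i) by [].
have [i hi] := gspan_incl hs1; have [j hj] := gspan_incl hU'.
have lge : ev (fun x => (d * n)%:Z <= lL (x - x0)) by apply: ev_shift (ev_ge p (d * n)%N).
have G1 x v : 0 <= lL (x - x0) -> hpart x v -> spanset (fun _ : 'I_1 => s) v ->
    exists f, v = eta (x - x0) 1 *: act f s.
  move=> lx hv /(gspan_homog hs1 hv)[a ha ->]; exists (th (a ord0)).
  by rewrite big_ord1 (actA (ha ord0)).
have G2 x v : 0 <= lL (x - x0) -> hpart x v -> spanset (fun i : 'I_(size r) => nth 0 r i) v ->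
    exists2 u, U' u & v = eta (x - x0) 1 *: u.
  move=> lx hv /(gspan_homog hU' hv)[a ha ->].
  exists (\sum_(i < size r) act (th (a i)) (nth 0 r i)).
    apply: (big_ind U'); first by case: gU'.
      by move=> *; exact: (subgrpD gU').
    by move=> l _; apply: stU'; apply/hr; exact: mem_nth.
  by rewrite scaler_sumr; apply: eq_bigr => l _; rewrite (actA (ha l)).
have cop : is_coproduct i j.
  apply: coprod_tail.
    apply: ev_imp (ev_and (ev_and hi hj) lge) => x [[h1 h2] lx] m hm.
    have l0 : 0 <= lL (x - x0) by apply: le_trans lx.
    have [|u hu eu] := @eta1_onto (x - x0) m l0; first by rewrite subrK.
    have [f [v [Uv e]]] := sp u hu.
    (* Reduction modulo ze^n makes f small enough to be the dehomogenization of an element of degree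
       x - x0. *)
    pose f' : {poly k} := f %% ze ^+ n.
    have sf' : (size f' <= dsz (x - x0)%R)%N.
      have : (size f' < size (ze ^+ n))%N by rewrite ltn_modp expf_neq0 // (ze_neq0 irr).
      by rewrite (size_zetan Hz); have := dszE l0; move: lx; lia.
    have [a ea] : exists a : gspan hs1, gincl a = eta (x - x0) f' *: s.
      by apply: gincl_surj; exists (fun=> eta (x - x0) f'); rewrite big_ord1.
    have [b eb] : exists b : gspan hU', gincl b = eta (x - x0) 1 *: v.
      apply: gincl_surj; have vr : v \in r by exact/hr.
      have iv : (index v r < size r)%N by rewrite index_mem.
      exists (fun l => if l == Ordinal iv then eta (x - x0) 1 else 0).
      rewrite (bigD1 (Ordinal iv)) //= eqxx nth_index // big1 ?addr0 // => l /negPf ->.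
      by rewrite scale0r.
    have ha : hpart x a.
      by apply/hpart_gincl; rewrite ea; exact: hE.
    have hb : hpart x b.
      by apply/hpart_gincl; rewrite eb; apply: hE; exact: U'U.
    exists a, b; split=> //; rewrite h1 // h2 // ea eb (actA (homog_eta _ _)) // etaK // mz //.
    by rewrite -scalerDr -e.
  apply: ev_imp (ev_and (ev_and hi hj) lge) => x [[h1 h2] lx] a b ha hb; rewrite h1 // h2 // => e.
  have l0 : 0 <= lL (x - x0) by apply: le_trans lx.
  have [f ef] := G1 x _ l0 (proj1 (hpart_gincl _ _) ha) (gincl_P a).
  have [v Uv ev] := G2 x _ l0 (proj1 (hpart_gincl _ _) hb) (gincl_P b).
  have hv : hpart x0 v by exact: U'U.
  move: e; rewrite ef ev -scalerDr => e0.
  have {}e0 : act f s + v = 0.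
    by apply: (eta1_i (lexx _) l0) e0; apply: hpartD => //; exact: act_h.
  have eN : act f s = - v by apply/eqP; rewrite -addr_eq0 e0.
  have f0 : act f s = 0 by apply: un; rewrite eN; exact: subgrpN.
  have v0 : v = 0 by rewrite -[v]opprK -eN f0 oppr0.
  split; apply: gincl_inj; first by rewrite ef f0 scaler0 gincl0.
  by rewrite ev v0 scaler0 gincl0.
have [nz ind] := indM.
have s_neq : s <> 0.
  move=> e; apply: nz; apply/zero_objectP; apply: ev_imp lge => x lx m hm.
  have l0 : 0 <= lL (x - x0) by apply: le_trans lx.
  have [|u hu <-] := @eta1_onto (x - x0) m l0; first by rewrite subrK.
  by rewrite (s0 e u hu) scaler0.
have U'0 v : U' v -> v = 0.
  case: (ind _ _ i j cop) => /zero_objectP zo Uv.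
    case: s_neq; have [x [zx lx]] := ev_ex (ev_and zo lge).
    have l0 : 0 <= lL (x - x0) by apply: le_trans lx.
    have [a ea] : exists a : gspan hs1, gincl a = eta (x - x0) 1 *: s.
      by apply: gincl_surj; exists (fun=> eta (x - x0) 1); rewrite big_ord1.
    apply: (eta1_i (lexx _) l0 hs); rewrite -ea (zx a) ?gincl0 //.
    by apply/hpart_gincl; rewrite ea; exact: hE.
  have [x [zx lx]] := ev_ex (ev_and zo lge).
  have l0 : 0 <= lL (x - x0) by apply: le_trans lx.
  have [b eb] : exists b : gspan hU', gincl b = eta (x - x0) 1 *: v.
    apply: gincl_surj; have vr : v \in r by exact/hr.
    have iv : (index v r < size r)%N by rewrite index_mem.
    exists (fun l => if l == Ordinal iv then eta (x - x0) 1 else 0).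
    rewrite (bigD1 (Ordinal iv)) //= eqxx nth_index // big1 ?addr0 // => l /negPf ->.
    by rewrite scale0r.
  apply: (eta1_i (lexx _) l0 (U'U _ Uv)); rewrite -eb (zx b) ?gincl0 //.
  by apply/hpart_gincl; rewrite eb; apply: hE; exact: U'U.
have gen u : hpart x0 u -> exists f, u = act f s.
  by move=> /sp[f [v [/U'0 -> ->]]]; exists f; rewrite addr0.
exists s; split=> //.
have ex : exists e, act (ze ^+ e) s == 0 by exists n; rewrite act_Zn.
case: (ex_minnP ex) => -[|e] /eqP ze0 mn; first by case: s_neq; rewrite -ze0 expr0 act1.
have sn : act (ze ^+ e) s <> 0 by move=> /eqP /mn; rewrite ltnn.
have ann f : act f s = 0 <-> ze ^+ e.+1 %| f.
  split; first exact: (act_ann irr gU actDr actDl actM hs sn ze0).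
  move=> dv; have [g ->] : exists g : {poly k}, f = g * ze ^+ e.+1 by exact/dvdpP.
  by rewrite actM // ze0 a0r.
suff -> : n = e.+1 by [].
have ee : enum_of [set f : {poly k} | (size f <= d * e.+1)%N] (ps k (d * e.+1)).
  by split; [exact: ps_uniq|move=> f; rewrite mem_ps].
have [||||_ cc] := @ncard_bij _ _ [set f : {poly k} | (size f <= d * e.+1)%N] U (fun f => act f s).
- by exists (ps k (d * e.+1)).
- move=> f g sf sg E.
  have : act (f - g) s = 0.
    rewrite actDl // -scaleN1r -mul_polyC actM // actC ?kAN ?kA1 ?scaleN1r ?E ?subrr //.
    exact: act_h.
  move=> /ann dv; apply/eqP; rewrite -subr_eq0; apply/negPn/negP => n0; have := dvdp_leq n0 dv.
  rewrite (size_zetan Hz) ltnNge; apply/negP/negPn.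
  by apply: leq_trans (size_polyD _ _) _; rewrite size_polyN geq_max sf sg.
- by move=> f _; exact: act_h.
- move=> u /gen[f ->]; exists (f %% ze ^+ e.+1).
    by rewrite /= -ltnS -(size_zetan Hz) ltn_modp expf_neq0 // (ze_neq0 irr).
  by rewrite {2}(divp_eq f (ze ^+ e.+1)) actDl // actM // ze0 a0r add0r.
move: cc; rewrite (ncardE ee) size_ps (cM (lexx _)) => /eqP.
rewrite eqn_exp2l; last exact: card_finNzRing_gt1.
by rewrite eqn_pmul2l ?(d_gt0 Hz) // => /eqP.
Qed.

End Degree.
End TubeChart.

Definition fac (k : fieldType) (p : weights) (w : Lgroup p) (i : 'I_3) (x : Lgroup p) : {poly k} :=
  tau k i ^+ ((sL i (x + w)).+1 == p i).

(* In degree x, sg identifies M with k[t]/(ze^n). *)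
Definition schart (k : finFieldType) (p : weights) (ze : {poly k}) (n : nat) (M : gmod k p)
    (w : Lgroup p) (sg : Lgroup p -> {poly k} -> M) (x : Lgroup p) : Prop :=
  [/\ forall f, hpart x (sg x f), forall f g, sg x (f + g) = sg x f + sg x g,
      forall c f, sg x (c *: f) = kA p c *: sg x f,
      forall m, hpart x m -> exists f, sg x f = m &
   (forall f, sg x f = 0 <-> ze ^+ n %| f) /\
   forall i f, XA k p i *: sg x f = sg (vx p i + x) (fac k w i x * f)].

(** The reference degree x0 is congruent to -w modulo c, so X_i acts on S by the factor [fac] of the
    shift w. With w the shift of the chart of E, arrows from E to S become polynomial maps that
    commute with common factors. *)
Lemma schart_ex (k : finFieldType) (p : weights) (d n : nat) (z : {mpoly k[2]}) (S : coh k p)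
    (w : Lgroup p) : ordinary_point d z -> is_tube_object z n S ->
  exists sg : Lgroup p -> {poly k} -> S, ev (schart (zeta z) n w sg).
Proof.
move=> Hz [sS iS lS]; have [kS cS] := len_tail Hz lS sS.
have [n0 h0] := ev_and (ev_and kS cS) (killed_X Hz kS).
pose x0 : Lgroup p := - w + vc p *+ (n0 + `|lL (- w)|).
have lx0 : n0%:Z <= lL x0 by rewrite lL_addvcn; lia.
have kM x : lL x0 <= lL x -> forall v : S, hpart x v -> point_eq p z ^+ n *: v = 0.
  by move=> lx; have [[]] := h0 x (le_trans lx0 lx).
have cM x : lL x0 <= lL x -> ncard (hpart x : set S) = (#|k| ^ (d * n))%N.
  by move=> lx; have [[]] := h0 x (le_trans lx0 lx).
have iM : Xinj S x0.
  by move=> x lx; have [_] := h0 x (le_trans lx0 lx).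
have [s [hs gen ann]] := cyclic_gen Hz kM cM iM iS.
exists (fun x f => eta (x - x0) 1 *: act x0 f s).
have lge : ev (fun x : Lgroup p => 0 <= lL (x - x0)) by apply: ev_shift (ev_ge p 0).
apply: ev_imp lge => x lx.
have ah f : hpart x0 (act x0 f s) by exact: (act_h cM iM).
split.
- by move=> f; rewrite -{1}[x](subrK x0); apply: hpartZ (ah f); exact: homog_eta.
- by move=> f g; rewrite (actDl cM iM) // scalerDr.
- by move=> c f; rewrite -mul_polyC (actM cM iM) // (actC cM iM) // !scalerA mulrC.
- move=> m hm; have [|u hu <-] := eta1_onto cM iM lx (w := m); first by rewrite subrK.
  by have [f ->] := gen u hu; exists f.
split=> [f|i f].
  rewrite -ann; split=> [e|->]; last by rewrite scaler0.
  by apply: (eta1_inj iM _ lx e).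
have l1 : 0 <= lL (vx p i + x - x0).
  by rewrite -addrA; apply: le_trans lx (lL_vx_ge _ _).
have hX : homogA (vx p i + x - x0) (XA k p i * eta (x - x0) 1).
  by rewrite -addrA; apply: homogAM; [exact: homog_XA|exact: homog_eta].
rewrite scalerA (actA cM iM hX) // (actM cM iM) // (th_XA _ (homog_eta _ _)).
have s1 : (size (1%R : {poly k}) <= dsz (x - x0)%R)%N.
  by rewrite size_poly1; have := dszE lx; lia.
rewrite etaK // mulr1 /fac.
suff -> : sL i (x - x0) = sL i (x + w) by [].
by rewrite /x0 opprD opprK addrA sL_subvcn.
Qed.

(** * Charts of extension bundles *)

Section Mu.
Variables (k : fieldType) (p : weights).
Local Notation A := (coordA k p).
Local Notation L := (Lgroup p).
Implicit Types (x y : L) (a b : A).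

Definition mu a x : {poly k} := th (a * smono k x).

Lemma th_mu x a b : homogA x b -> th (a * b) = mu a x * th b.
Proof.
move=> hb; have [lx|lx] := ltP (lL x) 0.
  by rewrite (homogA_lt0 hb lx) mulr0 !th0 mulr0.
have [l el] : exists l : nat, lL x = l by case: (lL x) lx => // l; exists l.
have sb : (size (th b) <= l.+1)%N by have := size_th hb; rewrite /dsz el.
rewrite -{1}(thK hb) /eta el mulrA mulrC th_etaRM //; exact: mulrC.
Qed.

Lemma th_smono2 x y : th (smono k x * smono k y) = \prod_i tau k i ^+ ((sL i x + sL i y) %/ p i)%N.
Proof.
have e z : smono k z = toA p 'X_[[multinom sL i z | i < 3]].
  rewrite mpolyXE_id rmorph_prod; apply: eq_bigr => i _; by rewrite mnmE rmorphXn.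
by rewrite !e -rmorphM -mpolyXD th_toA thSX /thm; apply: eq_bigr => i _; rewrite mnmDE !mnmE.
Qed.

End Mu.

Lemma fact01 (k : fieldType) (c2 c3 : bool) (P : {poly k}) :
  (c2 -> P.[0] = 0) -> (c3 -> P.[1] = 0) ->
  exists2 G : {poly k}, P = 'X^c2 * ('X - 1) ^+ c3 * G & (size G + (c2 + c3) <= maxn (size P) (c2 + c3))%N.
Proof.
move=> h2 h3; have [P0|P0] := eqVneq P 0.
  by exists 0; rewrite ?mulr0 // P0 size_poly0 max0n.
have [G2 e2] : exists G2 : {poly k}, P = 'X^c2 * G2.
  case: c2 h2 {h3} => h2; last by exists P; rewrite expr0 mul1r.
  have : 'X - 0%:P %| P by rewrite dvdp_XsubCl; apply/rootP; exact: h2.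
  rewrite subr0 => /dvdpP[/= G e]; by exists G; rewrite expr1 mulrC.
have [G3 e3] : exists G3 : {poly k}, G2 = ('X - 1) ^+ c3 * G3.
  case: c3 h3 => h3; last by exists G2; rewrite expr0 mul1r.
  have : 'X - 1%:P %| G2.
    rewrite dvdp_XsubCl; apply/rootP; have := h3 isT; rewrite e2 hornerM hornerXn expr1n mul1r //.
  move=> /dvdpP[/= G e]; exists G; rewrite expr1 mulrC //.
have eP : P = 'X^c2 * ('X - 1) ^+ c3 * G3 by rewrite e2 e3 mulrA.
exists G3 => //; rewrite leq_max; apply/orP; left.
have nG : G3 != 0 by apply: contraNneq P0 => e; rewrite eP e mulr0.
have n1 : ('X - 1 : {poly k}) ^+ c3 != 0 by rewrite expf_neq0 // -[1]/(1%:P) polyXsubC_eq0.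
have s1 : size (('X - 1 : {poly k}) ^+ c3) = c3.+1.
  by case: c3 {h3 e3 eP n1}; rewrite ?expr0 ?expr1 ?size_poly1 // -[1]/(1%:P) size_XsubC.
have nX : ('X^c2 : {poly k}) != 0 by rewrite expf_neq0 ?polyX_eq0.
have s2 := size_mul (mulf_neq0 nX n1) nG; have s3 := size_mul nX n1.
have s4 : size P = (c2 + c3 + size G3)%N by rewrite eP s2 s3 size_polyXn s1 addSn addnS.
by rewrite s4 addnC.
Qed.

Lemma size_f01 (k : fieldType) (c2 c3 : bool) (f : {poly k}) n : (size f <= n)%N ->
  (size ('X^c2 * ('X - 1) ^+ c3 * f)%R <= n + c2 + c3)%N.
Proof.
case: n => [|n] sf; first by move: sf; rewrite leqn0 size_poly_eq0 => /eqP ->; rewrite mulr0 size_poly0.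
have := size_tauM i2 c2 (size_tauM i3 c3 sf); rewrite ?tauE mulrA => h.
by apply: leq_trans h _; lia.
Qed.

Definition pmul (R : nzRingType) (f : {poly R}) (r : {poly R} * {poly R}) := (f * r.1, f * r.2).

Lemma pmul_inj (k : fieldType) (f : {poly k}) (r s : {poly k} * {poly k}) : f != 0 -> pmul f r = pmul f s -> r = s.
Proof.
by move=> f0; case: r s => [a b] [c e] [/(mulfI f0) -> /(mulfI f0) ->].
Qed.

Lemma pmulD (k : fieldType) (f : {poly k}) (r s : {poly k} * {poly k}) : pmul f (r + s) = pmul f r + pmul f s.
Proof. by rewrite /pmul /= !mulrDr. Qed.

Lemma pmulA (k : fieldType) (f g : {poly k}) (r : {poly k} * {poly k}) : pmul f (pmul g r) = pmul (f * g) r.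
Proof. by rewrite /pmul /= !mulrA. Qed.

(** One integer m carries both degree bounds: sizes at most m/2 and (m+1)/2, rounded down. For m at
    least 2 these are m coefficients, of which each imposed condition removes one. *)
Definition inB (k : fieldType) (m : int) (c2 c3 : bool) (r : {poly k} * {poly k}) : Prop :=
  [/\ (2 * size r.1)%:Z <= m, (2 * size r.2)%:Z <= m + 1, c2 -> r.2.[0] = 0 & c3 -> r.1.[1] = r.2.[1]].

Definition facC (k : fieldType) (p : weights) (C2 C3 : Lgroup p -> bool) (i : 'I_3) (x : Lgroup p)
  : {poly k} :=
  if i == i1 then 1 else if i == i2 then 'X^(~~ C2 x && C2 (vx p i + x)%R)
  else ('X - 1) ^+ (~~ C3 x && C3 (vx p i + x)).

(* In degree x, psi identifies M with the pairs satisfying inB, and X_i acts by F i x. *)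
Definition echart (k : finFieldType) (p : weights) (M : gmod k p) (mm : Lgroup p -> int)
    (F : 'I_3 -> Lgroup p -> {poly k}) (C2 C3 : Lgroup p -> bool)
    (psi : Lgroup p -> M -> {poly k} * {poly k}) (x : Lgroup p) : Prop :=
  [/\ forall m m', hpart x m -> hpart x m' -> psi x (m + m') = psi x m + psi x m',
      forall c m, hpart x m -> psi x (kA p c *: m) = pmul c%:P (psi x m),
      forall m, hpart x m -> psi x m = 0 -> m = 0,
      forall r, inB (mm x) (C2 x) (C3 x) r <-> exists2 m, hpart x m & psi x m = r &
      forall i m, hpart x m -> psi (vx p i + x) (XA k p i *: m) = pmul (F i x) (psi x m)].

(** * Coordinates on a nonsplit extension of two line bundles *)

Section Ext.
Variables (k : finFieldType) (p : weights) (M : gmod k p).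
Local Notation A := (coordA k p).
Local Notation L := (Lgroup p).
Local Notation X i := (XA k p i).
Local Notation T i := (TA k p i).
Variables (u v : L) (iota : L -> A -> M) (ppi : L -> M -> A) (n0 : nat).
Local Notation hi x := (n0%:Z <= lL x).
Hypothesis iH : forall x a, hi x -> homogA (u + x) a -> hpart x (iota x a).
Hypothesis iD : forall x a b, hi x -> homogA (u + x) a -> homogA (u + x) b ->
  iota x (a + b) = iota x a + iota x b.
Hypothesis iZ : forall x y a b, hi x -> 0 <= lL y -> homogA y b -> homogA (u + x) a ->
  iota (y + x) (b * a) = b *: iota x a.
Hypothesis iI : forall x a, hi x -> homogA (u + x) a -> iota x a = 0 -> a = 0.
Hypothesis pH : forall x m, hi x -> hpart x m -> homogA (v + x) (ppi x m).
Hypothesis pD : forall x m m', hi x -> hpart x m -> hpart x m' -> ppi x (m + m') = ppi x m + ppi x m'.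
Hypothesis pZ : forall x y b m, hi x -> 0 <= lL y -> homogA y b -> hpart x m ->
  ppi (y + x) (b *: m) = b * ppi x m.
Hypothesis ip0 : forall x a, hi x -> homogA (u + x) a -> ppi x (iota x a) = 0.
Hypothesis ex : forall x m, hi x -> hpart x m -> ppi x m = 0 ->
  exists2 a, homogA (u + x) a & iota x a = m.
Hypothesis su : forall x a, hi x -> homogA (v + x) a -> exists2 m, hpart x m & ppi x m = a.
Hypothesis ns : ~ exists (sec : L -> A -> M) (n1 : nat), forall x, n1%:Z <= lL x ->
  [/\ forall a, homogA (v + x) a -> hpart x (sec x a) /\ ppi x (sec x a) = a,
      forall a b, homogA (v + x) a -> homogA (v + x) b -> sec x (a + b) = sec x a + sec x b,
      forall c a, homogA (v + x) a -> sec x (kA p c * a) = kA p c *: sec x a &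
      forall i a, homogA (v + x) a -> sec (vx p i + x) (X i * a) = X i *: sec x a].
Hypothesis luv : lL (u - v)%R = -2.
Hypothesis buv : forall i, (0 < sL i (u - v)%R)%N.

Let pB x m m' : hi x -> hpart x m -> hpart x m' -> ppi x (m - m') = ppi x m - ppi x m'.
Proof.
move=> hx hm hm'; apply: (addIr (ppi x m')); rewrite [RHS]subrK -pD ?subrK //; exact: hpartB.
Qed.

Let iB x a b : hi x -> homogA (u + x) a -> homogA (u + x) b -> iota x (a - b) = iota x a - iota x b.
Proof.
move=> hx ha hb; apply: (addIr (iota x b)); rewrite [RHS]subrK -iD ?subrK //.
by apply: homogAD => //; exact: homogAN.
Qed.

Let iInj x a b : hi x -> homogA (u + x) a -> homogA (u + x) b -> iota x a = iota x b -> a = b.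
Proof.
move=> hx ha hb e; apply/eqP; rewrite -subr_eq0; apply/eqP; apply: (iI hx).
  by apply: homogAD => //; exact: homogAN.
by rewrite iB // e subrr.
Qed.

Variable N : nat.
Hypothesis lN : (n0 + `|lL (- v)%R| + 2 <= N)%N.
Let XN : L := vc p *+ N.
Let x1 : L := - v + XN.
Let hx1 : hi x1. Proof. by rewrite /x1 /XN lL_addvcn; lia. Qed.
Let lXN : 0 <= lL XN. Proof. by rewrite -[XN]add0r /XN lL_addvcn lL0. Qed.
Let hXN (x : L) : hi x -> hi (XN + x).
Proof. by move=> hx; rewrite /XN addrC lL_addvcn; lia. Qed.
Let hT i : homogA XN (T i ^+ N). Proof. by apply: homogAX; exact: homog_TA. Qed.
Let vx1 : v + x1 = XN. Proof. by rewrite /x1 addrA subrr add0r. Qed.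
Let de : L := u + (XN + x1).
Let deE : de = (u - v)%R + vc p *+ (N + N).
Proof. by rewrite /de /x1 /XN mulrnDr [in LHS](addrCA (vc p *+ N)) -[in RHS]addrA. Qed.
Let sde i : sL i de = sL i (u - v)%R. Proof. by rewrite deE sL_addvcn. Qed.

(** T1^N m2 - T2^N m1 is the Cech cocycle of the extension for the cover T1 <> 0, T2 <> 0. Changing
    the lifts by elements of O(u) removes from its dehomogenization the N - 1 coefficients below
    t^(N-1) and the N - 1 above it, leaving the one class that Ext^1 allows. *)
Lemma norm_lifts : exists (m1 m2 : M) (lam : k) (et : A),
  [/\ hpart x1 m1, hpart x1 m2, ppi x1 m1 = T i1 ^+ N, ppi x1 m2 = T i2 ^+ N &
  [/\ homogA de et, th et = lam *: 'X^(N.-1) & T i1 ^+ N *: m2 - T i2 ^+ N *: m1 = iota (XN + x1) et]].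
Proof.
have hv i : homogA (v + x1) (T i ^+ N) by rewrite vx1.
have [m1 h1 e1] := su hx1 (hv i1); have [m2 h2 e2] := su hx1 (hv i2).
have hh : hpart (XN + x1) (T i1 ^+ N *: m2 - T i2 ^+ N *: m1) by apply: hpartB; exact: hpartZ.
have [|et het eet] := ex (hXN hx1) hh.
  by rewrite pB ?(hXN hx1) //; [|exact: hpartZ|exact: hpartZ]; rewrite !pZ // e1 e2 mulrC subrr.
have lde : lL de = (N + N - 2)%N%:Z by rewrite deE lL_addvcn luv; lia.
have ss := size_th het; rewrite /dsz -/de lde in ss.
pose lo := take_poly N.-1 (th et); pose up := drop_poly N (th et).
have lux : lL (u + x1) = (N - 2)%N%:Z by rewrite /x1 addrA /XN lL_addvcn luv; lia.
have dux : dsz (u + x1) = N.-1 by rewrite /dsz lux; lia.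
have slo : (size lo <= dsz (u + x1)%R)%N by rewrite dux size_take_poly.
have sup : (size up <= dsz (u + x1)%R)%N by rewrite dux size_drop_poly; lia.
pose g1 := eta (u + x1) up; pose g2 := eta (u + x1) (- lo).
have hg1 : homogA (u + x1) g1 by exact: homog_eta.
have hg2 : homogA (u + x1) g2 by exact: homog_eta.
have dE a : homogA (u + x1) a -> forall i, homogA de (T i ^+ N * a).
  by move=> ha i; rewrite /de addrCA; exact: homogAM.
exists (m1 + iota x1 g1), (m2 + iota x1 g2), (th et)`_N.-1, (et + T i1 ^+ N * g2 - T i2 ^+ N * g1).
have hi1 := iH hx1 hg1; have hi2 := iH hx1 hg2.
split; [exact: hpartD|exact: hpartD|by rewrite pD // ip0 // addr0|by rewrite pD // ip0 // addr0|].
split.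
- by apply: homogAD; [apply: homogAD => //; exact: dE|apply: homogAN; exact: dE].
- rewrite thB thD !th_TAn ?tauE expr1n mul1r !etaK ?size_polyN //.
  have e0 := poly_take_drop N.-1 (th et); rewrite -/lo in e0.
  have eU : drop_poly N.-1 (th et) = ((th et)`_N.-1)%:P + up * 'X.
    apply/polyP => j; rewrite coefD coefC coefMX !coef_drop_poly.
    by case: j => [|j] /=; rewrite ?addn0 ?add0r ?addr0 //; congr (_`_ _); lia.
  rewrite -{1}e0 eU mulrDl -mul_polyC.
  have -> : 'X^N = 'X * 'X^(N.-1) :> {poly k} by rewrite -exprS; congr (_ ^+ _); lia.
  ring.
- rewrite !scalerDr -(iZ hx1 lXN (hT i1)) // -(iZ hx1 lXN (hT i2)) //.
  rewrite iB ?iD ?(hXN hx1) //; do ?[exact: dE|exact: hXN].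
    by rewrite eet opprD addrACA addrA.
  by apply: homogAD => //; exact: dE.
Qed.

Definition jo x (m : M) : A := xget 0 [set a | homogA (u + x) a /\ iota x a = m].

Lemma joP x m : hi x -> hpart x m -> ppi x m = 0 -> homogA (u + x) (jo x m) /\ iota x (jo x m) = m.
Proof.
move=> hx hm e; rewrite /jo; case: xgetP => [a _ []//|/=].
by have [a ha ea] := ex hx hm e => /(_ a)[].
Qed.

Lemma joU x m a : hi x -> homogA (u + x) a -> iota x a = m -> jo x m = a.
Proof.
move=> hx ha e; have hm : hpart x m by rewrite -e; exact: iH.
have [|h1 h2] := joP hx hm; first by rewrite -e ip0.
by apply: (iInj hx h1 ha); rewrite h2 e.
Qed.

Let cc i (x : L) : bool := (sL i (x + u)%R < sL i (u - v)%R)%N.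
Let mI (x : L) : int := 2 * (lL (x + u)%R + 2) - (cc i1 x)%:Z.

Lemma wrap_cc i x : ((sL i (u - v)%R + sL i (v + x)%R) %/ p i)%N = cc i x.
Proof.
rewrite /cc; have -> : x + u = (u - v)%R + (v + x) by rewrite addrA subrK addrC.
rewrite (sLD i (u - v) (v + x)); have l1 := sL_lt i (u - v)%R; have l2 := sL_lt i (v + x).
have [h|h] := ltnP (sL i (u - v)%R + sL i (v + x)%R) (p i).
  by rewrite divn_small // modn_small //; case: ltnP => //; lia.
have -> : (sL i (u - v)%R + sL i (v + x)%R = p i + (sL i (u - v)%R + sL i (v + x)%R - p i))%N by lia.
rewrite divnDl ?dvdnn // divnn wt_gt0 divn_small ?modnDl ?modn_small; lia.
Qed.

Lemma lL_cc x : lL (v + x) = lL (x + u)%R + 2 - (cc i1 x)%:Z - (cc i2 x)%:Z - (cc i3 x)%:Z.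
Proof.
have e : x + u = (u - v)%R + (v + x) by rewrite addrA subrK addrC.
rewrite {1}e (lLD (u - v) (v + x)) luv big_ord3 /= !wrap_cc; lia.
Qed.

(** The normalized cocycle is lam times [smono k de] times the power N - 1 of T1 T2; this is
    multiplication by its monomial factor. *)
Definition QQ (a : A) := th (smono k de * a).

Lemma QQE x a : homogA (v + x) a -> QQ a = 'X^(cc i2 x) * ('X - 1) ^+ cc i3 x * th a.
Proof.
move=> ha; rewrite /QQ (th_mu _ ha) /mu th_smono2 big_ord3 /= !sde !wrap_cc !tauE.
by rewrite expr1n mul1r.
Qed.

Lemma QQX i x a : homogA (v + x) a -> QQ (X i * a) = fac k u i x * QQ a.
Proof.
move=> ha; rewrite /QQ mulrCA (th_XA _ (homogAM (homog_smono k de) ha)) /fac.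
have -> // : sL i (\sum_i0 vx p i0 *+ sL i0 de + (v + x)) = sL i (x + u)%R.
have -> : \sum_i vx p i *+ sL i de = de - vc p *~ lL de by rewrite {2}(normal_form de) addrK.
have -> : lL de = (N + N - 2)%N%:Z by rewrite deE lL_addvcn luv; lia.
rewrite addrAC sL_subvcn deE addrAC sL_addvcn.
by congr (sL i _); rewrite addrA subrK addrC.
Qed.

Section Chart.
Variables (m1 m2 : M) (lam : k) (et : A).
Hypotheses (hm1 : hpart x1 m1) (hm2 : hpart x1 m2).
Hypotheses (em1 : ppi x1 m1 = T i1 ^+ N) (em2 : ppi x1 m2 = T i2 ^+ N).
Hypotheses (het : homogA de et) (eet : th et = lam *: 'X^(N.-1)).
Hypothesis (rel : T i1 ^+ N *: m2 - T i2 ^+ N *: m1 = iota (XN + x1) et).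

Let mj (i : 'I_3) := if i == i1 then m1 else m2.
(** Where T_i is invertible, i = 1 or 2, the sequence splits by T_i^N |-> m_i. The element [KK] lies
    in O(u), and [HH] divided by T_i^N is the O(u)-coordinate of m in this splitting. *)
Definition KK i x m := T i ^+ N *: m - ppi x m *: mj i.
Definition HH i x m := jo (XN + x) (KK i x m).

Let n1 := (n0 + `|lL v| + `|lL u|)%N.
Local Notation Hi x := (n1%:Z <= lL x).
Let Hhi (x : L) : Hi x -> hi x. Proof. by rewrite /n1; lia. Qed.
Let Hlv (x : L) : Hi x -> 0 <= lL (v + x).
Proof. by move=> h; apply: le_trans (lLD_ge _ _); move: h; rewrite /n1; lia. Qed.
Let dgE x : (v + x) + x1 = XN + x.
Proof. by rewrite /x1 addrACA subrr add0r addrC. Qed.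
Local Notation i12 i := ((i == i1) || (i == i2)).
Let hmj i : hpart x1 (mj i). Proof. by rewrite /mj; case: eqP. Qed.
Let emj i : i12 i -> ppi x1 (mj i) = T i ^+ N.
Proof. by rewrite /mj; case: eqP => [->|_] //= /eqP ->. Qed.

Lemma KKh i x m : Hi x -> hpart x m -> hpart (XN + x) (KK i x m).
Proof.
move=> hx hm; apply: hpartB; first exact: hpartZ.
by rewrite -dgE; apply: hpartZ (hmj i); apply: pH => //; exact: Hhi.
Qed.

Lemma KKp i x m : i12 i -> Hi x -> hpart x m -> ppi (XN + x) (KK i x m) = 0.
Proof.
move=> hi12 hx hm; have hg := pH (Hhi hx) hm.
rewrite pB ?(hXN (Hhi hx)) //; first last.
- by rewrite -dgE; apply: hpartZ (hmj i).
- exact: hpartZ.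
rewrite pZ ?(Hhi hx) // -dgE pZ ?Hlv // emj // mulrC subrr //.
Qed.

Lemma HHP i x m : i12 i -> Hi x -> hpart x m ->
  homogA (u + (XN + x)) (HH i x m) /\ iota (XN + x) (HH i x m) = KK i x m.
Proof. by move=> h hx hm; apply: joP; [exact: hXN (Hhi hx)|exact: KKh|exact: KKp]. Qed.

Lemma HHD i x m m' : i12 i -> Hi x -> hpart x m -> hpart x m' -> HH i x (m + m') = HH i x m + HH i x m'.
Proof.
move=> h hx hm hm'; have [a1 a2] := HHP h hx hm; have [b1 b2] := HHP h hx hm'.
apply: joU; [exact: hXN (Hhi hx)|exact: homogAD|].
rewrite iD ?(hXN (Hhi hx)) // a2 b2 /KK pD ?Hhi // scalerDl scalerDr opprD addrACA //.
Qed.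

Lemma HHZ i x y b m : i12 i -> Hi x -> 0 <= lL y -> homogA y b -> hpart x m ->
  HH i (y + x) (b *: m) = b * HH i x m.
Proof.
move=> h hx ly hb hm; have [a1 a2] := HHP h hx hm.
have hyx : hi (y + x) by apply: le_trans (lLD_ge _ _); have := Hhi hx; lia.
apply: joU; first exact: hXN.
  by rewrite [XN + (y + x)]addrCA [u + _]addrCA; exact: homogAM.
rewrite addrCA iZ ?(hXN (Hhi hx)) // a2 /KK pZ ?Hhi // scalerBr !scalerA mulrC //.
Qed.

Lemma HH_iota i x a : i12 i -> Hi x -> homogA (u + x) a -> HH i x (iota x a) = T i ^+ N * a.
Proof.
move=> h hx ha; apply: joU; [exact: hXN (Hhi hx)|by rewrite addrCA; exact: homogAM|].
by rewrite iZ ?Hhi // /KK ip0 ?Hhi // scale0r subr0.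
Qed.

(** The two local coordinates of m differ by the cocycle applied to the image of m in O(v). *)
Lemma HHrel x m : Hi x -> hpart x m ->
  'X^N * th (HH i1 x m) - th (HH i2 x m) = lam *: ('X^(N.-1) * QQ (ppi x m)).
Proof.
move=> hx hm; have [a1 a2] := @HHP i1 x m isT hx hm; have [b1 b2] := @HHP i2 x m isT hx hm.
have hg := pH (Hhi hx) hm.
have dE : (v + x) + (XN + x1) = XN + (XN + x) by rewrite addrCA dgE.
have h1 : homogA (u + (XN + (XN + x))) (T i2 ^+ N * HH i1 x m) by rewrite addrCA; exact: homogAM.
have h2 : homogA (u + (XN + (XN + x))) (T i1 ^+ N * HH i2 x m) by rewrite addrCA; exact: homogAM.
have h3 : homogA (u + (XN + (XN + x))) (ppi x m * et).
  by rewrite -dE addrCA; exact: homogAM.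
have e : T i2 ^+ N * HH i1 x m - T i1 ^+ N * HH i2 x m = ppi x m * et.
  have hh := hXN (Hhi hx); apply: (iInj (hXN hh) _ h3).
    by apply: homogAD => //; exact: homogAN.
  rewrite (iB (hXN hh) h1 h2) (iZ hh lXN (hT i2) a1) (iZ hh lXN (hT i1) b1) a2 b2.
  rewrite -dE (iZ (hXN hx1) (Hlv hx) hg het) -rel /KK /mj /= !scalerBr !scalerA.
  rewrite [T i1 ^+ N * T i2 ^+ N]mulrC [T i2 ^+ N * ppi x m]mulrC [T i1 ^+ N * ppi x m]mulrC.
  by rewrite opprB addrC addrA subrK.
have := congr1 (@th k p) e; rewrite thB !th_TAn ?tauE expr1n mul1r => ->.
rewrite (th_mu _ het) eet /mu mulrC -scalerAl; congr (_ *: (_ * _)).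
by rewrite /QQ mulrC.
Qed.

Let lN1 : N = N.-1.+1. Proof. by lia. Qed.

Lemma HH1_size x m : Hi x -> hpart x m -> (size (th (HH i2 x m)) <= (N + `|lL (x + u)%R|).+1)%N.
Proof.
move=> hx hm; have [b1 _] := @HHP i2 x m isT hx hm; have := size_th b1.
have l0 : 0 <= lL (x + u)%R by apply: le_trans (lLD_ge _ _); move: hx; rewrite /n1; lia.
have e : lL (u + (XN + x)) = lL (x + u)%R + N%:Z by rewrite addrCA addrC /XN lL_addvcn [u + x]addrC.
have l1 : 0 <= lL (u + (XN + x)) by rewrite e; lia.
have := dszE l1; rewrite e; lia.
Qed.

(** If lam = 0 the two local splittings glue: the equation T1^N m = a m1 singles out one lift m of
    each a, which gives a section of the sequence. *)
Lemma lam_neq0 : lam != 0.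
Proof.
apply/negP => /eqP l0; apply: ns.
have rl x m : Hi x -> hpart x m -> 'X^N * th (HH i1 x m) = th (HH i2 x m).
  by move=> hx hm; apply/eqP; rewrite -subr_eq0 HHrel // l0 scale0r.
pose R x (a : A) (m : M) := [/\ hpart x m, ppi x m = a & T i1 ^+ N *: m = a *: m1].
have RE x a : Hi x -> homogA (v + x) a -> exists m, R x a m.
  move=> hx ha; have [m0 h0 e0] := su (Hhi hx) ha.
  have [a1 a2] := @HHP i1 x m0 isT hx h0.
  have l1 : 0 <= lL (u + x) by apply: le_trans (lLD_ge _ _); move: hx; rewrite /n1; lia.
  have sz : (size (th (HH i1 x m0)) <= dsz (u + x)%R)%N.
    have := HH1_size hx h0; rewrite -(rl x m0 hx h0).
    have [->|nz] := eqVneq (th (HH i1 x m0)) 0; first by rewrite size_poly0.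
    rewrite size_mul ?expf_neq0 ?polyX_eq0 // size_polyXn /=.
    have dE : dsz (u + x) = `|lL (x + u)%R|.+1 by rewrite [x + u]addrC /dsz; move: l1; case: (lL (u + x)).
    by rewrite dE -addnS leq_add2l.
  pose h := eta (u + x) (th (HH i1 x m0)).
  have hh : homogA (u + x) h by exact: homog_eta.
  have eh : T i1 ^+ N * h = HH i1 x m0.
    apply: (th_inj _ a1); first by rewrite addrCA; exact: homogAM.
    by rewrite th_TAn ?tauE expr1n mul1r etaK.
  exists (m0 - iota x h); have hih := iH (Hhi hx) hh; split; first exact: hpartB.
    by rewrite pB ?Hhi // ip0 ?Hhi // subr0.
  rewrite scalerBr -(iZ (Hhi hx) lXN) // eh a2 /KK /mj /= e0 opprB addrC subrK //.
have RU x a m m' : Hi x -> R x a m -> R x a m' -> m = m'.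
  move=> hx [a1 a2 a3] [b1 b2 b3]; apply/eqP; rewrite -subr_eq0; apply/eqP.
  have [|h hh eh] := ex (Hhi hx) (hpartB a1 b1); first by rewrite pB ?Hhi // a2 b2 subrr.
  have : T i1 ^+ N *: (m - m') = 0 by rewrite scalerBr a3 b3 subrr.
  rewrite -eh -(iZ (Hhi hx) lXN) // => /(iI (hXN (Hhi hx))) h0.
  have th0' : T i1 ^+ N * h = 0 by apply: h0; rewrite addrCA; exact: homogAM.
  suff -> : h = 0 by apply: (addrI (iota x 0)); rewrite -iD ?Hhi ?addr0 //; exact: homogA0.
  apply: (th_inj hh (homogA0 _ _)); have := congr1 (@th k p) th0'.
  by rewrite th_TAn ?tauE expr1n mul1r.
have lx i x : Hi x -> Hi (vx p i + x) by move=> hx; apply: le_trans hx (lL_vx_ge _ _).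
exists (fun x a => xget 0 (R x a)), n1 => x hx.
have P x' a : Hi x' -> homogA (v + x') a -> R x' a (xget 0 (R x' a)).
  by move=> hx' ha; case: xgetP => // h; have [m /h] := RE x' a hx' ha.
split.
- by move=> a ha; have [] := P x a hx ha.
- move=> a b ha hb; have [a1 a2 a3] := P x a hx ha; have [b1 b2 b3] := P x b hx hb.
  apply: (RU x (a + b)) => //; first by apply: P => //; exact: homogAD.
  by split; [exact: hpartD|rewrite pD ?Hhi // a2 b2|rewrite scalerDr a3 b3 scalerDl].
- move=> c a ha; have [a1 a2 a3] := P x a hx ha.
  apply: (RU x (kA p c * a)) => //; first by apply: P => //; exact: homogAZ.
  split; first exact: hpartkA.
    have := pZ (Hhi hx) _ (homog_kA p c) a1; rewrite add0r a2; apply; by rewrite lL0.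
  by rewrite scalerA [T i1 ^+ N * _]mulrC -[LHS]scalerA a3 scalerA.
- move=> i a ha; have [a1 a2 a3] := P x a hx ha; have hX := homog_XA k p i.
  have hXa : homogA (v + (vx p i + x)) (X i * a) by rewrite addrCA; exact: homogAM.
  apply: (RU _ _ _ _ (lx i x hx) (P _ _ (lx i x hx) hXa)).
  split; first exact: hpartZ.
    by rewrite pZ ?Hhi // ?a2 // lL_vx.
  by rewrite scalerA [T i1 ^+ N * _]mulrC -[LHS]scalerA a3 scalerA.
Qed.

(** The coordinate over T1 <> 0 and t times the one over T2 <> 0. By construction t r1 - r2 is lam
    times [QQ] of the image in O(v), divisible by t and t - 1 as the [cc i] prescribe; this is the
    origin of the two linear conditions. *)
Definition psi x m : {poly k} * {poly k} :=
  (th (HH i1 x m), 'X * th (HH i1 x m) - lam *: QQ (ppi x m)).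

Lemma psi_H2 x m : Hi x -> hpart x m -> th (HH i2 x m) = 'X^(N.-1) * (psi x m).2.
Proof.
move=> hx hm; have /eqP := HHrel hx hm; rewrite subr_eq addrC -subr_eq => /eqP <-.
by rewrite /psi /= {1}lN1 exprS mulrBr -scalerAr; congr (_ - _); rewrite mulrCA mulrA.
Qed.

Lemma psi2_size x m : Hi x -> hpart x m -> (size (psi x m).2 <= `|lL (x + u)%R| + 2)%N.
Proof.
move=> hx hm; have := HH1_size hx hm; rewrite psi_H2 //.
have [->|nz] := eqVneq (psi x m).2 0; first by rewrite size_poly0.
rewrite size_mul ?expf_neq0 ?polyX_eq0 // size_polyXn addSn /= => hs.
by rewrite -(leq_add2l N.-1); apply: leq_trans hs _; have := lN1; lia.
Qed.

Lemma psi_iota x a : Hi x -> homogA (u + x) a -> psi x (iota x a) = (th a, 'X * th a).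
Proof.
move=> hx ha; rewrite /psi HH_iota // ip0 ?Hhi // /QQ mulr0 th0 scaler0 subr0.
by rewrite th_TAn ?tauE expr1n mul1r.
Qed.

Lemma psi_chart x : Hi x -> echart mI (fac k u) (cc i2) (cc i3) psi x.
Proof.
move=> hx; have hhx := Hhi hx.
have X1 : (('X - 1 : {poly k}) == 0) = false by apply/negbTE; exact: (tau_neq0 k i3).
have sX1 : size ('X - 1 : {poly k}) = 2 by rewrite -[1]/(1%:P) size_XsubC.
have QD a b : QQ (a + b) = QQ a + QQ b by rewrite /QQ mulrDr thD.
have psiD m m' : hpart x m -> hpart x m' -> psi x (m + m') = psi x m + psi x m'.
  move=> hm hm'; rewrite /psi HHD // pD // QD thD; congr pair.
  rewrite mulrDr scalerDr opprD addrACA //.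
have psik c m : hpart x m -> psi x (kA p c *: m) = pmul c%:P (psi x m).
  move=> hm; have l0 : 0 <= lL (0 : L) by rewrite lL0.
  have := HHZ (i := i1) isT hx l0 (homog_kA p c) hm.
  have := pZ hhx l0 (homog_kA p c) hm; rewrite add0r /psi => -> ->.
  rewrite /QQ mulrCA !th_kA /pmul /= mul_polyC; congr pair.
  by rewrite mul_polyC scalerBr -scalerAr !scalerA [lam * c]mulrC.
have lux : 0 <= lL (x + u)%R by apply: le_trans (lLD_ge _ _); move: hx; rewrite /n1; lia.
have [l el] : exists l : nat, lL (x + u)%R = l by case: (lL (x + u)%R) lux => // l; exists l.
have al : `|lL (x + u)%R|%N = l by rewrite el.
have mE : mI x = 2 * (l%:Z + 2) - (cc i1 x)%:Z by rewrite /mI el.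
have dv : (dsz (v + x))%:Z = l%:Z + 3 - (cc i1 x)%:Z - (cc i2 x)%:Z - (cc i3 x)%:Z.
  by rewrite (dszE (Hlv hx)) lL_cc el; lia.
have du : (dsz (u + x))%:Z = l%:Z + 1 by rewrite [u + x]addrC (dszE lux) el.
split=> //.
- move=> m hm; rewrite /psi => -[e1 e2].
  have [a1 a2] := @HHP i1 x m isT hx hm; have hg := pH hhx hm.
  have g0 : ppi x m = 0.
    apply: (th_inj hg (homogA0 _ _)); rewrite th0; move: e2; rewrite e1 mulr0 sub0r => /eqP.
    rewrite oppr_eq0 scaler_eq0 (negPf lam_neq0) /= (QQE hg) !mulf_eq0 !expf_eq0 polyX_eq0.
    by rewrite X1 !andbF /= => /eqP.
  have [a ha ea] := ex hhx hm g0; have := psi_iota hx ha; rewrite ea /psi e1 => -[/esym ta _].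
  rewrite -ea; have -> : a = 0 by apply: (th_inj ha (homogA0 _ _)); rewrite ta th0.
  by apply: (addrI (iota x 0)); rewrite -iD ?addr0 //; exact: homogA0.
- move=> r; split.
    case: r => r1 r2 [/= s1 s2 z2 z3].
    have {}s1 : (2 * size r1)%:Z <= mI x := s1.
    have {}s2 : (2 * size r2)%:Z <= mI x + 1 := s2.
    have sr2 : (size r2 <= l + 2)%N by move: s2; rewrite mE; case: (cc i1 x) => /=; lia.
    (* The conditions make t r1 - r2 divisible by the factors occurring in [QQ]; the quotient
       prescribes the image in O(v). *)
    have [||G eG sG] := @fact01 k (cc i2 x) (cc i3 x) ('X * r1 - r2).
    + by move=> /z2 e; rewrite hornerD hornerN hornerM hornerX e mul0r subr0.
    + by move=> /z3 e; rewrite hornerD hornerN hornerM hornerX e mul1r subrr.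
    have sP : (size ('X * r1 - r2)%R <= maxn (size r1).+1 (size r2))%N.
      apply: leq_trans (size_polyD _ _) _; rewrite size_polyN geq_max leq_max.
      apply/andP; split; last by rewrite leq_max leqnn orbT.
      by apply/orP; left; apply: leq_trans (size_polyMleq _ _) _; rewrite size_polyX.
    have sG' : (size (lam^-1 *: G) <= dsz (v + x)%R)%N.
      apply: leq_trans (size_scale_leq _ _) _.
      move: s1 s2 dv sG sP; rewrite mE; move: (size _) (size _) (size _) (size _) => s3 s4 s5 s6.
      case: (cc i1 x) (cc i2 x) (cc i3 x) => [] [] []; lia.
    pose g := eta (v + x) (lam^-1 *: G); have hg : homogA (v + x) g by exact: homog_eta.
    have [m0 h0 e0] := su hhx hg.
    have E0 : 'X * (psi x m0).1 - (psi x m0).2 = 'X * r1 - r2.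
      rewrite /psi /= e0 opprB addrC subrK (QQE hg) etaK // eG -scalerAr scalerA mulfV ?lam_neq0 //.
      by rewrite scale1r.
    have s20 : (size (psi x m0).2 <= l + 2)%N.
      rewrite -al; exact: psi2_size.
    (* As m0 has the right image in O(v), its pair differs from (r1, r2) by (h, t h), which comes
       from O(u). *)
    pose h : {poly k} := r1 - (psi x m0).1.
    have eh : 'X * h = r2 - (psi x m0).2.
      have E1 : 'X * r1 = 'X * (psi x m0).1 - (psi x m0).2 + r2 by rewrite E0 subrK.
      rewrite /h mulrBr E1; ring.
    have sh : (size h <= dsz (u + x)%R)%N.
      have [->|nz] := eqVneq h 0; first by rewrite size_poly0.
      have : (size ('X * h)%R <= l + 2)%N.
        rewrite eh; apply: leq_trans (size_polyD _ _) _; rewrite size_polyN geq_max s20 andbT.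
        exact: sr2.
      have dd : dsz (u + x) = l.+1 by lia.
      by rewrite size_mul ?polyX_eq0 // size_polyX dd addn2 ltnS.
    pose a := eta (u + x) h; have ha : homogA (u + x) a by exact: homog_eta.
    exists (m0 + iota x a); first by apply: hpartD => //; exact: iH.
    rewrite (psiD _ _ h0 (iH hhx ha)) (psi_iota hx ha) etaK // eh {1}[psi x m0]surjective_pairing.
    by congr pair; rewrite /h /= addrC subrK.
  case=> m hm <-; have hg := pH hhx hm.
  have s2 : (size (psi x m).2 <= l + 2)%N.
    rewrite -al; exact: psi2_size.
  have sQ : (size (QQ (ppi x m)) <= dsz (v + x)%R + cc i2 x + cc i3 x)%N.
    by rewrite (QQE hg); apply: size_f01; exact: size_th.
  have s1 : (size (psi x m).1 <= l + 2 - cc i1 x)%N.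
    have [->|nz] := eqVneq (psi x m).1 0; first by rewrite size_poly0.
    have eX : 'X * (psi x m).1 = (psi x m).2 + lam *: QQ (ppi x m) by rewrite /psi /= subrK.
    have : (size ('X * (psi x m).1)%R <= maxn (l + 2) (dsz (v + x)%R + cc i2 x + cc i3 x))%N.
      rewrite eX; apply: leq_trans (size_polyD _ _) _; rewrite geq_max; apply/andP; split.
        by rewrite leq_max s2.
      by apply: leq_trans (size_scale_leq _ _) _; rewrite leq_max sQ orbT.
    have ar (a b : nat) : b%:Z = l%:Z + 3 - (cc i1 x)%:Z - (cc i2 x)%:Z - (cc i3 x)%:Z ->
        (a.+1 <= maxn (l + 2) (b + cc i2 x + cc i3 x))%N -> (a <= l + 2 - cc i1 x)%N.
      by case: (cc i1 x) (cc i2 x) (cc i3 x) => [] [] [] /=; lia.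
    by rewrite mulrC size_mulX // => h; exact: ar dv h.
  split.
  + have h : (2 * size (psi x m).1)%:Z <= mI x by rewrite mE; move: s1; case: (cc i1 x) => /=; lia.
    exact: h.
  + have h : (2 * size (psi x m).2)%:Z <= mI x + 1 by rewrite mE; move: s2; case: (cc i1 x) => /=; lia.
    exact: h.
  + by move=> c2; rewrite /psi /= (QQE hg) c2 hornerD hornerN hornerZ !hornerM !hornerX !mul0r mulr0 subr0.
  + move=> c3; rewrite /psi /= (QQE hg) c3 hornerD hornerN hornerZ !hornerM hornerX hornerXn hornerD hornerN hornerX.
    have h11 : (1 : {poly k}).[1] = 1 := hornerC 1 1.
    by rewrite h11 subrr !(mulr0, mul0r) mul1r subr0.
- move=> i m hm; have hX := homog_XA k p i; have hg := pH hhx hm.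
  have l0 : 0 <= lL (vx p i) by rewrite lL_vx.
  have [a1 _] := @HHP i1 x m isT hx hm.
  have f1 : th (X i * HH i1 x m) = fac k u i x * th (HH i1 x m).
    rewrite (th_XA _ a1) /fac; have -> // : sL i (u + (XN + x)) = sL i (x + u)%R.
    by rewrite addrCA addrC /XN sL_addvcn addrC.
  rewrite /psi (HHZ (i := i1) isT hx l0 hX hm) (pZ hhx l0 hX hm) f1 (QQX _ hg) /pmul /=.
  by congr pair; rewrite mulrBr -scalerAr; congr (_ - _); rewrite mulrCA.
Qed.

End Chart.
End Ext.

(** * Degree bounds and linear conditions as functions of the degree *)

Section Data.
Variable p : weights.
Local Notation L := (Lgroup p).
Variables (u : L) (b : 'I_3 -> nat).
Hypothesis hb : forall i, (0 < b i < p i)%N.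

(* cI i2 and cI i3 tell which of the two linear conditions of inB hold in degree x, mI is
   the degree bound, and chi is the dimension of the degree x component. *)
Definition cI (i : 'I_3) (x : L) : bool := (sL i (x + u)%R < b i)%N.
Definition mI (x : L) : int := 2 * (lL (x + u) + 2) - (cI i1 x)%:Z.
Definition chi (x : L) : int := mI x - (cI i2 x)%:Z - (cI i3 x)%:Z.

Let shiftE i x : vx p i + x + u = (x + u) + vx p i. Proof. by rewrite -addrA addrC. Qed.

Lemma cI_other i j x : i != j -> cI i (vx p j + x) = cI i x.
Proof. by move=> ne; rewrite /cI shiftE sL_addvx (negPf ne). Qed.

Lemma cI_wrap i x : (sL i (x + u)).+1 == p i = ~~ cI i x && cI i (vx p i + x).
Proof.
rewrite /cI shiftE sL_addvx eqxx; have /andP[b0 b1] := hb i; have := sL_lt i (x + u).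
move: (sL i (x + u)) => s ls; case: eqP => h.
  by rewrite b0 andbT -leqNgt; apply/esym; lia.
by apply/esym/negbTE; lia.
Qed.

(** Switching a condition on raises [lL] by 1, hence [mI] by 2, at the cost of one condition;
    switching it off only drops the condition. Either way the dimension grows by one, so dimensions
    reveal the switches but not the state. *)
Lemma chi_step i x : i != i1 -> chi (vx p i + x) - chi x = (cI i x != cI i (vx p i + x))%:Z.
Proof.
rewrite /chi /mI => ni; have e : lL (vx p i + x + u) = lL (x + u) + (~~ cI i x && cI i (vx p i + x))%:Z.
  by rewrite shiftE lL_addvx cI_wrap.
rewrite e; move: ni; elim/ord3P: i e => // e _.
  rewrite (@cI_other i1 i2) // (@cI_other i3 i2) //.
  by case: (cI i2 x) (cI i2 (vx p i2 + x)) => [] [] /=; lia.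
rewrite (@cI_other i1 i3) // (@cI_other i2 i3) //.
by case: (cI i3 x) (cI i3 (vx p i3 + x)) => [] [] /=; lia.
Qed.

Lemma fac_facC (k : fieldType) i x : fac k u i x = facC k (cI i2) (cI i3) i x.
Proof.
rewrite /fac cI_wrap /facC; elim/ord3P: i; rewrite ?tauE //=; exact: expr1n.
Qed.

(** The normal form of x + u can be chosen freely: exponent 0 imposes a condition and exponent b_i
    drops it. The exponent of x_1 adjusts the parity of [mI] to that of N, and a large multiple of c
    supplies j. *)
Lemma fullC n0 (c2 c3 : bool) N : exists (x : L) (j : nat),
  [/\ n0%:Z <= lL x, cI i2 x = c2, cI i3 x = c3 & mI x = N%:Z + 2 * j%:Z].
Proof.
pose s (i : 'I_3) := if (if i == i1 then odd N else if i == i2 then c2 else c3) then 0%N else b i.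
pose l := (n0 + `|lL (- u)%R| + N)%N.
pose w : L := degL p [multinom s i | i < 3] + vc p *+ l.
have ls i : (s i < p i)%N by rewrite /s; have /andP[b0 b1] := hb i; case: ifP => _; lia.
have sw i : sL i w = s i by rewrite sL_addvcn sL_degL mnmE modn_small.
have lw : lL w = l.
  by rewrite lL_addvcn lL_degL big1 // => i _; rewrite mnmE divn_small.
exists (w - u), (l + 2 - (N + odd N)./2)%N.
have cE i : cI i (w - u) = (if i == i1 then odd N else if i == i2 then c2 else c3).
  rewrite /cI subrK sw /s; have /andP[b0 b1] := hb i; by case: ifP => _; rewrite ?ltnn.
split; rewrite ?cE //.
  by have := lLD_ge w (- u); rewrite lw /l; lia.
rewrite /mI subrK lw cE /=; have := odd_double_half N; rewrite /l.
by case: (odd N) => /=; lia.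
Qed.

End Data.

Lemma shift_const (p : weights) (T : eqType) (e : Lgroup p -> T) (n0 : nat) :
  (forall x i, n0%:Z <= lL x -> e (vx p i + x) = e x) ->
  forall x y, n0%:Z <= lL x -> n0%:Z <= lL y -> e x = e y.
Proof.
move=> h; have hd s x : n0%:Z <= lL x -> e (dl p s + x) = e x.
  move=> lx; elim: s => [|i s IH]; first by rewrite /dl big_nil add0r.
  rewrite /dl big_cons -addrA h //; apply: le_trans lx _; exact: lL_dl.
have hp z x : 0 <= lL z -> n0%:Z <= lL x -> e (z + x) = e x.
  by move=> lz; have [s _ <-] := eta1_Xl 'F_2 lz; exact: hd.
move=> x y lx ly; pose N := `|lL (y - x)%R|%N.
have lN : 0 <= lL (vc p *+ N : Lgroup p) by rewrite -[_ *+ _]add0r lL_addvcn lL0.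
rewrite -(hp (y - x + vc p *+ N) x) //; last by rewrite lL_addvcn /N; lia.
by rewrite -(hp (vc p *+ N) y) //; congr e; rewrite addrAC subrK addrC.
Qed.

Lemma ncard_homog (k : finFieldType) (p : weights) (y e : Lgroup p) x :
  ncard (hpart x : set (twist (line_bundle k y) e)) = (#|k| ^ dsz (y + e + x)%R)%N.
Proof.
have hp (a : twist (line_bundle k y) e) : hpart x a <-> homogA (y + e + x) (a : coordA k p).
  by rewrite homogAP -addrA.
have en : enum_of (hpart x : set (twist (line_bundle k y) e))
    [seq (eta (y + e + x) f : coordA k p) | f <- ps k (dsz (y + e + x))].
  split.
    rewrite map_inj_in_uniq ?ps_uniq // => f g; rewrite !mem_ps => sf sg E.
    by rewrite -(etaK sf) E etaK.
  move=> a; split=> [/mapP[f _ ->]|/hp ha]; first by apply/hp; exact: homog_eta.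
  by apply/mapP; exists (th (a : coordA k p)); rewrite ?mem_ps ?size_th ?thK.
by rewrite (ncardE en) size_map size_ps.
Qed.

Lemma delta_bound (p : weights) (x : Lgroup p) : Lle 0 x -> Lle x (vdelta p) ->
  lL x = 0 /\ forall i, (sL i x + 2 <= p i)%N.
Proof.
have pos (y : Lgroup p) : Lpos y -> 0 <= lL y.
  case=> l [m [_ ->]]; rewrite lL_addvcn.
  have -> : \sum_i vx p i *+ l i = degL p [multinom l i | i < 3].
    by rewrite /degL; apply: eq_bigr => i _; rewrite mnmE.
  by rewrite lL_degL; lia.
rewrite /Lle subr0 => /pos l0 /pos l1.
have dE : vdelta p = degL p [multinom (p i - 2)%N | i < 3].
  by rewrite /degL; apply: eq_bigr => i _; rewrite mnmE.
have ld : lL (vdelta p) = 0.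
  rewrite dE lL_degL big1 // => i _; rewrite mnmE divn_small //; have := wt_ge2 p i; lia.
have sd i : sL i (vdelta p) = (p i - 2)%N.
  rewrite dE sL_degL mnmE modn_small //; have := wt_ge2 p i; lia.
have e : x + (vdelta p - x) = vdelta p by rewrite addrC subrK.
have := lLD x (vdelta p - x); rewrite e ld => E.
have z : (\sum_i ((sL i x + sL i (vdelta p - x)%R) %/ p i)%N)%N = 0%N by move: E; lia.
split; first by move: E; lia.
move=> i; have := sd i; rewrite -e sLD modn_small; last first.
  move/eqP: z; rewrite sum_nat_eq0 => /forallP /(_ i) /eqP h.
  by rewrite ltnNge; apply/negP => le; have := divn_gt0 (sL i x + sL i (vdelta p - x)%R)%N (wt_gt0 p i);
     rewrite h le.
have := wt_ge2 p i; lia.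
Qed.

Lemma echart_iso (k : finFieldType) (p : weights) (E E0 : coh k p) mm F C2 C3 psi :
  isomorphic E E0 -> ev (echart (M := E0) mm F C2 C3 psi) ->
  exists psi', ev (echart (M := E) mm F C2 C3 psi').
Proof.
move=> [f /isoP[fi fs]] ch; exists (fun x m => psi x (tf f x m)).
apply: ev_imp (ev_and (ev_and (tinj_eq fi) fs) (ev_and (ev_up (tfokP f)) ch)).
move=> x [[h1 h2] [okf [c1 c2 c3 c4 c5]]]; have ok := okf x (lexx _).
have th m : hpart x m -> hpart x (tf f x m) by exact: tf_hpart.
split.
- by move=> m m' hm hm'; rewrite tfD // c1 //; exact: th.
- by move=> c m hm; rewrite tfkA // c2 //; exact: th.
- move=> m hm /c3 e; apply: h1 => //; first exact: hpart0.
  by rewrite tf0 // e //; exact: th.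
- move=> r; rewrite c4; split=> -[m hm <-].
    by have [m' hm' <-] := h2 m hm; exists m'.
  by exists (tf f x m) => //; exact: th.
- move=> i m hm; rewrite (tfZ ok (okf _ (lL_vx_ge _ _)) (homog_XA k p i)) // c5 //; exact: th.
Qed.

Lemma ext_chart (k : finFieldType) (p : weights) (E : coh k p) : extension_bundle E ->
  exists (u : Lgroup p) (b : 'I_3 -> nat) psi, [/\ forall i, (0 < b i < p i)%N,
    ev (echart (M := E) (mI u b) (fac k u) (cI u b i2) (cI u b i3) psi) &
    ev (fun x => exists2 e : nat, ncard (hpart x : set E) = (#|k| ^ e)%N & e%:Z = chi u b x)].
Proof.
move=> [y [x0 [E0 [ge0 led [f [g [sx nsp]]] iso]]]].
have [lx0 sx0] := delta_bound ge0 led.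
have [fi te] := short_exact_tail sx; have [gs exg] := te.
pose u : Lgroup p := y + vomega p; pose v : Lgroup p := y + x0.
pose m0 := [multinom (p i - (sL i x0).+1)%N | i < 3].
(* For x0 = sum l_i x_i, the normal form of u - v = omega - x0 is sum (p_i - 1 - l_i) x_i - 2c. Its
   coefficients are the numbers b_i, positive because l_i is at most p_i - 2. *)
have uvE : u - v = degL p m0 - vc p *+ 2.
  have -> : degL p m0 = \sum_i (vc p - vx p i *+ (sL i x0).+1).
    rewrite /degL; apply: eq_bigr => i _; rewrite mnmE -(vcE p i) mulrnBr //.
    by have := sx0 i; lia.
  have -> : u - v = vomega p - x0 by rewrite /u /v opprD addrACA subrr add0r.
  have -> : vomega p = vc p - \sum_i vx p i by rewrite /vomega big_ord3 /= !opprD !addrA.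
  rewrite {1}(normal_form x0) lx0 mulr0z addr0 sumrB sumr_const card_ord.
  rewrite [RHS]addrAC [vc p *+ 3]mulrS addrK -addrA -opprD -big_split /=.
  by congr (_ - _); apply: eq_bigr => i _; rewrite mulrS.
have pm i : (p i - (sL i x0).+1 < p i)%N by have := wt_gt0 p i; lia.
have luv : lL (u - v) = -2.
  rewrite uvE lL_subvcn lL_degL big1 // => i _; by rewrite mnmE divn_small.
have suv i : sL i (u - v) = (p i - (sL i x0).+1)%N.
  by rewrite uvE sL_subvcn sL_degL mnmE modn_small.
have [n0 h0] := ev_and (ev_and (tfokP f) (tfokP g)) (ev_and fi (ev_and gs exg)).
pose O1 : coh k p := twist (line_bundle k y) (vomega p).
pose O2 : coh k p := twist (line_bundle k y) x0.
have hp1 x (a : O1) : hpart x a <-> homogA (u + x) (a : coordA k p) by rewrite homogAP /u -addrA.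
have hp2 x (a : O2) : hpart x a <-> homogA (v + x) (a : coordA k p) by rewrite homogAP /v -addrA.
have lyx (x z : Lgroup p) : 0 <= lL z -> n0%:Z <= lL x -> n0%:Z <= lL (z + x).
  by move=> lz lx; apply: le_trans (lLD_ge _ _); lia.
exists u, (fun i => sL i (u - v)).
suff [psi hpsi] : exists psi, ev (echart (M := E0) (mI u (fun i => sL i (u - v))) (fac k u)
    (cI u (fun i => sL i (u - v)) i2) (cI u (fun i => sL i (u - v)) i3) psi).
  have [psi' hpsi'] := echart_iso iso hpsi; exists psi'; split=> //.
    by move=> i; rewrite suv; have := sx0 i; have := wt_gt0 p i; lia.
  have lu : ev (fun x : Lgroup p => 0 <= lL (x + u)) by apply: ev_shift (ev_ge p 0).
  have lv : ev (fun x : Lgroup p => 0 <= lL (x + v)) by apply: ev_shift (ev_ge p 0).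
  apply: ev_imp (ev_and (ev_and lu lv) (ev_and (iso_card iso) (texact_card fi te))).
  move=> x [[{}lu {}lv] [<- ->]]; rewrite !ncard_homog -expnD.
  exists (dsz (y + x0 + x)%R + dsz (y + vomega p + x)%R)%N => //.
  rewrite -/u -/v PoszD [u + x]addrC (dszE lu); rewrite addrC in lv.
  rewrite (dszE lv) (@lL_cc p u v 0 luv _ (leqnn _)) /chi /mI /cI /=; lia.
pose iota (x : Lgroup p) (a : coordA k p) : E0 := tf f x (a : O1).
pose ppi (x : Lgroup p) (m : E0) : coordA k p := tf g x m.
have iH x a : n0%:Z <= lL x -> homogA (u + x) a -> hpart x (iota x a).
  by move=> lx ha; have [[o1 _] _] := h0 x lx; apply: (tf_hpart o1); exact/hp1.
have iD x a b : n0%:Z <= lL x -> homogA (u + x) a -> homogA (u + x) b ->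
    iota x (a + b) = iota x a + iota x b.
  by move=> lx ha hb; have [[o1 _] _] := h0 x lx; apply: (tfD o1); exact/hp1.
have iZ x z a b : n0%:Z <= lL x -> 0 <= lL z -> homogA z b -> homogA (u + x) a ->
    iota (z + x) (b * a) = b *: iota x a.
  move=> lx lz hb ha; have [[o1 _] _] := h0 x lx; have [[o1' _] _] := h0 _ (lyx x z lz lx).
  by apply: (tfZ o1 o1' hb); exact/hp1.
have iI x a : n0%:Z <= lL x -> homogA (u + x) a -> iota x a = 0 -> a = 0.
  by move=> lx ha; have [_ [i1' _]] := h0 x lx; apply: i1'; exact/hp1.
have pH x m : n0%:Z <= lL x -> hpart x m -> homogA (v + x) (ppi x m).
  by move=> lx hm; have [[_ o2] _] := h0 x lx; apply/hp2; exact: (tf_hpart o2).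
have pD x m m' : n0%:Z <= lL x -> hpart x m -> hpart x m' -> ppi x (m + m') = ppi x m + ppi x m'.
  by move=> lx hm hm'; have [[_ o2] _] := h0 x lx; exact: (tfD o2).
have pZ x z b m : n0%:Z <= lL x -> 0 <= lL z -> homogA z b -> hpart x m ->
    ppi (z + x) (b *: m) = b * ppi x m.
  move=> lx lz hb hm; have [[_ o2] _] := h0 x lx; have [[_ o2'] _] := h0 _ (lyx x z lz lx).
  exact: (tfZ o2 o2' hb).
have ip0 x a : n0%:Z <= lL x -> homogA (u + x) a -> ppi x (iota x a) = 0.
  move=> lx ha; have [_ [_ [_ e]]] := h0 x lx; apply/e; first exact: iH.
  by exists a => //; exact/hp1.
have ex x m : n0%:Z <= lL x -> hpart x m -> ppi x m = 0 -> exists2 a, homogA (u + x) a & iota x a = m.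
  move=> lx hm; have [_ [_ [_ e]]] := h0 x lx; move=> /(e m hm)[a /hp1 ha <-]; by exists a.
have su x a : n0%:Z <= lL x -> homogA (v + x) a -> exists2 m, hpart x m & ppi x m = a.
  by move=> lx ha; have [_ [_ [s _]]] := h0 x lx; apply: s; exact/hp2.
have ns : ~ exists (sec : Lgroup p -> coordA k p -> E0) (n1 : nat), forall x, n1%:Z <= lL x ->
  [/\ forall a, homogA (v + x) a -> hpart x (sec x a) /\ ppi x (sec x a) = a,
      forall a b, homogA (v + x) a -> homogA (v + x) b -> sec x (a + b) = sec x a + sec x b,
      forall c a, homogA (v + x) a -> sec x (kA p c * a) = kA p c *: sec x a &
      forall i a, homogA (v + x) a -> sec (vx p i + x) (XA k p i * a) = XA k p i *: sec x a].
  move=> [sec [n1 hs]]; apply: nsp.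
  have [||||s es] := @mk_arrow k p O2 E0 sec n1.
  - by move=> x a lx /hp2 ha; have [h _ _ _] := hs x lx; exact: (h a ha).1.
  - by move=> x a a' lx /hp2 ha /hp2 ha'; have [_ h _ _] := hs x lx; exact: (h a a' ha ha').
  - by move=> x c a lx /hp2 ha; have [_ _ h _] := hs x lx; exact: (h c a ha).
  - by move=> x i a lx /hp2 ha; have [_ _ _ h] := hs x lx; exact: (h i a ha).
  exists s; apply/heqP.
  apply: ev_imp (ev_and (ev_and es (tf_comp g s)) (ev_and (tf_id O2) (ev_ge p n1))).
  move=> x [[e1 e2] [e3 lx]] a ha; rewrite e2 // e1 // e3 //.
  by have [h _ _ _] := hs x lx; apply: (h a _).2; exact/hp2.
have [m1 [m2 [lam [et [h1 h2 h3 h4 [h5 h6 h7]]]]]] := norm_lifts iH iD iZ pD pZ ip0 ex su luv (leqnn _).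
eexists; exists (n0 + `|lL v| + `|lL u|)%N => x hx.
exact: (psi_chart iH iD iZ iI pH pD pZ ip0 ex su ns luv (leqnn _) h1 h2 h3 h4 h5 h6 h7 hx).
Qed.

(** * Changes of coordinates that complement the linear conditions *)

Section ChartChange.
Variables (k : finFieldType) (p : weights) (M : gmod k p).
Local Notation L := (Lgroup p).
Local Notation PP := ({poly k} * {poly k})%type.
Variables (mm mm' : L -> int) (F F' : 'I_3 -> L -> {poly k}) (C2 C3 C2' C3' : L -> bool).
Variables (Aop : PP -> PP) (pp : L -> {poly k}).
Hypothesis AD : forall r s, Aop (r + s) = Aop r + Aop s.
Hypothesis AZ : forall f r, Aop (pmul f r) = pmul f (Aop r).
Hypothesis A0 : forall r, Aop r = 0 -> r = 0.
Hypothesis pp0 : forall x, pp x != 0.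
Hypothesis dn : ev (fun x => forall r, inB (mm x) (C2 x) (C3 x) r ->
  exists2 s, inB (mm' x) (C2' x) (C3' x) s & pmul (pp x) s = Aop r).
Hypothesis up : ev (fun x => forall s, inB (mm' x) (C2' x) (C3' x) s ->
  exists2 r, inB (mm x) (C2 x) (C3 x) r & pmul (pp x) s = Aop r).
Hypothesis FE : forall i x, F i x * pp x = F' i x * pp (vx p i + x).

(** The new coordinates are [Aop r] divided by [pp x], a denominator that varies with the degree;
    [dn] and [up] say that the bounded sets correspond under this division. *)
Lemma chart_change psi : ev (echart (M := M) mm F C2 C3 psi) ->
  exists psi', ev (echart (M := M) mm' F' C2' C3' psi').
Proof.
move=> ch; pose psi' x m : PP := xget 0 [set s | pmul (pp x) s = Aop (psi x m)].
exists psi'; apply: ev_imp (ev_and (ev_and (ev_up ch) (ev_up dn)) up) => x [[{}ch dn'] up'].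
have P y m : lL x <= lL y -> hpart y m -> pmul (pp y) (psi' y m) = Aop (psi y m).
  move=> ly hm; have [_ _ _ im _] := ch y ly.
  have [|s _ es] := dn' y ly (psi y m); first by apply/im; exists m.
  by rewrite /psi'; case: xgetP => [t _ /= ->//|/(_ s)[]].
have [c1 c2 c3 c4 c5] := ch x (lexx _).
have inj := pmul_inj (pp0 x).
split.
- move=> m m' hm hm'; apply: inj; rewrite pmulD !P // ?c1 ?AD //; exact: hpartD.
- move=> c m hm; apply: inj; rewrite (P _ _ (lexx _) (hpartkA c hm)) c2 // AZ -(P _ _ (lexx _) hm) !pmulA mulrC //.
- move=> m hm e; apply: c3 => //; apply: A0; rewrite -P // e /pmul /= !mulr0 //.
- move=> s; split.
    move=> /up'[r /c4[m hm <-] e]; exists m => //; apply: inj; by rewrite P.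
  case=> m hm <-; have [|s' hs' es] := dn' x (lexx _) (psi x m); first by apply/c4; exists m.
  by rewrite (inj (psi' x m) s') // es P.
- move=> i m hm; have hX : hpart (vx p i + x) (XA k p i *: m).
    by apply: hpartZ hm; exact: homog_XA.
  apply: (pmul_inj (pp0 (vx p i + x))); rewrite (P _ _ (lL_vx_ge _ _) hX) c5 // AZ -(P _ _ (lexx _) hm) !pmulA FE mulrC //.
Qed.

End ChartChange.

Ltac lebd := solve [match goal with H : is_true (_ <= _)%R |- _ => apply: (le_trans H); lia end].

Section Swap.
Variable k : fieldType.
Implicit Types (a b q P : {poly k}) (r s : {poly k} * {poly k}) (m : int).

Lemma sz2D a b m : (2 * size a)%:Z <= m -> (2 * size b)%:Z <= m -> (2 * size (a + b)%R)%:Z <= m.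
Proof. by move=> h1 h2; have := size_polyD a b; lia. Qed.

Lemma sz2B a b m : (2 * size a)%:Z <= m -> (2 * size b)%:Z <= m -> (2 * size (a - b)%R)%:Z <= m.
Proof. by move=> h1 h2; apply: sz2D => //; rewrite size_polyN. Qed.

Lemma sz2M P q m : size P = 2 -> (2 * size q)%:Z <= m -> (2 * size (P * q)%R)%:Z <= m + 2.
Proof. by move=> sP h; have := size_polyMleq P q; rewrite sP; lia. Qed.

Lemma sz2V P q m : size P = 2 -> 0 <= m -> (2 * size (P * q)%R)%:Z <= m + 2 -> (2 * size q)%:Z <= m.
Proof.
move=> sP m0; have [->|q0] := eqVneq q 0; first by rewrite size_poly0.
have e : size (P * q) = (size q).+1 by rewrite size_mul ?sP // -size_poly_gt0 sP.
by rewrite e mulnS PoszD addrC lerD2r.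
Qed.

Lemma root_div (c : k) a : a.[c] = 0 -> exists q, a = ('X - c%:P) * q.
Proof.
by move=> /rootP; rewrite -dvdp_XsubCl => /dvdpP[/= q e]; exists q; rewrite mulrC.
Qed.

Let X0 : 'X = 'X - 0%:P :> {poly k}. Proof. by rewrite subr0. Qed.
Let sX : size ('X : {poly k}) = 2. Proof. exact: size_polyX. Qed.
Let sX1 : size ('X - 1%:P : {poly k}) = 2. Proof. exact: size_XsubC. Qed.

(** [op12] complements the condition at 0 and keeps the one at 1; [op13] complements the condition
    at 1 and keeps the one at 0. Where the condition was imposed the image is divisible by t, or by
    t - 1, and is divided by it, so m drops by one; elsewhere the image acquires the condition and m
    grows by one. *)
Definition op12 r : {poly k} * {poly k} := (r.2, 'X * r.1).
Definition op13 r : {poly k} * {poly k} := (r.1 - r.2, 'X * r.1 - r.2).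

Lemma swap12_dn m (c2 c3 : bool) r : 2 <= m -> inB m c2 c3 r ->
  exists2 s, inB (m + 1 - 2 * c2%:Z) (~~ c2) c3 s & pmul 'X^c2 s = op12 r.
Proof.
case: r => r1 r2 m2 [/= s1 s2 z2 z3]; case: c2 z2 => z2.
  have [q eq] := root_div (z2 isT); rewrite -X0 in eq; exists (q, r1) => /=; last first.
    by rewrite /pmul /op12 /= expr1 eq.
  split=> //=; try lebd.
    apply: (sz2V sX); [lia|rewrite -eq; lebd].
  by move=> /z3 ->; rewrite eq hornerM hornerX mul1r.
exists (r2, 'X * r1); last by rewrite /pmul /op12 /= expr0 !mul1r.
split=> //=; try lebd.
- by apply: le_trans (sz2M sX s1) _; lia.
- by rewrite hornerM hornerX mul0r.
- by move=> /z3 <-; rewrite hornerM hornerX mul1r.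
Qed.

Lemma swap12_up m (c2 c3 : bool) s : 2 <= m -> inB (m + 1 - 2 * c2%:Z) (~~ c2) c3 s ->
  exists2 r, inB m c2 c3 r & pmul 'X^c2 s = op12 r.
Proof.
case: s => s1 s2 m2 [/= h1 h2 z2 z3]; case: c2 z2 h1 h2 => z2 h1 h2.
  exists (s2, 'X * s1); last by rewrite /pmul /op12 /= expr1.
  split=> //=; try lebd.
  - by apply: le_trans (sz2M sX h1) _; lia.
  - by rewrite hornerM hornerX mul0r.
  - by move=> /z3 <-; rewrite hornerM hornerX mul1r.
have [q eq] := root_div (z2 isT); rewrite -X0 in eq; exists (q, s1); last first.
  by rewrite /pmul /op12 /= expr0 !mul1r eq.
split=> //=; try lebd.
  by apply: (sz2V sX); [lia|rewrite -eq; lebd].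
by move=> /z3 ->; rewrite eq hornerM hornerX mul1r.
Qed.

Lemma swap13_dn m (c2 c3 : bool) r : 2 <= m -> inB m c2 c3 r ->
  exists2 s, inB (m + 1 - 2 * c3%:Z) c2 (~~ c3) s & pmul (('X - 1) ^+ c3) s = op13 r.
Proof.
case: r => r1 r2 m2 [/= s1 s2 z2 z3]; case: c3 z3 => z3.
  have [|q eq] := @root_div 1 (r1 - r2); first by rewrite hornerD hornerN z3 // subrr.
  have sq : (2 * size q)%:Z <= m - 1.
    apply: (sz2V sX1); first by lia.
    by rewrite -eq; apply: sz2B; lebd.
  exists (q, r1 + q); last first.
    rewrite /pmul /op13 /= expr1 eq; congr pair; rewrite mulrDr -eq; change (1%:P) with (1 : {poly k}); ring.
  split=> //=; try lebd.
    by apply: sz2D; lebd.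
  move=> /z2 e; have := congr1 (horner^~ 0) eq; rewrite hornerM !hornerE e => h.
  by move: h; rewrite subr0 mulN1r => ->; rewrite addNr.
exists (r1 - r2, 'X * r1 - r2); last by rewrite /pmul /op13 /= expr0 !mul1r.
split=> //=.
- by apply: sz2B; lebd.
- by apply: sz2B; [apply: le_trans (sz2M sX s1) _; lia|lebd].
- by move=> /z2 e; rewrite hornerD hornerN hornerM hornerX mul0r e subr0.
- by move=> _; rewrite !hornerD !hornerN hornerM hornerX mul1r.
Qed.

Lemma swap13_up m (c2 c3 : bool) s : 2 <= m -> inB (m + 1 - 2 * c3%:Z) c2 (~~ c3) s ->
  exists2 r, inB m c2 c3 r & pmul (('X - 1) ^+ c3) s = op13 r.
Proof.
case: s => s1 s2 m2 [/= h1 h2 z2 z3]; case: c3 z3 h1 h2 => z3 h1 h2.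
  have hh : (2 * size (('X - 1%:P) * s1)%R)%:Z <= m + 1 by apply: le_trans (sz2M sX1 h1) _; lia.
  have hr : (2 * size (s2 - s1)%R)%:Z <= m by apply: sz2B; lebd.
  exists (s2 - s1, s2 - s1 - ('X - 1%:P) * s1); last first.
    by rewrite /pmul /op13 /= expr1; change (1%:P) with (1 : {poly k}); congr pair; ring.
  split=> //=.
  - by apply: sz2B => //; lebd.
  - by move=> /z2 e; rewrite !hornerE e; ring.
  - by move=> _; rewrite !hornerE; ring.
have [|q eq] := @root_div 1 (s2 - s1); first by rewrite hornerD hornerN z3 // subrr.
have sq : (2 * size q)%:Z <= m.
  apply: (sz2V sX1); first by lia.
  by rewrite -eq; apply: sz2B; lebd.
exists (q, q - s1); last first.
  have {}eq : s2 = ('X - 1%:P) * q + s1 by rewrite -eq subrK.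
  by rewrite /pmul /op13 /= expr0 eq; change (1%:P) with (1 : {poly k}); congr pair; ring.
split=> //=.
- by apply: sz2B => //; lebd.
- move=> /z2 e; have := congr1 (horner^~ 0) eq; rewrite hornerM !hornerE e => h.
  by move: h; rewrite !sub0r mulN1r => /oppr_inj ->; rewrite subrr.
Qed.

End Swap.

Section Normalise.
Variables (k : finFieldType) (p : weights) (M : gmod k p).
Local Notation L := (Lgroup p).

Lemma echart_ext (mm mm1 : L -> int) F F1 (C2 C3 C21 C31 : L -> bool) psi :
  ev (fun x => [/\ mm x = mm1 x, forall i, F i x = F1 i x, C2 x = C21 x & C3 x = C31 x]) ->
  ev (echart (M := M) mm F C2 C3 psi) -> ev (echart (M := M) mm1 F1 C21 C31 psi).
Proof.
move=> h1 h2; apply: ev_imp (ev_and h1 h2) => x [[e1 e2 e3 e4]].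
rewrite /echart e1 e3 e4 => -[a1 a2 a3 a4 a5]; split=> // i m hm.
by rewrite a5 // e2.
Qed.

Lemma swap12 (mm : L -> int) (C2 C3 : L -> bool) psi : (forall c : int, ev (fun x => c <= mm x)) ->
  (forall i x, i != i2 -> C2 (vx p i + x) = C2 x) ->
  ev (echart (M := M) mm (facC k C2 C3) C2 C3 psi) ->
  exists psi', ev (echart (M := M) (fun x => mm x + 1 - 2 * (C2 x)%:Z)
    (facC k (fun x => ~~ C2 x) C3) (fun x => ~~ C2 x) C3 psi').
Proof.
move=> hm h2; apply: (@chart_change k p M _ _ _ _ _ _ _ _ (@op12 k) (fun x => 'X^(C2 x))).
- by move=> r s; rewrite /op12 /= mulrDr.
- by move=> f r; rewrite /op12 /pmul /= mulrCA.
- move=> [r1 r2] [/= -> /eqP]; rewrite mulf_eq0 polyX_eq0 /= => /eqP -> //.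
- by move=> x; rewrite expf_neq0 ?polyX_eq0.
- by apply: ev_imp (hm 2) => x m2 r; exact: swap12_dn.
- by apply: ev_imp (hm 2) => x m2 r; exact: swap12_up.
- move=> i x; rewrite /facC; elim/ord3P: i => /=.
  + by rewrite h2.
  + by case: (C2 x) (C2 (vx p i2 + x)) => [] [] /=; rewrite ?expr0 ?expr1 ?mul1r ?mulr1.
  + by rewrite h2.
Qed.

Lemma swap13 (mm : L -> int) (C2 C3 : L -> bool) psi : (forall c : int, ev (fun x => c <= mm x)) ->
  (forall i x, i != i3 -> C3 (vx p i + x) = C3 x) ->
  ev (echart (M := M) mm (facC k C2 C3) C2 C3 psi) ->
  exists psi', ev (echart (M := M) (fun x => mm x + 1 - 2 * (C3 x)%:Z)
    (facC k C2 (fun x => ~~ C3 x)) C2 (fun x => ~~ C3 x) psi').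
Proof.
have X1 : ('X - 1 : {poly k}) != 0 by exact: (tau_neq0 k i3).
move=> hm h3; apply: (@chart_change k p M _ _ _ _ _ _ _ _ (@op13 k) (fun x => ('X - 1) ^+ (C3 x))).
- move=> r s; rewrite /op13 /=; congr pair => /=; ring.
- move=> f r; rewrite /op13 /pmul /=; congr pair => /=; ring.
- move=> [r1 r2] [/= /eqP]; rewrite subr_eq0 => /eqP -> /eqP.
  rewrite -{2}[r2]mul1r -mulrBl mulf_eq0 (negPf X1) /= => /eqP -> //.
- by move=> x; rewrite expf_neq0.
- by apply: ev_imp (hm 2) => x m2 r; exact: swap13_dn.
- by apply: ev_imp (hm 2) => x m2 r; exact: swap13_up.
- move=> i x; rewrite /facC; elim/ord3P: i => /=.
  + by rewrite h3.
  + by rewrite h3.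
  + by case: (C3 x) (C3 (vx p i3 + x)) => [] [] /=; rewrite ?expr0 ?expr1 ?mul1r ?mulr1.
Qed.

(** Since the [chi] differ by a constant, the conditions of both charts switch at the same steps, so
    each condition of one chart is that of the other up to a fixed complement. A swap undoes the
    complement, and the degree bounds then differ by D. *)
Lemma norm_chart (u u' : L) (b b' : 'I_3 -> nat) (D : nat) psi :
  (forall i, (0 < b i < p i)%N) -> (forall i, (0 < b' i < p i)%N) ->
  ev (fun x => chi u b x = chi u' b' x + D%:Z) ->
  ev (echart (M := M) (mI u' b') (fac k u') (cI u' b' i2) (cI u' b' i3) psi) ->
  exists psi', ev (echart (M := M) (fun x => mI u b x - D%:Z) (fac k u) (cI u b i2) (cI u b i3) psi').
Proof.
move=> hb hb' [n0 hchi] ch.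
have cst i : i != i1 -> exists e : bool, forall x, n0%:Z <= lL x -> cI u' b' i x = e (+) cI u b i x.
  move=> ni; have [x0 lx0] := ev_ex (ev_ge p n0).
  exists (cI u' b' i x0 (+) cI u b i x0) => x lx.
  suff -> : cI u' b' i x0 (+) cI u b i x0 = cI u' b' i x (+) cI u b i x by rewrite addbK.
  apply: (@shift_const p _ (fun x => cI u' b' i x (+) cI u b i x) n0) => // {lx}x j lx.
  have [->|ne] := eqVneq j i; last by rewrite !cI_other // eq_sym.
  have := chi_step u hb x ni; have := chi_step u' hb' x ni.
  have lx' : n0%:Z <= lL (vx p i + x) by apply: le_trans lx (lL_vx_ge _ _).
  rewrite (hchi _ lx) (hchi _ lx').
  move: (cI u b i x) (cI u b i (vx p i + x)) (cI u' b' i x) (cI u' b' i (vx p i + x)).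
  by move=> [] [] [] [] /=; lia.
have [e2 he2] := cst i2 isT; have [e3 he3] := cst i3 isT.
have big (c : int) : ev (fun x => c <= mI u' b' x).
  have : ev (fun x : L => c <= lL (x + u')) by apply: ev_shift (ev_ge p c).
  have : ev (fun x : L => 0 <= lL (x + u')) by apply: ev_shift (ev_ge p 0).
  move=> h1 h2; apply: ev_imp (ev_and h1 h2) => x []; rewrite /mI; case: (cI _ _ _ _) => /=; lia.
have {}ch : ev (echart (M := M) (mI u' b') (facC k (cI u' b' i2) (cI u' b' i3)) (cI u' b' i2) (cI u' b' i3) psi).
  by apply: echart_ext ch; apply: ev_true => x; split=> // i; exact: fac_facC.
have [mm1 [psi1 [ch1 big1 mE1]]] : exists mm1 psi1,
   [/\ ev (echart (M := M) mm1 (facC k (fun x => e2 (+) cI u' b' i2 x) (cI u' b' i3))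
        (fun x => e2 (+) cI u' b' i2 x) (cI u' b' i3) psi1),
     forall c : int, ev (fun x => c <= mm1 x) &
     forall x, mm1 x - (e2 (+) cI u' b' i2 x)%:Z = mI u' b' x - (cI u' b' i2 x)%:Z].
  case: e2 {he2}.
    have [|psi1 h1] := swap12 big _ ch; first by move=> i x ni; rewrite cI_other // eq_sym.
    exists (fun x => mI u' b' x + 1 - 2 * (cI u' b' i2 x)%:Z), psi1; split=> //.
      by move=> c; apply: ev_imp (big (c + 1)) => x; case: (cI _ _ i2 _) => /=; lia.
    by move=> x; case: (cI _ _ i2 _) => /=; lia.
  by exists (mI u' b'), psi; split.
have [mm2 [psi2 [ch2 mE2]]] : exists mm2 psi2,
   ev (echart (M := M) mm2 (facC k (fun x => e2 (+) cI u' b' i2 x) (fun x => e3 (+) cI u' b' i3 x))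
        (fun x => e2 (+) cI u' b' i2 x) (fun x => e3 (+) cI u' b' i3 x) psi2) /\
     forall x, mm2 x - (e3 (+) cI u' b' i3 x)%:Z = mm1 x - (cI u' b' i3 x)%:Z.
  case: e3 {he3}.
    have [|psi2 h2] := swap13 big1 _ ch1; first by move=> i x ni; rewrite cI_other // eq_sym.
    exists (fun x => mm1 x + 1 - 2 * (cI u' b' i3 x)%:Z), psi2; split=> //.
    by move=> x; case: (cI _ _ i3 _) => /=; lia.
  by exists mm1, psi1; split.
exists psi2; apply: echart_ext ch2; exists n0 => x lx.
have c2 y : n0%:Z <= lL y -> e2 (+) cI u' b' i2 y = cI u b i2 y by move=> /he2 ->; rewrite addKb.
have c3 y : n0%:Z <= lL y -> e3 (+) cI u' b' i3 y = cI u b i3 y by move=> /he3 ->; rewrite addKb.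
split; rewrite ?c2 ?c3 //.
  have := hchi x lx; have := mE1 x; have := mE2 x; rewrite c2 // c3 // /chi; lia.
move=> i; rewrite (fac_facC u hb) /facC.
have lx' j : n0%:Z <= lL (vx p j + x) by apply: le_trans lx (lL_vx_ge _ _).
by rewrite !c2 // !c3.
Qed.

End Normalise.

(** * Subobjects and points of a projective line *)

Section MuRect.
Variables (k : finFieldType) (p : weights) (u : Lgroup p).
Local Notation A := (coordA k p).
Local Notation L := (Lgroup p).

Lemma smono_sL i (x : L) : sL i (\sum_j vx p j *+ sL j x : L) = sL i x.
Proof.
have -> : \sum_j vx p j *+ sL j x = x - vc p *~ lL x by rewrite {2}(normal_form x) addrK.
case: (lL x) => l; first by rewrite sL_subvcn.
by rewrite NegzE mulrNz opprK sL_addvcn.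
Qed.

Lemma th_smono1 (x : L) : th (smono k (x : L)) = 1.
Proof. by rewrite -[smono k x]mulr1 -etaR01 th_smono ?size_poly1. Qed.

Lemma mu_XM (y : L) a (x : L) i : homogA y a -> mu (XA k p i * a) (x + u) = fac k u i (y + x) * mu a (x + u).
Proof.
move=> ha; rewrite /mu -mulrA (th_XA _ (homogAM ha (homog_smono k (x + u)))) /fac.
by rewrite sLD smono_sL -sLD addrA.
Qed.

Lemma mu_etaR l (f : {poly k}) (x : L) : (size f <= l.+1)%N -> mu (etaR p l f) x = f.
Proof. by move=> sf; rewrite /mu th_etaRM // th_smono1 mulr1. Qed.

Lemma mu_TA i a (x : L) : mu (TA k p i * a) x = tau k i * mu a x.
Proof. by rewrite /mu -mulrA th_TA. Qed.

(** Induction on a through monomials, carrying along the polynomial by which it acts; it extends the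
    action of the X_i on a chart to all homogeneous elements. *)
Lemma mu_rect (R : L -> A -> {poly k} -> Prop) x :
  (forall y, 0 <= lL y -> R y 0 0) ->
  (forall y a b f g, 0 <= lL y -> homogA y a -> homogA y b -> R y a f -> R y b g -> R y (a + b) (f + g)) ->
  (forall c, R 0 (kA p c) c%:P) ->
  (forall y i a f, 0 <= lL y -> homogA y a -> R y a f -> R (vx p i + y) (XA k p i * a) (fac k u i (y + x) * f)) ->
  forall y a, 0 <= lL y -> homogA y a -> R y a (mu a (x + u)).
Proof.
move=> R0 RD Rk RX y a ly ha.
suff [_ /(_ ly)] : homogA y a /\ (0 <= lL y -> R y a (mu a (x + u))) by [].
move: y a ha {ly}; apply: homogA_ind.
- by move=> y; split=> [|ly]; [exact: homogA0|rewrite /mu mul0r th0; exact: R0].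
- move=> y a b [ha IHa] [hb IHb]; split=> [|ly]; first exact: homogAD.
  by rewrite /mu mulrDl thD; apply: RD; auto.
- move=> c; split=> [|_]; first exact: homog_kA.
  by rewrite /mu th_kA th_smono1 alg_polyC; exact: Rk.
- move=> y i a ha [_ IH]; split=> [|ly]; first by apply: homogAM => //; exact: homog_XA.
  have [l0|l0] := ltP (lL y) 0.
    by rewrite (homogA_lt0 ha l0) mulr0 /mu mul0r th0; exact: R0.
  by rewrite (mu_XM _ _ ha); apply: RX => //; exact: IH.
Qed.

(** Monomials act by products of t and t - 1, prime to ze because ze vanishes neither at 0 nor at
    1. *)
Lemma mu_Xl (ze : {poly k}) s (x : L) : irreducible_poly ze -> ze.[0] != 0 -> ze.[1] != 0 ->
  ~~ (ze %| mu (Xl k p s) (x + u)).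
Proof.
move=> irr z0 z1; have [sz _] := irr.
have nc (c : k) : ze.[c] != 0 -> ~~ (ze %| 'X - c%:P).
  move=> zc; apply/negP => dv.
  have : coprimep ze ('X - c%:P) by rewrite coprimep_XsubC /root zc.
  by move=> /(coprimep_dvdl dv); rewrite coprimepp gtn_eqF.
have nt i : ~~ (ze %| tau k i).
  elim/ord3P: i; rewrite ?tauE.
  - by rewrite dvdp1 gtn_eqF.
  - by rewrite -['X]subr0; exact: nc z0.
  - exact: nc z1.
elim: s => [|i s IH].
  by rewrite /Xl big_nil /mu mul1r th_smono1 dvdp1 gtn_eqF.
rewrite /Xl big_cons -/(Xl k p s) (mu_XM _ _ (homog_Xl k p s)) /fac.
apply/negP => /(ze_prime irr)/orP[]; last by apply/negP.
case: (_ == _); first by rewrite expr1; apply/negP.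
by rewrite expr0 dvdp1 gtn_eqF.
Qed.

End MuRect.

Section ChartAction.
Variables (k : finFieldType) (p : weights) (E : gmod k p) (u : Lgroup p).
Local Notation L := (Lgroup p).
Variables (mm : L -> int) (C2 C3 : L -> bool) (psi : L -> E -> {poly k} * {poly k}) (n0 : nat).
Local Notation hi x := (n0%:Z <= lL x).
Hypothesis chE : forall x, hi x -> echart mm (fac k u) C2 C3 psi x.
Implicit Types (x y : L).

Lemma hiD x y : 0 <= lL y -> hi x -> hi (y + x).
Proof. by move=> ly lx; apply: le_trans (lLD_ge _ _); lia. Qed.

Lemma hiX i x : hi x -> hi (vx p i + x).
Proof. by move=> lx; apply: le_trans lx (lL_vx_ge _ _). Qed.

Lemma psi0 x : hi x -> psi x 0 = 0.
Proof.
move=> lx; have [c1 _ _ _ _] := chE lx; have h0 := hpart0 E x.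
by apply: (addrI (psi x 0)); rewrite -c1 // !addr0.
Qed.

Lemma psi_inj x m m' : hi x -> hpart x m -> hpart x m' -> psi x m = psi x m' -> m = m'.
Proof.
move=> lx hm hm' e; have [c1 _ c3 _ _] := chE lx; have hB := hpartB hm hm'.
apply/eqP; rewrite -subr_eq0; apply/eqP; apply: c3 => //.
by apply: (addIr (psi x m')); rewrite -c1 // subrK add0r.
Qed.

Lemma psi_mu x y a m : hi x -> 0 <= lL y -> homogA y a -> hpart x m ->
  psi (y + x) (a *: m) = pmul (mu a (x + u)) (psi x m).
Proof.
move=> lx ly ha hm; move: y a ly ha.
apply: (@mu_rect k p u (fun y a f => psi (y + x) (a *: m) = pmul f (psi x m)) x).
- by move=> y ly; rewrite scale0r psi0 ?hiD // /pmul !mul0r.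
- move=> y a a' f g ly ha ha' ea ea'; have [c1 _ _ _ _] := chE (hiD ly lx).
  rewrite scalerDl c1; [|exact: hpartZ|exact: hpartZ].
  by rewrite ea ea' /pmul /= !mulrDl.
- by move=> c; rewrite add0r; have [_ c2 _ _ _] := chE lx; rewrite c2.
- move=> y i a f ly ha ea; have [_ _ _ _ c5] := chE (hiD ly lx).
  rewrite -scalerA -addrA c5; last exact: hpartZ.
  by rewrite ea /pmul /= !mulrA.
Qed.

End ChartAction.

Section Hall.
Variables (k : finFieldType) (p : weights) (d n : nat) (z : {mpoly k[2]}).
Hypothesis Hz : ordinary_point d z.
Local Notation A := (coordA k p).
Local Notation L := (Lgroup p).
Local Notation C := (coh k p).
Local Notation ze := (zeta z).
Local Notation D := (d * n)%N.
Local Notation PP := ({poly k} * {poly k})%type.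
Variables (E S : C) (u : L) (b : 'I_3 -> nat).
Hypothesis hb : forall i, (0 < b i < p i)%N.
Local Notation mm := (mI u b).
Local Notation C2 := (cI u b i2).
Local Notation C3 := (cI u b i3).
Variables (psi : L -> E -> PP) (sg : L -> {poly k} -> S) (n0 : nat).
Local Notation hi x := (n0%:Z <= lL x).
Hypothesis chE : forall x, hi x -> echart mm (fac k u) C2 C3 psi x.
Hypothesis chS : forall x, hi x -> schart ze n u sg x.
Hypothesis big : forall x, hi x -> (2 * (D + 10))%:Z <= mm x.

Let irr := zeta_irr Hz.
Implicit Types (x y : L).

Lemma sg0 x : hi x -> sg x 0 = 0.
Proof. by move=> lx; have [_ _ _ _ [h _]] := chS lx; apply/h; exact: dvdp0. Qed.

Lemma sg_mu x y a f : hi x -> 0 <= lL y -> homogA y a ->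
  a *: sg x f = sg (y + x) (mu a (x + u) * f).
Proof.
move=> lx ly ha; move: y a ly ha.
apply: (@mu_rect k p u (fun y a g => a *: sg x f = sg (y + x) (g * f)) x).
- by move=> y ly; rewrite scale0r mul0r sg0 // hiD.
- move=> y a a' g g' ly ha ha' ea ea'; have [_ c1 _ _ _] := chS (hiD ly lx).
  by rewrite scalerDl ea ea' mulrDl c1.
- by move=> c; rewrite add0r mul_polyC; have [_ _ c2 _ _] := chS lx; rewrite c2.
- move=> y i a g ly ha ea; have [_ _ _ _ [_ c5]] := chS (hiD ly lx).
  by rewrite -scalerA ea c5 addrA mulrA.
Qed.

Lemma sg_eq x f g : hi x -> sg x f = sg x g <-> ze ^+ n %| f - g.
Proof.
move=> lx; have [_ c1 _ _ [c0 _]] := chS lx; rewrite -c0.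
have e : sg x f = sg x (f - g) + sg x g by rewrite -c1 subrK.
by split=> h; [apply: (addIr (sg x g)); rewrite -e h add0r|rewrite e h add0r].
Qed.

Definition Lf (pt r : PP) : {poly k} := pt.1 * r.1 + pt.2 * r.2.

Lemma LfM pt f r : Lf pt (pmul f r) = f * Lf pt r.
Proof. by rewrite /Lf /pmul /= mulrDr; congr (_ + _); rewrite mulrCA. Qed.

Lemma LfD pt r s : Lf pt (r + s) = Lf pt r + Lf pt s.
Proof. by rewrite /Lf /= !mulrDr addrACA. Qed.

Lemma arrow_pt (pt : PP) : exists g : Hom E S,
  ev (fun x => forall m, hpart x m -> tf g x m = sg x (Lf pt (psi x m))).
Proof.
apply: (@mk_arrow k p E S (fun x m => sg x (Lf pt (psi x m))) n0).
- by move=> x m lx hm; have [h _ _ _ _] := chS lx.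
- move=> x m m' lx hm hm'; have [c1 _ _ _ _] := chE lx; have [_ s1 _ _ _] := chS lx.
  by rewrite c1 // LfD s1.
- move=> x c m lx hm; have [_ c2 _ _ _] := chE lx; have [_ _ s2 _ _] := chS lx.
  by rewrite c2 // LfM mul_polyC s2.
- move=> x i m lx hm; have [_ _ _ _ c5] := chE lx; have [_ _ _ _ [_ s5]] := chS lx.
  by rewrite c5 // LfM s5.
Qed.

Local Notation tt1 := ('X * ('X - 1) : {poly k}).

Lemma nze_tt1 : ~~ (ze %| tt1).
Proof.
have [sz _] := irr.
have nc (c : k) : ze.[c] != 0 -> ~~ (ze %| 'X - c%:P).
  move=> zc; apply/negP => dv.
  have : coprimep ze ('X - c%:P) by rewrite coprimep_XsubC /root zc.
  by move=> /(coprimep_dvdl dv); rewrite coprimepp gtn_eqF.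
apply/negP => /(ze_prime irr)/orP[]; last by apply/negP; exact: nc (zeta_1 Hz).
by rewrite -['X]subr0; apply/negP; exact: nc (zeta_0 Hz).
Qed.

Lemma size_tt1 : size tt1 = 3.
Proof.
rewrite size_mul ?polyX_eq0 ?(tau_neq0 k i3) // size_polyX.
by have -> : size ('X - 1 : {poly k}) = 2 by exact: (size_XsubC 1).
Qed.

(** Multiples of t(t - 1) meet both conditions in every degree, and this factor is invertible modulo
    ze^n. It turns arbitrary small pairs into elements of E without loss for arrows to S; the margin
    in [big] leaves room for it. *)
Lemma B_small x (r : PP) : hi x -> (size r.1 <= D + 5)%N -> (size r.2 <= D + 5)%N ->
  inB (mm x) (C2 x) (C3 x) (pmul tt1 r).
Proof.
move=> lx s1 s2; have hs (f : {poly k}) : (size f <= D + 5)%N -> (size (tt1 * f)%R <= D + 7)%N.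
  move=> sf; apply: leq_trans (size_polyMleq _ _) _; rewrite size_tt1 -subn1 leq_subLR.
  by apply: leq_trans (leq_add (leqnn 3) sf) _; lia.
have bd (f : {poly k}) : (size f <= D + 7)%N -> (2 * size f)%:Z <= mm x.
  move=> sf; apply: le_trans (big lx); rewrite lez_nat leq_mul2l /=.
  by apply: leq_trans sf _; rewrite leq_add2l.
have h0 (f : {poly k}) : (tt1 * f).[0] = 0 by rewrite !hornerM hornerX !mul0r.
have h1 (f : {poly k}) : (tt1 * f).[1] = 0.
  by rewrite !hornerM hornerD hornerN hornerX (hornerC 1 1 : (1 : {poly k}).[1] = 1) subrr mulr0 mul0r.
split=> /=; first by apply: bd; exact: hs.
- by apply: le_trans (bd _ (hs _ s2)) _; rewrite lerDl.
- by move=> _; exact: h0.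
- by move=> _; rewrite !h1.
Qed.

(** The arrow is determined by its values on e1 and e2, whose pairs are t(t - 1) times the unit
    vectors: a suitable multiple of any m is a combination of them, and the multiplier acts on S by
    a polynomial prime to ze. *)
Lemma arrow_form (g : Hom E S) : exists pt : PP,
  ev (fun x => forall m, hpart x m -> tf g x m = sg x (Lf pt (psi x m))).
Proof.
have [n1 h1] := ev_and (tfokP g) (ev_ge p n0).
have [x1 [okx1 lx1]] := ev_ex (ev_and (ev_up (tfokP g)) (ev_ge p n0)).
have [s1h _ _ s1s _] := chS lx1; have [_ _ _ c4 _] := chE lx1.
have one : (size (1%R : {poly k}) <= D + 5)%N by rewrite size_poly1 addnS.
have zer : (size (0%R : {poly k}) <= D + 5)%N by rewrite size_poly0.
have [e1 he1 pe1] := proj1 (c4 _) (@B_small x1 (1, 0) lx1 one zer).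
have [e2 he2 pe2] := proj1 (c4 _) (@B_small x1 (0, 1) lx1 zer one).
have ok1 := okx1 x1 (lexx _).
have [a1 ea1] := s1s _ (tf_hpart ok1 he1); have [a2 ea2] := s1s _ (tf_hpart ok1 he2).
have [w hw] := ze_inv irr n nze_tt1.
exists (w * a1, w * a2), n1 => x lx m hm.
have [okx lx0] := h1 x lx; have [_ _ _ sx _] := chS lx0.
have [h eh] := sx _ (tf_hpart okx hm); rewrite -eh; apply/(sg_eq _ _ lx0).
pose N := `|lL (x1 - x)%R|%N.
have ly : 0 <= lL (x1 - x + vc p *+ N) by rewrite lL_addvcn /N; lia.
have [s _ ds] := eta1_Xl k ly; set y := x1 - x + vc p *+ N in ly ds.
have hs : homogA y (Xl k p s) by rewrite -ds; exact: homog_Xl.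
pose P := mu (Xl k p s) (x + u).
have nP : ~~ (ze %| P) by apply: mu_Xl; [exact: irr|exact: (zeta_0 Hz)|exact: (zeta_1 Hz)].
pose r := psi x m.
have [K K1 K2] : exists2 K, (size (P * r.1)%R <= K)%N & (size (P * r.2)%R <= K)%N.
  by exists (size (P * r.1)%R + size (P * r.2)%R)%N; [exact: leq_addr|exact: leq_addl].
(* T2 and T3 contribute t(t - 1), the monomial moves the degree into the class of x1 modulo c, and
   T1^K only raises the degree until the coefficients fit. *)
pose bb := TA k p i1 ^+ K * (TA k p i2 * (TA k p i3 * Xl k p s)).
pose yb : L := vc p *+ K + (vc p + (vc p + y)).
have hbb : homogA yb bb.
  apply: homogAM; first by apply: homogAX; exact: homog_TA.
  by do 2!(apply: homogAM; first exact: homog_TA).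
have lvc : 0 <= lL (vc p) by rewrite lL_vc.
have lyb : 0 <= lL yb.
  by rewrite /yb addrC lL_addvcn !(addrC (vc p)) !lL_addvc; lia.
have mbb : mu bb (x + u) = tt1 * P.
  have mn j a (v : L) : mu (TA k p i1 ^+ j * a) v = mu a v.
    by elim: j => [|j IH]; rewrite ?expr0 ?mul1r // exprS -mulrA mu_TA tauE mul1r.
  by rewrite /bb mn !mu_TA !tauE mulrA.
pose l := (K + 2 + N)%N.
have dE : yb + x = vc p *+ l + x1.
  rewrite /yb /y /l !mulrnDr mulr2n -!addrA; congr (_ + (_ + (_ + _))).
  by rewrite (addrC (vc p *+ N)) addKr addrC.
have lvl : 0 <= lL (vc p *+ l) by rewrite -[_ *+ _]add0r lL_addvcn lL0.
have z1 : (size (P * r.1)%R <= l.+1)%N by apply: leq_trans K1 _; rewrite /l; lia.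
have z2 : (size (P * r.2)%R <= l.+1)%N by apply: leq_trans K2 _; rewrite /l; lia.
have hy := hiD lyb lx0; have [c1 _ _ _ _] := chE hy.
have hr1 : hpart (yb + x) (etaR p l (P * r.1) *: e1).
  by rewrite dE; apply: hpartZ he1; exact: homog_etaR.
have hr2 : hpart (yb + x) (etaR p l (P * r.2) *: e2).
  by rewrite dE; apply: hpartZ he2; exact: homog_etaR.
have key : bb *: m = etaR p l (P * r.1) *: e1 + etaR p l (P * r.2) *: e2.
  apply: (psi_inj chE hy); [exact: hpartZ|exact: hpartD|].
  rewrite (psi_mu chE lx0 lyb hbb hm) mbb c1 // dE.
  rewrite (psi_mu chE lx1 lvl (homog_etaR _ _ _) he1) (psi_mu chE lx1 lvl (homog_etaR _ _ _) he2).
  rewrite !mu_etaR // pe1 pe2 /pmul -/r /=; congr pair => /=; ring.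
have [_ s1 _ _ _] := chS hy.
have nb : n1%:Z <= lL (yb + x) by apply: le_trans (lLD_ge _ _); move: lx lyb; lia.
have [oky _] := h1 _ nb.
have : sg (yb + x) (tt1 * P * h) = sg (yb + x) (P * r.1 * a1 + P * r.2 * a2).
  rewrite -mbb -(sg_mu _ lx0 lyb hbb) eh -(tfZ okx oky hbb hm) key tfD // s1.
  have okl : tfok g (vc p *+ l + x1) by apply: okx1; apply: le_trans (lLD_ge _ _); move: lvl; lia.
  rewrite dE !(tfZ ok1 okl (homog_etaR _ _ _)) // -ea1 -ea2.
  by rewrite !(sg_mu _ lx1 lvl (homog_etaR _ _ _)) !mu_etaR.
move=> /(sg_eq _ _ hy) dv.
have nPt : ~~ (ze %| tt1 * P).
  by apply/negP => /(ze_prime irr)/orP[]; apply/negP; [exact: nze_tt1|].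
apply: (ze_cancel irr nPt); rewrite /Lf -/r /=.
have -> : tt1 * P * (h - (w * a1 * r.1 + w * a2 * r.2)) =
    tt1 * P * h - (P * r.1 * a1 + P * r.2 * a2) - (w * tt1 - 1) * (P * r.1 * a1 + P * r.2 * a2) by ring.
by apply: dvdp_sub => //; exact: dvdp_mulr.
Qed.

End Hall.

(** * Degrees of pairs *)

Section Degree.
Variable k : fieldType.
Local Notation PP := ({poly k} * {poly k})%type.
Implicit Types (r s : PP) (f : {poly k}).

(** The least natural m whose bounds in [inB] admit the pair. A nonzero first component contributes
    an even value, a nonzero second one an odd value. *)
Definition nd r : nat := maxn (2 * size r.1) (2 * size r.2).-1.
Definition cc2 r : bool := r.2.[0] == 0.
Definition cc3 r : bool := r.1.[1] == r.2.[1].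

Lemma inB_nd (m : nat) c2 c3 r : inB m%:Z c2 c3 r <->
  [/\ (nd r <= m)%N, c2 -> cc2 r & c3 -> cc3 r].
Proof.
rewrite /inB /nd geq_max; move: (size r.1) (size r.2) => a b.
split=> [[h1 h2 h3 h4]|[/andP[h1 h2] h3 h4]].
  split=> [|/h3 e|/h4 e]; [lia|by rewrite /cc2 e|by rewrite /cc3 e].
split=> [||/h3/eqP //|/h4/eqP //]; lia.
Qed.

Lemma nd_pmul f r : f != 0 -> r != 0 -> nd (pmul f r) = (nd r + 2 * (size f).-1)%N.
Proof.
case: r => a b f0 r0; rewrite /nd /pmul /=.
have sM (g : {poly k}) : size (f * g) = if g == 0 then 0%N else ((size f).-1 + size g)%N.
  have [->|g0] := eqVneq g 0; first by rewrite mulr0 size_poly0.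
  have [j ej] : exists j, size f = j.+1 by exists (size f).-1; rewrite prednK // size_poly_gt0.
  by rewrite size_mul // ej.
rewrite !sM; have [ea|a0] := eqVneq a 0; have [eb|b0] := eqVneq b 0.
- by rewrite ea eb eqxx in r0.
- have : (0 < size b)%N by rewrite size_poly_gt0.
  rewrite ea size_poly0; move: (size b) (size f).-1 => x y; lia.
- have : (0 < size a)%N by rewrite size_poly_gt0.
  rewrite eb size_poly0; move: (size a) (size f).-1 => x y; lia.
- have : (0 < size a)%N by rewrite size_poly_gt0.
  have : (0 < size b)%N by rewrite size_poly_gt0.
  move: (size a) (size b) (size f).-1 => x y w; lia.
Qed.

Lemma nd_gt0 r : r != 0 -> (0 < nd r)%N.
Proof.
case: r => a b r0; rewrite /nd /=.
have [ea|a0] := eqVneq a 0; last first.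
  have : (0 < size a)%N by rewrite size_poly_gt0.
  by move: (size a) (size b) => x y; lia.
have b0 : b != 0 by apply: contraNneq r0 => ->; rewrite ea.
have : (0 < size b)%N by rewrite size_poly_gt0.
by move: (size a) (size b) => x y; lia.
Qed.

(** Only pairs of constants could violate this. It bounds the pairs of E' from below when a kernel
    is compared with E'. *)
Lemma nu_pos r : r != 0 -> (cc2 r + cc3 r < nd r)%N.
Proof.
move=> r0; rewrite ltnNge; apply/negP => le; have := nd_gt0 r0.
case: r r0 le => a b r0; rewrite /nd /= => le gt.
have sa : (size a <= 1)%N.
  by move: le; move: (cc2 _) (cc3 _) (size a) (size b) => [] [] x y /=; lia.
have sb : (size b <= 1)%N.
  by move: le; move: (cc2 _) (cc3 _) (size a) (size b) => [] [] x y /=; lia.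
have ea := size1_polyC sa; have eb := size1_polyC sb.
move: le gt; rewrite /cc2 /cc3 /= ea eb !hornerC.
have [a0|a0] := eqVneq a`_0 0; have [b0|b0] := eqVneq b`_0 0.
- by case/eqP: r0; rewrite ea eb a0 b0 polyC0.
- by rewrite a0 polyC0 size_poly0 size_polyC b0 [0 == _]eq_sym (negPf b0).
- by rewrite b0 polyC0 size_poly0 size_polyC a0 (negPf a0).
- by rewrite !size_polyC a0 b0; case: (_ == _).
Qed.

Lemma pmul_eq0 f r : (pmul f r == 0) = (f == 0) || (r == 0).
Proof.
case: r => a b; rewrite /pmul /=; apply/eqP/orP => [[/eqP h1 /eqP h2]|].
  move: h1 h2; rewrite !mulf_eq0; case: eqP => [_|_ /= /eqP -> /eqP ->]; [by left|by right].
by case=> [/eqP ->|/eqP [-> ->]]; rewrite ?mul0r ?mulr0.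
Qed.

End Degree.

Section Pigeon.
Variable k : finFieldType.
Local Notation PP := ({poly k} * {poly k})%type.

(** Pigeonhole: there are more pairs than residues modulo P, and two pairs with equal residue have
    their difference in the kernel. *)
Lemma ker_ex (P : {poly k}) (D s1 s2 : nat) (phi : PP -> {poly k}) :
  size P = D.+1 -> (D < s1 + s2)%N -> (forall r s, phi (r - s) = phi r - phi s) ->
  exists r : PP, [/\ r != 0, (size r.1 <= s1)%N, (size r.2 <= s2)%N & P %| phi r].
Proof.
move=> sP ls pB; pose l := [seq (a, b) | a <- ps k s1, b <- ps k s2].
have ul : uniq l by apply: allpairs_uniq; rewrite ?ps_uniq // => -[? ?] [? ?].
have P0 : P != 0 by rewrite -size_poly_gt0 sP.
apply: contrapT => no.
have inj : {in l &, injective (fun r => phi r %% P)}.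
  move=> r s /allpairsP[[a b] [/= ha hb er]] /allpairsP[[c e] [/= hc he es]] E.
  apply/eqP; rewrite -subr_eq0; apply/negPn/negP => n0; apply: no; exists (r - s).
  rewrite !mem_ps in ha hb hc he; split=> //.
  - by rewrite er es /=; apply: leq_trans (size_polyD _ _) _; rewrite size_polyN geq_max ha hc.
  - by rewrite er es /=; apply: leq_trans (size_polyD _ _) _; rewrite size_polyN geq_max hb he.
  - by rewrite pB /dvdp modpD modpN E subrr.
have um : uniq [seq phi r %% P | r <- l] by rewrite map_inj_in_uniq.
have sub : {subset [seq phi r %% P | r <- l] <= ps k D}.
  by move=> _ /mapP[r _ ->]; rewrite mem_ps -ltnS -sP ltn_modp.
have := uniq_leq_size um sub; rewrite size_map size_allpairs !size_ps -expnD.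
by rewrite leq_exp2l ?card_finNzRing_gt1 // leqNgt ls.
Qed.

End Pigeon.

Lemma texact_of_card (k : finFieldType) (p : weights) (X Y Z : coh k p) (f : Hom X Y) (g : Hom Y Z) :
  tinj f -> tsurj g -> ev (fun x => forall m, hpart x m -> tf g x (tf f x m) = 0) ->
  ev (fun x => ncard (hpart x : set Y) = (ncard (hpart x : set Z) * ncard (hpart x : set X))%N) ->
  texact f g.
Proof.
move=> fi gs gf cd; split=> //.
apply: ev_imp (ev_and (ev_and (tinj_eq fi) gs) (ev_and (ev_and gf cd) (ev_and (tfokP f) (tfokP g)))).
move=> x [[h1 h2] [[h3 h4] [o1 o2]]] m hm; split; last by case=> m' hm' <-; exact: h3.
move=> e; pose K : set Y := [set v | hpart x v /\ tf g x v = 0].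
pose I : set Y := [set v | exists2 w, hpart x w & tf f x w = v].
have fK : fin K by apply: sub_fin (fin_hpart Y x) => v [].
have [|||fI cI] := @ncard_bij _ _ (hpart x : set X) I (tf f x) (fin_hpart X x).
- by move=> a c ha hc; exact: h1.
- by move=> a ha; exists a.
- by [].
have IK : I `<=` K by move=> _ [w hw <-]; split; [exact: tf_hpart|exact: h3].
suff /(_ m) : K `<=` I by apply.
apply: (ncard_eq IK fK); rewrite cI.
have CF : ncard (hpart x : set Y) = _ := @ncard_fiber _ _ (hpart x : set Y) (tf g x)
  (fin_hpart Y x) (hpart_subgrp Y x) (fun a c ha hc => tfD o2 ha hc).
have e2 : [set w | exists2 v, hpart x v & tf g x v = w] = (hpart x : set Z).
  apply/seteqP; split=> [w [v hv <-]|w hw]; first exact: tf_hpart.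
  by have [v hv ev] := h2 w hw; exists v.
move/eqP: CF; rewrite e2 h4 eqn_pmul2l ?ncard_hpart_gt0 // => /eqP <- //.
Qed.

Ltac clia := repeat match goal with H : _ |- _ => clear H end; lia.

(** * Subobjects of E with quotient S as kernels of points *)

Section HallCount.
Variables (k : finFieldType) (p : weights) (d n : nat) (z : {mpoly k[2]}).
Hypothesis Hz : ordinary_point d z.
Hypothesis n_gt0 : (0 < n)%N.
Local Notation A := (coordA k p).
Local Notation L := (Lgroup p).
Local Notation C := (coh k p).
Local Notation ze := (zeta z).
Local Notation D := (d * n)%N.
Local Notation PP := ({poly k} * {poly k})%type.
Variables (E E' S : C) (u : L) (b : 'I_3 -> nat).
Hypothesis hb : forall i, (0 < b i < p i)%N.
Local Notation mm := (mI u b).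
Local Notation C2 := (cI u b i2).
Local Notation C3 := (cI u b i3).
Variables (psi : L -> E -> PP) (psi' : L -> E' -> PP) (sg : L -> {poly k} -> S) (n0 : nat).
Local Notation hi x := (n0%:Z <= lL x).
Hypothesis chE : forall x, hi x -> echart mm (fac k u) C2 C3 psi x.
Hypothesis chE' : forall x, hi x -> echart (fun x => mm x - D%:Z) (fac k u) C2 C3 psi' x.
Hypothesis chS : forall x, hi x -> schart ze n u sg x.
Hypothesis big : forall x, hi x -> (2 * (D + 10))%:Z <= mm x.
Hypothesis card : ev (fun x => ncard (hpart x : set E) =
  (ncard (hpart x : set S) * ncard (hpart x : set E'))%N).

Let irr := zeta_irr Hz.
Implicit Types (x y : L) (pt r : PP).
Local Notation zn := (ze ^+ n).

Definition unimod pt := ~~ (ze %| pt.1) || ~~ (ze %| pt.2).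
Definition ker pt x (m : E) := zn %| Lf pt (psi x m).
(* For unimodular pt, the kernel of Lf pt modulo zn is isomorphic to E' iff pt is good. *)
Definition good pt := forall r, r != 0 -> zn %| Lf pt r -> (D + cc2 r + cc3 r < nd r)%N.

Let szn : size zn = D.+1. Proof. exact: (size_zetan Hz). Qed.
Let zn0 : zn != 0. Proof. by rewrite -size_poly_gt0 szn. Qed.

Lemma ze_unit (f : {poly k}) : ~~ (ze %| f) -> exists w : {poly k},
  [/\ (size w <= D)%N, zn %| w * f - 1 & ~~ (ze %| w)].
Proof.
move=> nf; have [w hw] := ze_inv irr n nf; exists (w %% zn).
have h : zn %| (w %% zn) * f - 1.
  have -> : (w %% zn) * f - 1 = (w * f - 1) - (w %/ zn) * f * zn.
    by rewrite {2}(divp_eq w zn); ring.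
  by apply: dvdp_sub => //; exact: dvdp_mull.
split=> //; first by rewrite -ltnS -szn ltn_modp.
apply/negP => dw; have : ze %| zn by rewrite -(prednK n_gt0) exprS dvdp_mulr.
move=> /dvdp_trans /(_ h); rewrite dvdp_subr ?dvdp_mulr // dvdp1.
by have [sz _] := irr; rewrite gtn_eqF.
Qed.

Lemma modp_sub (f : {poly k}) : f %% zn = f - f %/ zn * zn.
Proof. by rewrite {2}(divp_eq f zn) addrC addKr. Qed.

Lemma dvd_mod (f g : {poly k}) : zn %| f - g -> (zn %| f) = (zn %| g).
Proof. by move=> h; rewrite -(subrK g f) dvdp_addr. Qed.

Lemma pt_surj pt (g : Hom E S) : unimod pt ->
  ev (fun x => forall m, hpart x m -> tf g x m = sg x (Lf pt (psi x m))) -> tsurj g.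
Proof.
move=> um hg; apply: ev_imp (ev_and hg (ev_ge p n0)) => x [{}hg lx] s hs.
have [_ _ _ ss _] := chS lx; have [f <-] := ss s hs; have [_ _ _ c4 _] := chE lx.
have key (c : {poly k}) (r0 : {poly k} -> PP) : ~~ (ze %| c) ->
    (forall f' : {poly k}, (size f' <= D)%N -> (size (r0 f').1 <= D + 5)%N /\ (size (r0 f').2 <= D + 5)%N) ->
    (forall f', Lf pt (r0 f') = c * f') -> exists2 m, hpart x m & tf g x m = sg x f.
  move=> nc sr lr; have nt : ~~ (ze %| 'X * ('X - 1) * c).
    by apply/negP => /(ze_prime irr)/orP[]; apply/negP => //; exact: (nze_tt1 Hz).
  have [w [_ hw _]] := ze_unit nt; pose f' := (w * f) %% zn.
  have sf : (size f' <= D)%N by rewrite -ltnS -szn ltn_modp.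
  have [h1 h2] := sr _ sf; have [m hm em] := proj1 (c4 _) (B_small big lx h1 h2).
  exists m => //; rewrite hg // em LfM lr; apply/(sg_eq chS _ _ lx).
  have -> : 'X * ('X - 1) * (c * f') - f = (w * ('X * ('X - 1) * c) - 1) * f
      - 'X * ('X - 1) * c * ((w * f) %/ zn) * zn.
    by rewrite /f' modp_sub; ring.
  by apply: dvdp_sub; [exact: dvdp_mulr|exact: dvdp_mull].
have s0 : (size (0%R : {poly k}) <= D + 5)%N by rewrite size_poly0.
case/orP: um => nc.
  apply: (key _ (fun f' => (f', 0)) nc) => f'; last by rewrite /Lf /= mulr0 addr0.
  by move=> sf; split=> //=; apply: leq_trans sf _; exact: leq_addr.
apply: (key _ (fun f' => (0, f')) nc) => f'; last by rewrite /Lf /= mulr0 add0r.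
by move=> sf; split=> //=; apply: leq_trans sf _; exact: leq_addr.
Qed.

Lemma sz2MM (f g : {poly k}) (a c : int) : (2 * size f)%:Z <= a -> (2 * size g)%:Z <= c -> 2 <= a + c ->
  (2 * size (f * g)%R)%:Z <= a + c - 2.
Proof.
move=> h1 h2 h3; have := size_polyMleq f g.
move: h1 h2 h3; move: (size f) (size g) (size (f * g)) => i j l; clia.
Qed.

(* The kernel lattice of a good point has a basis of degrees D + 1 and D + 2, found by
   counting dimensions. *)
Lemma good_mat pt : good pt -> exists e1 e2 : PP,
  [/\ zn %| Lf pt e1, zn %| Lf pt e2, nd e1 = D.+2, nd e2 = D.+1 &
      e1.2.[0] = 0 /\ (e1 + e2).1.[1] = (e1 + e2).2.[1]].
Proof.
move=> gp; have LB r s : Lf pt (r - s) = Lf pt r - Lf pt s by rewrite /Lf /=; ring.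
have hD : (D < D.+1./2 + D.+2./2)%N by clia.
have [e2 [e20 s1 s2 dv2]] := ker_ex szn hD LB.
(* The second vector is sought in the form (e.2, t e.1), which meets the condition at 0 at the price
   of one unit of [nd]. *)
have LB' (r s : PP) : Lf pt ((r - s).2, 'X * (r - s).1) =
    Lf pt (r.2, 'X * r.1) - Lf pt (s.2, 'X * s.1) by rewrite /Lf /=; ring.
have [e [e0 t1 t2 dv1]] := ker_ex (phi := fun r => Lf pt (r.2, 'X * r.1)) szn hD LB'.
pose e1 : PP := (e.2, 'X * e.1).
have e10 : e1 != 0.
  apply: contraNneq e0 => -[h1 /eqP h2]; rewrite [e]surjective_pairing h1.
  by move: h2; rewrite mulf_eq0 polyX_eq0 /= => /eqP ->.
have n2 : (nd e2 <= D.+1)%N.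
  by rewrite /nd; move: s1 s2; move: (size e2.1) (size e2.2) => i j; clia.
have n1 : (nd e1 <= D.+2)%N.
  have sX : (size ('X * e.1)%R <= (size e.1).+1)%N.
    by apply: leq_trans (size_polyMleq _ _) _; rewrite size_polyX.
  rewrite /nd /e1 /=; move: sX t1 t2; move: (size e.1) (size e.2) (size ('X * e.1)) => i j l; clia.
have c1 : cc2 e1 by rewrite /cc2 /e1 /= hornerM hornerX mul0r.
have g2 := gp e2 e20 dv2; have g1 := gp e1 e10 dv1.
have nc3 : ~~ cc3 e1 by move: g1 n1; rewrite c1; case: (cc3 e1) => //=; clia.
have nc3' : ~~ cc3 e2 by move: g2 n2; case: (cc2 e2); case: (cc3 e2) => //=; clia.
(* Goodness forces [nd e2] = D + 1 with neither condition met, and [nd e1] = D + 2 with only the one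
   at 0 met. Hence a1 and a2 are nonzero, and a scalar multiple of e1 makes the sum with e2 meet the
   condition at 1. *)
pose a1 := e1.1.[1] - e1.2.[1]; pose a2 := e2.1.[1] - e2.2.[1].
have a10 : a1 != 0 by rewrite subr_eq0.
have a20 : a2 != 0 by rewrite subr_eq0.
pose c := - a2 / a1.
have c0 : c != 0 by rewrite mulf_neq0 ?oppr_eq0 ?invr_eq0.
have cP : c%:P != 0 by rewrite polyC_eq0.
exists (pmul c%:P e1), e2; split=> //.
- by rewrite LfM dvdp_mull.
- rewrite nd_pmul // size_polyC c0 /= addn0; move: g1 n1; rewrite c1; clia.
- by move: g2 n2; clia.
split; first by rewrite /= !hornerM hornerX mul0r mulr0.
rewrite /pmul /= !hornerD !hornerM !hornerC.
apply/eqP; rewrite -subr_eq0; apply/eqP.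
have -> : c * e.2.[1] + e2.1.[1] - (c * ('X.[1] * e.1.[1]) + e2.2.[1]) = c * a1 + a2.
  by rewrite /a1 /a2 /e1 /= hornerM; ring.
by rewrite /c mulrVK ?unitfE // addNr.
Qed.

Definition el x r : E := xget 0 [set m | hpart x m /\ psi x m = r].

Lemma elP x r : hi x -> inB (mm x) (C2 x) (C3 x) r -> hpart x (el x r) /\ psi x (el x r) = r.
Proof.
move=> lx; have [_ _ _ c4 _] := chE lx; move=> /c4[m hm em].
by rewrite /el; case: xgetP => [m' _ []//|/(_ m)[]].
Qed.

(** On charts the embedding of E' is r |-> r1 e1 + r2 e2. The vanishing of e1.2 at 0 and the
    condition at 1 for e1 + e2 make it respect both conditions in every degree; its image is the
    whole kernel by cardinality. *)
Lemma good_sub pt : unimod pt -> good pt -> exists U : subobject E, hall_sub S E' U /\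
  ev (fun x => forall m, hpart x m -> (ker pt x m <-> exists2 m', hpart x m' & tf (sub_arrow U) x m' = m)).
Proof.
move=> um gp; have [e1 [e2 [dv1 dv2 n1 n2 [z1 z3]]]] := good_mat gp.
pose mat (r : PP) : PP := pmul r.1 e1 + pmul r.2 e2.
have matD r s : mat (r + s) = mat r + mat s by rewrite /mat /pmul /=; congr pair => /=; ring.
have matM f r : mat (pmul f r) = pmul f (mat r) by rewrite /mat /pmul /=; congr pair => /=; ring.
have e10 : e1 != 0 by apply: contra_eqN n1 => /eqP ->; rewrite /nd /= size_poly0.
have e20 : e2 != 0 by apply: contra_eqN n2 => /eqP ->; rewrite /nd /= size_poly0.
(* Nonzero multiples of e1 and of e2 have values of [nd] of different parity, so no nontrivial
   combination vanishes. *)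
have mat0 r : mat r = 0 -> r = 0.
  move=> e; have [r1|r1] := eqVneq r.1 0.
    move/eqP: e; rewrite /mat r1 {1}/pmul !mul0r add0r pmul_eq0 (negPf e20) orbF => /eqP r2.
    by rewrite [r]surjective_pairing r1 r2.
  have e' : pmul r.1 e1 = pmul (- r.2) e2.
    have h : pmul (- r.2) e2 = - pmul r.2 e2 by rewrite /pmul /=; congr pair; rewrite mulNr.
    by rewrite h; apply/eqP; rewrite -addr_eq0; apply/eqP.
  have r2 : - r.2 != 0.
    apply: contraNneq r1 => h; move/eqP: e'; rewrite h [pmul 0 _]/pmul !mul0r pmul_eq0.
    by rewrite (negPf e10) orbF.
  have := congr1 (@nd k) e'; rewrite !nd_pmul // n1 n2.
  by move: (size r.1).-1 (size (- r.2)).-1 => i j; clia.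
have matB x r : hi x -> inB (mm x - D%:Z) (C2 x) (C3 x) r -> inB (mm x) (C2 x) (C3 x) (mat r).
  move=> lx [s1 s2 c2 c3].
  have bb : (2 * (D + 10))%:Z <= mm x := big lx.
  have h11 : (2 * size e1.1)%:Z <= (D + 2)%:Z by move: n1; rewrite /nd; move: (size e1.1) (size e1.2) => i j; clia.
  have h12 : (2 * size e1.2)%:Z <= (D + 3)%:Z by move: n1; rewrite /nd; move: (size e1.1) (size e1.2) => i j; clia.
  have h21 : (2 * size e2.1)%:Z <= (D + 1)%:Z by move: n2; rewrite /nd; move: (size e2.1) (size e2.2) => i j; clia.
  have h22 : (2 * size e2.2)%:Z <= (D + 2)%:Z by move: n2; rewrite /nd; move: (size e2.1) (size e2.2) => i j; clia.
  split.
  - apply: sz2D; [apply: le_trans (sz2MM s1 h11 _) _|apply: le_trans (sz2MM s2 h21 _) _]; move: bb; clia.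
  - apply: sz2D; [apply: le_trans (sz2MM s1 h12 _) _|apply: le_trans (sz2MM s2 h22 _) _]; move: bb; clia.
  - by move=> /c2 e; rewrite /mat /= hornerD !hornerM e z1 mulr0 mul0r addr0.
  - move=> /c3 e; rewrite /mat /= !hornerD !hornerM -e -!mulrDr; congr (_ * _).
    by move: z3; rewrite /= !hornerD.
have inB' x m : hi x -> hpart x m -> inB (mm x) (C2 x) (C3 x) (mat (psi' x m)).
  by move=> lx hm; apply: matB => //; have [_ _ _ c4 _] := chE' lx; apply/c4; exists m.
pose phi x (m : E') := el x (mat (psi' x m)).
have phP x m : hi x -> hpart x m -> hpart x (phi x m) /\ psi x (phi x m) = mat (psi' x m).
  by move=> lx hm; apply: elP => //; exact: inB'.
have [h hh] : exists h : qhom E' E, ev (fun x => forall m, hpart x m -> tf h x m = phi x m).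
  apply: (@mk_arrow k p E' E phi n0).
  - by move=> x m lx hm; have [] := phP x m lx hm.
  - move=> x m m' lx hm hm'; have [h1 q1] := phP x m lx hm; have [h2 q2] := phP x m' lx hm'.
    have [h3 q3] := phP x _ lx (hpartD hm hm').
    apply: (psi_inj chE lx h3 (hpartD h1 h2)).
    have [c1 _ _ _ _] := chE lx; have [c1' _ _ _ _] := chE' lx.
    by rewrite q3 c1 // q1 q2 c1' // matD.
  - move=> x c m lx hm; have [h1 q1] := phP x m lx hm; have [h3 q3] := phP x _ lx (hpartkA c hm).
    apply: (psi_inj chE lx h3 (hpartkA c h1)).
    have [_ c1 _ _ _] := chE lx; have [_ c1' _ _ _] := chE' lx.
    by rewrite q3 c1 // q1 c1' // matM.
  - move=> x i m lx hm; have [h1 q1] := phP x m lx hm.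
    have lx' : hi (vx p i + x) by exact: hiX.
    have hX := homog_XA k p i.
    have [h3 q3] := phP _ _ lx' (hpartZ hX hm).
    apply: (psi_inj chE lx' h3 (hpartZ hX h1)).
    have [_ _ _ _ c1] := chE lx; have [_ _ _ _ c1'] := chE' lx.
    by rewrite q3 c1 // q1 c1' // matM.
have hinj : tinj h.
  apply: ev_imp (ev_and hh (ev_ge p n0)) => x [{}hh lx] m hm; rewrite hh // => e.
  have [_ q] := phP x m lx hm; have [_ _ c3 _ _] := chE' lx; apply: c3 => //.
  by apply: mat0; rewrite -q e (psi0 chE).
have [g hg] := arrow_pt chE chS pt.
have gs := pt_surj um hg.
have te : texact h g.
  apply: texact_of_card => //.
  apply: ev_imp (ev_and (ev_and hh (ev_ge p n0)) hg) => x [[{}hh lx] {}hg] m hm.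
  have [h1 q1] := phP x m lx hm; rewrite hh // hg // q1.
  have [_ _ _ _ [s0 _]] := chS lx; apply/s0.
  by rewrite /mat LfD !LfM; apply: dvdp_add; exact: dvdp_mull.
exists (Subobject (tinj_monic hinj)); split.
  split; last by exists g; apply/cokernelP.
  by exists (idm E'), (idm E'); exact: comp1m.
have [_ ex] := te; apply: ev_imp (ev_and (ev_and ex hg) (ev_ge p n0)) => x [[{}ex {}hg] lx] m hm.
by rewrite -(ex m hm) hg //; have [_ _ _ _ [s0 _]] := chS lx; rewrite s0.
Qed.

(** An r violating goodness yields t^i r, for i at most J, in one component of the kernel. The
    isomorphism with E' carries them to t^i s under a bound lower by D, so nd s <= nd r - D, which
    is at most the number of conditions met by s; no nonzero pair is that small. *)
Lemma sub_good pt (Xo : C) (h : Hom Xo E) (g : Hom E S) : tinj h -> texact h g -> isomorphic Xo E' ->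
  ev (fun x => forall m, hpart x m -> tf g x m = sg x (Lf pt (psi x m))) -> good pt.
Proof.
move=> hi' [_ ex] [j /isoP[ji _]] hg r r0 dv; rewrite ltnNge; apply/negP => le.
have [n1 h1] := ev_and (ev_and (tinj_eq hi') ex) (ev_and (ev_and ji hg) (ev_and (ev_and (tfokP h) (tfokP j)) (ev_ge p n0))).
(* A high degree in which exactly the conditions met by r are imposed and the bound is nd r + 2J, so
   that t^J r just fits. *)
have [x [J [lx1 c2x c3x mx]]] := @fullC p u b hb n1 (cc2 r) (cc3 r) (nd r).
have [[hx ex1] [[jx gx] [[okh okj] lx]]] := h1 x lx1.
have lvc : 0 <= lL (vc p) by rewrite lL_vc.
have lx1' : n1%:Z <= lL (vc p + x) by apply: le_trans lx1 (lL_vc_ge _).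
have [[hx' _] [_ [[okh' okj'] lx']]] := h1 _ lx1'.
have [_ _ _ c4 _] := chE lx.
have inBi i : (i <= J)%N -> inB (mm x) (C2 x) (C3 x) (pmul 'X^i r).
  move=> lei; rewrite mx c2x c3x -PoszM -PoszD; apply/inB_nd.
  have X0 : 'X^i != 0 :> {poly k} by rewrite expf_neq0 ?polyX_eq0.
  split; first by rewrite nd_pmul // size_polyXn /= leq_add2l leq_mul2l.
  - by rewrite /cc2 /= hornerM => /eqP ->; rewrite mulr0.
  - by rewrite /cc3 /= !hornerM => /eqP ->.
have Xi i : exists xi : Xo, (i <= J)%N -> hpart x xi /\ psi x (tf h x xi) = pmul 'X^i r.
  have [lei|gt] := leqP i J; last by exists 0.
  have [m hm em] := proj1 (c4 _) (inBi i lei).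
  have : tf g x m = 0.
    rewrite gx // em LfM; have [_ _ _ _ [s0 _]] := chS lx; apply/s0; exact: dvdp_mull.
  move=> /(ex1 m hm)[xi hxi exi]; by exists xi => _; rewrite exi.
have [xs hxs] := choice Xi.
pose s i := psi' x (tf j x (xs i)).
have hT l := homog_TA k p l.
(* Multiplication by t is not an operation on a component; it is expressed by T1 v' = T2 v, which
   arrows preserve. *)
have sS i : (i < J)%N -> s i.+1 = pmul 'X (s i).
  move=> lei; have [a1 b1] := hxs i.+1 lei; have [a0 b0] := hxs i (ltnW lei).
  have e : TA k p i1 *: xs i.+1 = TA k p i2 *: xs i.
    apply: hx'; [exact: hpartZ|exact: hpartZ|].
    rewrite (tfZ okh okh' (hT i1)) // (tfZ okh okh' (hT i2)) //.
    have ha1 := tf_hpart okh a1; have ha0 := tf_hpart okh a0.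
    apply: (psi_inj chE lx'); [exact: hpartZ|exact: hpartZ|].
    rewrite (psi_mu chE lx lvc (hT i1) ha1) (psi_mu chE lx lvc (hT i2) ha0) b1 b0.
    rewrite -[TA k p i1]mulr1 -[TA k p i2]mulr1 !mu_TA /mu !mul1r !th_smono1 !mulr1 !tauE.
    by rewrite !pmulA mul1r -exprS.
  have := congr1 (fun v => psi' (vc p + x) (tf j (vc p + x) v)) e => /=.
  rewrite (tfZ okj okj' (hT i1)) // (tfZ okj okj' (hT i2)) //.
  have ja1 := tf_hpart okj a1; have ja0 := tf_hpart okj a0.
  rewrite (psi_mu chE' lx lvc (hT i1) ja1) (psi_mu chE' lx lvc (hT i2) ja0).
  rewrite -[TA k p i1]mulr1 -[TA k p i2]mulr1 !mu_TA /mu !mul1r !th_smono1 !mulr1 !tauE -/(s _) -/(s _).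
  by rewrite {1}/pmul !mul1r -surjective_pairing.
have sJ i : (i <= J)%N -> s i = pmul 'X^i (s 0%N).
  elim: i => [_|i IH lei]; first by rewrite expr0 /pmul !mul1r -surjective_pairing.
  by rewrite sS // IH 1?ltnW // pmulA -exprS.
have [a0 b0] := hxs 0%N (leq0n _).
have s00 : s 0%N != 0.
  apply/eqP => e; have [_ _ c3 _ _] := chE' lx.
  have := c3 _ (tf_hpart okj a0) e => /(jx _ a0) x0.
  move/eqP: b0; rewrite x0 tf0 // (psi0 chE) // expr0 /pmul !mul1r -surjective_pairing eq_sym.
  by rewrite (negPf r0).
have inBs i : (i <= J)%N -> inB (mm x - D%:Z) (C2 x) (C3 x) (s i).
  move=> lei; have [ai bi] := hxs i lei; have [_ _ _ c4' _] := chE' lx; apply/c4'.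
  by exists (tf j x (xs i)) => //; exact: tf_hpart.
have nuS := nu_pos s00.
have X0 : 'X^J != 0 :> {poly k} by rewrite expf_neq0 ?polyX_eq0.
have [leD|gtD] := leqP D (nd r + 2 * J); last first.
  have := inBs J (leqnn _); case=> s1 _ _ _.
  move: s1 gtD; rewrite mx; move: (size (s J).1) => i; clia.
have mE : mm x - D%:Z = (nd r + 2 * J - D)%N%:Z by move: leD; rewrite mx; clia.
have := inBs J (leqnn _); rewrite mE => /inB_nd[nJ _ _].
have := inBs 0%N (leq0n _); rewrite mE => /inB_nd[_ z2 z3].
rewrite c2x in z2; rewrite c3x in z3.
move: nJ; rewrite sJ // nd_pmul // size_polyXn /= => nJ.
have q2 : (cc2 r <= cc2 (s 0%N))%N by case: (cc2 r) z2 => // ->.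
have q3 : (cc3 r <= cc3 (s 0%N))%N by case: (cc3 r) z3 => // ->.
by move: nJ nuS le q2 q3 leD; clia.
Qed.


(* Representatives of the points of the projective line over k[t]/(ze^n). *)
Definition pts : seq PP :=
  [seq (1, be) | be <- ps k D] ++ [seq (ze * al, 1) | al <- ps k (D - d)].

Let ze0 : ze != 0. Proof. exact: (ze_neq0 irr). Qed.
Let nze1 : ~~ (ze %| 1). Proof. by rewrite dvdp1; have [sz _] := irr; rewrite gtn_eqF. Qed.

Lemma ptsP pt : pt \in pts -> (exists2 be, pt = (1, be) & (size be <= D)%N) \/
  (exists2 al, pt = (ze * al, 1) & (size (ze * al)%R <= D)%N).
Proof.
rewrite mem_cat => /orP[/mapP[be]|/mapP[al]]; rewrite mem_ps => sz ->; first by left; exists be.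
right; exists al => //; have le : (d <= D)%N by rewrite -{1}[d]muln1 leq_mul2l n_gt0 orbT.
have [->|a0] := eqVneq al 0; first by rewrite mulr0 size_poly0.
by rewrite size_mul // (size_zeta Hz) /= -(subnKC le) leq_add2l.
Qed.

Lemma pts_unimod pt : pt \in pts -> unimod pt.
Proof. by rewrite /unimod => /ptsP[[be ->]|[al ->]] /= _; rewrite nze1 ?orbT. Qed.

Lemma small0 (f : {poly k}) : (size f <= D)%N -> zn %| f -> f = 0.
Proof.
move=> sf dv; apply/eqP/negPn/negP => f0; have := dvdp_leq f0 dv.
by rewrite szn ltnNge sf.
Qed.

Let ze_zn : ze %| zn. Proof. by rewrite -(prednK n_gt0) exprS dvdp_mulr. Qed.

Lemma pts_dist pt pt' : pt \in pts -> pt' \in pts -> zn %| pt'.1 * pt.2 - pt'.2 * pt.1 -> pt = pt'.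
Proof.
have sB (f g : {poly k}) : (size f <= D)%N -> (size g <= D)%N -> (size (f - g)%R <= D)%N.
  by move=> sf sg'; apply: leq_trans (size_polyD _ _) _; rewrite size_polyN geq_max sf sg'.
move=> /ptsP[[be -> sb]|[al -> sa]] /ptsP[[be' -> sb']|[al' -> sa']] /=; rewrite ?(mul1r, mulr1).
- by move=> /small0 h; congr pair; apply/eqP; rewrite -subr_eq0 h ?sB.
- move=> /(dvdp_trans ze_zn); rewrite -mulrA dvdp_subr ?dvdp_mulr // => h.
  by case/negP: nze1.
- move=> /(dvdp_trans ze_zn); rewrite mulrCA dvdp_subl ?dvdp_mulr // => h.
  by case/negP: nze1.
- by move=> /small0 h; congr pair; apply/esym/eqP; rewrite -subr_eq0 h ?sB.
Qed.

Lemma pts_uniq : uniq pts.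
Proof.
rewrite cat_uniq; apply/and3P; split.
- by rewrite map_inj_in_uniq ?ps_uniq // => a c _ _ [].
- apply/hasPn => _ /mapP[al _ ->]; apply/negP => /mapP[be _ [e _]].
  by case/negP: nze1; rewrite -e dvdp_mulr.
- by rewrite map_inj_in_uniq ?ps_uniq // => a c _ _ [/(mulfI ze0)].
Qed.

(** A coordinate prime to ze is scaled to 1 and the other one reduced modulo ze^n; if the first
    coordinate is divisible by ze, so is its reduction, which gives the second family. *)
Lemma pts_norm pt0 : unimod pt0 ->
  exists2 pt, pt \in pts & forall r, (zn %| Lf pt0 r) = (zn %| Lf pt r).
Proof.
have key w pt pt' : ~~ (ze %| w) -> zn %| w * pt.1 - pt'.1 -> zn %| w * pt.2 - pt'.2 ->
    forall r, (zn %| Lf pt r) = (zn %| Lf pt' r).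
  move=> nw d1 d2 r; have -> : (zn %| Lf pt r) = (zn %| w * Lf pt r).
    by apply/idP/idP => [|/(ze_cancel irr nw)] //; exact: dvdp_mull.
  apply: dvd_mod; rewrite /Lf.
  have -> : w * (pt.1 * r.1 + pt.2 * r.2) - (pt'.1 * r.1 + pt'.2 * r.2) =
    (w * pt.1 - pt'.1) * r.1 + (w * pt.2 - pt'.2) * r.2 by ring.
  by apply: dvdp_add; exact: dvdp_mulr.
have mz (f : {poly k}) : zn %| f - f %% zn.
  by rewrite modp_sub opprB addrC subrK dvdp_mull.
have smod (f : {poly k}) : (size (f %% zn)%R <= D)%N by rewrite -ltnS -szn ltn_modp.
have [d1|nd1] := boolP (ze %| pt0.1); last first.
  move=> _; have [w [_ hw nw]] := ze_unit nd1.
  exists (1, (w * pt0.2) %% zn); last by apply: (key w).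
  by rewrite mem_cat; apply/orP; left; apply/mapP; exists ((w * pt0.2) %% zn); rewrite ?mem_ps.
rewrite /unimod d1 /= => nd2; have [w [_ hw nw]] := ze_unit nd2.
pose f := (w * pt0.1) %% zn.
have [al ea] : exists al : {poly k}, f = ze * al.
  have : ze %| f.
    by rewrite /f modp_sub dvdp_subr ?dvdp_mull.
  by move=> /dvdpP[/= al e]; exists al; rewrite mulrC.
exists (ze * al, 1); last by apply: (key w) => //=; rewrite -ea; exact: mz.
rewrite mem_cat; apply/orP; right; apply/mapP; exists al => //; rewrite mem_ps.
have [->|a0] := eqVneq al 0; first by rewrite size_poly0.
have := smod (w * pt0.1); rewrite -/f ea size_mul // (size_zeta Hz) /=.
by rewrite leq_subRL // -{1}[d]muln1 leq_mul2l n_gt0 orbT.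
Qed.

Lemma sub_le_im (U V : subobject E) : sub_le U V <->
  ev (fun x => forall m, hpart x m -> (exists2 m', hpart x m' & tf (sub_arrow U) x m' = m) ->
    exists2 m', hpart x m' & tf (sub_arrow V) x m' = m).
Proof.
split.
  case=> h /heqP e; apply: ev_imp (ev_and (ev_and e (tf_comp (sub_arrow V) h)) (tfokP h)).
  move=> x [[h1 h2] ok] m _ [m' hm' <-]; exists (tf h x m'); first exact: tf_hpart.
  by rewrite -h2 // h1.
move=> im; apply: lift_ex; first exact: monic_tinj (@sub_monic _ _ V).
apply: ev_imp (ev_and im (tfokP (sub_arrow U))) => x [{}im ok] m hm.
by apply: im; [exact: tf_hpart|exists m].
Qed.

Lemma hall_count : hall_number S E' E (size [seq pt <- pts | `[< good pt >]]).
Proof.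
set G := [seq pt <- pts | `[< good pt >]].
have GP (i : 'I_(size G)) : nth 0 G i \in pts /\ good (nth 0 G i).
  have : nth 0 G i \in G by exact: mem_nth.
  by rewrite mem_filter => /andP[/asboolP].
have UE (i : 'I_(size G)) : exists U : subobject E, hall_sub S E' U /\
  ev (fun x => forall m, hpart x m ->
    (ker (nth 0 G i) x m <-> exists2 m', hpart x m' & tf (sub_arrow U) x m' = m)).
  by have [h1 h2] := GP i; apply: good_sub => //; exact: pts_unimod.
have [Us hUs] := choice UE.
exists Us; split.
- by move=> i; have [] := hUs i.
- move=> i j [/sub_le_im l1 /sub_le_im l2]; have [_ k1] := hUs i; have [_ k2] := hUs j.
  have [x [[m1 m2] [[q1 q2] lx]]] := ev_ex (ev_and (ev_and l1 l2) (ev_and (ev_and k1 k2) (ev_ge p n0))).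
  have [pi gi] := GP i; have [pj gj] := GP j; set pt := nth 0 G i in pi gi q1 k1.
  set pt' := nth 0 G j in pj gj q2 k2.
  have bnd f : f \in pts -> (size f.1 <= D + 5)%N /\ (size f.2 <= D + 5)%N.
    have s1 : (size (1%R : {poly k}) <= D + 5)%N by rewrite size_poly1 addnS.
    by move=> /ptsP[[be -> sb]|[al -> sa]]; split=> //=;
      [apply: leq_trans sb _|apply: leq_trans sa _]; exact: leq_addr.
  have [b1 b2] := bnd pt pi.
  have b1' : (size (- pt.1) <= D + 5)%N by rewrite size_polyN.
  have [_ _ _ c4 _] := chE lx.
  (* The pair t(t - 1)(pt.2, - pt.1) lies in the kernel of pt; lying also in that of pt' makes the
     determinant of the two points divisible by ze^n. *)
  have [m hm em] := proj1 (c4 _) (@B_small k p d n u b n0 big x (pt.2, - pt.1) lx b2 b1').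
  have : ker pt x m by rewrite /ker em LfM /Lf /= mulrN [pt.2 * _]mulrC subrr mulr0 dvdp0.
  move=> /(q1 m hm)/(m1 m hm)/(q2 m hm); rewrite /ker em LfM.
  move=> /(ze_cancel irr (nze_tt1 Hz)); rewrite /Lf /= mulrN => dv.
  have e : pt = pt' by exact: pts_dist dv.
  apply: val_inj; apply/eqP; rewrite -(nth_uniq 0 (ltn_ord i) (ltn_ord j)); first exact/eqP.
  by rewrite filter_uniq ?pts_uniq.
- move=> X [iX [g /cokernelP te]].
  have Xi := monic_tinj (@sub_monic _ _ X); have [pt0 hg] := arrow_form Hz chE chS big g.
  have [gs ex] := te.
  have um : unimod pt0.
    rewrite /unimod -negb_and; apply/negP => /andP[d1 d2].
    have [x [[sx gx] lx]] := ev_ex (ev_and (ev_and gs hg) (ev_ge p n0)).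
    have [sh _ _ _ _] := chS lx; have [m hm] := sx _ (sh 1); rewrite gx // => /(sg_eq chS _ _ lx).
    move=> /(dvdp_trans ze_zn); rewrite dvdp_subr; first by move=> h; case/negP: nze1.
    by rewrite /Lf; apply: dvdp_add; exact: dvdp_mulr.
  have g0 := sub_good Xi te iX hg.
  have [pt hpt ept] := pts_norm um.
  have gpt : good pt by move=> r r0; rewrite -ept; exact: g0.
  have ptG : pt \in G by rewrite mem_filter hpt andbT; exact/asboolP.
  have iG : (index pt G < size G)%N by rewrite index_mem.
  exists (Ordinal iG); have [_ k1] := hUs (Ordinal iG); rewrite /= nth_index // in k1.
  have K : ev (fun x => forall m, hpart x m ->
      (ker pt x m <-> exists2 m', hpart x m' & tf (sub_arrow X) x m' = m)).
    apply: ev_imp (ev_and (ev_and ex hg) (ev_ge p n0)) => x [[{}ex {}hg] lx] m hm.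
    rewrite -(ex m hm) hg //; have [_ _ _ _ [s0 _]] := chS lx.
    by rewrite /ker -ept s0.
  split; apply/sub_le_im; apply: ev_imp (ev_and k1 K) => x [h1 h2] m hm.
    by move=> /(h2 m hm)/(h1 m hm).
  by move=> /(h1 m hm)/(h2 m hm).
Qed.

End HallCount.

(** * Primitive pairs and the number of good points *)

Section Primitive.
Variable k : fieldType.
Local Notation PP := ({poly k} * {poly k})%type.
Implicit Types (r s rho : PP) (f g h : {poly k}).

Definition prim rho := coprimep rho.1 rho.2.
(** Each condition met by the pair is credited against its degree, so that goodness reads: nonzero
    pairs in the kernel have [nu] above D. *)
Definition nu rho : nat := (nd rho - (cc2 rho + cc3 rho))%N.

Lemma prim_neq0 rho : prim rho -> rho != 0.
Proof. by apply: contraTneq => ->; rewrite /prim /= coprimep0 -size_poly_eq1 size_poly0. Qed.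

Lemma prim_scale (c : k) rho : c != 0 -> prim (pmul c%:P rho) = prim rho.
Proof. by move=> c0; rewrite /prim /pmul /= !mul_polyC coprimepZl // coprimepZr. Qed.

Lemma prim_decomp r : r != 0 -> exists h rho, [/\ h \is poly.monic, prim rho & r = pmul h rho].
Proof.
case: r => a b r0; pose g := gcdp a b.
have ab : (a != 0) || (b != 0).
  by rewrite -negb_and; apply: contra r0 => /andP[/eqP -> /eqP ->].
have g0 : g != 0 by rewrite gcdp_eq0 negb_and.
have c0 : lead_coef g != 0 by rewrite lead_coef_eq0.
exists ((lead_coef g)^-1 *: g), (pmul (lead_coef g)%:P (a %/ g, b %/ g)); split.
- by rewrite monicE lead_coefZ mulVf.
- by rewrite prim_scale // /prim /=; exact: coprimep_div_gcd.
- have eg : (lead_coef g)^-1 *: g * (lead_coef g)%:P = g by rewrite mulrC mul_polyC scalerA mulfV // scale1r.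
  rewrite pmulA eg /pmul /=.
  by congr pair; rewrite mulrC divpK ?dvdp_gcdl ?dvdp_gcdr.
Qed.

Lemma prim_dvd h f rho : prim rho -> h %| f * rho.1 -> h %| f * rho.2 -> h %| f.
Proof.
move=> /Bezout_eq1_coprimepP[[a b] /= e] h1 h2; rewrite -[f]mulr1 -e mulrDr.
by apply: dvdp_add; rewrite mulrCA dvdp_mull.
Qed.

Lemma prim_uniq h h' rho rho' : h \is poly.monic -> h' \is poly.monic -> prim rho -> prim rho' ->
  pmul h rho = pmul h' rho' -> h = h' /\ rho = rho'.
Proof.
move=> mh mh' pr pr' e; have [e1 e2] := e.
have d1 : h %| h' by apply: (prim_dvd pr'); rewrite -?e1 -?e2 dvdp_mulr.
have d2 : h' %| h by apply: (prim_dvd pr); rewrite ?e1 ?e2 dvdp_mulr.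
have eh : h = h' by apply/eqP; rewrite -eqp_monic // /eqp d1 d2.
split=> //; move: e; rewrite eh => /pmul_inj; apply; exact: monic_neq0.
Qed.

(** The Bezout identity of each pair writes the other one as a polynomial multiple of it; the two
    multipliers are inverse to each other, hence constants. *)
Lemma prim_prop rho rho' : prim rho -> prim rho' -> rho.1 * rho'.2 = rho.2 * rho'.1 ->
  exists2 c : k, c != 0 & rho' = pmul c%:P rho.
Proof.
have half r r' : prim r -> r.1 * r'.2 = r.2 * r'.1 -> exists f, r' = pmul f r.
  move=> /Bezout_eq1_coprimepP[[a b] /= e] E; exists (a * r'.1 + b * r'.2).
  rewrite [r']surjective_pairing /pmul /=; congr pair.
    rewrite mulrDl -(mulrA b) (mulrC r'.2) E mulrC -[LHS]mul1r -e; ring.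
  rewrite mulrDl -(mulrA a) (mulrC r'.1) -E -[LHS]mul1r -e; ring.
move=> pr pr' E; have [f ef] := half _ _ pr E.
have [|g eg] := half rho' rho pr'; first by rewrite mulrC -E mulrC.
have r0 := prim_neq0 pr.
have fg : g * f = 1.
  have : pmul (g * f) rho = pmul 1 rho by rewrite -pmulA -ef -eg /pmul !mul1r -surjective_pairing.
  move/eqP; rewrite -subr_eq0 => /eqP h; apply/eqP; rewrite -subr_eq0.
  have : pmul (g * f - 1) rho == 0.
    rewrite -h; apply/eqP; rewrite /pmul /=; congr pair; rewrite mulrBl //.
  by rewrite pmul_eq0 (negPf r0) orbF.
have sf : size f = 1.
  have f1 : f %| 1 by apply/dvdpP; exists g.
  by apply/eqP; rewrite -dvdp1.
have [c c0 ec] : exists2 c : k, c != 0 & f = c%:P by apply/size_poly1P; rewrite sf.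
by exists c => //; rewrite -ec.
Qed.

End Primitive.

Section Lists.
Variable k : finFieldType.
Local Notation PP := ({poly k} * {poly k})%type.
Local Notation q := #|k|.
Implicit Types (r s : PP).

Fixpoint mons (j : nat) : seq {poly k} :=
  if j is j'.+1 then mons j' ++ [seq 'X^j' + g | g <- ps k j'] else [::].

Lemma mem_mons j h : (h \in mons j) = (h \is poly.monic) && (size h <= j)%N.
Proof.
elim: j => [|j IH] /=.
  apply/esym/negP => /andP[mh]; rewrite leqn0 size_poly_eq0 => /eqP h0.
  by move: mh; rewrite h0 monicE lead_coef0 eq_sym oner_eq0.
have szX (g : {poly k}) : (size g <= j)%N -> size ('X^j + g) = j.+1.
  by move=> sg; rewrite size_polyDl size_polyXn.
rewrite mem_cat IH; apply/orP/andP => [[/andP[mh sh]|/mapP[g]]|[mh]].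
- by split=> //; exact: leqW.
- rewrite mem_ps => sg ->; split; last by rewrite szX.
  by rewrite monicE /lead_coef szX // coefD coefXn eqxx nth_default ?addr0.
- rewrite leq_eqVlt ltnS => /orP[/eqP sh|sh]; last by left; rewrite mh.
  right; apply/mapP; exists (h - 'X^j); last by rewrite addrC subrK.
  rewrite mem_ps; apply/leq_sizeP => i le; rewrite coefB coefXn.
  move: le; rewrite leq_eqVlt => /orP[/eqP <-|lt].
    by move: mh; rewrite monicE /lead_coef sh eqxx => /eqP ->; rewrite subrr.
  by rewrite gtn_eqF // nth_default ?sh // subr0.
Qed.

Lemma mons_uniq j : uniq (mons j).
Proof.
elim: j => //= j IH; rewrite cat_uniq IH /= map_inj_in_uniq ?ps_uniq ?andbT.
  apply/hasPn => f /mapP[g]; rewrite mem_ps => sg ->; apply/negP; rewrite mem_mons => /andP[_].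
  by rewrite size_polyDl size_polyXn // ltnn.
by move=> a b _ _ /addrI.
Qed.

Lemma size_monsS j : (size (mons j.+1) = size (mons j) + q ^ j)%N.
Proof. by rewrite /= size_cat size_map size_ps. Qed.

Lemma size_mons_rec j : (size (mons j.+1) = 1 + q * size (mons j))%N.
Proof.
elim: j => [|j IH]; first by rewrite size_monsS muln0.
by rewrite size_monsS {1}IH [in RHS]size_monsS mulnDr expnS addnA.
Qed.

Definition pairs_of (B : nat) : seq PP := [seq (a, b) | a <- ps k B, b <- ps k B].

Lemma mem_pairs B r : (r \in pairs_of B) = (size r.1 <= B)%N && (size r.2 <= B)%N.
Proof.
apply/allpairsP/andP => [[[a b] [/=]]|[h1 h2]]; first by rewrite !mem_ps => h1 h2 ->.
by exists r; rewrite !mem_ps -surjective_pairing.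
Qed.

Lemma pairs_uniq B : uniq (pairs_of B).
Proof. by apply: allpairs_uniq; rewrite ?ps_uniq // => -[? ?] [? ?]. Qed.

(** The bound is raised by the number of imposed conditions, so that there are q^M - 1 such pairs
    whichever conditions are chosen. *)
Definition bounded_pair (M : nat) (c2 c3 : bool) (r : PP) :=
  [&& r != 0, (nd r <= M + c2 + c3)%N, c2 ==> cc2 r & c3 ==> cc3 r].

Lemma nd_le (r : PP) m : (nd r <= m)%N = (2 * size r.1 <= m)%N && (2 * size r.2 <= m.+1)%N.
Proof.
rewrite /nd geq_max; congr (_ && _); by move: (size r.2) => j; apply/idP/idP; lia.
Qed.

Lemma count_bounded_pair_aux (M B : nat) (c2 c3 : bool) (phi : PP -> PP) :
  (forall r s, phi r = phi s -> r = s) -> phi 0 = 0 ->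
  (forall r, (size r.1 <= M./2)%N -> (size r.2 <= M.+1./2)%N ->
    [/\ (nd (phi r) <= M + c2 + c3)%N, c2 ==> cc2 (phi r) & c3 ==> cc3 (phi r)]) ->
  (forall s, (nd s <= M + c2 + c3)%N -> c2 ==> cc2 s -> c3 ==> cc3 s ->
    exists r, [/\ (size r.1 <= M./2)%N, (size r.2 <= M.+1./2)%N & phi r = s]) ->
  (M + 3 <= B)%N -> (count (bounded_pair M c2 c3) (pairs_of B)).+1 = (q ^ M)%N.
Proof.
move=> inj phi0 dn up lB.
pose l := [seq (a, b) | a <- ps k M./2, b <- ps k M.+1./2].
have ml r : (r \in l) = (size r.1 <= M./2)%N && (size r.2 <= M.+1./2)%N.
  apply/allpairsP/andP => [[[a b] [/=]]|[h1 h2]]; first by rewrite !mem_ps => h1 h2 ->.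
  by exists r; rewrite !mem_ps -surjective_pairing.
have ul : uniq l by apply: allpairs_uniq; rewrite ?ps_uniq // => -[? ?] [? ?].
have pe : perm_eq (0 :: [seq r <- pairs_of B | bounded_pair M c2 c3 r]) [seq phi r | r <- l].
  apply: uniq_perm.
  - by rewrite /= filter_uniq ?pairs_uniq // andbT mem_filter /bounded_pair eqxx.
  - by rewrite map_inj_in_uniq // => a b _ _; exact: inj.
  move=> s; rewrite inE mem_filter; apply/orP/mapP => [[/eqP ->|/andP[/and4P[s0 h1 h2 h3] _]]|[r]].
  - by exists 0 => //; rewrite ml /= size_poly0.
  - by have [r [a1 a2 <-]] := up s h1 h2 h3; exists r => //; rewrite ml a1.
  - rewrite ml => /andP[a1 a2] ->; have [r0|r0] := eqVneq (phi r) 0; [by left|right].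
    have [h1 h2 h3] := dn r a1 a2; rewrite /bounded_pair r0 h1 h2 h3 /= mem_pairs.
    move: h1; rewrite nd_le; case: c2 c3 {dn up h2 h3} => [] []; move: (size _) (size _) => i j; lia.
have := perm_size pe; rewrite /= size_filter size_map size_allpairs !size_ps -expnD => ->.
by congr (_ ^ _)%N; lia.
Qed.

Lemma size_Xc (c : k) (f : {poly k}) j : (size (('X - c%:P) * f)%R <= j.+1)%N = (size f <= j)%N.
Proof.
have [->|f0] := eqVneq f 0; first by rewrite mulr0 size_poly0.
by rewrite size_mul ?polyXsubC_eq0 // size_XsubC.
Qed.

Lemma size_Dle (f g : {poly k}) j : (size f <= j)%N -> (size g <= j)%N -> (size (f + g)%R <= j)%N.
Proof. by move=> h1 h2; apply: leq_trans (size_polyD _ _) _; rewrite geq_max h1 h2. Qed.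

Lemma size_Ble (f g : {poly k}) j : (size f <= j)%N -> (size g <= j)%N -> (size (f - g)%R <= j)%N.
Proof. by move=> h1 h2; apply: size_Dle => //; rewrite size_polyN. Qed.

(** Solving the conditions leaves two free polynomials of sizes at most M/2 and (M+1)/2, rounded
    down, together M coefficients. The margin 3 puts all the pairs into [pairs_of B]. *)
Lemma count_bounded_pair (M B : nat) c2 c3 : (M + 3 <= B)%N ->
  (count (bounded_pair M c2 c3) (pairs_of B)).+1 = (q ^ M)%N.
Proof.
have h1 (a b : nat) : (2 * a <= b)%N = (a <= b./2)%N by apply/idP/idP; lia.
have X0 : 'X = 'X - 0%:P :> {poly k} by rewrite subr0.
have X1 : ('X - 1%:P : {poly k}) != 0 by rewrite polyXsubC_eq0.
have eM : (M.+1./2 <= M./2.+1)%N by lia.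
case: c2; case: c3; rewrite ?addn0 ?addn1.
- apply: (@count_bounded_pair_aux M B true true (fun r => (r.2 + ('X - 1%:P) * r.1, 'X * r.2))).
  + move=> [a b] [c e] /= [h2 /(mulfI (negbT (polyX_eq0 k))) eb]; move: h2; rewrite eb => /addrI.
    by move=> /(mulfI X1) ->.
  + by rewrite /= !mulr0 addr0.
  + move=> [a b] /= sa sb; split.
    * rewrite nd_le !h1 /= !addn1 /=; apply/andP; split.
        by apply: size_Dle; [exact: leq_trans sb eM|rewrite size_Xc].
      by rewrite X0 size_Xc.
    * by rewrite /cc2 /= hornerM hornerX mul0r.
    * by rewrite /cc3 /= hornerD !hornerM hornerXsubC subrr mul0r addr0 hornerX mul1r.
  + move=> [a b]; rewrite nd_le !h1 /= !addn1 /= => /andP[sa sb] /eqP /= c2 /eqP /= c3.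
    have [g eg] := root_div c2; rewrite -X0 in eg.
    have [|f ef] := @root_div k 1 (a - g).
      by rewrite hornerD hornerN; move: c3; rewrite /= eg hornerM hornerX mul1r => ->; rewrite subrr.
    have sg : (size g <= M.+1./2)%N by move: sb; rewrite eg {1}X0 size_Xc.
    exists (f, g); split=> //=; last by rewrite -ef eg addrC subrK.
    by rewrite -(size_Xc 1) -ef; apply: size_Ble => //; exact: leq_trans sg eM.
- apply: (@count_bounded_pair_aux M B true false (fun r => (r.2, 'X * r.1))).
  + by move=> [a b] [c e] /= [-> /(mulfI (negbT (polyX_eq0 k))) ->].
  + by rewrite /= mulr0.
  + move=> [a b] /= sa sb; split=> //.
      by rewrite nd_le !h1 /= addn0 addn1 /= sb X0 size_Xc.
    by rewrite /cc2 /= hornerM hornerX mul0r.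
  + move=> [a b]; rewrite nd_le !h1 /= addn0 addn1 /= => /andP[sa sb] /eqP /= c2 _.
    have [g eg] := root_div c2; rewrite -X0 in eg; exists (g, a); split=> //=; last by rewrite eg.
    by move: sb; rewrite eg {1}X0 size_Xc.
- apply: (@count_bounded_pair_aux M B false true (fun r => (r.2, r.2 + ('X - 1%:P) * r.1))).
  + by move=> [a b] [c e] /= [-> /addrI /(mulfI X1) ->].
  + by rewrite /= mulr0 addr0.
  + move=> [a b] /= sa sb; split=> //.
      rewrite nd_le !h1 /= addn0 addn1 /= sb /=.
      by apply: size_Dle; [exact: leq_trans sb eM|rewrite size_Xc].
    by rewrite /cc3 /= hornerD !hornerM hornerXsubC subrr mul0r addr0.
  + move=> [a b]; rewrite nd_le !h1 /= addn0 addn1 /= => /andP[sa sb] _ /eqP /= c3.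
    have [|f ef] := @root_div k 1 (b - a); first by rewrite hornerD hornerN -c3 subrr.
    exists (f, a); split=> //=; last by rewrite -ef addrC subrK.
    by rewrite -(size_Xc 1) -ef; apply: size_Ble => //; exact: leq_trans sa eM.
- apply: (@count_bounded_pair_aux M B false false id) => //.
  + by move=> r sa sb; split=> //; rewrite nd_le !h1 !addn0 sa sb.
  + by move=> r; rewrite nd_le !h1 !addn0 => /andP[sa sb] _ _; exists r.
Qed.

End Lists.

(** * The recursion for the number of primitive pairs *)

Section PrimCount.
Variables (k : finFieldType) (B : nat).
Local Notation PP := ({poly k} * {poly k})%type.
Local Notation q := #|k|.
Implicit Types (r s rho : PP) (h : {poly k}).

Definition prims : seq PP := [seq rho <- pairs_of k B | prim rho].
(* B only serves to make the set of primitive pairs finite. *)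
Definition Snu (M : nat) : nat := count (fun rho => nu rho <= M)%N prims.

Lemma nd_nu rho : rho != 0 -> nd rho = (nu rho + cc2 rho + cc3 rho)%N /\ (0 < nu rho)%N.
Proof.
move=> r0; have := nu_pos r0; rewrite /nu.
by case: (cc2 rho) (cc3 rho) => [] [] /=; move: (nd rho) => i; lia.
Qed.

Lemma mem_bounded_pair M c2 c3 r : (M + 3 <= B)%N -> bounded_pair M c2 c3 r -> r \in pairs_of k B.
Proof.
move=> lB /and4P[_ h _ _]; rewrite mem_pairs; move: h; rewrite nd_le.
by case: c2 c3 => [] [] /=; move: (size _) (size _) => i j; lia.
Qed.

Lemma count_decomp M c2 c3 : (M + 3 <= B)%N ->
  count (bounded_pair M c2 c3) (pairs_of k B) =
  (\sum_(rho <- prims) count (fun h => bounded_pair M c2 c3 (pmul h rho)) (mons k B))%N.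
Proof.
move=> lB; pose l := [seq (rho, h) | rho <- prims, h <- mons k B].
have ml c : (c \in l) = (c.1 \in prims) && (c.2 \in mons k B).
  apply/allpairsP/andP => [[[a b] [/= h1 h2 ->]]|[h1 h2]] //.
  by exists c; rewrite -surjective_pairing.
have ul : uniq l.
  apply: allpairs_uniq; rewrite ?mons_uniq ?filter_uniq ?pairs_uniq //.
  by move=> [? ?] [? ?].
pose a (c : PP * {poly k}) := bounded_pair M c2 c3 (pmul c.2 c.1).
have pe : perm_eq [seq r <- pairs_of k B | bounded_pair M c2 c3 r] [seq pmul c.2 c.1 | c <- [seq c <- l | a c]].
  apply: uniq_perm.
  - by rewrite filter_uniq ?pairs_uniq.
  - rewrite map_inj_in_uniq ?filter_uniq // => -[r1 h1] [r2 h2]; rewrite !mem_filter !ml /= !mem_filter !mem_mons.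
    move=> /and3P[_ /andP[p1 _] /andP[m1 _]] /and3P[_ /andP[p2 _] /andP[m2 _]] e.
    by have [-> ->] := prim_uniq m1 m2 p1 p2 e.
  move=> r; rewrite mem_filter; apply/andP/mapP => [[Wr rB]|[[rho h]]]; last first.
    rewrite mem_filter ml => /andP[Wr _] ->; split=> //; exact: mem_bounded_pair Wr.
  have /and4P[r0 _ _ _] := Wr.
  have [h [rho [mh pr er]]] := prim_decomp r0.
  exists (rho, h) => //; rewrite mem_filter ml /= /a /= -er Wr mem_filter pr mem_mons mh /=.
  have h0 := monic_neq0 mh.
  move: rB; rewrite !mem_pairs er /= => /andP[s1 s2].
  have le (f : {poly k}) : (size (h * f)%R <= B)%N -> (size f <= B)%N.
    move=> sf; have [->|f0] := eqVneq f 0; first by rewrite size_poly0.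
    by apply: leq_trans sf; apply: dvdp_leq; rewrite ?mulf_neq0 ?dvdp_mull.
  rewrite (le _ s1) (le _ s2) /=; have := r0; rewrite er pmul_eq0 (negPf h0) /= => rn.
  have [e1|n1] := eqVneq rho.1 0; last by apply: leq_trans s1; apply: dvdp_leq; rewrite ?mulf_neq0 ?dvdp_mulr.
  have n2 : rho.2 != 0 by apply: contraNneq rn => e2; rewrite [rho]surjective_pairing e1 e2.
  by apply: leq_trans s2; apply: dvdp_leq; rewrite ?mulf_neq0 ?dvdp_mulr.
rewrite -size_filter (perm_size pe) size_map size_filter -sum1_count big_mkcond big_allpairs /=.
by apply: eq_bigr => rho _; rewrite -big_mkcond sum1_count.
Qed.

(** The size allowed to the free part of a monic cofactor of rho, where v = nu rho and the
    conditions met by rho differ from the imposed ones in x places. A missing condition costs a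
    factor t or t - 1, two units of [nd] against one unit of allowance; a condition met but not
    imposed costs the unit credited for it. Either way the cost is one. *)
Definition cofactor_size (M v x : nat) : nat := if (v + x <= M)%N then ((M - v - x)./2).+1 else 0%N.

Lemma cofactor_size_arith (M v s : nat) (a2 a3 c2 c3 : bool) : (0 < s)%N ->
  (v + a2 + a3 + 2 * ((c2 && ~~ a2) + (c3 && ~~ a3) + s).-1 <= M + c2 + c3)%N =
  (s <= cofactor_size M v ((c2 (+) a2) + (c3 (+) a3)))%N.
Proof.
case: s => // s _; have h2 (a b : nat) : (a <= b./2)%N = (2 * a <= b)%N by apply/idP/idP; clia.
rewrite /cofactor_size; case: ifP => [|/negbT]; rewrite ?addnS ?ltnS /= ?h2.
  by case: a2; case: a3; case: c2; case: c3 => /= h; apply/idP/idP; move: h; clia.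
by case: a2; case: a3; case: c2; case: c3 => /= h; apply/negbTE; move: h; clia.
Qed.

Lemma count_cofactors M (c2 c3 : bool) rho : (M + 3 <= B)%N -> prim rho ->
  count (fun h => bounded_pair M c2 c3 (pmul h rho)) (mons k B) =
  size (mons k (cofactor_size M (nu rho) ((c2 (+) cc2 rho) + (c3 (+) cc3 rho)))).
Proof.
move=> lB pr; have r0 := prim_neq0 pr; have [en nu0] := nd_nu r0.
set x := (X in cofactor_size _ _ X).
pose m2 := c2 && ~~ cc2 rho; pose m3 := c3 && ~~ cc3 rho.
pose P : {poly k} := 'X^m2 * ('X - 1) ^+ m3.
have m1 : ('X - 1 : {poly k}) \is poly.monic by exact: monicXsubC.
have mP : P \is poly.monic by rewrite monicMl ?monicXn ?monic_exp.
have sP : size P = (m2 + m3).+1.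
  rewrite size_monicM ?monicXn ?monic_neq0 ?monic_exp // size_polyXn.
  have -> : size (('X - 1 : {poly k}) ^+ m3) = m3.+1.
    by case: (m3); rewrite ?expr0 ?expr1 ?size_poly1 //; exact: (size_XsubC 1).
  by rewrite addSn addnS.
have ar (s : nat) : (0 < s)%N -> (nd rho + 2 * (m2 + m3 + s).-1 <= M + c2 + c3)%N = (s <= cofactor_size M (nu rho) x)%N.
  by move=> s0; rewrite en; exact: cofactor_size_arith.
have sPM (g : {poly k}) : g != 0 -> size (P * g) = (m2 + m3 + size g)%N.
  by move=> g0; rewrite size_monicM // sP.
have mono0 (g : {poly k}) : g \is poly.monic -> (0 < size g)%N.
  by move=> mg; rewrite size_poly_gt0 monic_neq0.
rewrite -size_filter -[RHS](size_map (fun g => P * g)); apply: perm_size; apply: uniq_perm.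
- by rewrite filter_uniq ?mons_uniq.
- by rewrite map_inj_in_uniq ?mons_uniq // => f g _ _ /(mulfI (monic_neq0 mP)).
move=> h; rewrite mem_filter mem_mons; apply/andP/mapP => [[/and4P[h0 ndh w2 w3] /andP[mh sh]]|[g]].
  have hn := monic_neq0 mh.
  have [||G eG _] := @fact01 k m2 m3 h.
  - move=> /andP[e2 /negPf n2]; move: w2; rewrite e2 /cc2 /= hornerM mulf_eq0 [X in _ || X]n2 orbF.
    by move=> /eqP.
  - move=> /andP[e3 n3]; move: w3; rewrite e3 /cc3 /= !hornerM => /eqP h3.
    apply/eqP; apply: contraNT n3 => hn1; apply/eqP; exact: (mulfI hn1).
  exists G; last by rewrite eG.
  have mG : G \is poly.monic by move: mh; rewrite eG -/P monicMl.
  rewrite mem_mons mG /= -ar ?mono0 //.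
  by move: ndh; rewrite nd_pmul // eG -/P sPM ?monic_neq0.
rewrite mem_mons => /andP[mg sg] ->; have g0 := monic_neq0 mg.
have mPg : P * g \is poly.monic by rewrite monicMl.
have ndl : (nd (pmul (P * g) rho) <= M + c2 + c3)%N.
  by rewrite nd_pmul ?monic_neq0 // sPM // ar // mono0.
have hW : bounded_pair M c2 c3 (pmul (P * g) rho).
  rewrite /bounded_pair pmul_eq0 (negPf (monic_neq0 mPg)) (negPf r0) ndl /=; apply/andP; split; apply/implyP => hc.
    rewrite /cc2 /= hornerM mulf_eq0; have [c2r|n2] := boolP (cc2 rho).
      by apply/orP; right.
    by rewrite !hornerM /m2 hc n2 hornerX !mul0r eqxx.
  rewrite /cc3 /= !hornerM; have [/eqP c3r|n3] := boolP (cc3 rho); first by rewrite c3r.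
  have -> : (('X - 1 : {poly k}) ^+ m3).[1] = 0.
    by rewrite /m3 hc n3 expr1 hornerD hornerN hornerX (hornerC 1 1 : (1 : {poly k}).[1] = 1) subrr.
  by rewrite mulr0 !mul0r.
split=> //; rewrite mPg /=.
move: ndl; rewrite nd_pmul ?monic_neq0 // sPM // => ndl.
move: ndl (mono0 g mg) (nd_gt0 r0) lB; move: (size g) (nd rho) => s t.
by move: (nat_of_bool m2) (nat_of_bool m3) => a b; case: (c2); case: (c3); clia.
Qed.

(** Over the four choices of conditions the number of differences from those met by rho takes the
    values 0, 1, 1, 2 for every rho, so the summand depends on [nu rho] alone. *)
Lemma sum_cofactors M : (M + 3 <= B)%N ->
  (\sum_(rho <- prims) (size (mons k (cofactor_size M (nu rho) 0)) + 2 * size (mons k (cofactor_size M (nu rho) 1))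
     + size (mons k (cofactor_size M (nu rho) 2))) + 4 = 4 * q ^ M)%N.
Proof.
move=> lB.
have e c2 c3 : (\sum_(rho <- prims) size (mons k (cofactor_size M (nu rho) ((c2 (+) cc2 rho) + (c3 (+) cc3 rho)))) + 1 = q ^ M)%N.
  rewrite -(count_bounded_pair k c2 c3 lB) (count_decomp _ _ lB) addn1; congr _.+1.
  rewrite big_seq [RHS]big_seq; apply: eq_bigr => rho; rewrite mem_filter => /andP[pr _].
  by rewrite count_cofactors.
have -> : (\sum_(rho <- prims) (size (mons k (cofactor_size M (nu rho) 0)) + 2 * size (mons k (cofactor_size M (nu rho) 1))
     + size (mons k (cofactor_size M (nu rho) 2))) =
  \sum_(rho <- prims) (size (mons k (cofactor_size M (nu rho) ((false (+) cc2 rho) + (false (+) cc3 rho))))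
   + size (mons k (cofactor_size M (nu rho) ((false (+) cc2 rho) + (true (+) cc3 rho))))
   + size (mons k (cofactor_size M (nu rho) ((true (+) cc2 rho) + (false (+) cc3 rho))))
   + size (mons k (cofactor_size M (nu rho) ((true (+) cc2 rho) + (true (+) cc3 rho))))))%N.
  apply: eq_bigr => rho _; case: (cc2 rho) (cc3 rho) => [] [] /=;
  move: (size (mons k (cofactor_size M (nu rho) 0))) (size (mons k (cofactor_size M (nu rho) 1))) (size (mons k (cofactor_size M (nu rho) 2))) => i j l; lia.
have ar (a b c f x : nat) : (a + 1 = x -> b + 1 = x -> c + 1 = x -> f + 1 = x -> a + b + c + f + 4 = 4 * x)%N by lia.
by rewrite !big_split; exact: ar (e false false) (e false true) (e true false) (e true true).
Qed.

Lemma size_mons_cofactor M v x : size (mons k (cofactor_size M.+2 v x)) =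
  ((v + x <= M.+2) + q * size (mons k (cofactor_size M v x)))%N.
Proof.
rewrite /cofactor_size; case: leqP => h1; last first.
  have -> : (v + x <= M)%N = false by apply/negbTE; lia.
  by rewrite muln0.
rewrite size_mons_rec; congr (_ + _ * size (mons k _))%N; case: leqP => h2; lia.
Qed.

(** Raising M by 2 allows cofactors of one degree more, which multiplies their number by q and adds
    1 whenever rho is small enough. Subtracting q times the identity for M from that for M + 2
    leaves only these ones. *)
Lemma Snu_rec M : (M + 5 <= B)%N ->
  (Snu M.+2 + 2 * Snu M.+1 + Snu M + 4 + 4 * q ^ M.+1 = 4 * q ^ M.+2 + 4 * q)%N.
Proof.
move=> lB; have l1 : (M + 3 <= B)%N by lia. have l2 : (M.+2 + 3 <= B)%N by lia.
have := sum_cofactors l1; have := sum_cofactors l2.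
under eq_bigr => rho _ do rewrite !size_mons_cofactor.
have -> : (\sum_(rho <- prims) ((nu rho + 0 <= M.+2) + q * size (mons k (cofactor_size M (nu rho) 0)) +
     2 * ((nu rho + 1 <= M.+2) + q * size (mons k (cofactor_size M (nu rho) 1))) +
     ((nu rho + 2 <= M.+2) + q * size (mons k (cofactor_size M (nu rho) 2)))) =
   (Snu M.+2 + 2 * Snu M.+1 + Snu M) + q * \sum_(rho <- prims) (size (mons k (cofactor_size M (nu rho) 0)) +
     2 * size (mons k (cofactor_size M (nu rho) 1)) + size (mons k (cofactor_size M (nu rho) 2))))%N.
  have Sd j : Snu j = (\sum_(rho <- prims) (nu rho <= j)%N)%N.
    by rewrite /Snu -sum1_count big_mkcond; apply: eq_bigr => rho _; case: ifP.
  rewrite !Sd (big_distrr q) (big_distrr 2) /= -!big_split /=; apply: eq_bigr => rho _.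
  rewrite addn0 addn1 addn2 !ltnS.
  move: (size (mons k (cofactor_size M (nu rho) 0))) (size (mons k (cofactor_size M (nu rho) 1))) (size (mons k (cofactor_size M (nu rho) 2))) => i j l.
  by ring.
set T := (\sum_(rho <- prims) _)%N => h2 h1.
have h3 : (q * T + 4 * q = 4 * q ^ M.+1)%N by rewrite expnS mulnCA -h1 mulnDr [(4 * q)%N]mulnC.
by rewrite -h3 -h2; move: (q * T)%N (4 * q)%N (Snu M.+2) (Snu M.+1) (Snu M) => a b c e f; lia.
Qed.

Lemma Snu0 : Snu 0 = 0%N.
Proof.
apply/eqP; rewrite -leqn0 leqNgt -has_count; apply/hasPn => rho; rewrite mem_filter => /andP[pr _].
by have [_] := nd_nu (prim_neq0 pr); rewrite lt0n leqn0.
Qed.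

Lemma Snu1 : (4 <= B)%N -> (Snu 1 + 4 = 4 * q)%N.
Proof.
move=> lB; rewrite -[q]expn1 -(@sum_cofactors 1) //; congr (_ + _)%N.
rewrite /Snu -sum1_count big_mkcond big_seq [RHS]big_seq; apply: eq_bigr => rho.
rewrite mem_filter => /andP[pr _]; have [_ n0] := nd_nu (prim_neq0 pr).
rewrite /cofactor_size; move: (nu rho) n0 => [|[|v]] // _ /=.
by rewrite size_map size_ps.
Qed.

End PrimCount.

Lemma Posz_exp (a m : nat) : (a ^ m)%N%:Z = a%:Z ^+ m.
Proof. by elim: m => // m IH; rewrite expnS exprS PoszM IH. Qed.

(** * Points whose kernel contains a pair that is too small *)

Section BadPoints.
Variables (k : finFieldType) (d n : nat) (z : {mpoly k[2]}).
Hypothesis Hz : ordinary_point d z.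
Hypothesis n_gt0 : (0 < n)%N.
Local Notation ze := (zeta z).
Local Notation D := (d * n)%N.
Local Notation B := (D + 5)%N.
Local Notation PP := ({poly k} * {poly k})%type.
Local Notation q := #|k|.
Implicit Types (pt r s rho : PP) (f g h : {poly k}).

Let irr := zeta_irr Hz.
Let ze0 : ze != 0. Proof. exact: (ze_neq0 irr). Qed.
Let d0 : (0 < d)%N. Proof. exact: d_gt0 Hz. Qed.
Let szn j : size (ze ^+ j) = (d * j).+1. Proof. exact: (size_zetan Hz). Qed.

Lemma horner_ev0 h rho : h.[0] != 0 -> cc2 (pmul h rho) = cc2 rho.
Proof. by move=> h0; rewrite /cc2 /= hornerM mulf_eq0 (negPf h0). Qed.

Lemma horner_ev1 h rho : h.[1] != 0 -> cc3 (pmul h rho) = cc3 rho.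
Proof. by move=> h0; rewrite /cc3 /= !hornerM (inj_eq (mulfI h0)). Qed.

Lemma nu_pmul_unit h rho : h.[0] != 0 -> h.[1] != 0 -> rho != 0 ->
  nu (pmul h rho) = (nu rho + 2 * (size h).-1)%N.
Proof.
move=> h0 h1 r0; have hn : h != 0 by apply: contraNneq h0 => ->; rewrite horner0.
have [e0 _] := nd_nu r0.
rewrite {1}/nu horner_ev0 // horner_ev1 // nd_pmul // e0.
by move: (nu rho) (size h).-1 (cc2 rho) (cc3 rho) => a b [] []; clia.
Qed.

(** A condition gained through h comes from a zero of h at 0 or 1, that is, from a factor that adds
    2 to [nd] and only 1 to the credit. *)
Lemma nu_pmul h rho : h != 0 -> rho != 0 -> (nu rho <= nu (pmul h rho))%N.
Proof.
move=> h0 r0; have [e0 _] := nd_nu r0.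
have [||G eG sG] := @fact01 k (h.[0] == 0) (h.[1] == 0) h; [by move/eqP|by move/eqP|].
have G0 : (0 < size G)%N.
  by rewrite size_poly_gt0; apply: contraNneq h0 => G0; rewrite eG G0 mulr0.
rewrite {2}/nu nd_pmul // e0.
have q2 : (cc2 (pmul h rho) <= cc2 rho + (h.[0%R] == 0%R))%N.
  case: (eqVneq h.[0] 0) => [_|/horner_ev0 ->]; last by rewrite addn0.
  by case: (cc2 (pmul h rho)); case: (cc2 rho).
have q3 : (cc3 (pmul h rho) <= cc3 rho + (h.[1%R] == 0%R))%N.
  case: (eqVneq h.[1] 0) => [_|/horner_ev1 ->]; last by rewrite addn0.
  by case: (cc3 (pmul h rho)); case: (cc3 rho).
move: q2 q3 sG G0; move: (nat_of_bool (h.[0] == 0)) (nat_of_bool (h.[1] == 0)).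
move: (nat_of_bool (cc2 (pmul h rho))) (nat_of_bool (cc3 (pmul h rho))).
move: (nat_of_bool (cc2 rho)) (nat_of_bool (cc3 rho)).
by move: (size G) (size h) (nu rho) => a b c; clia.
Qed.

(* The largest j such that ze^j rho is small enough to make a point bad. *)
Definition zmult rho : nat := ((D - nu rho) %/ (2 * d))%N.
(** Equivalently, the largest admissible multiple ze^j rho, with j = zmult rho, lies in the kernel
    of pt modulo ze^n. *)
Definition incident pt rho := (nu rho <= D)%N && (ze ^+ (n - zmult rho) %| Lf pt rho).

Lemma nu_ze j rho : rho != 0 -> nu (pmul (ze ^+ j) rho) = (nu rho + 2 * d * j)%N.
Proof.
move=> r0; rewrite nu_pmul_unit // ?horner_exp ?expf_neq0 ?(zeta_0 Hz) ?(zeta_1 Hz) //.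
by rewrite szn mulnA.
Qed.

Lemma zmult_le rho : (nu rho <= D)%N -> (nu rho + 2 * d * zmult rho <= D)%N.
Proof. by move=> le; rewrite -[leqRHS](subnKC le) leq_add2l mulnC leq_trunc_div. Qed.

Lemma zmult_lt rho : rho != 0 -> (zmult rho < n)%N.
Proof.
move=> /nd_nu[_ n0]; rewrite ltn_divLR ?muln_gt0 //.
have : (0 < D)%N by rewrite muln_gt0 d0.
have : (D <= n * (2 * d))%N by rewrite mulnCA [(n * d)%N]mulnC leq_pmull.
by move: n0; move: (nu rho) (D) (n * (2 * d))%N => a b c; clia.
Qed.

Lemma goodP pt : good d n z pt <-> forall r, r != 0 -> ze ^+ n %| Lf pt r -> (D < nu r)%N.
Proof.
have e r : r != 0 -> (D + cc2 r + cc3 r < nd r)%N = (D < nu r)%N.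
  move=> /nd_nu[-> _]; move: (D) (nu r) (cc2 r) (cc3 r) => a b [] []; apply/idP/idP; clia.
by split=> h r r0 dv; have := h r r0 dv; rewrite e.
Qed.

(** A small kernel element is h rho with rho primitive and h = ze^e g, g prime to ze. Cancelling g
    keeps it in the kernel and does not increase [nu], so e is at most [zmult rho]. *)
Lemma not_good_incident pt : ~ good d n z pt <-> exists2 rho, prim rho & incident pt rho.
Proof.
split=> [ng|[rho pr /andP[le dv]] /goodP g]; last first.
  have r0 := prim_neq0 pr.
  have := g (pmul (ze ^+ zmult rho) rho).
  rewrite pmul_eq0 (negPf r0) expf_eq0 (negPf ze0) andbF LfM => /(_ isT).
  rewrite nu_ze // ltnNge zmult_le // => h; apply: notF; apply: h.
  by rewrite -{1}(subnKC (ltnW (zmult_lt r0))) exprD dvdp_mul2l ?expf_neq0.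
apply: contrapT => no; apply: ng; apply/goodP => r r0 dv; rewrite ltnNge; apply/negP => le.
have [h [rho [mh pr er]]] := prim_decomp r0.
have [e [g [eh ndg]]] := ze_split irr (monic_neq0 mh).
have p0 := prim_neq0 pr.
have g0 : g != 0 by apply: contraNneq ndg => ->; rewrite dvdp0.
have pg0 : pmul g rho != 0 by rewrite pmul_eq0 negb_or g0.
have le2 : (nu rho + 2 * d * e <= D)%N.
  apply: leq_trans le; rewrite er eh -pmulA nu_ze // leq_add2r; exact: nu_pmul.
have et : (e <= zmult rho)%N.
  by rewrite leq_divRL ?muln_gt0 // mulnC; move: le2; move: (2 * d * e)%N (nu rho) (D) => a b c; clia.
have tn := zmult_lt p0.
apply: no; exists rho => //; apply/andP; split; first by apply: leq_trans le2; exact: leq_addr.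
have en : (e <= n)%N by exact: ltnW (leq_ltn_trans et tn).
apply: dvdp_trans (_ : ze ^+ (n - e) %| _); first by rewrite dvdp_exp2l // leq_sub2l.
move: dv; rewrite er eh LfM -mulrA -{1}(subnKC en) exprD dvdp_mul2l ?expf_neq0 //.
exact: (ze_cancel irr).
Qed.

(* The determinant of two incident primitive pairs is divisible by a power of ze exceeding
   its degree, hence vanishes. *)
Lemma incident_prop pt rho rho' : unimod z pt -> prim rho -> prim rho' -> incident pt rho -> incident pt rho' ->
  exists2 c : k, c != 0 & rho' = pmul c%:P rho.
Proof.
move=> um pr pr' /andP[le dv] /andP[le' dv'].
have r0 := prim_neq0 pr; have r0' := prim_neq0 pr'.
apply: prim_prop => //; apply/eqP; rewrite -subr_eq0; set de := _ - _.
apply/negPn/negP => de0; pose T := maxn (zmult rho) (zmult rho').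
have dvT : ze ^+ (n - T) %| Lf pt rho.
  by apply: dvdp_trans dv; rewrite dvdp_exp2l // leq_sub2l // leq_maxl.
have dvT' : ze ^+ (n - T) %| Lf pt rho'.
  by apply: dvdp_trans dv'; rewrite dvdp_exp2l // leq_sub2l // leq_maxr.
have dd : ze ^+ (n - T) %| de.
  case/orP: um => nz; apply: (ze_cancel irr nz).
    have -> : pt.1 * de = Lf pt rho * rho'.2 - Lf pt rho' * rho.2 by rewrite /Lf /de; ring.
    by apply: dvdp_sub; exact: dvdp_mulr.
  have -> : pt.2 * de = Lf pt rho' * rho.1 - Lf pt rho * rho'.1 by rewrite /Lf /de; ring.
  by apply: dvdp_sub; exact: dvdp_mulr.
(* Conditions met by both pairs give zeros of the determinant at 0 and 1. The corresponding factors
   are prime to ze and are split off; they make up for the shared credits in the degree estimate. *)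
pose m2 := cc2 rho && cc2 rho'; pose m3 := cc3 rho && cc3 rho'.
have [||G eG sG] := @fact01 k m2 m3 de.
- by move=> /andP[/eqP e1 /eqP e2]; rewrite /de hornerD hornerN !hornerM e1 e2 mulr0 mul0r subrr.
- by move=> /andP[/eqP e1 /eqP e2]; rewrite /de hornerD hornerN !hornerM e1 e2 mulrC subrr.
have G0 : G != 0 by apply: contraNneq de0 => G0; rewrite eG G0 mulr0.
have nz : ~~ (ze %| 'X^m2 * ('X - 1) ^+ m3).
  apply: contra (nze_tt1 Hz) => h; apply: dvdp_trans h _; apply: dvdp_mul.
    by case: (m2); rewrite ?expr0 ?expr1 ?dvd1p ?dvdpp.
  by case: (m3); rewrite ?expr0 ?expr1 ?dvd1p ?dvdpp.
have sG1 : ((d * (n - T)).+1 <= size G)%N.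
  by rewrite -szn; apply: dvdp_leq => //; move: dd; rewrite eG; exact: (ze_cancel irr).
have sde : (2 * size de < nd rho + nd rho')%N.
  have s1 := size_polyMleq rho.1 rho'.2; have s2 := size_polyMleq rho.2 rho'.1.
  have := size_polyD (rho.1 * rho'.2) (- (rho.2 * rho'.1)); rewrite size_polyN -/de.
  have := nd_gt0 r0; have := nd_gt0 r0'; move: s1 s2; rewrite /nd.
  move: (size rho.1) (size rho.2) (size rho'.1) (size rho'.2) (size (rho.1 * rho'.2)) (size (rho.2 * rho'.1)) (size de).
  by move=> a b a' b' x y w; clia.
have [e1 _] := nd_nu r0; have [e2 _] := nd_nu r0'.
have t1 := zmult_le le; have t2 := zmult_le le'.
have eT : (d * (n - T) + d * T = D)%N.
  by rewrite -mulnDr subnK // /T geq_max (ltnW (zmult_lt r0)) (ltnW (zmult_lt r0')).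
have sM : (size G + (m2 + m3) <= size de)%N.
  have : (0 < size G)%N by rewrite size_poly_gt0.
  by move: sG; move: (size G) (size de) (m2) (m3) => a b [] []; clia.
have tT : (2 * (d * T) <= 2 * d * zmult rho + 2 * d * zmult rho')%N.
  rewrite mulnA -mulnDr leq_mul2l; apply/orP; right; rewrite /T; move: (zmult rho) (zmult rho') => a b; clia.
move: sG1 sde t1 t2 eT sM tT; rewrite e1 e2 /m2 /m3.
move: (2 * d * zmult rho)%N (2 * d * zmult rho')%N (d * T)%N (d * (n - T))%N (D) (size G) (size de) (nu rho) (nu rho').
by move=> a b c e f g h i j; case: (cc2 rho); case: (cc3 rho); case: (cc2 rho'); case: (cc3 rho') => /=; clia.
Qed.

Lemma incident_scale pt (c : k) rho : c != 0 -> rho != 0 -> incident pt (pmul c%:P rho) = incident pt rho.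
Proof.
move=> c0 r0.
have en : nu (pmul c%:P rho) = nu rho.
  by rewrite nu_pmul_unit ?hornerC // size_polyC c0 muln0 addn0.
by rewrite /incident /zmult en LfM mul_polyC dvdpZr.
Qed.

Lemma incident_mem pt rho : prim rho -> incident pt rho -> rho \in prims k B.
Proof.
move=> pr /andP[le _]; rewrite mem_filter pr mem_pairs /=.
have [e _] := nd_nu (prim_neq0 pr).
have : (nd rho <= D + 2)%N by rewrite e; move: le; move: (nu rho) (D) (cc2 rho) (cc3 rho) => a b [] []; clia.
by rewrite nd_le; move: (size rho.1) (size rho.2) (D) => a b c; clia.
Qed.

Lemma count_incident pt : unimod z pt ->
  count (incident pt) (prims k B) = if `[< good d n z pt >] then 0%N else q.-1.
Proof.
move=> um; case: asboolP => [g|/not_good_incident[rho pr ic]].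
  apply/eqP; rewrite -leqn0 leqNgt -has_count; apply/hasPn => rho; rewrite mem_filter => /andP[pr _].
  by apply/negP => ic; have : ~ good d n z pt by apply/not_good_incident; exists rho.
have r0 := prim_neq0 pr.
rewrite -(cardC1 (0 : k)) cardE -(size_map (fun c => pmul c%:P rho)) -size_filter.
apply: perm_size; apply: uniq_perm.
- by rewrite filter_uniq // filter_uniq // pairs_uniq.
- rewrite map_inj_in_uniq ?enum_uniq // => a c _ _ [e1 e2]; apply/polyC_inj/eqP; rewrite -subr_eq0.
  have : pmul (a%:P - c%:P) rho == 0.
    by apply/eqP; rewrite /pmul !mulrBl e1 e2 !subrr.
  by rewrite pmul_eq0 (negPf r0) orbF.
move=> s; rewrite mem_filter; apply/andP/mapP => [[ics]|[c]].
  rewrite mem_filter => /andP[ps _].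
  by have [c c0 ->] := incident_prop um pr ps ic ics; exists c => //; rewrite mem_enum.
rewrite mem_enum /= inE => c0 ->; rewrite incident_scale //; split=> //.
by apply: (@incident_mem pt); rewrite ?prim_scale ?incident_scale.
Qed.

Lemma count_cong (P f : {poly k}) (j M : nat) : size P = j.+1 -> (j <= M)%N ->
  count (fun g => P %| g - f) (ps k M) = (q ^ (M - j))%N.
Proof.
move=> sP lj; have P0 : P != 0 by rewrite -size_poly_gt0 sP.
rewrite -size_filter -(size_ps k (M - j)) -[RHS](size_map (fun g => P * g + f %% P)).
have sm : (size (f %% P)%R <= M)%N.
  by apply: leq_trans lj; rewrite -ltnS -sP ltn_modp.
have szP (g : {poly k}) : (size (P * g)%R <= M)%N = (size g <= M - j)%N.
  have [->|g0] := eqVneq g 0; first by rewrite mulr0 size_poly0.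
  by rewrite size_mul // sP /=; move: (size g) => a; apply/idP/idP; lia.
have fm : f = (f %/ P) * P + f %% P by exact: divp_eq.
apply: perm_size; apply: uniq_perm.
- by rewrite filter_uniq ?ps_uniq.
- by rewrite map_inj_in_uniq ?ps_uniq // => a c _ _ /addIr /(mulfI P0).
move=> g; rewrite mem_filter mem_ps; apply/andP/mapP => [[/dvdpP[/= a ea] sg]|[a]].
  have eg : g = P * (a + f %/ P) + f %% P.
    by rewrite mulrDr -addrA (mulrC P (f %/ P)) -fm mulrC -ea subrK.
  exists (a + f %/ P) => //; rewrite mem_ps -szP.
  have -> : P * (a + f %/ P) = g - f %% P by rewrite {1}eg addrK.
  exact: size_Ble.
rewrite mem_ps -szP => sa ->; split; last exact: size_Dle.
by rewrite {2}fm opprD addrACA subrr addr0 mulrC -mulrBl dvdp_mull.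
Qed.

Lemma count_lin (g h : {poly k}) (e M : nat) : ~~ (ze %| g) -> (d * e <= M)%N ->
  count (fun f => ze ^+ e %| f * g + h) (ps k M) = (q ^ (M - d * e))%N.
Proof.
move=> ng le; have [w hw] := ze_inv irr e ng.
rewrite -(count_cong (- (w * h)) (szn e) le); apply: eq_count => f; rewrite opprK.
have nw (j : nat) : (0 < j)%N -> ze ^+ j %| w * g - 1 -> ~~ (ze %| w).
  move=> j0 hj; apply/negP => dw; have : ze %| ze ^+ j by rewrite -(prednK j0) exprS dvdp_mulr.
  move=> /dvdp_trans /(_ hj); rewrite dvdp_subr ?dvdp_mulr // dvdp1.
  by have [sz _] := irr; rewrite gtn_eqF.
case: e le hw => [|e] le hw; first by rewrite expr0 !dvd1p.
have {nw}nw := nw _ (ltn0Sn e) hw.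
apply/idP/idP => h1.
  have -> : f + w * h = w * (f * g + h) - (w * g - 1) * f by ring.
  by apply: dvdp_sub; [exact: dvdp_mull|exact: dvdp_mulr].
apply: (ze_cancel irr nw).
have -> : w * (f * g + h) = (f + w * h) + (w * g - 1) * f by ring.
by apply: dvdp_add => //; exact: dvdp_mulr.
Qed.

(* rho being primitive, Lf pt rho = 0 modulo ze^e is a single point modulo ze^e. *)
Lemma count_pts e rho : prim rho -> (0 < e <= n)%N ->
  count (fun pt => ze ^+ e %| Lf pt rho) (pts d n z) = (q ^ (d * (n - e)))%N.
Proof.
move=> pr /andP[e0 en]; rewrite count_cat [X in (X + _)%N]count_map [X in (_ + X)%N]count_map.
have zee : ze %| ze ^+ e by rewrite -(prednK e0) exprS dvdp_mulr.
have nze1 : ~~ (ze %| 1) by rewrite dvdp1; have [sz _] := irr; rewrite gtn_eqF.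
have ze_e (f : {poly k}) : ~~ (ze %| f) -> (ze ^+ e %| f) = false.
  by move=> nf; apply/negbTE; apply: contra nf; exact: dvdp_trans.
(* As e is positive, the congruence admits only points (ze al, 1) if ze divides rho.2, and one
   factor ze then drops out; otherwise it admits only points (1, be). *)
have [/dvdpP[/= g eg]|nd2] := boolP (ze %| rho.2).
  have nd1 : ~~ (ze %| rho.1).
    apply: contra nze1 => h1; apply: (prim_dvd pr); rewrite mul1r //.
    by rewrite eg dvdp_mull.
  rewrite (eq_count (a2 := pred0)) ?count_pred0 ?add0n; last first.
    move=> be /=; rewrite ze_e // /Lf /= mul1r dvdp_addl // eg mulrA dvdp_mull //.
  have eD : (D - d = d * (n - 1))%N by rewrite mulnBr muln1.
  have le : (d * e.-1 <= D - d)%N.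
    by rewrite eD leq_mul2l; apply/orP; right; move: e0 en; clia.
  have -> : (d * (n - e) = D - d - d * e.-1)%N.
    by rewrite eD -mulnBr; congr (_ * _)%N; move: e0 en; clia.
  rewrite -(count_lin g nd1 le); apply: eq_count => al /=; rewrite /Lf /= mul1r eg.
  have -> : ze * al * rho.1 + g * ze = ze * (al * rho.1 + g) by ring.
  by rewrite -{1}(prednK e0) exprS dvdp_mul2l.
rewrite [X in (_ + X)%N](eq_count (a2 := pred0)) ?count_pred0 ?addn0; last first.
  by move=> al /=; rewrite ze_e // /Lf /= mul1r -mulrA dvdp_addr // dvdp_mulr.
have le : (d * e <= D)%N by rewrite leq_mul2l en orbT.
rewrite mulnBr -(count_lin rho.1 nd2 le); apply: eq_count => be /=.
by rewrite /Lf /= mul1r addrC.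
Qed.

Lemma size_pts : size (pts d n z) = (q ^ D + q ^ (D - d))%N.
Proof. by rewrite size_cat; congr (_ + _)%N; rewrite size_map size_ps. Qed.

Lemma count_exchange (T1 T2 : Type) (s1 : seq T1) (s2 : seq T2) (a : T1 -> T2 -> bool) :
  (\sum_(x <- s1) count (a x) s2 = \sum_(y <- s2) count (a^~ y) s1)%N.
Proof.
have c (T : Type) (s : seq T) (b : pred T) : count b s = (\sum_(y <- s) (b y : nat))%N.
  by rewrite -sum1_count big_mkcond; apply: eq_bigr => y _; case: (b y).
under eq_bigr => x _ do rewrite c.
by rewrite exchange_big; apply: eq_bigr => y _; rewrite c.
Qed.

Local Notation F := (size [seq pt <- pts d n z | `[< good d n z pt >]]).

(** Double count of incidences: a bad point is incident with the q - 1 scalar multiples of one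
    primitive pair, and a primitive rho with nu rho <= D is incident with as many points as q to the
    power d zmult rho. *)
Lemma bad_count : ((q ^ D + q ^ (D - d)) * q.-1 =
  F * q.-1 + \sum_(rho <- prims k B | (nu rho <= D)%N) q ^ (d * zmult rho))%N.
Proof.
rewrite -size_pts size_filter.
have e : (\sum_(pt <- pts d n z) count (incident pt) (prims k B) =
   \sum_(rho <- prims k B | (nu rho <= D)%N) q ^ (d * zmult rho))%N.
  rewrite count_exchange [RHS]big_mkcond big_seq [RHS]big_seq; apply: eq_bigr => rho.
  rewrite mem_filter => /andP[pr _]; rewrite /incident; case: leqP => le /=; last by rewrite count_pred0.
  have tn := zmult_lt (prim_neq0 pr).
  by rewrite count_pts ?subn_gt0 ?tn ?leq_subr // subKn // ltnW.
rewrite -e -(count_predC (fun pt => `[< good d n z pt >])) mulnDl; congr (_ + _)%N.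
rewrite -sum1_count big_mkcond big_distrl big_seq [RHS]big_seq; apply: eq_bigr => pt hp.
by rewrite count_incident ?(pts_unimod Hz n_gt0) //=; case: asboolP; rewrite ?mul1n.
Qed.

Lemma zmult_ge rho j : rho != 0 -> (nu rho <= D)%N -> (j <= zmult rho)%N = (nu rho <= D - 2 * d * j)%N.
Proof.
move=> /nd_nu[_ n0] le; rewrite leq_divRL ?muln_gt0 // mulnC.
by move: n0 le; move: (2 * d * j)%N (nu rho) (D) => a b c h1 h2; apply/idP/idP; move: h1 h2; clia.
Qed.

(** Summation by parts: q^(dt) is 1 plus the sum of q^(ds) - q^(d(s-1)) over 1 <= s <= t, and zmult
    rho >= s means nu rho <= D - 2ds. Truncated subtraction does no harm, as no primitive pair has
    [nu] equal to 0. *)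
Lemma bad_sum : (\sum_(rho <- prims k B | (nu rho <= D)%N) q ^ (d * zmult rho))%N%:Z =
  (Snu k B D)%:Z + \sum_(1 <= s < n.+1) (q%:Z ^+ (d * s) - q%:Z ^+ (d * (s - 1))) * (Snu k B (D - 2 * d * s))%:Z.
Proof.
have Sd j : (Snu k B j)%:Z = \sum_(rho <- prims k B) (nu rho <= j)%N%:Z.
  rewrite /Snu -sum1_count big_mkcond (big_morph Posz PoszD (erefl _)); apply: eq_bigr => rho _.
  by case: ifP.
rewrite Sd; under [X in _ + X]eq_bigr => s _ do rewrite Sd big_distrr /=.
rewrite [X in _ + X]exchange_big -big_split /= big_mkcond (big_morph Posz PoszD (erefl _)).
rewrite big_seq [RHS]big_seq; apply: eq_bigr => rho; rewrite mem_filter => /andP[pr _].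
have r0 := prim_neq0 pr; have [_ n0] := nd_nu r0.
case: (leqP (nu rho) D) => le; last first.
  rewrite add0r big1_seq // => s _.
  have -> : (nu rho <= D - 2 * d * s)%N = false.
    by move: le; move: (nu rho) (D) (2 * d * s)%N => a b c; clia.
  by rewrite mulr0.
have tn := zmult_lt r0; have ht j := zmult_ge j r0 le; move: (zmult rho) tn ht => t tn ht.
under eq_bigr => s _ do rewrite -ht.
rewrite (big_cat_nat _ (n := t.+1)) ?ltnS //=; last exact: ltnW.
rewrite [X in _ + (_ + X)]big_nat_cond [X in _ + (_ + X)]big1 ?addr0; last first.
  by move=> s /andP[/andP[h1 h2] _]; rewrite leqNgt h1 mulr0.
have -> : \sum_(1 <= s < t.+1) (q%:Z ^+ (d * s) - q%:Z ^+ (d * (s - 1))) * (s <= t)%N%:Z =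
   q%:Z ^+ (d * t) - 1.
  elim: t {tn ht} => [|t IH]; first by rewrite big_geq // muln0 expr0 subrr.
  rewrite big_nat_recr //= leqnn mulr1 subn1 /=.
  have -> : \sum_(1 <= s < t.+1) (q%:Z ^+ (d * s) - q%:Z ^+ (d * (s - 1))) * (s <= t.+1)%N%:Z =
    \sum_(1 <= s < t.+1) (q%:Z ^+ (d * s) - q%:Z ^+ (d * (s - 1))) * (s <= t)%N%:Z.
    apply: eq_big_nat => s /andP[_ h]; congr (_ * _%:Z); move: h; rewrite ltnS => h.
    by rewrite h (leqW h).
  rewrite IH; ring.
by rewrite Posz_exp; ring.
Qed.

End BadPoints.

(** * The polynomials f *)

Section Numeric.
Variable q : int.
Local Notation f m := ((fpoly m%:Z).[q]).
Local Notation fz m := ((fpoly m).[q]).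

(** The defining formula without case distinction: at m = 0 the sum is empty and the last term is
    1. *)
Definition fval (m : nat) : int :=
  \sum_(1 <= i < m.+1) ((-1) ^+ i.-1 * (2 * i - 1)%N%:R) * q ^+ (m.+1 - i) + (-1) ^+ m * m.+1%:R.

Lemma fvalE (m : nat) : f m = fval m.
Proof.
case: m => [|m]; first by rewrite /fval big_geq //= hornerC add0r expr0 mul1r.
rewrite /fval /fpoly hornerD hornerC; congr (_ + _).
rewrite horner_sum; apply: eq_bigr => i _.
by rewrite hornerZ hornerXn.
Qed.

Lemma fval_rec (m : nat) : fval m.+1 = q * fval m + (-1) ^+ m.+1 * (m.+2%:R - m%:R * q).
Proof.
rewrite /fval big_nat_recr // [q * (_ + _)]mulrDr [q * \sum_(_ <= _ < _) _]big_distrr.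
have -> : \sum_(1 <= i < m.+1) ((-1) ^+ i.-1 * (2 * i - 1)%N%:R) * q ^+ (m.+2 - i) =
  \sum_(1 <= i < m.+1) q * (((-1) ^+ i.-1 * (2 * i - 1)%N%:R) * q ^+ (m.+1 - i)).
  apply: eq_big_nat => i /andP[_ h]; rewrite (subSn (ltnW h)) exprS; ring.
rewrite -[LHS]addrA -[RHS]addrA; congr (_ + _); rewrite subSnn expr1 -[m.+1.-1]/m.
have -> : (2 * m.+1 - 1 = m + m.+1)%N by clia.
by rewrite natrD exprS -!natr1; ring.
Qed.

(** The coefficients 1, 2, 1 are those of the recursion for primitive pairs; they reduce the
    coefficients 1, -3, 5, ... of f to 1, -1, 0, ... *)
Lemma fval_rec2 (m : nat) : fval m.+2 + 2 * fval m.+1 + fval m = q ^+ m.+2 - q ^+ m.+1.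
Proof.
elim: m => [|m IH].
  by rewrite !fval_rec /fval big_geq //; ring.
have := congr1 ( *%R q) IH; rewrite (fval_rec m.+2) (fval_rec m.+1) (fval_rec m) => h.
have -> : q ^+ m.+3 - q ^+ m.+2 = q * (q ^+ m.+2 - q ^+ m.+1) by rewrite mulrBr -!exprS.
by rewrite -h -!natr1 !exprS; ring.
Qed.

Definition fdiff (m : nat) : int := f m - fz (m%:Z - 1).

Lemma fdiff0 : fdiff 0 = 1. Proof. by rewrite /fdiff /= hornerC horner0 subr0. Qed.

Lemma fdiffS m : fdiff m.+1 = fval m.+1 - fval m.
Proof. by rewrite /fdiff fvalE; congr (_ - _); rewrite -fvalE; congr ((fpoly _).[_]); lia. Qed.

Lemma fval0 : fval 0 = 1. Proof. by rewrite -fvalE /= hornerC. Qed.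

Lemma fval1 : fval 1 = q - 2. Proof. by rewrite fval_rec fval0; ring. Qed.

(** The correction at m = 0 reflects f_(-1) = 0, where continuing the recursion of f downwards would
    give -1. *)
Lemma fdiff_rec m : fdiff m.+2 + 2 * fdiff m.+1 + fdiff m = q ^+ m.+2 - 2 * q ^+ m.+1 + q ^+ m - (m == 0)%N%:R.
Proof.
rewrite !fdiffS; case: m => [|m].
  rewrite fdiff0 expr0 /=; have := fval_rec2 0; rewrite fval1 fval0 !expr1 => h; lia.
rewrite fdiffS subr0; have h1 := fval_rec2 m; have h2 := fval_rec2 m.+1.
move: h1 h2; move: (fval m) (fval m.+1) (fval m.+2) (fval m.+3) (q ^+ m.+1) (q ^+ m.+2) (q ^+ m.+3) => a b c e x y w.
clia.
Qed.

(* For y = q ^ d, the part of the number of bad points contributed by zmult = s that does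
   not involve f. *)
Definition cterm (y : int) (n s : nat) : int :=
  if (2 * s < n)%N then y ^+ (n - s - 1) + y ^+ (s - 1) else if (2 * s == n)%N then y ^+ (s - 1) else 0.

(** The exponents n - s - 1 and s - 1 run once through 0, ..., n - 2, the middle one arising from 2s
    = n, so the sum is geometric. The induction removes the two outermost exponents. *)
Lemma cterm_sum y n : (0 < n)%N -> (y - 1) * \sum_(1 <= s < n.+1) cterm y n s = y ^+ (n - 1) - 1.
Proof.
have [M le] := ubnP n; elim: M n le => // M IH [|[|[|n]]] // le _.
- by rewrite big_nat1 /cterm /= mulr0 expr0 subrr.
- by rewrite big_nat_recr //= big_nat1 /cterm /= expr0 expr1; ring.
have {IH} IH := IH n.+1 (ltnW (le : (n.+3 <= M)%N)) isT.
rewrite big_nat_recl // big_nat_recr //=.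
have -> : \sum_(1 <= i < n.+2) cterm y n.+3 i.+1 = y * \sum_(1 <= s < n.+2) cterm y n.+1 s.
  rewrite big_distrr; apply: eq_big_nat => s /andP[s0 _] /=; rewrite /cterm.
  have -> : (2 * s.+1 < n.+3)%N = (2 * s < n.+1)%N by apply/idP/idP; clia.
  have -> : (2 * s.+1 == n.+3)%N = (2 * s == n.+1)%N by apply/idP/idP; clia.
  have e1 : (s.+1 - 1 = (s - 1).+1)%N by move: s0; clia.
  case: ifP => h1; last by case: ifP => _; rewrite ?mulr0 // e1 exprS.
  have e2 : (n.+3 - s.+1 - 1 = (n.+1 - s - 1).+1)%N by move: s0 h1; clia.
  by rewrite e1 e2 !exprS mulrDr.
have -> : cterm y n.+3 n.+3 = 0.
  rewrite /cterm; have -> : (2 * n.+3 < n.+3)%N = false by clia.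
  by have -> : (2 * n.+3 == n.+3)%N = false by clia.
have -> : cterm y n.+3 1 = y ^+ n.+1 + 1 by rewrite /cterm /= !subSS subn0 expr0.
rewrite addr0 mulrDr mulrCA IH !subSS !subn0 !exprS; ring.
Qed.

End Numeric.

Section Count.
Variables (k : finFieldType) (d n : nat) (z : {mpoly k[2]}).
Hypothesis Hz : ordinary_point d z.
Hypothesis n_gt0 : (0 < n)%N.
Local Notation D := (d * n)%N.
Local Notation B := (D + 5)%N.
Local Notation q := (#|k|%:Z).

(** Both sides satisfy the same recursion of order two and agree at M = 0 and M = 1; the term for M
    = 0 compensates the exceptional value of f_(-1). *)
Lemma SnuE M : (M <= D)%N -> (Snu k B M)%:Z = (q - 1) * (q ^+ M + 1 - fdiff q M - (M == 0)%N%:R).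
Proof.
have [N le] := ubnP M; elim: N M le => // N IH [|[|M]] // le lD.
- by rewrite Snu0 fdiff0 expr0 (_ : (0 == 0)%N%:R = 1) //; ring.
- have : (Snu k B 1 + 4 = 4 * #|k|)%N by apply: Snu1; clia.
  rewrite fdiffS fval1 fval0 expr1 subr0 => h.
  have -> : (Snu k B 1)%:Z = 4 * q - 4 by lia.
  ring.
have h0 := IH M (ltnW (le : (M.+2 <= N)%N)) (ltnW (ltnW lD)).
have h1 := IH M.+1 le (ltnW lD).
have l5 : (M + 5 <= B)%N by move: lD; move: (D) => D; clia.
have e2 : (Snu k B M.+2)%:Z + 2 * (Snu k B M.+1)%:Z + (Snu k B M)%:Z + 4 + 4 * q ^+ M.+1 = 4 * q ^+ M.+2 + 4 * q.
  have := Snu_rec k l5; rewrite -!Posz_exp.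
  by move: (Snu k B M.+2) (Snu k B M.+1) (Snu k B M) (#|k| ^ M.+1)%N (#|k| ^ M.+2)%N #|k| => a b c x y w; clia.
have e1 := fdiff_rec q M; move: e1 e2.
rewrite h0 h1 (_ : (M.+1 == 0)%N%:R = 0) // !subr0.
set x := fdiff q M.+2; set y := fdiff q M.+1; set w := fdiff q M => e1 e2.
have -> : (Snu k B M.+2)%:Z = 4 * q ^+ M.+2 + 4 * q - 4 - 4 * q ^+ M.+1
   - 2 * ((q - 1) * (q ^+ M.+1 + 1 - y)) - (q - 1) * (q ^+ M + 1 - w - (M == 0)%N%:R).
  by rewrite -e2; ring.
have -> : x = q ^+ M.+2 - 2 * q ^+ M.+1 + q ^+ M - (M == 0)%N%:R - 2 * y - w by rewrite -e1; ring.
by rewrite !exprS; ring.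
Qed.

Local Notation F := (size [seq pt <- pts d n z | `[< good d n z pt >]]).

Lemma good_count : F%:Z = fdiff q D + (q ^+ d - 1) * \sum_(1 <= t < n.+1)
  q ^+ (d * (t - 1)) * ((fpoly (d%:Z * (n%:Z - 2 * t%:Z))).[q] - (fpoly (d%:Z * (n%:Z - 2 * t%:Z) - 1)).[q]).
Proof.
have d0 : (0 < d)%N := d_gt0 Hz.
have q1 : (1 < #|k|)%N := card_finNzRing_gt1 k.
have D0 : (0 < D)%N by rewrite muln_gt0 d0.
have eq1 : #|k|.-1%:Z = q - 1 by move: q1; clia.
have qn : q - 1 != 0 by move: q1; clia.
have dD : (d <= D)%N by rewrite leq_pmulr.
have /(congr1 Posz) := bad_count Hz n_gt0; rewrite PoszM PoszD PoszD PoszM (bad_sum Hz n_gt0) eq1.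
rewrite SnuE // gtn_eqF //= !Posz_exp.
(* By [SnuE] each summand splits into a summand of the assertion and a part free of f, collected in
   [cterm]. For 2s > n both vanish; for 2s = n they cancel, as f_0 - f_(-1) = 1 and no primitive
   pair has [nu] equal to 0. *)
have -> : \sum_(1 <= s < n.+1) (q ^+ (d * s) - q ^+ (d * (s - 1))) * (Snu k B (D - 2 * d * s))%:Z =
  (q - 1) * ((q ^+ d - 1) * (\sum_(1 <= s < n.+1) cterm (q ^+ d) n s - \sum_(1 <= t < n.+1)
    q ^+ (d * (t - 1)) * ((fpoly (d%:Z * (n%:Z - 2 * t%:Z))).[q] - (fpoly (d%:Z * (n%:Z - 2 * t%:Z) - 1)).[q]))).
  rewrite -sumrB !big_distrr /=; apply: eq_big_nat => s /andP[s0 sn].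
  have -> : q ^+ (d * s) = q ^+ d * q ^+ (d * (s - 1)).
    by rewrite -exprD -mulnS; congr (_ ^+ (_ * _)%N); move: s0; clia.
  rewrite SnuE ?leq_subr // /cterm -!exprM (mulnC 2%N d) -(mulnA d 2%N s).
  case: ltngtP => h.
  - have e : (D - d * (2 * s) = d * (n - 2 * s))%N by rewrite mulnBr.
    have e2 : d%:Z * (n%:Z - 2 * s%:Z) = (d * (n - 2 * s))%N%:Z by rewrite PoszM; congr (_ * _); move: h; clia.
    have e3 : (d * (n - 2 * s) == 0)%N = false by apply/negbTE; rewrite -lt0n muln_gt0 d0 subn_gt0.
    rewrite e e2 e3 -/(fdiff q _) subr0.
    have -> : q ^+ (d * (n - s - 1)) = q ^+ (d * (s - 1)) * q ^+ (d * (n - 2 * s)).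
      by rewrite -exprD -mulnDr; congr (_ ^+ (_ * _)%N); move: h s0; clia.
    ring.
  - have -> : (D - d * (2 * s) = 0)%N by apply/eqP; rewrite subn_eq0 leq_mul2l (ltnW h) orbT.
    rewrite fdiff0 expr0 (_ : (0 == 0)%N%:R = 1) //.
    have neg (m : int) : m < 0 -> (fpoly m).[q] = 0 by case: m => // m _; rewrite /= horner0.
    have h1 : d%:Z * (n%:Z - 2 * s%:Z) < 0 by rewrite pmulr_rlt0; move: h d0; clia.
    rewrite !neg //; last by move: h1; move: (d%:Z * _) => a; clia.
    by ring.
  - have -> : (D - d * (2 * s) = 0)%N by rewrite h subnn.
    have -> : d%:Z * (n%:Z - 2 * s%:Z) = 0 by rewrite -h PoszM subrr mulr0.
    rewrite -/(fdiff q 0) fdiff0 expr0 (_ : (0 == 0)%N%:R = 1) //; ring.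
set Sg := \sum_(1 <= t < n.+1) q ^+ _ * _.
(* The geometric series cancels the q^(D-d) points of the second family, and the q^D points of the
   first cancel against the main term of [SnuE]. *)
rewrite [(_ ^+ d - 1) * (_ - _)]mulrBr cterm_sum // -exprM mulnBr muln1 subr0 => h.
apply: (mulIf qn); move: h; set x := q ^+ (D - d) => h.
have -> : F%:Z * (q - 1) = (q ^+ D + x) * (q - 1) - ((q - 1) * (q ^+ D + 1 - fdiff q D) + (q - 1) * (x - 1 - (q ^+ d - 1) * Sg)).
  by rewrite h; ring.
by ring.
Qed.

End Count.

Section Charts.
Variables (k : finFieldType) (p : weights) (E E' S : coh k p) (z : {mpoly k[2]}) (d n : nat).

(** All cardinalities are powers of q, and the valuation at a prime divisor of q turns the identity
    in K_0 into one between exponents. *)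
Lemma K0_chi (u u' : Lgroup p) (b b' : 'I_3 -> nat) :
  ev (fun x => exists2 e : nat, ncard (hpart x : set E) = (#|k| ^ e)%N & e%:Z = chi u b x) ->
  ev (fun x => exists2 e : nat, ncard (hpart x : set E') = (#|k| ^ e)%N & e%:Z = chi u' b' x) ->
  ordinary_point d z -> is_tube_object z n S ->
  K0_eq (fun X => delta_ob E' X + delta_ob S X) (delta_ob E) ->
  ev (fun x => chi u b x = chi u' b' x + (d * n)%N%:Z) /\
  ev (fun x => ncard (hpart x : set E) = (ncard (hpart x : set S) * ncard (hpart x : set E'))%N).
Proof.
move=> cE cE' Hz [sS _ lS] /(K0_card (pdiv #|k|)) K0.
have [_ cS] := len_tail Hz lS sS.
have l0 : (0 < logn (pdiv #|k|) #|k|)%N.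
  by rewrite logn_gt0 mem_primes pdiv_dvd pdiv_prime ?card_finNzRing_gt1 // ltnW ?card_finNzRing_gt1.
have h : ev (fun x => chi u b x = chi u' b' x + (d * n)%N%:Z /\
    ncard (hpart x : set E) = (ncard (hpart x : set S) * ncard (hpart x : set E'))%N).
  apply: ev_imp (ev_and (ev_and cE cE') (ev_and cS K0)) => x [[[e -> <-] [e' -> <-]] [->]].
  rewrite !lognX -mulnDl => /eqP; rewrite eqn_pmul2r // => /eqP ->.
  by split; [rewrite PoszD|rewrite expnD mulnC].
by split; apply: ev_imp h => x [].
Qed.

End Charts.

(* The sum over t >= 1 is cut at t = n: for t > n / 2 the index d(n - 2t) is
   negative and f vanishes. *)
Theorem proposition4p4 (k : finFieldType) (p : weights) (E E' S : coh k p)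
    (z : {mpoly k[2]}) (d n : nat) :
  extension_bundle E -> extension_bundle E' ->
  ordinary_point d z -> (1 <= n)%N -> is_tube_object z n S ->
  K0_eq (fun X => delta_ob E' X + delta_ob S X) (delta_ob E) ->
  let q : int := #|k|%:Z in
  let f (m : int) : int := (fpoly m).[q] in
  exists2 F : nat, hall_number S E' E F &
    F%:Z = f (d%:Z * n%:Z) - f (d%:Z * n%:Z - 1)
           + (q ^+ d - 1) * \sum_(1 <= t < n.+1) q ^+ (d * (t - 1))
               * (f (d%:Z * (n%:Z - 2 * t%:Z)) - f (d%:Z * (n%:Z - 2 * t%:Z) - 1)).
Proof.
move=> /ext_chart[u [b [psi [hb chE cE]]]] /ext_chart[u' [b' [psi0 [hb' chE0 cE']]]] Hz n0 tS K0 q f.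
have [ec card] := K0_chi cE cE' Hz tS K0.
(* E' is described by the shift and the conditions of E, so that the charts of E, E' and S share the
   factors by which the X_i act. *)
have [psi' chE'] := norm_chart hb hb' ec chE0.
have [sg chS] := schart_ex u Hz tS.
have big : ev (fun x => (2 * (d * n + 10))%:Z <= mI u b x).
  apply: ev_imp (ev_shift u (ev_ge p (d * n + 10)%:Z)) => x; rewrite /mI.
  move: (lL _) (cI _ _ _ _) => l []; clia.
have [m hm] := ev_and (ev_and chE chE') (ev_and chS big).
exists (size [seq pt <- pts d n z | `[< good d n z pt >]]).
  apply: (@hall_count k p d n z Hz n0 E E' S u b hb psi psi' sg m) => //.
  - by move=> x /hm[[]].
  - by move=> x /hm[[]].
  - by move=> x /hm[_ []].
  - by move=> x /hm[_ []].
by rewrite (good_count Hz n0) /fdiff -PoszM.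
Qed.
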